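(* Let $f\colon\mathbb N\to\mathbb U$ be a pretentious multiplicative function. Then the following properties are equivalent: (i) $f\sim\chi$ for some primitive Dirichlet character $\chi$. (ii) Some Furstenberg system of $f$ for Cesàro or logarithmic averages is ergodic. (iii) All Furstenberg systems of $f$ for Cesàro and logarithmic averages are ergodic procyclic systems. (iv) There exists a sequence $N_k\to\infty$ along which $f$ is Besicovitch rationally almost periodic for Cesàro or logarithmic averages. (v) Every sequence $N_k\to\infty$ has a subsequence along which $f$ is Besicovitch rationally almost periodic for Cesàro and logarithmic averages.
   Context: $\mathbb N=\{1,2,\ldots\}$, $\mathbb P$ is the set of primes, $\mathbb U$ is the closed complex unit disc, $e(t)=e^{2\pi i t}$, $[N]=\{1,\ldots,N\}$. A function $f\colon\mathbb N\to\mathbb U$ is multiplicative if $f(mn)=f(m)f(n)$ whenever $(m,n)=1$. For multiplicative $f,g\colon\mathbb N\to\mathbb U$ let $\mathbb D^2(f,g)=\sum_{p\in\mathbb P}\frac1p\big(1-\mathrm{Re}(f(p)\overline{g(p)})\big)$ and write $f\sim g$ if $\mathbb D(f,g)<+\infty$. $f$ is pretentious if $f\sim n^{it}\cdot\chi$ for some $t\in\mathbb R$ and some primitive Dirichlet character $\chi$ (the constant $\chi=1$, with conductor $1$, is regarded as primitive). For a finite non-empty $A\subset\mathbb N$, $\mathbb E_{n\in A}a(n)=\frac1{|A|}\sum_{n\in A}a(n)$ (Cesàro average) and $\mathbb E^{\log}_{n\in A}a(n)=\big(\sum_{n\in A}\frac1n\big)^{-1}\sum_{n\in A}\frac{a(n)}n$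 (logarithmic average); these also act on measures. Sequences denoted $(N_k)$ are strictly increasing sequences of positive integers. Let $X=\mathbb U^{\mathbb Z}$ with the product topology and let $T\colon X\to X$ be the shift $(Tx)(k)=x(k+1)$. A sequence $a\colon\mathbb N\to\mathbb U$ is extended to $\mathbb Z$ arbitrarily (the extension does not matter) and viewed as a point of $X$. If the weak-star limit $\mu=\lim_{k\to\infty}\mathbb E_{n\in[N_k]}\delta_{T^na}$ exists, then $(X,\mu,T)$ is called the Furstenberg system of $a$ along $(N_k)$ for Cesàro averages. With $\mathbb E^{\log}$ in place of $\mathbb E$ one gets the Furstenberg system of $a$ along $(N_k)$ for logarithmic averages. A Furstenberg system of $a$ is one obtained along some $(N_k)$. A system $(X,\mu,T)$ has rational discrete spectrum if $L^2(\mu)$ is spanned (in the closed linear sense) by functions $g$ satisfying $g\circ T=e(\alpha)\,g$ for some $\alpha\in\mathbb Q$. A procyclic system is an ergodic system with rational discrete spectrum. A sequence $a\colon\mathbb N\to\mathbb U$ is Besicovitch rationally almost periodic for Cesàro averages along $(N_k)$ if for every $\varepsilon>0$ there is a periodic sequence $a_\varepsilon\colon\mathbb N\to\mathbb U$ with $\limsup_{k\to\infty}\mathbb E_{n\in[N_k]}|a(n)-a_\varepsilon(n)|^2\le\varepsilon$; for logarithmic averages replace $\mathbb E$ by $\mathbb E^{\log}$. *)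

(* Defs.v *)
From HB Require Import structures.
From mathcomp Require Import all_boot all_order all_algebra.
From mathcomp Require Import complex.
From mathcomp Require Import all_classical all_reals all_analysis.

Set Implicit Arguments.
Unset Strict Implicit.
Unset Printing Implicit Defensive.

Import Order.TTheory GRing.Theory Num.Theory.
Import numFieldNormedType.Exports.

Local Open Scope classical_set_scope.
Local Open Scope ring_scope.

(* A sequence indexed by {1, 2, ...} is a function on nat whose value at 0 is
   irrelevant: no definition below depends on it. *)

Section ComplexNumbers.
Context {R : realType}.

(* The modulus as an element of R; `|z| lives in R[i]. *)
Definition cnorm (z : R[i]) : R := ComplexField.Normc.normc z.

Definition cis (x : R) : R[i] := Complex (cos x) (sin x).

(* e(t) = exp(2 pi i t) *)
Definition ecirc (t : R) : R[i] := cis (2 * pi * t).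

(* n^{it}, for n >= 1 *)
Definition nit (t : R) (n : nat) : R[i] := cis (t * ln n%:R).

End ComplexNumbers.

Section SequenceSpace.
Context (R : realType).

Definition udisc : Type := [set z : R[i]^o | `|z| <= 1].

HB.instance Definition _ := Choice.on udisc.
HB.instance Definition _ := Topological.on udisc.

Fact udisc0_subproof : (0 : R[i]^o) \in [set z : R[i]^o | `|z| <= 1].
Proof. by rewrite inE /= normr0 ler01. Qed.

Definition udisc0 : udisc := exist _ (0 : R[i]^o) udisc0_subproof.

HB.instance Definition _ := isPointed.Build udisc udisc0.

Definition udisc_val (z : udisc) : R[i] := sval z.

(* U^Z with the product topology *)
Definition seqspace : Type := {ptws int -> udisc}.

HB.instance Definition _ := Topological.on seqspace.
HB.instance Definition _ := isPointed.Build seqspace (fun _ : int => udisc0).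

Definition seqshift (x : seqspace) : seqspace := fun k : int => x (k + 1).

End SequenceSpace.

Arguments udisc_val {R} z.
Arguments seqshift {R} x.

(* seqspace with its Borel sigma-algebra *)
Notation borel_seqspace R := (g_sigma_algebraType (@open (seqspace R))).

Section Averages.
Context {R : realType}.

Variant averaging := Cesaro | Logarithmic.

Definition weight (m : averaging) (n : nat) : R :=
  match m with Cesaro => 1 | Logarithmic => n%:R^-1 end.

Definition total_weight (m : averaging) (N : nat) : R :=
  \sum_(1 <= n < N.+1) weight m n.

Definition average (m : averaging) (N : nat) (u : nat -> R) : R :=
  (total_weight m N)^-1 * \sum_(1 <= n < N.+1) weight m n * u n.

Fact weight_ge0 (m : averaging) (n : nat) : 0 <= weight m n.
Proof. by case: m => /=; rewrite ?ler01 ?invr_ge0 ?ler0n. Qed.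

Fact total_weight_inv_ge0 (m : averaging) (N : nat) :
  0 <= (total_weight m N)^-1.
Proof. by rewrite invr_ge0 sumr_ge0// => i _; exact: weight_ge0. Qed.

(* The average over n in [N] of the Dirac masses at T^n x, where T is the
   shift; msum sums over j < N, whence n = j.+1. *)
Definition empirical (m : averaging) (N : nat) (x : seqspace R) :
    {measure set (borel_seqspace R) -> \bar R} :=
  mscale (NngNum (total_weight_inv_ge0 m N))
    (msum (fun j => mscale (NngNum (weight_ge0 m j.+1))
                      (dirac (iter j.+1 seqshift x : borel_seqspace R))) N).

Definition weak_star_cvg
    (nu : nat -> {measure set (borel_seqspace R) -> \bar R})
    (mu : {measure set (borel_seqspace R) -> \bar R}) : Prop :=
  forall F : seqspace R -> R, continuous F ->
    (\int[nu k]_x F x) @[k --> \oo] --> \int[mu]_x F x.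

(* strictly increasing sequences of positive integers *)
Definition index_seq (N : nat -> nat) : Prop :=
  (forall k, 0 < N k)%N /\ {homo N : i j / (i < j)%N}.

(* The value of the Furstenberg system does not depend on the extension x of a
   to int. *)
Definition furstenberg_system_along (m : averaging) (N : nat -> nat)
    (a : nat -> udisc R) (mu : probability (borel_seqspace R) R) : Prop :=
  exists x : seqspace R, (forall n : nat, (0 < n)%N -> x n%:Z = a n) /\
    weak_star_cvg (fun k => empirical m (N k) x) mu.

Definition furstenberg_system (m : averaging) (a : nat -> udisc R)
    (mu : probability (borel_seqspace R) R) : Prop :=
  exists N : nat -> nat, index_seq N /\ furstenberg_system_along m N a mu.

Definition periodic_seq (a : nat -> udisc R) : Prop :=
  exists q : nat, (0 < q)%N /\ forall n, (0 < n)%N -> a (n + q)%N = a n.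

Definition besicovitch_rap_along (m : averaging) (N : nat -> nat)
    (a : nat -> udisc R) : Prop :=
  forall eps : R, 0 < eps -> exists b : nat -> udisc R, periodic_seq b /\
    (limn_esup
       (fun k => (average m (N k) (fun n => cnorm (udisc_val (a n) - udisc_val (b n)) ^+ 2))%:E)
     <= eps%:E)%E.

End Averages.

Section Systems.
Context {R : realType} {d : measure_display} {X : measurableType d}.
Variables (mu : probability X R) (T : X -> X).

Definition ergodic : Prop :=
  [/\ measurable_fun setT T,
      forall A, measurable A -> mu (T @^-1` A) = mu A &
      forall A, measurable A -> T @^-1` A = A -> mu A = 0%E \/ mu A = 1%E].

Definition L2 (g : X -> R[i]) : Prop :=
  [/\ measurable_fun setT (fun x => complex.Re (g x)),
      measurable_fun setT (fun x => complex.Im (g x)) &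
      (\int[mu]_x (cnorm (g x) ^+ 2)%:E < +oo)%E].

Definition rational_eigenfunction (g : X -> R[i]) : Prop :=
  L2 g /\ exists alpha : rat,
    \forall x \ae mu, g (T x) = ecirc (ratr alpha) * g x.

(* L^2(mu) is the closed linear span of the rational eigenfunctions. *)
Definition rational_discrete_spectrum : Prop :=
  forall h, L2 h -> forall eps : R, 0 < eps ->
    exists (n : nat) (c : 'I_n -> R[i]) (g : 'I_n -> X -> R[i]),
      (forall i, rational_eigenfunction (g i)) /\
      (\int[mu]_x (cnorm (h x - \sum_i c i * g i x) ^+ 2)%:E
         < (eps ^+ 2)%:E)%E.

Definition procyclic : Prop := ergodic /\ rational_discrete_spectrum.

End Systems.

Section Multiplicative.
Context {R : realType}.

Definition is_multiplicative (f : nat -> udisc R) : Prop :=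
  forall m n : nat, (0 < m)%N -> (0 < n)%N -> coprime m n ->
    udisc_val (f (m * n)%N) = udisc_val (f m) * udisc_val (f n).

Definition dist2 (f g : nat -> R[i]) : \bar R :=
  (\sum_(0 <= p <oo | prime p)
     (p%:R^-1 * (1 - complex.Re (f p * conjc (g p))))%:E)%E.

(* For f and g valued in the unit disc, all the terms of dist2 are >= 0. *)
Definition pret_equiv (f g : nat -> R[i]) : Prop := (dist2 f g < +oo)%E.

Definition dirichlet_character (q : nat) (chi : nat -> R[i]) : Prop :=
  [/\ (0 < q)%N,
      forall n, chi (n + q)%N = chi n,
      forall m n, chi (m * n)%N = chi m * chi n &
      forall n, (chi n != 0) = coprime n q].

(* chi mod q is primitive when it is not induced by a character modulo a
   proper divisor of q. *)
Definition primitive_mod (q : nat) (chi : nat -> R[i]) : Prop :=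
  dirichlet_character q chi /\
  forall d chi', (d %| q)%N -> (d < q)%N -> dirichlet_character d chi' ->
    ~ (forall n, coprime n q -> chi n = chi' n).

Definition primitive_character (chi : nat -> R[i]) : Prop :=
  exists q : nat, primitive_mod q chi.

Definition pretentious (f : nat -> udisc R) : Prop :=
  exists (t : R) (chi : nat -> R[i]), primitive_character chi /\
    pret_equiv (udisc_val \o f) (fun n => nit t n * chi n).

End Multiplicative.

(* Main.v *)
Require Import Defs.
From HB Require Import structures.
From mathcomp Require Import all_boot all_order all_algebra.
From mathcomp Require Import complex.
From mathcomp Require Import all_classical all_reals all_analysis.
From mathcomp Require cyclic.
From mathcomp Require Import measurable_realfun.
From mathcomp Require Import ring lra zify.

(** Let f be at finite distance from n^{it} chi, and put g(n) = n^{-it} f(n).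

    Everything rests on one approximation: every sequence of lengths has a
    subsequence along which g is Besicovitch rationally almost periodic, for
    both kinds of averages.  Split n into its y-smooth and its y-rough part.
    On the rough part g is nearly chi times the exponential of the additive
    function sum of (g(p) conj(chi(p)) - 1) over p | n, and the Turan--Kubilius
    inequality replaces this function by its mean, the drift, which does not
    depend on n and moves slowly with the scale ([turan_kubilius],
    [averaged_model_approx], [drift_slow]).  The smooth part is, off a sparse
    set, the greatest common divisor of n with a fixed number, so that a
    periodic sequence remains ([periodic_model_approx]).  Along a subsequence
    on which the exponential of the drift converges, this proves the claim
    ([periodic_approx_along], [untwist_subsequence]).  For t = 0 this is
    (i) => (v), and (iv) is a special case of (v).

    Limits of averages along an ultrafilter are shift-invariant means, and the
    integral of a continuous function against a Furstenberg system is the mean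
    of its values along the orbit of f ([furstenberg_mean]).

    (i) => (iii).  Almost periodicity of a point x passes to F(T^n x) for every
    continuous F ([rap_continuous]).  An invariant set is close to such an F,
    and the averages of F over a period of its periodic approximation are
    nearly constant, so the set is null or full ([orbit_ergodic]).  Averages of
    F along multiples of q converge to functions invariant under T^q, close to
    F ([invariant_approx]); the discrete Fourier transform modulo q splits
    these into rational eigenfunctions ([orbit_rational_discrete_spectrum]).
    Without Furstenberg systems (iii) would hold vacuously; their existence,
    needed for (iii) => (iv) and (i) => (ii), is proved by assigning to each
    word of binary digits an interval as long as its frequency along the orbit
    and pushing the uniform measure of the unit interval forward to the
    sequence space ([furstenberg_exists]).

    It remains to see that (ii) and (iv) force t = 0.  The square mean of g is
    bounded below, because |g|^2 is multiplicative and close to 1 at most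
    primes ([mean_lower_bound]), while for t <> 0 the means of n^{it} have
    modulus at most rho < 1 ([mean_along_oscillating]), although n^{it} is almost
    constant on bounded windows.  If n^{it} g were almost periodic as well as
    g, comparing the two periodic approximations would make g negligible
    ([twist_rap_null]).  If a Furstenberg system were ergodic, take a nonzero
    Fourier coefficient gamma of g at a rational frequency with denominator q:
    the q-th power of the local Fourier coefficient of f is almost invariant,
    hence almost constant, but along the orbit it is close to
    n^{iqt} gamma^q, which oscillates ([twist_not_ergodic]). *)

Set Implicit Arguments.
Unset Strict Implicit.
Unset Printing Implicit Defensive.

Import Order.TTheory GRing.Theory Num.Theory.
Import numFieldNormedType.Exports.

Local Open Scope classical_set_scope.
Local Open Scope ring_scope.

(** * Complex numbers *)

Section ComplexNumbersTheory.
Context {R : realType}.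
Implicit Types z w : R[i].

Lemma cnormE z : `|z| = (cnorm z)%:C%C.
Proof. by []. Qed.

Lemma cnorm_ge0 z : 0 <= cnorm z.
Proof. by case: z => a b; exact: sqrtr_ge0. Qed.

Lemma cnorm0 : cnorm (0 : R[i]) = 0.
Proof. exact: ComplexField.Normc.normc0. Qed.

Lemma cnorm1 : cnorm (1 : R[i]) = 1.
Proof. exact: ComplexField.Normc.normc1. Qed.

Lemma cnormM z w : cnorm (z * w) = cnorm z * cnorm w.
Proof. exact: ComplexField.Normc.normcM. Qed.

Lemma cnormN z : cnorm (- z) = cnorm z.
Proof. by case: z => a b; rewrite /cnorm/= !sqrrN. Qed.

Lemma cnormB z w : cnorm (z - w) = cnorm (w - z).
Proof. by rewrite -opprB cnormN. Qed.

Lemma cnormX z n : cnorm (z ^+ n) = cnorm z ^+ n.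
Proof. by elim: n => [|n IH]; rewrite ?expr0 ?cnorm1// !exprS cnormM IH. Qed.

Lemma cnormD z w : cnorm (z + w) <= cnorm z + cnorm w.
Proof. by have := ler_normD z w; rewrite !cnormE -rmorphD lecR. Qed.

Lemma cnorm_triangle y z w : cnorm (z - w) <= cnorm (z - y) + cnorm (y - w).
Proof. by apply: le_trans (cnormD _ _); rewrite addrA subrK. Qed.

Lemma cnorm_sum (I : Type) (s : seq I) (P : pred I) (F : I -> R[i]) :
  cnorm (\sum_(i <- s | P i) F i) <= \sum_(i <- s | P i) cnorm (F i).
Proof.
elim/big_rec2: _ => [|i x y _ IH]; first by rewrite cnorm0.
by apply: le_trans (cnormD _ _) _; rewrite lerD2l.
Qed.

Lemma cnorm_sqr z : cnorm z ^+ 2 = complex.Re z ^+ 2 + complex.Im z ^+ 2.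
Proof. by case: z => a b; rewrite /cnorm/= sqr_sqrtr// addr_ge0// sqr_ge0. Qed.

Lemma cnorm_eq0 z : cnorm z = 0 -> z = 0.
Proof. exact: ComplexField.Normc.eq0_normc. Qed.

Lemma normr_Re_le z : `|complex.Re z| <= cnorm z.
Proof.
rewrite -ler_sqr ?nnegrE ?cnorm_ge0// real_normK ?num_real// cnorm_sqr.
by rewrite lerDl sqr_ge0.
Qed.

Lemma normr_Im_le z : `|complex.Im z| <= cnorm z.
Proof.
rewrite -ler_sqr ?nnegrE ?cnorm_ge0// real_normK ?num_real// cnorm_sqr.
by rewrite lerDr sqr_ge0.
Qed.

Lemma Re_le_cnorm z : complex.Re z <= cnorm z.
Proof. by apply: le_trans (normr_Re_le z); exact: ler_norm. Qed.

Lemma cnorm_le_ReIm z : cnorm z <= `|complex.Re z| + `|complex.Im z|.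
Proof.
rewrite -ler_sqr ?nnegrE ?cnorm_ge0 ?addr_ge0//.
rewrite cnorm_sqr sqrrD !real_normK ?num_real// -addrA lerD2l lerDr.
by rewrite mulrn_wge0// mulr_ge0.
Qed.

Lemma cnorm_real (r : R) : cnorm (r%:C%C) = `|r|.
Proof. by rewrite /cnorm/= expr0n/= addr0 sqrtr_sqr. Qed.

Lemma cnorm_imag (r : R) : cnorm (Complex 0 r) = `|r|.
Proof. by rewrite /cnorm/= expr0n/= add0r sqrtr_sqr. Qed.

Lemma cnorm_conj z : cnorm (conjc z) = cnorm z.
Proof. by case: z => a b; rewrite /cnorm/= sqrrN. Qed.

Lemma Re_addc z w : complex.Re (z + w) = complex.Re z + complex.Re w.
Proof. by case: z => a b; case: w. Qed.

Lemma Im_addc z w : complex.Im (z + w) = complex.Im z + complex.Im w.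
Proof. by case: z => a b; case: w. Qed.

Lemma Re_oppc z : complex.Re (- z) = - complex.Re z.
Proof. by case: z. Qed.

Lemma Im_oppc z : complex.Im (- z) = - complex.Im z.
Proof. by case: z. Qed.

Lemma Re_mulc z w : complex.Re (z * w) =
  complex.Re z * complex.Re w - complex.Im z * complex.Im w.
Proof. by case: z => a b; case: w. Qed.

Lemma Im_mulc z w : complex.Im (z * w) =
  complex.Re z * complex.Im w + complex.Im z * complex.Re w.
Proof. by case: z => a b; case: w. Qed.

Lemma Re_mulrc (r : R) z : complex.Re (r%:C%C * z) = r * complex.Re z.
Proof. by rewrite Re_mulc/= mul0r subr0. Qed.

Lemma Im_mulrc (r : R) z : complex.Im (r%:C%C * z) = r * complex.Im z.
Proof. by rewrite Im_mulc/= mul0r addr0. Qed.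

Lemma mulrc_Complex (r a b : R) :
  r%:C%C * Complex a b = Complex (r * a) (r * b) :> R[i].
Proof. by congr Complex; rewrite mul0r ?subr0 ?addr0. Qed.

Lemma Re_sum (I : Type) (s : seq I) (P : pred I) (F : I -> R[i]) :
  complex.Re (\sum_(i <- s | P i) F i) = \sum_(i <- s | P i) complex.Re (F i).
Proof. by elim/big_rec2: _ => // i x y _ <-; rewrite Re_addc. Qed.

Lemma Im_sum (I : Type) (s : seq I) (P : pred I) (F : I -> R[i]) :
  complex.Im (\sum_(i <- s | P i) F i) = \sum_(i <- s | P i) complex.Im (F i).
Proof. by elim/big_rec2: _ => // i x y _ <-; rewrite Im_addc. Qed.

Lemma complex_eq z w :
  complex.Re z = complex.Re w -> complex.Im z = complex.Im w -> z = w.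
Proof. by case: z => a b; case: w => c d /= -> ->. Qed.

Lemma Re_conjc z : complex.Re (conjc z) = complex.Re z.
Proof. by case: z. Qed.

Lemma Im_conjc z : complex.Im (conjc z) = - complex.Im z.
Proof. by case: z. Qed.

Lemma conjcM z w : conjc (z * w) = conjc z * conjc w.
Proof. by apply: complex_eq; rewrite ?(Re_mulc, Im_mulc, Re_conjc, Im_conjc); ring. Qed.

Lemma mulc_conj z : z * conjc z = (cnorm z ^+ 2)%:C%C.
Proof.
by apply: complex_eq; rewrite ?(Re_mulc, Im_mulc, Re_conjc, Im_conjc) ?cnorm_sqr/=; ring.
Qed.

Lemma cnormB_sqr z w : cnorm (z - w) ^+ 2 =
  cnorm z ^+ 2 + cnorm w ^+ 2 - 2 * complex.Re (z * conjc w).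
Proof.
by rewrite !cnorm_sqr !(Re_addc, Im_addc, Re_oppc, Im_oppc, Re_mulc, Re_conjc, Im_conjc); ring.
Qed.

Lemma cnorm_cis x : cnorm (cis x : R[i]) = 1.
Proof. by rewrite /cnorm/= cos2Dsin2 sqrtr1. Qed.

Lemma cis0 : cis 0 = 1 :> R[i].
Proof. by rewrite /cis cos0 sin0. Qed.

Lemma cisD x y : cis (x + y) = cis x * cis y :> R[i].
Proof. by apply: complex_eq; rewrite ?(Re_mulc, Im_mulc)/= ?cosD ?sinD; ring. Qed.

Lemma conjc_cis x : conjc (cis x) = cis (- x) :> R[i].
Proof. by apply: complex_eq; rewrite /= ?cosN ?sinN. Qed.

Lemma cisMn x n : cis (x * n%:R) = cis x ^+ n :> R[i].
Proof.
elim: n => [|n IH]; first by rewrite mulr0 cis0 expr0.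
by rewrite exprS -IH -cisD -[n.+1]addn1 natrD mulrDr mulr1 addrC.
Qed.

End ComplexNumbersTheory.

(** * Bounded sequences and invariant means *)

Section BoundedSequences.
Context {R : realType}.
Implicit Types (u v : nat -> R) (z w : nat -> R[i]).

Definition bdd u := exists B : R, forall n, `|u n| <= B.
Definition cbdd z := exists B : R, forall n, cnorm (z n) <= B.

Lemma bdd_cst (c : R) : bdd (fun=> c).
Proof. by exists `|c|. Qed.

Lemma bddD u v : bdd u -> bdd v -> bdd (fun n => u n + v n).
Proof.
move=> [B uB] [C vC]; exists (B + C) => n.
by apply: le_trans (ler_normD _ _) _; rewrite lerD.
Qed.

Lemma bddN u : bdd u -> bdd (fun n => - u n).
Proof. by move=> [B uB]; exists B => n; rewrite normrN. Qed.

Lemma bddM u v : bdd u -> bdd v -> bdd (fun n => u n * v n).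
Proof.
move=> [B uB] [C vC]; exists (B * C) => n.
by rewrite normrM ler_pM.
Qed.

Lemma bddX u k : bdd u -> bdd (fun n => u n ^+ k).
Proof.
move=> bu; elim: k => [|k IH]; first by exists 1 => n; rewrite expr0 normr1.
have [B HB] := bddM bu IH; exists B => n; rewrite exprS; exact: HB.
Qed.

Lemma bdd_norm u : bdd u -> bdd (fun n => `|u n|).
Proof. by move=> [B uB]; exists B => n; rewrite normr_id. Qed.

Lemma bdd_sum (I : Type) (s : seq I) (P : pred I) (F : I -> nat -> R) :
  (forall i, bdd (F i)) -> bdd (fun n => \sum_(i <- s | P i) F i n).
Proof.
move=> bF; elim: s => [|i s [B IH]].
  by exists 0 => n; rewrite big_nil normr0.
have [C HC] := bF i; exists (C + B + B) => n; rewrite big_cons; case: ifP => _.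
  apply: le_trans (ler_normD _ _) _; rewrite -addrA lerD// (le_trans (IH n))//.
  by rewrite lerDl (le_trans _ (IH 0%N)).
apply: le_trans (IH n) _; rewrite lerDr addr_ge0//.
  exact: le_trans (HC 0%N).
exact: le_trans (IH 0%N).
Qed.

Lemma bdd_comp u (s : nat -> nat) : bdd u -> bdd (fun n => u (s n)).
Proof. by move=> [B uB]; exists B. Qed.

Lemma cbdd_comp z (s : nat -> nat) : cbdd z -> cbdd (fun n => z (s n)).
Proof. by move=> [B uB]; exists B. Qed.

Lemma cbdd_cst (c : R[i]) : cbdd (fun=> c).
Proof. by exists (cnorm c). Qed.

Lemma cbddD z w : cbdd z -> cbdd w -> cbdd (fun n => z n + w n).
Proof.
move=> [B uB] [C vC]; exists (B + C) => n.
by apply: le_trans (cnormD _ _) _; rewrite lerD.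
Qed.

Lemma cbddN z : cbdd z -> cbdd (fun n => - z n).
Proof. by move=> [B uB]; exists B => n; rewrite cnormN. Qed.

Lemma cbddM z w : cbdd z -> cbdd w -> cbdd (fun n => z n * w n).
Proof.
move=> [B uB] [C vC]; exists (B * C) => n.
by rewrite cnormM ler_pM ?cnorm_ge0.
Qed.

Lemma cbddX z k : cbdd z -> cbdd (fun n => z n ^+ k).
Proof.
move=> bu; elim: k => [|k IH]; first by exists 1 => n; rewrite expr0 cnorm1.
have [B HB] := cbddM bu IH; exists B => n; rewrite exprS; exact: HB.
Qed.

Lemma cbdd_conj z : cbdd z -> cbdd (fun n => conjc (z n)).
Proof. by move=> [B uB]; exists B => n; rewrite cnorm_conj. Qed.

Lemma cbdd_sum (I : Type) (s : seq I) (P : pred I) (F : I -> nat -> R[i]) :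
  (forall i, cbdd (F i)) -> cbdd (fun n => \sum_(i <- s | P i) F i n).
Proof.
move=> bF; have [|B HB] := @bdd_sum I s P (fun i n => cnorm (F i n)).
  by move=> i; have [B FB] := bF i; exists B => n; rewrite ger0_norm ?cnorm_ge0.
exists B => n; apply: le_trans (cnorm_sum _ _ _) _.
exact: le_trans (ler_norm _) (HB n).
Qed.

Lemma bdd_cnorm z : cbdd z -> bdd (fun n => cnorm (z n)).
Proof. by move=> [B zB]; exists B => n; rewrite ger0_norm ?cnorm_ge0. Qed.

Lemma bdd_Re z : cbdd z -> bdd (fun n => complex.Re (z n)).
Proof. by move=> [B zB]; exists B => n; apply: le_trans (normr_Re_le _) _. Qed.

Lemma bdd_Im z : cbdd z -> bdd (fun n => complex.Im (z n)).
Proof. by move=> [B zB]; exists B => n; apply: le_trans (normr_Im_le _) _. Qed.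

End BoundedSequences.

Ltac solve_bdd := repeat first
  [ assumption
  | exact: bdd_cst | exact: cbdd_cst
  | apply: bddD | apply: bddN | apply: bddM | apply: bddX | apply: bdd_norm
  | apply: cbddD | apply: cbddN | apply: cbddM | apply: cbddX
  | apply: cbdd_conj | apply: bdd_cnorm | apply: bdd_Re | apply: bdd_Im
  | (apply: bdd_sum; move=> ?) | (apply: cbdd_sum; move=> ?)
  | apply: bdd_comp | apply: cbdd_comp ].

(** Such a functional is only required to behave well on bounded sequences;
    linearity and shift invariance are what remains of an average along a
    sequence of intervals after a limit has been taken. *)
Record invariant_mean {R : realType} (L : (nat -> R) -> R) : Prop := InvariantMean {
  meanD : forall u v, bdd u -> bdd v -> L (fun n => u n + v n) = L u + L v;
  meanZ : forall c u, bdd u -> L (fun n => c * u n) = c * L u;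
  mean_ge0 : forall u, bdd u -> (forall n, 0 <= u n) -> 0 <= L u;
  mean1 : L (fun=> 1) = 1;
  meanS : forall u, bdd u -> L (fun n => u n.+1) = L u }.

Section InvariantMeanTheory.
Context {R : realType} (L : (nat -> R) -> R) (HL : invariant_mean L).
Implicit Types u v : nat -> R.

Lemma mean_cst c : L (fun=> c) = c.
Proof.
have -> : (fun=> c) = (fun n : nat => c * 1) :> (nat -> R).
  by apply/funext => n; rewrite mulr1.
by rewrite (meanZ HL) ?(mean1 HL) ?mulr1//; exact: bdd_cst.
Qed.

Lemma meanN u : bdd u -> L (fun n => - u n) = - L u.
Proof.
move=> bu; rewrite -[RHS]mulN1r -(meanZ HL)//.
by congr (L _); apply/funext => n; rewrite mulN1r.
Qed.

Lemma meanB u v : bdd u -> bdd v -> L (fun n => u n - v n) = L u - L v.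
Proof. by move=> bu bv; rewrite (meanD HL)// ?meanN//; exact: bddN. Qed.

Lemma mean_shift k u : bdd u -> L (fun n => u (n + k)%N) = L u.
Proof.
move=> bu; elim: k => [|k IH].
  by congr (L _); apply/funext => n; rewrite addn0.
rewrite -IH -[RHS](meanS HL); first by congr (L _); apply/funext => n; rewrite addnS addSn.
by solve_bdd.
Qed.

Lemma mean_le_from k u v : bdd u -> bdd v -> (forall n, (k <= n)%N -> u n <= v n) ->
  L u <= L v.
Proof.
move=> bu bv uv; rewrite -(mean_shift k bu) -(mean_shift k bv) -subr_ge0 -meanB.
- by apply: (mean_ge0 HL); [solve_bdd|move=> n; rewrite subr_ge0 uv// leq_addl].
- by solve_bdd.
- by solve_bdd.
Qed.

Lemma mean_le u v : bdd u -> bdd v -> (forall n, u n <= v n) -> L u <= L v.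
Proof. by move=> bu bv uv; apply: (@mean_le_from 0%N). Qed.

Lemma mean_eq_from k u v : bdd u -> bdd v -> (forall n, (k <= n)%N -> u n = v n) ->
  L u = L v.
Proof.
by move=> bu bv uv; apply/eqP; rewrite eq_le; apply/andP; split;
  apply: (@mean_le_from k) => // n kn; rewrite uv.
Qed.

Lemma mean_sum (I : Type) (s : seq I) (P : pred I) (F : I -> nat -> R) :
  (forall i, bdd (F i)) ->
  L (fun n => \sum_(i <- s | P i) F i n) = \sum_(i <- s | P i) L (F i).
Proof.
move=> bF; elim: s => [|i s IH].
  rewrite big_nil -[RHS]mean_cst; congr (L _).
  by apply/funext => n; rewrite big_nil.
rewrite big_cons -IH; case: ifP => Pi.
  rewrite -(meanD HL)//; last exact: bdd_sum.
  by congr (L _); apply/funext => n; rewrite big_cons Pi.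
by congr (L _); apply/funext => n; rewrite big_cons Pi.
Qed.

Lemma mean_norm u : bdd u -> `|L u| <= L (fun n => `|u n|).
Proof.
move=> bu; rewrite ler_norml -meanN; last by solve_bdd.
by apply/andP; split; apply: mean_le; solve_bdd => n;
  rewrite ?ler_norm// lerNl -normrN ler_norm.
Qed.

(** An invariant mean ignores every initial segment, so a sequence that is
    eventually below e has mean at most e. *)
Lemma mean_null u : bdd u ->
  (forall e : R, 0 < e -> exists k, forall n, (k <= n)%N -> `|u n| <= e) ->
  L (fun n => `|u n|) = 0.
Proof.
move=> bu H; apply/eqP; rewrite eq_le; apply/andP; split; last first.
  by apply: (mean_ge0 HL); [solve_bdd|move=> n].
apply/ler_addgt0Pr => e e0; rewrite add0r.
have [k Hk] := H _ e0; rewrite -(mean_cst e).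
by apply: (@mean_le_from k) => //; solve_bdd.
Qed.

(** Cauchy--Schwarz against the constant 1. No square root of a mean is taken:
    the AM-GM inequality with a well chosen scale does the same work inside
    the mean. *)
Lemma mean_sqr_le u e : bdd u -> 0 <= e -> L (fun n => u n ^+ 2) <= e ^+ 2 ->
  L (fun n => `|u n|) <= e.
Proof.
move=> bu; rewrite le_eqVlt => /orP[/eqP <-|e0] H.
  (* for e = 0 no scale is optimal, and the scale d tends to 0 *)
  apply/ler_addgt0Pr => d d0; rewrite add0r.
  have : L (fun n => `|u n|) <= L (fun n => d + d^-1 * u n ^+ 2).
    apply: mean_le; solve_bdd => n.
    rewrite -(ler_pM2l d0) mulrDr mulrA divff ?gt_eqF// mul1r.
    rewrite -[u n ^+ 2]real_normK ?num_real//; set x := `|u n|.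
    have := sqr_ge0 (d - x); have x0 : 0 <= x by exact: normr_ge0.
    nra.
  rewrite (meanD HL) ?mean_cst ?(meanZ HL); [|solve_bdd..].
  move=> /le_trans; apply; rewrite gerDl pmulr_rle0 ?invr_gt0//.
  by move: H; rewrite expr0n.
have : L (fun n => `|u n|) <= L (fun n => e / 2 + (2 * e)^-1 * u n ^+ 2).
  apply: mean_le; solve_bdd => n.
  rewrite -[u n ^+ 2]real_normK ?num_real//; set x := `|u n|.
  rewrite -(ler_pM2l (_ : 0 < 2 * e)) ?mulr_gt0// mulrDr [_ * (_^-1 * _)]mulrA.
  rewrite divff ?mulf_neq0 ?gt_eqF// mul1r.
  by have := sqr_ge0 (e - x); nra.
rewrite (meanD HL) ?mean_cst ?(meanZ HL); [|solve_bdd..].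
move=> /le_trans; apply.
rewrite -lerBrDl; have -> : e - e / 2 = (2 * e)^-1 * e ^+ 2.
  by field; rewrite gt_eqF.
by rewrite ler_pM2l// invr_gt0 mulr_gt0.
Qed.

End InvariantMeanTheory.

(** * Cesaro and logarithmic averages and their limits along ultrafilters *)

Section UltraLimits.
Context {R : realType}.

(** The limit is the supremum of the levels that w exceeds along U: for each
    level above it the ultrafilter must choose the side below. *)
Lemma ultra_cvg (U : set_system nat) (w : nat -> R) :
  UltraFilter U -> bdd w -> cvg (w k @[k --> U]).
Proof.
move=> UU [B wB].
pose S := [set x | U [set k | x <= w k]].
have SB : S (- B).
  by apply: filterE => k /=; move: (wB k); rewrite ler_norml => /andP[].
have ubS : ubound S B.
  move=> x Sx; rewrite leNgt; apply/negP => Bx.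
  have [k /= xk] := filter_ex Sx.
  by have := lt_le_trans Bx xk; rewrite ltNge (le_trans (ler_norm _) (wB k)).
have hS : has_sup S by split; [exists (- B)|exists B].
apply/cvg_ex; exists (sup S); apply/cvgrPdist_le => e e0.
have [x Sx ltx] := sup_adherent e0 hS.
have [Se|Se] := in_ultra_setVsetC [set k | sup S + e <= w k] UU.
  have : sup S + e <= sup S by exact: sup_upper_bound.
  by rewrite gerDl leNgt e0.
have {}Sx : U [set k | x <= w k] by [].
near=> k; rewrite ler_distlC; apply/andP; split.
  apply: (le_trans (ltW ltx)); near: k; exact: Sx.
rewrite ltW// ltNge; apply/negP; near: k; exact: Se.
Unshelve. all: by end_near. Qed.

(** The upper limits in the statement of almost periodicity are extended real
    numbers; this reads a bound on one of them as an eventual bound on the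
    averages. *)
Lemma limn_esup_leP (w : nat -> R) (a : R) :
  (limn_esup (fun k => (w k)%:E) <= a%:E)%E <->
  (forall e : R, 0 < e -> \forall k \near \oo, w k <= a + e).
Proof.
rewrite /limn_esup limf_esupE; split=> [H e e0|H].
  have : (ereal_inf [set ereal_sup [set (w x)%:E | x in V] | V in \oo] < (a + e)%:E)%E.
    by apply: le_lt_trans H _; rewrite lte_fin ltrDl.
  move=> /ereal_inf_lt[_ [V oV <-]] lte; apply: filterS oV => k Vk.
  rewrite -lee_fin; apply: le_trans (ltW lte); apply: ereal_sup_ubound.
  by exists k.
apply/lee_addgt0Pr => e e0; rewrite -EFinD; apply: ereal_inf_le.
exists (ereal_sup [set (w x)%:E | x in [set k | w k <= a + e]]).
  by exists [set k | w k <= a + e] => //; exact: H.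
by apply: ge_ereal_sup => _ [k /= wk <-]; rewrite lee_fin.
Qed.

End UltraLimits.

Section AverageTheory.
Context {R : realType}.
Implicit Types (m : averaging) (u v : nat -> R).
Local Notation weight := (@weight R).
Local Notation total_weight := (@total_weight R).
Local Notation average := (@average R).

Lemma weight_gt0 m n : (0 < n)%N -> 0 < weight m n.
Proof. by case: m => n0 /=; rewrite ?ltr01// invr_gt0 ltr0n. Qed.

Lemma total_weightS m N : total_weight m N.+1 = total_weight m N + weight m N.+1.
Proof. by rewrite /total_weight big_nat_recr. Qed.

Lemma total_weight0 m : total_weight m 0 = 0.
Proof. by rewrite /total_weight big_geq. Qed.

Lemma total_weight_gt0 m N : (0 < N)%N -> 0 < total_weight m N.
Proof.
case: N => // N _; rewrite total_weightS ltr_wpDl ?weight_gt0//.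
by apply: sumr_ge0 => i _; exact: weight_ge0.
Qed.

Lemma le_total_weight m M N : (M <= N)%N -> total_weight m M <= total_weight m N.
Proof.
move=> MN; rewrite -(subnKC MN); elim: (N - M)%N => [|k IH].
  by rewrite addn0.
by rewrite addnS total_weightS (le_trans IH)// lerDl weight_ge0.
Qed.

Lemma total_weight_Cesaro N : total_weight Cesaro N = N%:R.
Proof. by rewrite /total_weight sumr_const_nat subn1. Qed.

(** The block between 2^j and 2^(j+1) has 2^j terms, each at least 2^-(j+1). *)
Lemma total_weight_log_ge j : 1 + j%:R / 2 <= total_weight Logarithmic (2 ^ j).
Proof.
elim: j => [|j IH].
  by rewrite expn0 mul0r addr0 total_weightS total_weight0 /= add0r invr1.
have le2 : (2 ^ j <= 2 ^ j.+1)%N by rewrite leq_exp2l.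
rewrite /total_weight (@big_cat_nat _ _ _ (2 ^ j).+1)//=.
rewrite -[j.+1]addn1 natrD mulrDl addrA lerD//.
apply: (@le_trans _ _ (\sum_((2 ^ j).+1 <= i < (2 ^ (j + 1)).+1) ((2 ^ (j + 1))%:R^-1 : R))).
  rewrite sumr_const_nat subSS addn1 expnS mul2n -addnn addKn.
  have p0 : (0 : R) < (2 ^ j)%:R by rewrite ltr0n expn_gt0.
  rewrite natrD -[leRHS]mulr_natl ler_pdivlMr ?addr_gt0// mulrAC.
  by rewrite ler_pdivrMr// mul1r mulr_natr mulr2n.
apply: ler_sum_nat => i /andP[i1 i2].
by rewrite lef_pV2 ?posrE ?ltr0n ?expn_gt0 ?(leq_trans _ i1)// ler_nat.
Qed.

(** The block between 2^j and 2^(j+1) has 2^j terms, each at most 2^-j. *)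
Lemma total_weight_log_le j : total_weight Logarithmic (2 ^ j) <= 1 + j%:R.
Proof.
elim: j => [|j IH].
  by rewrite expn0 addr0 total_weightS total_weight0 /= add0r invr1.
have le2 : (2 ^ j <= 2 ^ j.+1)%N by rewrite leq_exp2l.
rewrite /total_weight (@big_cat_nat _ _ _ (2 ^ j).+1)//=.
rewrite -[j.+1]addn1 natrD addrA lerD//.
apply: (@le_trans _ _ (\sum_((2 ^ j).+1 <= i < (2 ^ (j + 1)).+1) ((2 ^ j)%:R^-1 : R))).
  apply: ler_sum_nat => i /andP[i1 i2].
  by rewrite lef_pV2 ?posrE ?ltr0n ?expn_gt0 ?(leq_trans _ i1)// ler_nat ltnW.
rewrite sumr_const_nat subSS addn1 expnS mul2n -addnn addKn.
by rewrite -[leLHS]mulr_natl mulfV// pnatr_eq0 -lt0n expn_gt0.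
Qed.

Lemma total_weight_unbounded m (A : R) :
  exists N0, forall N, (N0 <= N)%N -> A <= total_weight m N.
Proof.
have A0 : A <= (Num.truncn `|A|).+1%:R.
  by rewrite (le_trans (ler_norm _))// ltW// truncnS_gt.
case: m.
  exists (Num.truncn `|A|).+1 => N N0; rewrite total_weight_Cesaro.
  by rewrite (le_trans A0)// ler_nat.
exists (2 ^ (Num.truncn `|A|).+1.*2)%N => N N0; apply: le_trans (le_total_weight _ N0).
apply: le_trans (total_weight_log_ge _); rewrite (le_trans A0)//.
by rewrite -muln2 natrM mulfK// lerDr.
Qed.

Lemma averageD m N u v :
  average m N (fun n => u n + v n) = average m N u + average m N v.
Proof.
rewrite /average -mulrDr -big_split/=; congr (_ * _).
by apply: eq_bigr => i _; rewrite mulrDr.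
Qed.

Lemma averageZ m N c u : average m N (fun n => c * u n) = c * average m N u.
Proof.
rewrite /average [RHS]mulrCA; congr (_ * _); rewrite mulr_sumr.
by apply: eq_bigr => i _; rewrite mulrCA.
Qed.

Lemma average_cst m N c : (0 < N)%N -> average m N (fun=> c) = c.
Proof.
move=> N0; rewrite /average -mulr_suml mulrA mulVf ?mul1r//.
by rewrite gt_eqF// total_weight_gt0.
Qed.

Lemma eq_average m N u v : (forall n, (0 < n <= N)%N -> u n = v n) ->
  average m N u = average m N v.
Proof.
move=> uv; rewrite /average; congr (_ * _).
rewrite big_nat_cond [RHS]big_nat_cond; apply: eq_bigr => i.
by rewrite ltnS andbT => /uv ->.
Qed.

Lemma le_average m N u v : (forall n, (0 < n <= N)%N -> u n <= v n) ->
  average m N u <= average m N v.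
Proof.
move=> uv; rewrite /average ler_wpM2l ?total_weight_inv_ge0//.
rewrite big_nat_cond [leRHS]big_nat_cond; apply: ler_sum => i.
by rewrite ltnS andbT => /uv iN; rewrite ler_wpM2l ?weight_ge0.
Qed.

Lemma average_ge0 m N u : (forall n, (0 < n <= N)%N -> 0 <= u n) -> 0 <= average m N u.
Proof.
move=> u0; rewrite -[leLHS](mul0r (average m N u)) -averageZ.
by apply: le_average => n /u0; rewrite mul0r.
Qed.

Lemma average_norm_le m N u B : (0 < N)%N -> (forall n, `|u n| <= B) ->
  `|average m N u| <= B.
Proof.
move=> N0 uB; rewrite ler_norml -{1}(average_cst m B N0) -[X in _ <= _ <= X](average_cst m B N0).
rewrite -mulN1r -averageZ.
by apply/andP; split; apply: le_average => n _; have := uB n; rewrite ?mulN1r ler_norml => /andP[].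
Qed.

Lemma weightS_le m n : (0 < n)%N -> weight m n.+1 <= weight m n.
Proof. by case: m => //= n0; rewrite lef_pV2 ?posrE ?ltr0n// ler_nat. Qed.

(** Summation by parts: the weights are nonincreasing and at most 1, so that
    the differences of the weights telescope. The bound tends to 0 as the
    total weight grows, which makes limits of averages shift invariant. *)
Lemma average_shift m N u B : (0 < N)%N -> (forall n, `|u n| <= B) ->
  `|average m N (fun n => u n.+1) - average m N u| <= 2 * B / total_weight m N.
Proof.
move=> N0 uB.
have B0 : 0 <= B by apply: le_trans (uB 0%N).
rewrite /average -mulrBr -sumrB normrM [leRHS]mulrC.
rewrite [X in X * _]ger0_norm ?total_weight_inv_ge0//.
rewrite ler_wpM2l ?total_weight_inv_ge0//.
suff H : `|\sum_(1 <= i < N.+1) (weight m i * u i.+1 - weight m i * u i)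
         - weight m N * u N.+1| <= B * (2 - weight m N).
  rewrite -[X in `|X|](subrK (weight m N * u N.+1)) (le_trans (ler_normD _ _))//.
  rewrite -lerBrDr (le_trans H)// mulrBr (mulrC B 2) lerD2l lerN2 normrM mulrC.
  by rewrite ler_pM ?weight_ge0// ger0_norm// weight_ge0.
case: N N0 => // N _; elim: N => [|N IH].
  rewrite big_nat1.
  have w1 : weight m 1 = 1 by case: (m) => //=; rewrite invr1.
  by rewrite w1 !mul1r addrAC subrr add0r normrN (_ : 2 - 1 = 1 :> R) ?mulr1//; lra.
rewrite big_nat_recr//=.
set S := \sum_(_ <= _ < _) _ in IH *; set w := weight m N.+1 in IH *.
set w' := weight m N.+2.
have -> : S + (w' * u N.+3 - w' * u N.+2) - w' * u N.+3 = (S - w * u N.+2) + (w - w') * u N.+2.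
  by ring.
rewrite (le_trans (ler_normD _ _))//.
have ww : 0 <= w - w' by rewrite subr_ge0 weightS_le.
have -> : B * (2 - w') = B * (2 - w) + (w - w') * B by ring.
by rewrite lerD// normrM ger0_norm// ler_wpM2l.
Qed.

End AverageTheory.

Section MeansAlong.
Context {R : realType}.
Implicit Types (m : averaging) (N : nat -> nat) (u v : nat -> R).

(** A limit of averages need not exist for every bounded sequence. An
    ultrafilter finer than the neighbourhoods of infinity chooses limits for
    all of them at once, linearly, and the limit lies below every eventual
    upper bound of the averages. *)
Definition mean_along m N (L : (nat -> R) -> R) := exists U : set_system nat,
  [/\ UltraFilter U, \oo `<=` U &
      forall u, L u = lim (average m (N k) u @[k --> U])].

Lemma mean_along_ex m N : exists L, mean_along m N L.
Proof.
have [U [UU oU]] := ultraFilterLemma eventually_filter.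
by exists (fun u => lim (average m (N k) u @[k --> U])), U.
Qed.

Lemma increasing_ge (phi : nat -> nat) k : {homo phi : i j / (i < j)%N} -> (k <= phi k)%N.
Proof. by move=> ph; elim: k => // k IH; exact: leq_ltn_trans IH (ph _ _ _). Qed.

Section Theory.
Context m N L (HN : index_seq N) (HL : mean_along m N L).

Let bdd_average u : bdd u -> bdd (fun k => average m (N k) u).
Proof. by move=> [B uB]; exists B => k; apply: average_norm_le => //; apply HN.1. Qed.

Lemma mean_along_cvg u a : average m (N k) u @[k --> \oo] --> a -> L u = a.
Proof.
move=> ua; have [U [UU oU ->]] := HL; apply: cvg_lim => //.
by apply: cvg_trans ua => A /=; exact: oU.
Qed.

Lemma mean_along_le u a : bdd u ->
  (\forall k \near \oo, average m (N k) u <= a) -> L u <= a.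
Proof.
move=> bu ua; have [U [UU oU ->]] := HL.
by apply: limr_le; [apply: ultra_cvg; exact: bdd_average|exact: oU].
Qed.

Lemma mean_along_ge u a : bdd u ->
  (\forall k \near \oo, a <= average m (N k) u) -> a <= L u.
Proof.
move=> bu ua; have [U [UU oU ->]] := HL.
by apply: limr_ge; [apply: ultra_cvg; exact: bdd_average|exact: oU].
Qed.

Lemma total_weight_index (A : R) : \forall k \near \oo, A <= total_weight m (N k).
Proof.
have [N0 HN0] := total_weight_unbounded m A; exists N0 => // k /= N0k.
by apply: HN0; apply: leq_trans N0k _; exact: increasing_ge HN.2.
Qed.

Lemma mean_along_mean : invariant_mean L.
Proof.
have [U [UU oU LE]] := HL; split.
- move=> u v bu bv; rewrite !LE; apply: cvg_lim => //.
  under eq_fun do rewrite averageD.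
  by apply: cvgD; apply: ultra_cvg; exact: bdd_average.
- move=> c u bu; rewrite !LE; apply: cvg_lim => //.
  under eq_fun do rewrite averageZ.
  by apply: cvgM; [exact: cvg_cst|apply: ultra_cvg; exact: bdd_average].
- move=> u bu u0; apply: mean_along_ge => //.
  by apply: nearW => k; apply: average_ge0.
- apply: mean_along_cvg.
  under eq_fun do rewrite (average_cst _ _ (HN.1 _)).
  exact: cvg_cst.
- move=> u bu; have [B uB] := bu.
  have B0 : 0 <= B by apply: le_trans (uB 0%N).
  have bS : bdd (fun n => u n.+1) by exact: bdd_comp.
  apply/eqP; rewrite -subr_eq0 -normr_le0; apply/ler_addgt0Pr => e e0; rewrite add0r.
  have H : \forall k \near U,
      `|average m (N k) (fun n => u n.+1) - average m (N k) u| <= e.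
    apply: oU; have := total_weight_index (2 * B / e); apply: filterS => k Hk.
    apply: le_trans (average_shift _ (HN.1 k) uB) _.
    by rewrite ler_pdivrMr ?total_weight_gt0 ?HN.1// [leRHS]mulrC -ler_pdivrMr.
  rewrite !LE -limB; [|apply: ultra_cvg; exact: bdd_average..].
  rewrite -lim_norm; last by apply: is_cvgB; apply: ultra_cvg; exact: bdd_average.
  apply: limr_le => //.
  by apply: is_cvg_norm; apply: is_cvgB; apply: ultra_cvg; exact: bdd_average.
Qed.

(** This is how ultrafilter limits lead back to convergence of the averages
    along a subsequence. *)
Lemma mean_along_approx (I : finType) (F : I -> nat -> R) k0 (e : R) :
  (forall i, bdd (F i)) -> 0 < e ->
  exists2 k, (k0 <= k)%N & forall i, `|average m (N k) (F i) - L (F i)| <= e.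
Proof.
move=> bF e0; have [U [UU oU LE]] := HL.
have Hi i : \forall k \near U, `|average m (N k) (F i) - L (F i)| <= e.
  have := @ultra_cvg _ U _ UU (bdd_average (bF i)).
  by rewrite LE => /cvgrPdist_le /(_ _ e0); apply: filterS => k; rewrite distrC.
have Hall : \forall k \near U, forall i, `|average m (N k) (F i) - L (F i)| <= e.
  exact: filter_forall.
have : \forall k \near U, (k0 <= k)%N /\ forall i, `|average m (N k) (F i) - L (F i)| <= e.
  by apply: filterI => //; apply: oU; exists k0.
by move=> /filter_ex[k [k0k Hk]]; exists k.
Qed.

End Theory.
End MeansAlong.

(** * Oscillation of n^{it} *)

Section ElementaryInequalities.
Context {R : realType}.
Implicit Types x y a b : R.

(** The source of the Taylor bounds below: each follows from the previous one
    by comparing derivatives on the half-line. *)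
Lemma ge_at0_of_derive_ge0 (f df : R -> R) x :
  (forall y, is_derive y 1 f (df y)) -> (forall y, 0 <= y -> 0 <= df y) ->
  0 <= x -> f 0 <= f x.
Proof.
move=> fd df0 x0; rewrite -subr_ge0.
have fc : {within `[0, x], continuous f}.
  apply: continuous_subspaceT => y.
  by apply: differentiable_continuous; apply/derivable1_diffP; case: (fd y).
have [c] := MVT_segment x0 (fun y _ => fd y) fc.
by rewrite in_itv/= => /andP[c0 _] ->; rewrite subr0 mulr_ge0// df0.
Qed.

Lemma sin_le_id x : 0 <= x -> sin x <= x.
Proof.
move=> x0; rewrite -subr_ge0.
have fd y : is_derive y 1 (fun y => y - sin y : R) (1 - cos y) by exact: is_deriveB.
have f0 y : 0 <= y -> 0 <= 1 - cos y by rewrite subr_ge0 cos_le1.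
by have := ge_at0_of_derive_ge0 fd f0 x0; rewrite sin0 subr0.
Qed.

Lemma one_sub_cos_le x : 0 <= x -> 1 - cos x <= x ^+ 2 / 2.
Proof.
move=> x0; rewrite lerBlDr.
have fd y : is_derive y 1 (fun y => y ^+ 2 / 2 + cos y : R) (y - sin y).
  by apply: is_derive_eq; rewrite /GRing.scale/=; field.
have f0 y : 0 <= y -> 0 <= y - sin y by rewrite subr_ge0; exact: sin_le_id.
by have := ge_at0_of_derive_ge0 fd f0 x0; rewrite cos0 expr0n/= mul0r add0r.
Qed.

Lemma one_sub_cos_le_id x : 0 <= x -> 1 - cos x <= x.
Proof.
move=> x0; rewrite lerBlDr.
have fd y : is_derive y 1 (fun y => y + cos y : R) (1 - sin y) by exact: is_deriveD.
have f0 y : 0 <= y -> 0 <= 1 - sin y by rewrite subr_ge0 sin_le1.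
by have := ge_at0_of_derive_ge0 fd f0 x0; rewrite cos0 add0r.
Qed.

Lemma id_sub_sin_le x : 0 <= x -> x - sin x <= x ^+ 2 / 2.
Proof.
move=> x0; rewrite lerBlDr -subr_ge0.
have fd y : is_derive y 1 (fun y => y ^+ 2 / 2 + sin y - y : R) (y + cos y - 1).
  by apply: is_derive_eq; rewrite /GRing.scale/=; field.
have f0 y : 0 <= y -> 0 <= y + cos y - 1.
  by rewrite subr_ge0 -lerBlDr; exact: one_sub_cos_le_id.
by have := ge_at0_of_derive_ge0 fd f0 x0; rewrite sin0 expr0n/= mul0r addr0 subr0.
Qed.

Lemma expRN_le x : 0 <= x -> expR (- x) <= 1 - x + x ^+ 2 / 2.
Proof.
move=> x0; rewrite -subr_ge0.
have fd y : is_derive y 1 (fun y => 1 - y + y ^+ 2 / 2 - expR (- y) : R)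
    (- 1 + y + expR (- y)).
  by apply: is_derive_eq; rewrite /GRing.scale/=; field.
have f0 y : 0 <= y -> 0 <= - 1 + y + expR (- y).
  by have := expR_ge1Dx (- y); lra.
have /= := ge_at0_of_derive_ge0 fd f0 x0.
by rewrite (_ : - (0 : R) = 0) ?oppr0// expR0 expr0n/= mul0r !addr0 subrr.
Qed.

Lemma normr_1Bcos_le x : `|1 - cos x| <= x ^+ 2 / 2.
Proof.
wlog x0 : x / 0 <= x => [H|].
  have [/H//|x0] := leP 0 x.
  by have := H (- x); rewrite oppr_ge0 sqrrN cosN; apply; exact: ltW.
by rewrite ger0_norm ?one_sub_cos_le// subr_ge0 cos_le1.
Qed.

Lemma normr_sinB_le x : `|sin x - x| <= x ^+ 2 / 2.
Proof.
wlog x0 : x / 0 <= x => [H|].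
  have [/H//|x0] := leP 0 x.
  have := H (- x); rewrite oppr_ge0 sqrrN sinN -opprD normrN; apply; exact: ltW.
by rewrite distrC ger0_norm ?id_sub_sin_le// subr_ge0 sin_le_id.
Qed.

Lemma cnorm_cisB1_le x : cnorm (cis x - 1 : R[i]) <= `|x|.
Proof.
rewrite -ler_sqr ?nnegrE ?cnorm_ge0// real_normK ?num_real// cnorm_sqr.
rewrite !(Re_addc, Im_addc, Re_oppc, Im_oppc)/= subr0.
have -> : (cos x - 1) ^+ 2 + sin x ^+ 2 = 2 * (1 - cos x).
  by have := cos2Dsin2 x; lra.
by have := normr_1Bcos_le x; rewrite ger0_norm ?subr_ge0 ?cos_le1//; lra.
Qed.

Lemma cnorm_cisB_le x y : cnorm (cis x - cis y : R[i]) <= `|x - y|.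
Proof.
have -> : cis x - cis y = cis y * (cis (x - y) - 1) :> R[i].
  by rewrite mulrBr mulr1 -cisD addrCA subrr addr0.
by rewrite cnormM cnorm_cis mul1r cnorm_cisB1_le.
Qed.

Lemma cnorm_cis_taylor x : cnorm (cis x - 1 - Complex 0 x : R[i]) <= x ^+ 2.
Proof.
apply: le_trans (cnorm_le_ReIm _) _.
rewrite !(Re_addc, Im_addc, Re_oppc, Im_oppc)/= !subr0.
have := normr_1Bcos_le x; have := normr_sinB_le x; rewrite [`|1 - _|]distrC; lra.
Qed.

End ElementaryInequalities.

Section Oscillation.
Context {R : realType}.
Implicit Types (t : R) (n : nat).

(** The error is O(1/n^2), so that it remains negligible after multiplication
    by n, as the telescoping argument below requires. *)
Lemma ln_pred_bounds n : (1 < n)%N ->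
  - (2 / n%:R ^+ 2) <= ln (n.-1%:R : R) - ln n%:R + n%:R^-1 <= 0.
Proof.
case: n => [|[|n]]// _ /=; set a := n.+1%:R : R; set b := n.+2%:R : R.
have a0 : 0 < a by rewrite ltr0n.
have b0 : 0 < b by rewrite ltr0n.
have ba : b = a + 1 by rewrite /a /b -addn1 natrD.
have a1 : 1 <= a by rewrite ler1n.
clearbody a b.
rewrite -ln_div ?posrE//; apply/andP; split; last first.
  have -> : a / b = 1 + - b^-1.
    have b0' : b != 0 by rewrite gt_eqF.
    by apply: (mulIf b0'); rewrite divfK// mulrDl mulNr mulVf// ba; ring.
  rewrite -lerBrDr sub0r; apply: le_ln1Dx.
  by rewrite ltrN2 invf_lt1// ba ltrDr.
have : ln (b / a) <= a^-1.
  have -> : b / a = 1 + a^-1 by rewrite ba mulrDl mul1r divff// gt_eqF.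
  by apply: le_ln1Dx; rewrite (@lt_trans _ _ 0) ?invr_gt0// oppr_lt0.
rewrite !ln_div ?posrE// => H.
suff : a^-1 <= b^-1 + 2 / b ^+ 2 by move=> ?; lra.
rewrite -subr_ge0.
have -> : b^-1 + 2 / b ^+ 2 - a^-1 = (a - 1) / (a * b ^+ 2).
  have a0' : a != 0 by rewrite gt_eqF.
  have b0' : b != 0 by rewrite gt_eqF.
  have -> : a = b - 1 by rewrite ba addrK.
  by field; rewrite b0' -[b - 1](_ : a = _) ?a0'// ba addrK.
apply: divr_ge0; first by rewrite subr_ge0.
  by apply: mulr_ge0; [exact: ltW|exact: sqr_ge0].
Qed.

(** The discrete derivative of n^{it} is i t n^{it} / n, up to an error of
    order 1/n^2. *)
Lemma nit_step t n : (1 < n)%N ->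
  cnorm (nit t n.-1 - nit t n * (1 - Complex 0 (t / n%:R)))
    <= (2 * `|t| + 4 * t ^+ 2) / n%:R ^+ 2.
Proof.
move=> n1; have n0 : (0 : R) < n%:R by rewrite ltr0n ltnW.
set x : R := ln n.-1%:R - ln n%:R.
have := ln_pred_bounds n1; rewrite -/x; set b : R := n%:R in n0 * => Hx.
have -> : nit t n.-1 = nit t n * cis (t * x) by rewrite /nit -cisD; congr cis; rewrite /x; ring.
rewrite -mulrBr cnormM cnorm_cis mul1r.
have -> : cis (t * x) - (1 - Complex 0 (t / b)) =
    (cis (t * x) - 1 - Complex 0 (t * x)) + Complex 0 (t * (x + b^-1)) :> R[i].
  by apply: complex_eq; rewrite !(Re_addc, Im_addc, Re_oppc, Im_oppc)/=; ring.
apply: le_trans (cnormD _ _) _.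
have b1 : 1 <= b by rewrite ler1n ltnW.
have b2 : 0 < b ^+ 2 by rewrite exprn_gt0.
have xb : `|x + b^-1| <= 2 / b ^+ 2 by rewrite ler_norml; move: Hx => /andP[-> /le_trans->]//; rewrite divr_ge0// ltW.
have x2 : x ^+ 2 <= 4 / b ^+ 2.
  have : `|x| <= 2 / b.
    case/andP: Hx => H1 H2; rewrite ler_norml; apply/andP; split; last first.
      have : 0 <= b^-1 by rewrite invr_ge0 ltW.
      lra.
    have : 2 / b ^+ 2 <= 1 / b; last lra.
    have nb : 2 <= b by rewrite ler_nat.
    by rewrite ler_pdivrMr// mulrAC ler_pdivlMr// mul1r expr2 ler_pM2r.
  rewrite -[x ^+ 2]real_normK ?num_real// => H.
  apply: le_trans (_ : (2 / b) ^+ 2 <= _); first by rewrite ler_sqr ?nnegrE// divr_ge0// ltW.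
  by rewrite expr_div_n -natrX lexx.
rewrite mulrDl addrC lerD//.
  rewrite cnorm_imag normrM.
  by rewrite [2 * _]mulrC -mulrA ler_wpM2l.
apply: le_trans (cnorm_cis_taylor _) _.
by rewrite exprMn [4 * _]mulrC -[leRHS]mulrA ler_wpM2l ?sqr_ge0.
Qed.


(** The mean of n^{it} has modulus at most rho < 1; rotating by c makes this a
    bound on real parts. *)
Definition oscillating (L : (nat -> R) -> R) := forall t, t != 0 ->
  exists2 rho : R, 0 <= rho < 1 & forall c,
    L (fun n => complex.Re (c * nit t n)) <= rho * cnorm c.

Lemma cbdd_nit t : cbdd (nit t).
Proof. by exists 1 => n; rewrite cnorm_cis. Qed.

Lemma vanishes_Re (z : nat -> R[i]) (K : R) :
  (forall n, (1 < n)%N -> cnorm (z n) <= K / n%:R) ->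
  forall e : R, 0 < e -> exists k, forall n, (k <= n)%N -> `|complex.Re (z n)| <= e.
Proof.
move=> H e e0; exists (Num.truncn `|K / e|).+2 => n Hn.
have n1 : (1 < n)%N by apply: leq_trans Hn.
apply: le_trans (normr_Re_le _) _; apply: le_trans (H n n1) _.
have n0 : (0 : R) < n%:R by rewrite ltr0n; exact: ltnW.
rewrite ler_pdivrMr//.
have Kn : K / e <= n%:R.
  apply: le_trans (ler_norm _) _; apply: ltW; apply: lt_le_trans (truncnS_gt _) _.
  by rewrite ler_nat; exact: ltnW.
by rewrite mulrC -ler_pdivrMr.
Qed.

(** Telescoping. For Cesaro averages the increments of n n^{it} are (1 + it)
    n^{it} up to O(1/n) and sum to at most N in modulus, whence the constant
    1/|1 + it| < 1. For logarithmic averages n times the increment of n^{it}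
    is i t n^{it} up to O(1/n), and its weighted sum stays bounded, so that
    the mean is 0. *)
Lemma mean_along_oscillating m N L : index_seq N -> mean_along m N L -> oscillating L.
Proof.
move=> HN HL t t0; have LM := mean_along_mean HN HL.
pose d : R[i] := Complex 1 t.
have d1 : 1 < cnorm d.
  rewrite -ltr_sqr ?nnegrE ?cnorm_ge0// cnorm_sqr/= expr1n ltrDl.
  by rewrite lt_def sqrf_eq0 t0 sqr_ge0.
have d0 : d != 0.
  by apply: contraTneq d1 => ->; rewrite cnorm0 -leNgt ler01.
exists (cnorm d)^-1.
  by rewrite invr_ge0 cnorm_ge0/= invf_lt1// (lt_trans ltr01).
move=> c.
have C0 : 0 <= 2 * `|t| + 4 * t ^+ 2.
  by apply: addr_ge0; apply: mulr_ge0 => //; exact: sqr_ge0.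
set C := _ + _ in C0.
have bz := cbdd_nit t.
have step := @nit_step t; rewrite -/C in step.
have ibd : cbdd (fun n : nat => Complex 0 (t / n%:R) : R[i]).
  exists `|t| => -[|n].
    by rewrite invr0 mulr0 cnorm_imag normr0.
  rewrite cnorm_imag normrM ger_pMr ?normr_gt0//.
  by rewrite ger0_norm ?invr_ge0// invf_le1 ?ltr0n// ler1n.
(* tel is proportional to n^{it} up to O(1/n), and its weighted sum telescopes *)
pose tel n : R[i] := if m is Cesaro then n%:R * nit t n - n.-1%:R * nit t n.-1
                     else n%:R * (nit t n - nit t n.-1).
pose a : R[i] := if m is Cesaro then d else Complex 0 t.
have a0 : a != 0.
  by rewrite /a; case: (m) => //; apply: contra t0 => /eqP[->].
have natC (n : nat) : n%:R = n%:R%:C%C :> R[i].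
  by rewrite rmorph_nat.
have err n : (1 < n)%N -> cnorm (tel n - a * nit t n) <= (`|t| + C) / n%:R.
  move=> n1; have n0 : (0 : R) < n%:R by rewrite ltr0n ltnW.
  have nn0 : (n%:R : R) != 0 by rewrite gt_eqF.
  set r := nit t n.-1 - nit t n * (1 - Complex 0 (t / n%:R)).
  have Er : nit t n.-1 = nit t n * (1 - Complex 0 (t / n%:R)) + r by rewrite /r addrC subrK.
  have rC : cnorm r <= C / n%:R ^+ 2 by exact: step.
  have It : n%:R * Complex 0 (t / n%:R) = Complex 0 t :> R[i].
    by rewrite natC mulrc_Complex mulr0 mulrCA divff ?mulr1.
  have nr : cnorm (n%:R * r) <= C / n%:R.
    rewrite cnormM natC cnorm_real ger0_norm// (le_trans (ler_wpM2l _ rC))//.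
    by rewrite le_eqVlt; apply/orP; left; apply/eqP; field.
  rewrite /tel /a mulrDl; case: (m).
    have -> : n%:R * nit t n - n.-1%:R * nit t n.-1 - d * nit t n =
       - (Complex 0 (t / n%:R) * nit t n) - n.-1%:R * r.
      have -> : n.-1%:R = n%:R - 1 :> R[i] by rewrite -subn1 natrB// ltnW.
      have -> : d = 1 + n%:R * Complex 0 (t / n%:R).
        by rewrite It; apply: complex_eq; rewrite /= ?addr0 ?add0r.
      by rewrite Er; ring.
    apply: le_trans (cnormD _ _) _; rewrite !cnormN !cnormM cnorm_cis mulr1 lerD//.
      rewrite cnorm_imag normrM ler_wpM2l//.
      by rewrite ger0_norm// invr_ge0 ltW.
    apply: le_trans nr; rewrite cnormM ler_wpM2r ?cnorm_ge0// !natC !cnorm_real.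
    by rewrite !ger0_norm// ler_nat leq_pred.
  have -> : n%:R * (nit t n - nit t n.-1) - Complex 0 t * nit t n = - (n%:R * r).
    by rewrite Er -It; ring.
  rewrite cnormN (le_trans nr)// lerDr mulr_ge0// invr_ge0 ltW//.
pose c' := c / a.
have -> : (fun n => complex.Re (c * nit t n)) =
   (fun n => complex.Re (c' * tel n) - complex.Re (c' * (tel n - a * nit t n))).
  apply/funext => n; rewrite -Re_oppc -Re_addc; congr complex.Re.
  by rewrite mulrBr opprB addrCA subrr addr0 mulrA divfK.
have berr : cbdd (fun n => tel n - a * nit t n).
  exists (\sum_(j < 2) cnorm (tel j - a * nit t j) + (`|t| + C)) => n.
  have S0 : 0 <= \sum_(j < 2) cnorm (tel j - a * nit t j).
    by apply: sumr_ge0 => i _; exact: cnorm_ge0.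
  have [n1|n2] := ltnP n 2.
    rewrite (bigD1 (Ordinal n1))//= -addrA lerDl; apply: addr_ge0.
      by apply: sumr_ge0 => i _; exact: cnorm_ge0.
    by apply: addr_ge0.
  apply: le_trans (err _ n2) _; apply: le_trans (_ : `|t| + C <= _); last by rewrite lerDr.
  have n0 : (0 : R) < n%:R by rewrite ltr0n ltnW.
  by rewrite ler_pdivrMr// ler_peMr ?ler1n ?(ltnW n2)// addr_ge0.
have btel : cbdd tel.
  have -> : tel = (fun n => (tel n - a * nit t n) + a * nit t n).
    by apply/funext => n; rewrite subrK.
  by solve_bdd.
rewrite (meanB LM); [|by solve_bdd..].
have -> : L (fun n => complex.Re (c' * (tel n - a * nit t n))) = 0.
  apply/eqP; rewrite -normr_le0; apply: le_trans (mean_norm LM _) _; first by solve_bdd.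
  rewrite (mean_null LM)//; first by solve_bdd.
  apply: (@vanishes_Re _ (cnorm c' * (`|t| + C))) => n n1.
  by rewrite cnormM -mulrA ler_wpM2l ?cnorm_ge0// err.
rewrite subr0.
have telsum n : \sum_(1 <= i < n.+1) @weight R m i * complex.Re (c' * tel i) =
    complex.Re (c' * if m is Cesaro then n%:R * nit t n else nit t n - nit t 0).
  elim: n => [|n IH].
    by rewrite big_geq//; case: (m); rewrite ?mul0r ?subrr mulr0.
  rewrite big_nat_recr//= IH /tel; case: (m) => /=.
    by rewrite mul1r -Re_addc -mulrDr addrC subrK.
  have n0 : (n.+1%:R : R) != 0 by rewrite pnatr_eq0.
  rewrite [c' * (_ * _)]mulrCA natC Re_mulrc mulKf// -Re_addc -mulrDr.
  by rewrite addrC addrA subrK.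
have b1 : L (fun n => complex.Re (c' * tel n)) <= if m is Cesaro then cnorm c' else 0.
  apply/ler_addgt0Pr => e e0; apply: (mean_along_le HN HL); first by solve_bdd.
  have := total_weight_index m HN (cnorm c' * 2 / e); apply: filterS => k Wk.
  rewrite /average telsum; have Nk := HN.1 k.
  have W0 : 0 < @total_weight R m (N k) by exact: total_weight_gt0.
  rewrite mulrC ler_pdivrMr//; apply: le_trans (Re_le_cnorm _) _.
  move: Wk W0; case: (m) => Wk W0.
    rewrite total_weight_Cesaro cnormM cnormM cnorm_cis mulr1 natC cnorm_real.
    by rewrite ger0_norm// ler_wpM2r// lerDl ltW.
  rewrite cnormM add0r; apply: le_trans (_ : cnorm c' * 2 <= _).
    rewrite ler_wpM2l ?cnorm_ge0//; apply: le_trans (cnormD _ _) _.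
    by rewrite cnormN !cnorm_cis.
  by rewrite [leRHS]mulrC -ler_pdivrMr.
apply: le_trans b1 _; rewrite /c' /a; case: (m).
  by rewrite cnormM mulrC ler_wpM2r ?cnorm_ge0// /cnorm ComplexField.Normc.normcV.
by rewrite mulr_ge0 ?cnorm_ge0// invr_ge0 cnorm_ge0.
Qed.

End Oscillation.

(** * Sums over primes and the Turan--Kubilius inequality *)

Definition prime_sum (V : nmodType) (a b : nat) (F : nat -> V) :=
  \sum_(a.+1 <= p < b.+1 | prime p) F p.

Section PrimeSums.
Context {R : realType}.

Lemma prime_coprime_fact p n : prime p -> (n < p)%N -> coprime p n`!.
Proof.
move=> pp; elim: n => [|k IHk] kp; first by rewrite fact0 coprimen1.
by rewrite factS coprimeMr IHk ?(ltnW kp)// andbT prime_coprime// gtnNdvd.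
Qed.

Lemma bin_le_exp2 n m : ('C(n, m) <= 2 ^ n)%N.
Proof.
elim: n m => [|n IH] [|m]; rewrite ?bin0 ?bin0n ?expn_gt0//.
by rewrite binS expnS mul2n -addnn leq_add.
Qed.

Lemma prod_primes_dvd (s : seq nat) m : uniq s -> all prime s ->
  (forall p, p \in s -> (p %| m)%N) -> (\prod_(p <- s) p %| m)%N.
Proof.
elim: s => [|p s IH] /=; first by rewrite big_nil dvd1n.
move=> /andP[ps us] /andP[pp sp] H; rewrite big_cons Gauss_dvd.
  rewrite H ?mem_head//= IH// => r rs; apply: H.
  by rewrite inE rs orbT.
rewrite prime_coprime//; apply: contraNN ps.
elim: (s) sp => [|r r' IHr] /=; first by rewrite big_nil dvdn1 => _ /eqP p1; rewrite p1 in pp.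
move=> /andP[rp r'p]; rewrite big_cons Euclid_dvdM// inE.
by move=> /orP[|/IHr->//]; rewrite ?orbT// dvdn_prime2// => ->.
Qed.

(** The primes between n = 2^j and 2n divide the binomial coefficient C(2n,
    n), which is at most 4^n, and each of them exceeds n. *)
Lemma count_primes_dyadic j :
  (j * \sum_((2 ^ j).+1 <= p < (2 ^ j.+1).+1 | prime p) 1 <= 2 ^ j.+1)%N.
Proof.
set n := (2 ^ j)%N.
have n2 : (2 ^ j.+1 = n + n)%N by rewrite expnS mul2n addnn.
set s := [seq p <- index_iota n.+1 (2 ^ j.+1).+1 | prime p].
have sE p : p \in s = [&& prime p, (n < p)%N & (p <= n + n)%N].
  by rewrite mem_filter mem_index_iota ltnS n2.
have H : (\prod_(p <- s) p %| 'C(n + n, n))%N.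
  apply: prod_primes_dvd.
  - by apply: filter_uniq; apply: iota_uniq.
  - by apply/allP => p; rewrite sE => /and3P[].
  - move=> p; rewrite sE => /and3P[pp np pn].
    have : (p %| (n + n)`!)%N by rewrite dvdn_fact// prime_gt0.
    rewrite -(bin_fact (leq_addr n n)) addnK !Euclid_dvdM//.
    have -> : (p %| n`!)%N = false; last by rewrite !orbF.
    by apply/negbTE; rewrite -prime_coprime// prime_coprime_fact.
have Hle : (n ^ size s <= 2 ^ (n + n))%N.
  apply: leq_trans (bin_le_exp2 _ n).
  apply: leq_trans (dvdn_leq _ H); last by rewrite bin_gt0 leq_addr.
  rewrite -[size s]sum1_size; have : all (fun p => (n <= p)%N) s.
    by apply/allP => p; rewrite sE => /and3P[_ /ltnW].
  elim: s {sE H} => [|p s IH] /=; first by rewrite !big_nil.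
  by move=> /andP[np sp]; rewrite !big_cons expnD expn1 leq_mul// IH.
move: Hle; rewrite -n2 /n -expnM leq_exp2l//.
by rewrite -big_filter -/s sum1_size.
Qed.

Lemma le_prime_sum a b (F G : nat -> R) :
  (forall p, prime p -> (a < p <= b)%N -> F p <= G p) -> prime_sum a b F <= prime_sum a b G.
Proof.
move=> H; rewrite /prime_sum big_nat_cond [leRHS]big_nat_cond.
by apply: ler_sum => p /andP[/andP[ap pb] pp]; apply: H => //; rewrite ap -ltnS.
Qed.

Lemma prime_sum_ge0 a b (F : nat -> R) :
  (forall p, prime p -> (a < p <= b)%N -> 0 <= F p) -> 0 <= prime_sum a b F.
Proof.
move=> H; apply: le_trans (le_prime_sum H).
by rewrite /prime_sum big1.
Qed.

Lemma prime_sum_cat (V : nmodType) a b c (F : nat -> V) : (a <= b)%N -> (b <= c)%N ->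
  prime_sum a c F = prime_sum a b F + prime_sum b c F.
Proof. by move=> ab bc; rewrite /prime_sum (@big_cat_nat _ _ _ b.+1). Qed.

Lemma prime_sumZ a b (c : R) (F : nat -> R) :
  prime_sum a b (fun p => c * F p) = c * prime_sum a b F.
Proof. by rewrite /prime_sum mulr_sumr. Qed.

Lemma prime_sumD (V : nmodType) a b (F G : nat -> V) :
  prime_sum a b (fun p => F p + G p) = prime_sum a b F + prime_sum a b G.
Proof. by rewrite /prime_sum big_split. Qed.

(** Chebyshev: between 2^j and 2^(j+1) there are at most 2^(j+1) / j primes,
    and each contributes at most 2^-j. *)
Lemma prime_sum_inv_dyadic j : (0 < j)%N ->
  prime_sum (2 ^ j) (2 ^ j.+1) (fun p => p%:R^-1 : R) <= 2 / j%:R.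
Proof.
move=> j0.
apply: le_trans (_ : prime_sum (2 ^ j) (2 ^ j.+1) (fun=> (2 ^ j)%:R^-1 : R) <= _).
  apply: le_prime_sum => p pp /andP[jp _].
  by rewrite lef_pV2 ?posrE ?ltr0n ?expn_gt0 ?prime_gt0// ler_nat ltnW.
have -> : prime_sum (2 ^ j) (2 ^ j.+1) (fun=> (2 ^ j)%:R^-1 : R) =
    (\sum_((2 ^ j).+1 <= p < (2 ^ j.+1).+1 | prime p) 1)%N%:R / (2 ^ j)%:R :> R.
  by rewrite natr_sum mulr_suml; apply: eq_bigr => p _; rewrite mul1r.
have := count_primes_dyadic j; set c := (\sum_(_ <= _ < _ | _) _)%N => Hc.
rewrite ler_pdivrMr ?ltr0n ?expn_gt0// mulrAC ler_pdivlMr ?ltr0n//.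
by rewrite -!natrM ler_nat mulnC -expnS.
Qed.

(** Add the dyadic bounds, each at most 2/a: the sum of 1/p over the primes
    between Z and a fixed power of Z is bounded. *)
Lemma prime_sum_inv_window a b : (0 < a)%N -> (a <= b)%N ->
  prime_sum (2 ^ a) (2 ^ b) (fun p => p%:R^-1 : R) <= 2 * (b - a)%:R / a%:R.
Proof.
move=> a0 ab; rewrite -(subnKC ab) addKn; elim: (b - a)%N => [|k IH].
  by rewrite addn0 /prime_sum big_geq// mulr0 mul0r.
rewrite addnS (@prime_sum_cat _ _ (2 ^ (a + k))) ?leq_exp2l ?leq_addr//.
rewrite -[k.+1]addn1 natrD mulrDr mulr1 mulrDl lerD//.
apply: le_trans (prime_sum_inv_dyadic _) _; first by rewrite addn_gt0 a0.
by rewrite ler_pM2l// lef_pV2 ?posrE ?ltr0n ?addn_gt0 ?a0// ler_nat leq_addr.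
Qed.

Lemma sum_dvdn d N : (0 < d)%N -> \sum_(1 <= n < N.+1) ((d %| n)%:R : R) = (N %/ d)%:R.
Proof.
move=> d0; elim: N => [|N IH]; first by rewrite big_geq// div0n.
by rewrite big_nat_recr//= IH divnS// natrD addrC.
Qed.

Lemma divn_le_real d N : (0 < d)%N -> ((N %/ d)%:R : R) <= N%:R / d%:R.
Proof. by move=> d0; rewrite ler_pdivlMr ?ltr0n// -natrM ler_nat leq_trunc_div. Qed.

Lemma divn_ge_real d N : (0 < d)%N -> N%:R / d%:R - 1 <= ((N %/ d)%:R : R).
Proof.
move=> d0; rewrite lerBlDr ler_pdivrMr ?ltr0n// natr1 -natrM ler_nat.
by rewrite ltnW// ltn_ceil.
Qed.

End PrimeSums.

Section TuranKubilius.
Context {R : realType}.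

Let centred (p n : nat) : R := (p %| n)%:R - p%:R^-1.

(** The events p | n and r | n are independent up to the rounding of N/p, N/r
    and N/pr. The rounding errors are at most 1; those of the first two enter
    with the coefficients 1/r and 1/p, at most 1/2, and with the sign opposite
    to that of the third. *)
Lemma centred_cov p r N : prime p -> prime r -> p != r ->
  `|\sum_(1 <= n < N.+1) centred p n * centred r n| <= 1.
Proof.
move=> pp rp pr.
have p0 : (0 : R) < p%:R by rewrite ltr0n prime_gt0.
have r0 : (0 : R) < r%:R by rewrite ltr0n prime_gt0.
have -> : \sum_(1 <= n < N.+1) centred p n * centred r n =
   (N %/ (p * r))%:R - (N %/ p)%:R / r%:R - (N %/ r)%:R / p%:R + N%:R / (p%:R * r%:R).
  rewrite -(@sum_dvdn R (p * r)) ?muln_gt0 ?prime_gt0//.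
  rewrite -(@sum_dvdn R p) ?prime_gt0// -(@sum_dvdn R r) ?prime_gt0//.
  have -> : N%:R / (p%:R * r%:R) = \sum_(1 <= n < N.+1) (p%:R * r%:R)^-1 :> R.
    by rewrite sumr_const_nat subn1 -[RHS]mulr_natl.
  rewrite !mulr_suml -!sumrB -big_split/=; apply: eq_bigr => n _.
  rewrite /centred (_ : (p * r %| n)%N = (p %| n)%N && (r %| n)%N); last first.
    by rewrite Gauss_dvd// prime_coprime// dvdn_prime2.
  have [p0' r0'] : (p%:R != 0 :> R) /\ (r%:R != 0 :> R) by rewrite !gt_eqF.
  by case: (p %| n)%N; case: (r %| n)%N => /=; field; rewrite p0' r0'.
have d0 : (0 < p * r)%N by rewrite muln_gt0 !prime_gt0.
have := @divn_le_real R _ N d0; have := @divn_ge_real R _ N d0; rewrite natrM.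
have := @divn_le_real R _ N (prime_gt0 pp); have := @divn_ge_real R _ N (prime_gt0 pp).
have := @divn_le_real R _ N (prime_gt0 rp); have := @divn_ge_real R _ N (prime_gt0 rp).
set A := (N %/ p)%:R; set B := (N %/ r)%:R; set C := (N %/ (p * r))%:R.
move=> H1 H2 H3 H4 H5 H6.
have p2 : (2 : R) <= p%:R by rewrite ler_nat prime_gt1.
have r2 : (2 : R) <= r%:R by rewrite ler_nat prime_gt1.
set a : R := p%:R in p0 p2 H1 H2 H3 H4 H5 H6 *; set b : R := r%:R in r0 r2 H1 H2 H3 H4 H5 H6 *.
have ab : 0 < a * b by rewrite mulr_gt0.
have E1 : A / b <= N%:R / (a * b) by rewrite invfM mulrA ler_pM2r ?invr_gt0.
have E2 : B / a <= N%:R / (a * b) by rewrite invfM mulrA [X in _ <= X]mulrAC ler_pM2r ?invr_gt0.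
have E3 : N%:R / (a * b) - b^-1 <= A / b.
  have -> : N%:R / (a * b) - b^-1 = (N%:R / a - 1) / b by field; rewrite !gt_eqF.
  by rewrite ler_pM2r ?invr_gt0.
have E4 : N%:R / (a * b) - a^-1 <= B / a.
  have -> : N%:R / (a * b) - a^-1 = (N%:R / b - 1) / a by field; rewrite !gt_eqF.
  by rewrite ler_pM2r ?invr_gt0.
have a2 : a^-1 <= 2^-1 by rewrite lef_pV2 ?posrE.
have b2 : b^-1 <= 2^-1 by rewrite lef_pV2 ?posrE.
by rewrite ler_norml; apply/andP; split; lra.
Qed.

Lemma centred_var p N : prime p -> \sum_(1 <= n < N.+1) centred p n ^+ 2 <= N%:R / p%:R.
Proof.
move=> pp; have p0 : (0 : R) < p%:R by rewrite ltr0n prime_gt0.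
have -> : \sum_(1 <= n < N.+1) centred p n ^+ 2 =
   (N %/ p)%:R * (1 - 2 / p%:R) + N%:R / p%:R ^+ 2.
  rewrite -(@sum_dvdn R p) ?prime_gt0//.
  have -> : N%:R / p%:R ^+ 2 = \sum_(1 <= n < N.+1) (p%:R ^+ 2)^-1 :> R.
    by rewrite sumr_const_nat subn1 -[RHS]mulr_natl.
  rewrite mulr_suml -big_split/=; apply: eq_bigr => n _.
  by rewrite /centred; case: (p %| n)%N => /=; field; rewrite gt_eqF.
have := @divn_le_real R _ N (prime_gt0 pp).
have p2 : (2 : R) <= p%:R by rewrite ler_nat prime_gt1.
set a : R := p%:R in p0 p2 *; set A := (N %/ p)%:R => H.
have a2 : 0 <= 1 - 2 / a by rewrite subr_ge0 ler_pdivrMr// mul1r.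
apply: le_trans (lerD (ler_wpM2r a2 H) (lexx _)) _.
rewrite -subr_ge0.
have -> : N%:R / a - (N%:R / a * (1 - 2 / a) + N%:R / a ^+ 2) = N%:R / a ^+ 2.
  by field; rewrite gt_eqF.
by rewrite divr_ge0 ?sqr_ge0.
Qed.

(** Turan--Kubilius: expand the square. The diagonal gives N times the sum of
    w(p)^2/p. Each off-diagonal covariance is at most 1, and w(p) w(r) <=
    (w(p)^2 r/p + w(r)^2 p/r) / 2 bounds their total by the sum of w(p)^2/p
    times the sum of the primes involved, which is at most Z^2 <= N. *)
Lemma turan_kubilius (s : seq nat) (w : nat -> R) Z N :
  uniq s -> all prime s -> all (fun p => (p <= Z)%N) s -> (Z ^ 2 <= N)%N ->
  \sum_(1 <= n < N.+1) (\sum_(p <- s) w p * ((p %| n)%:R - p%:R^-1)) ^+ 2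
    <= 2 * N%:R * \sum_(p <- s) w p ^+ 2 / p%:R.
Proof.
move=> us /allP sp /allP sZ ZN; set S := \sum_(p <- s) _ / _.
pose T : R := \sum_(p <- s) p%:R.
have S0 : 0 <= S by apply: sumr_ge0 => p _; rewrite divr_ge0 ?sqr_ge0.
have TN : T <= N%:R.
  rewrite /T -natr_sum ler_nat; apply: leq_trans ZN; rewrite expnS expn1.
  apply: leq_trans (_ : \sum_(p <- s) Z <= _)%N.
    by rewrite big_seq [leqRHS]big_seq; apply: leq_sum => p /sZ.
  rewrite big_const_seq count_predT iter_addn_0 leq_mul2l; apply/orP; right.
  rewrite -(size_iota 1 Z); apply: uniq_leq_size => // p ps.
  by rewrite mem_iota add1n ltnS prime_gt0 ?sp// sZ.
have -> : \sum_(1 <= n < N.+1) (\sum_(p <- s) w p * ((p %| n)%:R - p%:R^-1)) ^+ 2 =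
  \sum_(p <- s) \sum_(r <- s) w p * w r * \sum_(1 <= n < N.+1) centred p n * centred r n.
  under eq_bigr do rewrite expr2 mulr_suml.
  rewrite exchange_big/=; apply: eq_bigr => p _.
  under eq_bigr do rewrite mulr_sumr.
  rewrite exchange_big/=; apply: eq_bigr => r _.
  by rewrite mulr_sumr; apply: eq_bigr => n _; rewrite /centred; ring.
apply: le_trans (_ : \sum_(p <- s) \sum_(r <- s) ((p == r)%:R * (w p ^+ 2 * (N%:R / p%:R)) +
   (w p ^+ 2 / p%:R * r%:R + w r ^+ 2 / r%:R * p%:R) / 2) <= _).
  rewrite big_seq [leRHS]big_seq; apply: ler_sum => p ps.
  rewrite big_seq [leRHS]big_seq; apply: ler_sum => r rs.
  have pp := sp _ ps; have rp := sp _ rs.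
  have p0 : (0 : R) < p%:R by rewrite ltr0n prime_gt0.
  have r0 : (0 : R) < r%:R by rewrite ltr0n prime_gt0.
  have [<-|pr] := eqVneq p r.
    rewrite mul1r -expr2; apply: ler_wpDr.
      by rewrite divr_ge0// addr_ge0// mulr_ge0// ?divr_ge0 ?sqr_ge0 ?ltW.
    rewrite ler_wpM2l ?sqr_ge0//.
    by under eq_bigr do rewrite -expr2; exact: centred_var.
  rewrite mul0r add0r.
  apply: le_trans (ler_norm _) _; rewrite normrM normrM.
  apply: le_trans (ler_wpM2l _ (centred_cov N pp rp pr)) _; first by rewrite mulr_ge0.
  rewrite mulr1 ler_pdivlMr// -[w p ^+ 2]real_normK ?num_real// -[w r ^+ 2]real_normK ?num_real//.
  set x := `|w p|; set y := `|w r|.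
  rewrite -subr_ge0.
  have -> : x ^+ 2 / p%:R * r%:R + y ^+ 2 / r%:R * p%:R - x * y * 2 =
     (x * r%:R - y * p%:R) ^+ 2 / (p%:R * r%:R) by field; rewrite !gt_eqF.
  by rewrite divr_ge0 ?sqr_ge0// mulr_ge0// ltW.
have diag : \sum_(p <- s) \sum_(r <- s) (p == r)%:R * (w p ^+ 2 * (N%:R / p%:R)) = N%:R * S.
  rewrite mulr_sumr big_seq [RHS]big_seq; apply: eq_bigr => p ps.
  rewrite (bigD1_seq p)//= eqxx mul1r big1 ?addr0; first by ring.
  by move=> r rp; rewrite eq_sym (negbTE rp) mul0r.
under eq_bigr do rewrite big_split/=.
rewrite big_split/= diag.
have -> : \sum_(p <- s) \sum_(r <- s) (w p ^+ 2 / p%:R * r%:R + w r ^+ 2 / r%:R * p%:R) / 2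
   = S * T.
  under eq_bigr do rewrite -mulr_suml big_split/= -mulr_sumr -mulr_suml -/S -/T.
  rewrite -mulr_suml big_split/= -mulr_suml -/S -mulr_sumr -/T; by field.
by rewrite -[leRHS]mulrA [leRHS]mulr_natl mulr2n lerD2l mulrC ler_wpM2r.
Qed.

End TuranKubilius.

(** * Approximating a multiplicative function up to the drift *)

Section ComplexExponential.
Context {R : realType}.
Implicit Types z w : R[i].

Definition cexp z : R[i] := (expR (complex.Re z))%:C%C * cis (complex.Im z).

Lemma cexp0 : cexp 0 = 1.
Proof. by rewrite /cexp expR0 cis0 mulr1. Qed.

Lemma cexpD z w : cexp (z + w) = cexp z * cexp w.
Proof. by rewrite /cexp Re_addc Im_addc expRD cisD rmorphM; ring. Qed.

Lemma cexp_sum (I : Type) (s : seq I) (P : pred I) (F : I -> R[i]) :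
  cexp (\sum_(i <- s | P i) F i) = \prod_(i <- s | P i) cexp (F i).
Proof.
by elim/big_rec2: _ => [|i y1 y2 _ <-]; rewrite ?cexp0 ?cexpD.
Qed.

Lemma cnorm_cexp z : cnorm (cexp z) = expR (complex.Re z).
Proof. by rewrite cnormM cnorm_cis mulr1 cnorm_real ger0_norm ?expR_ge0. Qed.

Lemma cexp_neq0 z : cexp z != 0.
Proof.
apply/eqP => /(congr1 cnorm); rewrite cnorm_cexp cnorm0 => /eqP.
by rewrite gt_eqF ?expR_gt0.
Qed.

Lemma cnorm_cexp_le1 z : complex.Re z <= 0 -> cnorm (cexp z) <= 1.
Proof. by move=> z0; rewrite cnorm_cexp -expR0 ler_expR. Qed.

Lemma expR_lipschitz (a b : R) : a <= 0 -> b <= 0 -> `|expR a - expR b| <= `|a - b|.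
Proof.
wlog ab : a b / b <= a => [H a0 b0|a0 _].
  have [ab|/ltW ab] := leP b a; first exact: H.
  by rewrite distrC [leRHS]distrC H.
rewrite !ger0_norm ?subr_ge0 ?ler_expR//.
have -> : expR a - expR b = expR a * (1 - expR (b - a)).
  by rewrite mulrBr mulr1 -expRD addrCA subrr addr0.
have ea1 : expR a <= 1 by rewrite -expR0 ler_expR.
have := expR_ge1Dx (b - a); have := expR_gt0 a.
have : 0 <= 1 - expR (b - a) by rewrite subr_ge0 -expR0 ler_expR subr_le0.
by move: (expR a) (expR _) ea1 => x y; nra.
Qed.

(** On the half-plane Re <= 0 the exponential is a contraction in the real
    part and 1-Lipschitz in the imaginary part. *)
Lemma cexp_lipschitz z w : complex.Re z <= 0 -> complex.Re w <= 0 ->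
  cnorm (cexp z - cexp w) <= 2 * cnorm (z - w).
Proof.
move=> z0 w0.
have -> : cexp z - cexp w =
    (expR (complex.Re z))%:C%C * (cis (complex.Im z) - cis (complex.Im w)) +
    (expR (complex.Re z) - expR (complex.Re w))%:C%C * cis (complex.Im w).
  by rewrite /cexp rmorphB; ring.
apply: le_trans (cnormD _ _) _; rewrite !cnormM cnorm_cis mulr1 !cnorm_real.
rewrite mulr2n mulrDl mul1r lerD//.
  apply: le_trans (_ : 1 * `|complex.Im z - complex.Im w| <= _).
    by apply: ler_pM; rewrite ?cnorm_ge0 ?cnorm_cisB_le// ger0_norm ?expR_ge0// -expR0 ler_expR.
  by rewrite mul1r -Im_oppc -Im_addc normr_Im_le.
apply: le_trans (expR_lipschitz z0 w0) _.
by rewrite -Re_oppc -Re_addc normr_Re_le.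
Qed.

Lemma cexp_taylor z : complex.Re z <= 0 ->
  cnorm (cexp z - 1 - z) <= 2 * cnorm z ^+ 2.
Proof.
move=> a0; rewrite cnorm_sqr /cexp.
have zE : z = Complex (complex.Re z) (complex.Im z) by case: (z).
set a := complex.Re z in a0 zE *; set b := complex.Im z in zE *; rewrite zE.
have -> : (expR a)%:C%C * cis b - 1 - Complex a b =
   (expR a - 1 - a)%:C%C + (expR a)%:C%C * (cis b - 1 - Complex 0 b) +
   (expR a - 1)%:C%C * Complex 0 b :> R[i].
  by apply: complex_eq; rewrite ?(Re_addc, Re_oppc, Im_addc, Im_oppc, Re_mulrc, Im_mulrc)/=; ring.
have ea1 : expR a <= 1 by rewrite -expR0 ler_expR.
have e0 := expR_ge0 a; have e1 := expR_ge1Dx a.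
have e2 := @expRN_le _ (- a); rewrite oppr_ge0 opprK sqrrN in e2; have {}e2 := e2 a0.
apply: le_trans (cnormD _ _) _; rewrite cnormM cnorm_real cnorm_imag.
apply: le_trans (lerD (cnormD _ _) (lexx _)) _; rewrite cnormM !cnorm_real.
have B1 : `|expR a - 1 - a| <= a ^+ 2 / 2 by rewrite ger0_norm; lra.
have B2 : `|expR a| * cnorm (cis b - 1 - Complex 0 b : R[i]) <= b ^+ 2.
  rewrite -[leRHS]mul1r ler_pM ?cnorm_ge0 ?cnorm_cis_taylor//.
  by rewrite ger0_norm.
have B3 : `|expR a - 1| * `|b| <= (a ^+ 2 + b ^+ 2) / 2.
  apply: le_trans (_ : `|a| * `|b| <= _).
    by rewrite ler_wpM2r// ler0_norm ?subr_le0// ler0_norm//; lra.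
  rewrite -[a ^+ 2]real_normK ?num_real// -[b ^+ 2]real_normK ?num_real//.
  by have := sqr_ge0 (`|a| - `|b|); rewrite sqrrB; lra.
by have := sqr_ge0 a; have := sqr_ge0 b; lra.
Qed.

(** Replace the factors one at a time; all the others lie in the unit disc. *)
Lemma cnorm_prodB (I : Type) (s : seq I) (P : pred I) (a b : I -> R[i]) :
  (forall i, cnorm (a i) <= 1) -> (forall i, cnorm (b i) <= 1) ->
  cnorm (\prod_(i <- s | P i) a i - \prod_(i <- s | P i) b i)
    <= \sum_(i <- s | P i) cnorm (a i - b i).
Proof.
move=> a1 b1; suff [] : cnorm (\prod_(i <- s | P i) a i - \prod_(i <- s | P i) b i)
    <= \sum_(i <- s | P i) cnorm (a i - b i) /\ cnorm (\prod_(i <- s | P i) b i) <= 1 by [].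
elim/big_rec3: _ => [|i y1 x y2 _ [IH1 IH2]].
  by rewrite subrr cnorm0 cnorm1.
split; last by rewrite cnormM mulr_ile1 ?cnorm_ge0.
have -> : a i * y2 - b i * x = (a i - b i) * x + a i * (y2 - x) by ring.
apply: le_trans (cnormD _ _) _; rewrite !cnormM lerD//.
  by rewrite ler_piMr ?cnorm_ge0.
by apply: le_trans IH1; rewrite ler_piMl ?cnorm_ge0.
Qed.

End ComplexExponential.

Section MultiplicativeFactorization.
Context {A : comNzRingType}.

Definition multiplicative_on_coprime (g : nat -> A) := forall m n : nat,
  (0 < m)%N -> (0 < n)%N -> coprime m n -> g (m * n)%N = g m * g n.

Lemma multiplicative_prod_primes (g : nat -> A) (s : seq nat) (e : nat -> nat) :
  multiplicative_on_coprime g -> g 1%N = 1 -> uniq s -> all prime s ->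
  g (\prod_(p <- s) p ^ e p)%N = \prod_(p <- s) g (p ^ e p)%N.
Proof.
move=> gM g1; elim: s => [|p s IH] /=; first by rewrite !big_nil g1.
move=> /andP[ps us] /andP[pp sp]; rewrite !big_cons gM ?IH//.
- by rewrite expn_gt0 prime_gt0.
- rewrite big_seq prodn_cond_gt0// => r rs.
  by rewrite expn_gt0 prime_gt0// (allP sp).
- elim: (s) ps sp {IH us} => [|r s' IHs]; first by rewrite big_nil coprimen1.
  rewrite inE negb_or big_cons /= coprimeMr => /andP[pr ps] /andP[rp sp].
  rewrite IHs// andbT coprimeXl// coprimeXr//.
  by rewrite prime_coprime// dvdn_prime2.
Qed.

Lemma multiplicative_eq_prod (g : nat -> A) n : multiplicative_on_coprime g -> g 1%N = 1 -> (0 < n)%N ->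
  g n = \prod_(p <- primes n) g (p ^ logn p n)%N.
Proof.
move=> gM g1 n0; rewrite -(@multiplicative_prod_primes _ _ (fun p => logn p n))//.
- by congr g; rewrite {1}[n]prod_prime_decomp// prime_decompE big_map.
- exact: primes_uniq.
- by apply/allP => p; rewrite mem_primes => /andP[].
Qed.

End MultiplicativeFactorization.

Section RoughApproximation.
Context {R : realType} (g chi : nat -> R[i]).
Hypothesis gM : multiplicative_on_coprime g.
Hypothesis g1 : g 1%N = 1.
Hypothesis g_le1 : forall n, (0 < n)%N -> cnorm (g n) <= 1.
Hypothesis chiM : forall m n, chi (m * n)%N = chi m * chi n.
Hypothesis chi1 : chi 1%N = 1.
Hypothesis chi_le1 : forall n, cnorm (chi n) <= 1.
Context (y : nat).
Hypothesis chi_unit : forall p, prime p -> (y < p)%N -> cnorm (chi p) = 1.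

(** The value at primes that measures how far g is from chi: twist p = 1 where
    they agree. *)
Definition twist p := g p * conjc (chi p).

Lemma Re_twist_le0 p : (0 < p)%N -> complex.Re (twist p - 1) <= 0.
Proof.
move=> p0; rewrite Re_addc Re_oppc/= subr_le0; apply: le_trans (Re_le_cnorm _) _.
by rewrite cnormM cnorm_conj mulr_ile1 ?cnorm_ge0 ?g_le1.
Qed.

(** For z in the unit disc |z - 1|^2 <= 2 (1 - Re z): the terms of the
    pretentious distance control the second moments. *)
Lemma cnorm_twistB1 p : (0 < p)%N ->
  cnorm (twist p - 1) ^+ 2 <= 2 * (1 - complex.Re (twist p)).
Proof.
move=> p0; rewrite cnormB_sqr cnorm1 expr1n.
have -> : twist p * conjc 1 = twist p by apply: complex_eq; rewrite ?(Re_mulc, Im_mulc)/=; ring.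
have : cnorm (twist p) ^+ 2 <= 1.
  by rewrite expr_le1 ?cnorm_ge0// cnormM cnorm_conj mulr_ile1 ?cnorm_ge0 ?g_le1.
lra.
Qed.

Lemma chi_eq_prod n : (0 < n)%N -> chi n = \prod_(p <- primes n) chi (p ^ logn p n)%N.
Proof. by move=> n0; apply: multiplicative_eq_prod => // m k _ _ _; exact: chiM. Qed.

(** On integers without small prime factor, g is chi times the exponential of
    an additive function, up to a small error. Compare the two products factor
    by factor. At a prime p <= Z dividing n exactly once, the factors twist p
    and exp(twist p - 1) differ by the quadratic Taylor error; above Z, where
    chi is left uncorrected, the error is |twist p - 1|; primes with p^2 | n
    are rare enough for the trivial bound. *)
Lemma rough_approx Z n : (0 < n)%N -> (forall p, p \in primes n -> (y < p)%N) ->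
  cnorm (g n - chi n * cexp (\sum_(p <- primes n | (p <= Z)%N) (twist p - 1)))
  <= \sum_(p <- primes n) ((if (p <= Z)%N then 2 * cnorm (twist p - 1) ^+ 2
                            else cnorm (twist p - 1)) + 2 * (p ^ 2 %| n)%:R).
Proof.
move=> n0 Hy; rewrite cexp_sum (multiplicative_eq_prod gM g1 n0) (chi_eq_prod n0).
rewrite [X in _ * X]big_mkcond -big_split/=.
pose a p := if (0 < p)%N then g (p ^ logn p n)%N else 1.
pose b p := chi (p ^ logn p n)%N * (if (p <= Z)%N && (0 < p)%N then cexp (twist p - 1) else 1).
have pn0 p : p \in primes n -> (0 < p)%N by rewrite mem_primes => /and3P[/prime_gt0].
rewrite (_ : \prod_(p <- primes n) g (p ^ logn p n)%N = \prod_(p <- primes n) a p); last first.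
  by rewrite big_seq [RHS]big_seq; apply: eq_bigr => p /pn0 p0; rewrite /a p0.
rewrite (_ : \prod_(p <- primes n) (_ * _) = \prod_(p <- primes n) b p); last first.
  by rewrite big_seq [RHS]big_seq; apply: eq_bigr => p /pn0 p0; rewrite /b p0 andbT.
have a1 p : cnorm (a p) <= 1.
  by rewrite /a; case: ifP => p0; rewrite ?cnorm1// g_le1// expn_gt0 p0.
have b1 p : cnorm (b p) <= 1.
  rewrite /b cnormM mulr_ile1 ?cnorm_ge0//; case: ifP => [/andP[_ p0]|_]; rewrite ?cnorm1//.
  by rewrite cnorm_cexp_le1// Re_twist_le0.
apply: le_trans (cnorm_prodB _ _ a1 b1) _.
rewrite big_seq [leRHS]big_seq; apply: ler_sum => p pn.
have p0 := pn0 _ pn; have yp := Hy _ pn; have pp : prime p by move: pn; rewrite mem_primes => /andP[].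
have ab2 : cnorm (a p - b p) <= 2.
  by apply: le_trans (cnormD _ _) _; rewrite cnormN; have := a1 p; have := b1 p; lra.
have [pp2|pp2] := boolP (p ^ 2 %| n)%N.
  rewrite mulr1; apply: le_trans ab2 _; rewrite lerDr; case: ifP => _; rewrite ?cnorm_ge0//.
  by rewrite mulr_ge0// sqr_ge0.
rewrite mulr0 addr0 /a /b p0 andbT.
have -> : logn p n = 1%N.
  apply/eqP; rewrite eqn_leq -(pfactor_dvdn 1 pp n0) expn1.
  move: pn; rewrite mem_primes => /and3P[_ _ ->]; rewrite andbT leqNgt.
  by rewrite -(pfactor_dvdn 2 pp n0).
rewrite expn1.
have cc : chi p * conjc (chi p) = 1 by rewrite mulc_conj chi_unit// expr1n.
have -> : g p = chi p * twist p by rewrite /twist mulrCA cc mulr1.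
rewrite -mulrBr cnormM chi_unit// mul1r.
case: ifP => _ //.
apply: le_trans (cexp_taylor (Re_twist_le0 p0)); rewrite cnormB.
by rewrite le_eqVlt; apply/orP; left; apply/eqP; congr cnorm; ring.
Qed.

Let small : nat_pred := [pred p | p <= y]%N.

(** Only on the y-rough part of n is g replaced by chi. The y-smooth part
    takes few values, except on a sparse set of n. *)
Definition model n := g (n`_small)%N * chi (n`_(negn small))%N.

Lemma cnorm_model_le1 n : cnorm (model n) <= 1.
Proof. by rewrite cnormM mulr_ile1 ?cnorm_ge0// g_le1 ?part_gt0. Qed.

(** Sums over the large prime divisors of n become sums over all primes up to
    N, which can be averaged over n. *)
Lemma primes_dvd_sum (V : nmodType) n N (P : pred nat) (F : nat -> V) : (0 < n <= N)%N ->
  \sum_(p <- primes n`_(negn small) | P p) F p =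
  prime_sum y N (fun p => if P p && (p %| n)%N then F p else 0).
Proof.
move=> /andP[n0 nN]; rewrite /prime_sum -big_mkcondr/= primes_part big_filter_cond.
rewrite -big_filter -[RHS]big_filter; apply: perm_big; apply: uniq_perm.
- by rewrite filter_uniq// primes_uniq.
- by rewrite filter_uniq// iota_uniq.
- move=> p; rewrite !mem_filter mem_index_iota mem_primes n0/= !inE/= ltnS -ltnNge.
  apply/idP/idP.
    move=> /andP[/andP[-> ->] /andP[-> pn]]; rewrite pn/=.
    by rewrite (leq_trans (dvdn_leq n0 pn)).
  by move=> /andP[/and3P[-> -> ->] /andP[-> _]].
Qed.

Lemma model_approx Z n N : (0 < n <= N)%N -> (Z <= N)%N ->
  cnorm (g n - model n * cexp (prime_sum y Z (fun p => if (p %| n)%N then twist p - 1 else 0)))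
  <= prime_sum y N (fun p => (p %| n)%:R *
       ((if (p <= Z)%N then 2 * cnorm (twist p - 1) ^+ 2 else cnorm (twist p - 1))))
     + 2 * prime_sum y N (fun p => (p ^ 2 %| n)%:R).
Proof.
move=> n0N ZN; have /andP[n0 nN] := n0N.
set r := (n`_(negn small))%N.
have gn : g n = g (n`_small)%N * g r.
  by rewrite -gM ?part_gt0 ?partnC// coprime_partC.
have sumZ : prime_sum y Z (fun p => if (p %| n)%N then twist p - 1 else 0) =
    \sum_(p <- primes r | (p <= Z)%N) (twist p - 1).
  rewrite (@primes_dvd_sum _ n N)// /prime_sum.
  have [yZ|Zy] := leqP y Z.
    rewrite -!/(prime_sum _ _ _) (@prime_sum_cat _ y Z N)// [X in _ + X]/prime_sum.
    rewrite [X in _ + X]big_nat_cond [X in _ + X]big1 ?addr0; last first.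
      by move=> p /andP[/andP[Zp _] _]; rewrite leqNgt Zp.
    rewrite /prime_sum big_nat_cond [RHS]big_nat_cond; apply: eq_bigr => p.
    by rewrite ltnS => /andP[/andP[_ ->] _].
  rewrite [LHS]big_geq; last by rewrite ltnS ltnW.
  rewrite big_nat_cond big1// => p /andP[/andP[yp _] _].
  by rewrite leqNgt (ltn_trans Zy yp).
rewrite sumZ gn /model -/r -mulrA -mulrBr cnormM.
apply: le_trans (_ : 1 * _ <= _); first by apply: ler_wpM2r; rewrite ?cnorm_ge0 ?g_le1 ?part_gt0.
rewrite mul1r; apply: le_trans (rough_approx Z _ _) _; rewrite ?part_gt0//.
  by move=> p; rewrite primes_part mem_filter inE/= -ltnNge => /andP[].
rewrite (@primes_dvd_sum _ n N)// -prime_sumZ -prime_sumD; apply: le_prime_sum => p pp _ /=.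
case: ifPn => pn; last first.
  by rewrite mul0r add0r mulr_ge0.
rewrite mul1r lerD2l ler_pM2l// ler_nat.
by have [pr|] := boolP (p ^ 2 %| r)%N => //; rewrite (dvdn_trans pr) ?dvdn_part.
Qed.

End RoughApproximation.

Section AveragedApproximation.
Context {R : realType}.
Implicit Types u v : nat -> R.

Lemma average_CesaroE N u : average Cesaro N u = N%:R^-1 * \sum_(1 <= n < N.+1) u n.
Proof.
rewrite /average total_weight_Cesaro; congr (_ * _).
by apply: eq_bigr => n _; rewrite mul1r.
Qed.

Lemma average_prime_sum_dvd y M N (d : nat -> nat) (F : nat -> R) :
  (forall p, prime p -> (0 < d p)%N) ->
  (forall p, prime p -> 0 <= F p) ->
  average Cesaro N (fun n => prime_sum y M (fun p => (d p %| n)%:R * F p))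
    <= prime_sum y M (fun p => F p / (d p)%:R).
Proof.
move=> d0 F0; have [->|N0] := posnP N.
  rewrite average_CesaroE big_geq// mulr0; apply: prime_sum_ge0 => p pp _.
  by rewrite divr_ge0 ?F0.
rewrite average_CesaroE ler_pdivrMl ?ltr0n// /prime_sum exchange_big/= mulr_sumr.
apply: ler_sum => p pp; rewrite -mulr_suml sum_dvdn ?d0//.
by rewrite mulrA [leRHS]mulrAC ler_wpM2r ?F0// divn_le_real ?d0.
Qed.

Lemma prime_sum_inv_sqr y N : (0 < y)%N ->
  prime_sum y N (fun p => (p ^ 2)%:R^-1 : R) <= y%:R^-1.
Proof.
move=> y0; have [Ny|yN] := leqP N y.
  by rewrite /prime_sum big_geq// invr_ge0.
apply: le_trans (_ : \sum_(y.+1 <= p < N.+1) ((p.-1)%:R^-1 - p%:R^-1 : R) <= _).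
  rewrite /prime_sum big_mkcond/=; apply: ler_sum_nat => p /andP[yp _].
  case: p yp => // p yp; have p0 : (0 < p)%N by exact: leq_trans y0 yp.
  have pR : (0 : R) < p%:R by rewrite ltr0n.
  have D : p%:R^-1 - p.+1%:R^-1 = (p%:R * p.+1%:R)^-1 :> R.
    have q0 : p%:R + 1 != 0 :> R by rewrite natr1 pnatr_eq0.
    have q1 : p%:R != 0 :> R by rewrite gt_eqF.
    by rewrite -natr1; field; rewrite q0 q1.
  rewrite /= D; case: ifP => _; last by rewrite invr_ge0 mulr_ge0.
  by rewrite -natrM lef_pV2 ?posrE ?ltr0n ?muln_gt0 ?expn_gt0 ?p0// ler_nat expnS expn1 leq_mul2r leqnSn orbT.
rewrite big_add1/= -[leRHS]subr0 -[X in _ <= X - _]opprK.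
under eq_bigr do rewrite -[_ - _]opprK opprB.
rewrite sumrN telescope_sumr ?(ltnW yN)// opprB opprK lerD2l lerN2.
by rewrite invr_ge0.
Qed.

(** AM-GM: trades a first moment for a second moment, at the price of s. *)
Lemma le_scaled_sqr (x s : R) : 0 < s -> x <= s + x ^+ 2 / s.
Proof.
move=> s0; rewrite -(ler_pM2r s0) mulrDl divfK ?gt_eqF//.
have := sqr_ge0 (x - s); have := sqr_ge0 x; have := sqr_ge0 s; nra.
Qed.

End AveragedApproximation.

Section AveragedModel.
Context {R : realType} (g chi : nat -> R[i]).
Hypothesis gM : multiplicative_on_coprime g.
Hypothesis g1 : g 1%N = 1.
Hypothesis g_le1 : forall n, (0 < n)%N -> cnorm (g n) <= 1.
Hypothesis chiM : forall m n, chi (m * n)%N = chi m * chi n.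
Hypothesis chi1 : chi 1%N = 1.
Hypothesis chi_le1 : forall n, cnorm (chi n) <= 1.
Context (y : nat) (y0 : (0 < y)%N).
Hypothesis chi_unit : forall p, prime p -> (y < p)%N -> cnorm (chi p) = 1.
Local Notation h := (twist g chi).

(** The mean over n of the additive function sum over p | n of (twist p - 1). *)
Definition drift a b : R[i] := prime_sum a b (fun p => (h p - 1) * p%:R^-1%:C%C).

Lemma Re_drift_le0 a b : complex.Re (drift a b) <= 0.
Proof.
rewrite /drift /prime_sum Re_sum; apply: sumr_le0 => p pp.
rewrite mulrC Re_mulrc mulr_ge0_le0 ?invr_ge0//.
exact: Re_twist_le0 (prime_gt0 pp).
Qed.

(** Turan--Kubilius for the real and the imaginary part of the additive
    function. *)
Lemma additive_concentration delta Z N : (Z ^ 2 <= N)%N -> (0 < N)%N ->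
  prime_sum y Z (fun p => cnorm (h p - 1) ^+ 2 / p%:R) <= delta ->
  average Cesaro N (fun n =>
    cnorm (prime_sum y Z (fun p => if (p %| n)%N then h p - 1 else 0) - drift y Z) ^+ 2)
    <= 2 * delta.
Proof.
move=> ZN N0 Hd; apply: le_trans (_ : 2 * prime_sum y Z (fun p => cnorm (h p - 1) ^+ 2 / p%:R) <= _);
  last by rewrite ler_pM2l.
rewrite average_CesaroE ler_pdivrMl ?ltr0n// mulrCA mulrA.
pose s := [seq p <- index_iota y.+1 Z.+1 | prime p].
have us : uniq s by rewrite filter_uniq// iota_uniq.
have sp : all prime s by apply/allP => p; rewrite mem_filter => /andP[].
have sZ : all (fun p => (p <= Z)%N) s.
  by apply/allP => p; rewrite mem_filter mem_index_iota ltnS => /and3P[].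
have TK1 := turan_kubilius (fun p => complex.Re (h p - 1)) us sp sZ ZN.
have TK2 := turan_kubilius (fun p => complex.Im (h p - 1)) us sp sZ ZN.
have := lerD TK1 TK2; rewrite -big_split/= -mulrDr -big_split/=.
have sE (V : nmodType) (G : nat -> V) : prime_sum y Z G = \sum_(p <- s) G p.
  by rewrite /prime_sum -big_filter.
rewrite [X in _ <= 2 * N%:R * X](_ : _ = prime_sum y Z (fun p => cnorm (h p - 1) ^+ 2 / p%:R)).
  move=> H; apply: le_trans H.
  rewrite le_eqVlt; apply/orP; left; apply/eqP; apply: eq_bigr => n _.
  have -> : prime_sum y Z (fun p => if (p %| n)%N then h p - 1 else 0) - drift y Z =
     \sum_(p <- s) (h p - 1) * ((p %| n)%:R - p%:R^-1)%:C%C.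
    rewrite /drift !sE -sumrB; apply: eq_bigr => p _.
    by rewrite rmorphB mulrBr; congr (_ - _); case: ifP => _; rewrite ?mulr1 ?mulr0.
  rewrite cnorm_sqr Re_sum Im_sum; congr (_ ^+ 2 + _ ^+ 2); apply: eq_bigr => p _.
    by rewrite mulrC Re_mulrc mulrC.
  by rewrite mulrC Im_mulrc mulrC.
by rewrite sE; apply: eq_bigr => p _; rewrite -mulrDl cnorm_sqr.
Qed.

(** Average the pointwise bound over n <= N, with Z = 2^K and Z <= sqrt N < 2
    Z. The primes up to Z contribute their second moments, at most delta; the
    primes between Z and N, whose inverses have a sum at most 6, are estimated
    through AM-GM with scale s; prime squares contribute at most 2/y.
    Concentration then replaces the additive function by its drift, which does
    not depend on n. *)
Lemma averaged_model_approx delta s K N : (0 < K)%N -> 0 < s ->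
  (2 ^ K.*2 <= N)%N -> (N < 2 ^ K.*2.+2)%N ->
  (forall b, prime_sum y b (fun p => cnorm (h p - 1) ^+ 2 / p%:R) <= delta) ->
  average Cesaro N (fun n => cnorm (g n - model g chi y n * cexp (drift y (2 ^ K))))
    <= 2 * delta + 5 * delta / s + 8 * s + 2 / y%:R.
Proof.
move=> K0 s0 NK NK2 Hd; set Z := (2 ^ K)%N.
have N0 : (0 < N)%N by apply: leq_trans NK; rewrite expn_gt0.
have ZZ : (Z ^ 2 <= N)%N by rewrite /Z -expnM muln2.
have ZN : (Z <= N)%N by apply: leq_trans ZZ; rewrite expnS expn1 leq_pmull// expn_gt0.
have d0 : 0 <= delta by apply: le_trans (Hd 0%N); rewrite /prime_sum big_geq.
pose psi n := prime_sum y Z (fun p => if (p %| n)%N then h p - 1 else 0).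
have psi0 n : complex.Re (psi n) <= 0.
  rewrite /psi /prime_sum Re_sum; apply: sumr_le0 => p pp; case: ifP => _//.
  exact: Re_twist_le0 (prime_gt0 pp).
pose F p := if (p <= Z)%N then 2 * cnorm (h p - 1) ^+ 2 else cnorm (h p - 1).
have F0 p : prime p -> 0 <= F p.
  by move=> _; rewrite /F; case: ifP => _; rewrite ?cnorm_ge0// mulr_ge0// sqr_ge0.
have B1 : average Cesaro N (fun n => cnorm (g n - model g chi y n * cexp (psi n))) <=
    prime_sum y N (fun p => F p / p%:R) + 2 / y%:R.
  apply: le_trans (_ : average Cesaro N (fun n =>
      prime_sum y N (fun p => (p %| n)%:R * F p)
    + 2 * prime_sum y N (fun p => (p ^ 2 %| n)%:R * 1)) <= _).
    apply: le_average => n nN.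
    apply: le_trans (model_approx gM g1 g_le1 chiM chi1 chi_le1 chi_unit nN ZN) _.
    rewrite lerD2l ler_pM2l//; apply: le_prime_sum => p _ _; by rewrite mulr1.
  rewrite averageD averageZ; apply: lerD.
    by apply: (@average_prime_sum_dvd _ y N N id) => // p /prime_gt0.
  rewrite ler_pM2l//; apply: le_trans (prime_sum_inv_sqr N y0).
  apply: le_trans (@average_prime_sum_dvd _ y N N (fun p => p ^ 2)%N (fun=> 1) _ _) _ => //.
    by move=> p pp; rewrite expn_gt0 prime_gt0.
  by apply: le_prime_sum => p _ _; rewrite mul1r.
have B2 : prime_sum y N (fun p => F p / p%:R) <= 2 * delta + (delta / s + s * 6).
  apply: le_trans (_ : prime_sum y N (fun p =>
     2 * (cnorm (h p - 1) ^+ 2 / p%:R) + (s^-1 * (cnorm (h p - 1) ^+ 2 / p%:R) +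
      s * (if (p <= Z)%N then 0 else p%:R^-1))) <= _).
    apply: le_prime_sum => p pp _; rewrite /F.
    have p0 : (0 : R) < p%:R^-1 by rewrite invr_gt0 ltr0n prime_gt0.
    have c2 : 0 <= cnorm (h p - 1) ^+ 2 / p%:R by rewrite divr_ge0 ?sqr_ge0// ltW.
    case: ifP => _.
      by rewrite mulr0 addr0 -mulrA lerDl mulr_ge0// invr_ge0 ltW.
    rewrite ler_wpDl ?mulr_ge0 ?cnorm_ge0//.
    rewrite [s^-1 * _]mulrA -mulrDl ler_pM2r//.
    by have := @le_scaled_sqr _ (cnorm (h p - 1)) s s0; rewrite [_ ^+ 2 / s]mulrC; lra.
  rewrite !prime_sumD !prime_sumZ; apply: lerD; first by rewrite ler_pM2l.
  apply: lerD; first by rewrite mulrC ler_pM2r ?invr_gt0.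
  rewrite ler_pM2l//.
  apply: le_trans (_ : prime_sum Z (2 ^ K.*2.+2) (fun p => p%:R^-1 : R) <= _).
    have ge0 a b : 0 <= prime_sum a b (fun p => p%:R^-1 : R).
      by apply: prime_sum_ge0 => p _ _; rewrite invr_ge0.
    have small0 a b : (b <= Z)%N ->
        prime_sum a b (fun p => if (p <= Z)%N then 0 else p%:R^-1 : R) = 0.
      move=> bZ; rewrite /prime_sum big_nat_cond big1// => p /andP[/andP[_ pb] _].
      by rewrite (leq_trans _ bZ).
    rewrite (@prime_sum_cat _ Z N)//; last exact: ltnW.
    apply: ler_wpDr; first exact: ge0.
    have [yZ|Zy] := leqP y Z.
      rewrite (@prime_sum_cat _ y Z N)// small0// add0r.
      by apply: le_prime_sum => p pp /andP[Zp _]; rewrite leqNgt Zp.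
    have [yN|Ny] := leqP y N; last first.
      apply: le_trans (ge0 Z N); rewrite /prime_sum big_geq//.
      by rewrite ltnS ltnW.
    rewrite (@prime_sum_cat _ Z y N) ?(ltnW Zy)// ler_wpDl//.
    by apply: le_prime_sum => p pp /andP[yp _]; rewrite leqNgt (ltn_trans Zy yp).
  (* N < 2^(2K+2), and 2 (K + 2) / K <= 6 *)
  apply: le_trans (@prime_sum_inv_window R K K.*2.+2 K0 _) _; first by rewrite -addnn; lia.
  rewrite ler_pdivrMr ?ltr0n// -!natrM ler_nat -addnn; lia.
have B3 : average Cesaro N (fun n => cnorm (psi n - drift y Z)) <= s + 2 * delta / s.
  apply: le_trans (_ : average Cesaro N (fun n => s + s^-1 * cnorm (psi n - drift y Z) ^+ 2) <= _).
    by apply: le_average => n _; rewrite [s^-1 * _]mulrC le_scaled_sqr.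
  rewrite averageD averageZ average_cst// lerD2l mulrC ler_pM2r ?invr_gt0//.
  exact: additive_concentration.
apply: le_trans (_ : average Cesaro N (fun n =>
   cnorm (g n - model g chi y n * cexp (psi n)) + 2 * cnorm (psi n - drift y Z)) <= _).
  apply: le_average => n /andP[n0 _].
  apply: le_trans (cnorm_triangle (model g chi y n * cexp (psi n)) _ _) _.
  rewrite lerD2l -mulrBr cnormM; apply: le_trans (_ : 1 * _ <= _).
    by apply: ler_wpM2r; [exact: cnorm_ge0|exact: cnorm_model_le1].
  by rewrite mul1r cexp_lipschitz// Re_drift_le0.
rewrite averageD averageZ.
apply: le_trans (lerD B1 (ler_wpM2l _ B3)) _ => //.
have : delta / s >= 0 by rewrite divr_ge0// ltW.
move: B2; rewrite -!mulrA; lra.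
Qed.

End AveragedModel.

(** * Besicovitch approximation by periodic sequences *)

Section Tails.
Context {R : realType}.

(** Cauchy criterion for a series with nonnegative terms. *)
Lemma prime_sum_tail (F : nat -> R) (S delta : R) :
  (forall p, prime p -> 0 <= F p) -> (forall b, prime_sum 0 b F <= S) -> 0 < delta ->
  exists y0, forall y b, (y0 <= y)%N -> prime_sum y b F <= delta.
Proof.
move=> F0 FS d0; pose A := [set x | exists b, x = prime_sum 0 b F].
have hA : has_sup A.
  split; first by exists (prime_sum 0 0 F), 0%N.
  by exists S => _ [b ->].
have [_ [y0 ->] Hy0] := sup_adherent d0 hA.
exists y0 => y b y0y; have [yb|yb] := leqP y b; last first.
  rewrite /prime_sum big_geq; first exact: ltW.
  by rewrite ltnS ltnW.
have ge0 a c : 0 <= prime_sum a c F by apply: prime_sum_ge0 => p pp _; exact: F0.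
have : prime_sum 0 b F <= sup A by apply: sup_upper_bound => //; exists b.
rewrite (@prime_sum_cat _ 0 y0 b)//; last exact: leq_trans yb.
rewrite (@prime_sum_cat _ y0 y b)//.
by have := ge0 y0 y; lra.
Qed.

End Tails.

Section PeriodicModel.
Context {R : realType} (g chi : nat -> R[i]) (q : nat).
Hypothesis g_le1 : forall n, (0 < n)%N -> cnorm (g n) <= 1.
Hypothesis chi_le1 : forall n, cnorm (chi n) <= 1.
Hypothesis q0 : (0 < q)%N.
Hypothesis chiP : forall n, chi (n + q)%N = chi n.

(** Unless n is divisible by a high power of a small prime, its y-smooth part
    is its greatest common divisor with (y!)^k, hence a periodic function of
    n. *)
Lemma partn_eq_gcdn y k n : (0 < n)%N ->
  (forall p, prime p -> (p <= y)%N -> ~~ (p ^ k.+1 %| n)%N) ->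
  (n`_[pred p | p <= y] = gcdn n (y`! ^ k))%N.
Proof.
move=> n0 H; apply/eqP; rewrite eqn_dvd; apply/andP; split.
  rewrite dvdn_gcd dvdn_part/=; apply/dvdn_partP; first exact: part_gt0.
  move=> p; rewrite -[p \in \pi(_)]/(p \in primes _) primes_part mem_filter inE/= mem_primes => /andP[py /and3P[pp _ pn]].
  rewrite partn_part; last by move=> r; rewrite !inE => /eqP ->.
  rewrite p_part.
  apply: (@dvdn_trans (p ^ k)).
    rewrite dvdn_exp2l// -ltnS ltnNge -pfactor_dvdn//; exact: H.
  by rewrite dvdn_exp2r// dvdn_fact// prime_gt0.
have sm : [pred p | p <= y]%N.-nat (gcdn n (y`! ^ k)).
  apply: (@pnat_dvd _ (y`! ^ k)); first exact: dvdn_gcdr.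
  rewrite pnatX; apply/orP; left; apply/pnatP; first exact: fact_gt0.
  move=> p pp py; rewrite inE/= leqNgt; apply/negP => yp.
  by move: py; apply/negP; rewrite -prime_coprime// prime_coprime_fact.
rewrite -{1}(part_pnat_id sm); apply: partn_dvd => //; exact: dvdn_gcdl.
Qed.

Definition periodic_model y k n := let d := gcdn n (y`! ^ k) in g d * chi (n %/ d)%N.

Let D0 y k : (0 < y`! ^ k)%N. Proof. by rewrite expn_gt0 fact_gt0. Qed.

(** Adding q (y!)^k to n changes neither the greatest common divisor d nor, as
    q (y!)^k / d is a multiple of q, the residue of n/d modulo q. *)
Lemma periodic_model_period y k n :
  periodic_model y k (n + q * y`! ^ k) = periodic_model y k n.
Proof.
rewrite /periodic_model.
rewrite (_ : gcdn (n + _) _ = gcdn n (y`! ^ k)); last by rewrite addnC gcdnC gcdnMDl gcdnC.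
set d := gcdn _ _; have dD : (d %| y`! ^ k)%N by exact: dvdn_gcdr.
congr (_ * _); rewrite divnDr ?dvdn_mull// -muln_divA//.
elim: ((y`! ^ k) %/ d)%N => [|j IH]; first by rewrite muln0 addn0.
by rewrite mulnS addnA addnAC chiP.
Qed.

Lemma cnorm_periodic_model_le1 y k n : cnorm (periodic_model y k n) <= 1.
Proof.
by rewrite cnormM mulr_ile1 ?cnorm_ge0// g_le1// gcdn_gt0 D0 orbT.
Qed.

(** The exceptional n are divisible by p^(k+1) for a prime p <= y, and such a
    divisibility has density at most 2^-(k+1). *)
Lemma periodic_model_approx y k N :
  average Cesaro N (fun n => cnorm (model g chi y n - periodic_model y k n))
    <= 2 * y%:R / 2 ^+ k.+1.
Proof.
apply: le_trans (_ : average Cesaro N (fun n =>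
    prime_sum 0 y (fun p => (p ^ k.+1 %| n)%:R * 2)) <= _).
  apply: le_average => n /andP[n0 _].
  have ge0 p : prime p -> (0 < p <= y)%N -> 0 <= (p ^ k.+1 %| n)%N%:R * 2 :> R.
    by move=> _ _; rewrite mulr_ge0.
  have [/forallP H|] := boolP [forall p : 'I_y.+1, prime p ==> ~~ (p ^ k.+1 %| n)%N].
    rewrite (_ : model g chi y n = periodic_model y k n) ?subrr ?cnorm0 ?prime_sum_ge0//.
    have E : (n`_[pred p | p <= y] = gcdn n (y`! ^ k))%N.
      apply: partn_eq_gcdn => // p pp py.
      by have /implyP := H (Ordinal (py : p < y.+1)%N); apply.
    rewrite /model /periodic_model -E; congr (_ * chi _).
    by rewrite -{2}(@partnC [pred p | p <= y]%N n n0) mulKn.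
  rewrite negb_forall => /existsP[p]; rewrite negb_imply negbK => /andP[pp pn].
  have py : (0 < p <= y)%N by rewrite prime_gt0//= -ltnS ltn_ord.
  apply: le_trans (_ : 2 <= _).
    apply: le_trans (cnormD _ _) _; rewrite cnormN.
    have := cnorm_periodic_model_le1 y k n; have := cnorm_model_le1 g_le1 chi_le1 y n; lra.
  rewrite /prime_sum big_mkcond (bigD1_seq (p : nat)) ?iota_uniq//= ?mem_index_iota ?ltnS//.
  rewrite pn pp mul1r lerDl; by apply: sumr_ge0 => r _; case: ifP => _ //; rewrite mulr_ge0.
apply: le_trans (average_prime_sum_dvd _ _ _ _ _) _ => //.
  by move=> p pp; rewrite expn_gt0 prime_gt0.
apply: le_trans (_ : prime_sum 0 y (fun=> 2 / 2 ^+ k.+1) <= _).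
  apply: le_prime_sum => p pp _; rewrite ler_pM2l// natrX.
  rewrite lef_pV2 ?posrE ?exprn_gt0 ?ltr0n ?prime_gt0// lerXn2r ?nnegrE//.
  by rewrite ler_nat prime_gt1.
rewrite /prime_sum big_mkcond/=.
apply: le_trans (_ : \sum_(1 <= p < y.+1) (2 / 2 ^+ k.+1) <= _).
  by apply: ler_sum => p _; case: ifP => // _; rewrite divr_ge0// exprn_ge0.
by rewrite sumr_const_nat subn1/= -[leLHS]mulr_natr mulrAC.
Qed.

End PeriodicModel.

Section LogFromCesaro.
Context {R : realType}.
Implicit Types u : nat -> R.
Local Notation W := (@total_weight R Logarithmic).

(** Summation by parts: a logarithmic average is a weighted mean of Cesaro
    averages at all smaller scales. *)
Lemma log_average_by_parts N u : (0 < N)%N ->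
  W N * average Logarithmic N u =
  average Cesaro N u + \sum_(1 <= n < N) average Cesaro n u / n.+1%:R.
Proof.
move=> N0; rewrite [average Logarithmic N u]/average mulrA divff ?mul1r; last by rewrite gt_eqF// total_weight_gt0.
elim: N N0 => // -[|N] IH _.
  rewrite big_nat1 [X in _ = _ + X]big_geq// addr0 average_CesaroE big_nat1.
  by rewrite /= invr1.
rewrite big_nat_recr//= IH// [X in _ = _ + X]big_nat_recr//=.
suff H : average Cesaro N.+1 u + N.+2%:R^-1 * u N.+2 =
    average Cesaro N.+2 u + average Cesaro N.+1 u / N.+2%:R.
  by rewrite addrAC H; ring.
rewrite !average_CesaroE [X in _ = _ * X + _]big_nat_recr//=.
set S := \sum_(_ <= _ < _) _.
have n1 : N.+1%:R != 0 :> R by rewrite pnatr_eq0.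
have n2 : N.+1%:R + 1 != 0 :> R by rewrite natr1 pnatr_eq0.
rewrite -[N.+2%:R]natr1; move: (N.+1%:R) n1 n2 => x n1 n2.
by field; rewrite n1 n2.
Qed.

(** The scales below n0, where only the trivial bound B is known, carry the
    small proportion W(n0) / W(N) of the weights. *)
Lemma log_average_le N n0 u (B eta : R) : (0 < N)%N -> 0 <= B -> 0 <= eta ->
  (forall n, (0 < n <= N)%N -> average Cesaro n u <= B) ->
  (forall n, (n0 <= n <= N)%N -> average Cesaro n u <= eta) ->
  average Logarithmic N u <= eta + B * (1 + W n0) / W N.
Proof.
move=> N0 B0 eta0 uB ueta; have WN := @total_weight_gt0 R Logarithmic N N0.
have Wge0 n : 0 <= W n.
  by apply: sumr_ge0 => i _; exact: weight_ge0.
suff H : \sum_(1 <= n < N) average Cesaro n u / n.+1%:R <= B * W n0 + eta * W N.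
  rewrite -(ler_pM2l WN) log_average_by_parts// mulrDr.
  rewrite [W N * (_ / _)]mulrCA divff ?gt_eqF// mulr1.
  by have := uB N; rewrite N0 leqnn => /(_ isT); lra.
have Hk k : (0 < k)%N -> (k <= N)%N ->
    \sum_(1 <= n < k) average Cesaro n u / n.+1%:R <= B * W (minn k n0) + eta * W k.
  elim: k => // -[|k] IH _ kN.
    by rewrite big_geq// addr_ge0// mulr_ge0.
  rewrite big_nat_recr//=; have {}IH := IH isT (ltnW kN).
  have WS n : W n.+1 = W n + n.+1%:R^-1 by rewrite total_weightS.
  have i0 : (0 : R) < k.+2%:R^-1 by rewrite invr_gt0 ltr0n.
  have [kn|nk] := ltnP k.+1 n0.
    move: IH; rewrite (minn_idPl (ltnW kn)) (minn_idPl kn) !WS.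
    have := uB k.+1 (ltnW kN); rewrite -(ler_pM2r i0).
    have : 0 <= eta * k.+2%:R^-1 by rewrite mulr_ge0// ltW.
    move: (k.+2%:R^-1) (k.+1%:R^-1) => x1 x2; lra.
  move: IH; rewrite (minn_idPr nk) (minn_idPr (leqW nk)) !WS.
  have := ueta k.+1; rewrite nk (ltnW kN) => /(_ isT); rewrite -(ler_pM2r i0).
  move: (k.+2%:R^-1) (k.+1%:R^-1) => x1 x2; lra.
apply: le_trans (Hk N N0 (leqnn _)) _; rewrite lerD2r ler_wpM2l//.
exact/le_total_weight/geq_minr.
Qed.

End LogFromCesaro.

Section Scales.
Context {R : realType}.

(** Chosen so that 4^(scale N) <= N < 4^(scale N + 1): then Z = 2^(scale N)
    satisfies Z^2 <= N, as the Turan--Kubilius inequality requires. *)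
Definition scale N := (trunc_log 2 N)./2.

Lemma scale_bounds N : (0 < N)%N -> (2 ^ (scale N).*2 <= N < 2 ^ (scale N).*2.+2)%N.
Proof.
move=> N0; have /andP[l1 l2] := trunc_log_bounds (isT : 1 < 2)%N N0.
have := odd_double_half (trunc_log 2 N); rewrite -/(scale N) => H.
apply/andP; split.
  by apply: leq_trans l1; rewrite leq_exp2l// -H leq_addl.
apply: leq_trans l2 _; rewrite leq_exp2l// -H.
by case: (odd _); rewrite ?add1n ?add0n ltnS// leqnSn.
Qed.

Lemma leq_scale : {homo scale : M N / (M <= N)%N}.
Proof. by move=> M N MN; apply: half_leq; apply: leq_trunc_log. Qed.

Lemma scale_ge r N : (2 ^ r.*2 <= N)%N -> (r <= scale N)%N.
Proof.
move=> H; rewrite -[r]doubleK; apply: half_leq.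
exact: trunc_log_max.
Qed.

End Scales.

Section Subsequences.

(** Recursive choice: each property holds at arbitrarily large indices, so
    these can be picked increasingly. *)
Lemma subsequence_choice (P : nat -> nat -> Prop) :
  (forall k j0, exists2 j, (j0 <= j)%N & P k j) ->
  exists phi : nat -> nat, {homo phi : i j / (i < j)%N} /\ forall k, P k (phi k).
Proof.
move=> H; pose c k j0 := projT1 (cid2 (H k j0)).
have c_ge k j0 : (j0 <= c k j0)%N by rewrite /c; case: cid2.
have cP k j0 : P k (c k j0) by rewrite /c; case: cid2.
pose phi := fix phi k := if k is k'.+1 then c k (phi k').+1 else c 0%N 0%N.
have phi_lt k : (phi k < phi k.+1)%N by exact: c_ge.
exists phi; split; last by case=> [|k]; exact: cP.
move=> i j; elim: j => // j IH; rewrite ltnS leq_eqVlt => /orP[/eqP ->|/IH]//.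
by move=> /ltn_trans; apply.
Qed.

(** Bolzano--Weierstrass: an ultrafilter limit is approached along a
    subsequence. *)
Lemma bounded_subsequence (R : realType) (w : nat -> R[i]) : cbdd w ->
  exists (phi : nat -> nat) (gamma : R[i]), {homo phi : i j / (i < j)%N} /\
    forall e : R, 0 < e -> exists k0, forall k, (k0 <= k)%N -> cnorm (w (phi k) - gamma) <= e.
Proof.
move=> bw; have [U [UU oU]] := ultraFilterLemma eventually_filter.
have cR := ultra_cvg UU (bdd_Re bw); have cI := ultra_cvg UU (bdd_Im bw).
set a := lim _ in cR; set b := lim _ in cI; pose gamma := Complex a b.
have near e : 0 < e -> \forall k \near U, cnorm (w k - gamma) <= e.
  move=> e0; have e2 : 0 < e / 2 by rewrite divr_gt0.
  move/cvgrPdist_le : cR => /(_ _ e2) cR; move/cvgrPdist_le : cI => /(_ _ e2) cI.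
  near=> k; apply: le_trans (cnorm_le_ReIm _) _.
  rewrite !(Re_addc, Im_addc, Re_oppc, Im_oppc)/= [e]splitr.
  by apply: lerD; rewrite distrC; near: k.
have [|phi [phi_lt Hphi]] :=
    @subsequence_choice (fun k j => cnorm (w j - gamma) <= k.+1%:R^-1).
  move=> k j0; have k1 : (0 : R) < k.+1%:R^-1 by rewrite invr_gt0 ltr0n.
  have : \forall j \near U, (j0 <= j)%N /\ cnorm (w j - gamma) <= k.+1%:R^-1.
    by apply: filterI; [apply: oU; exists j0|exact: near].
  by move=> /filter_ex[j [? ?]]; exists j.
exists phi, gamma; split => // e e0.
exists (Num.truncn e^-1) => k Hk; apply: le_trans (Hphi k) _.
rewrite -[leRHS]invrK lef_pV2 ?posrE ?invr_gt0 ?ltr0n//; apply: ltW.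
by apply: lt_le_trans (truncnS_gt _) _; rewrite ler_nat ltnS.
Unshelve. all: by end_near. Qed.

End Subsequences.

Section BesicovitchApproximation.
Context {R : realType} (g chi : nat -> R[i]) (q : nat).
Hypothesis gM : multiplicative_on_coprime g.
Hypothesis g1 : g 1%N = 1.
Hypothesis g_le1 : forall n, (0 < n)%N -> cnorm (g n) <= 1.
Hypothesis chiM : forall m n, chi (m * n)%N = chi m * chi n.
Hypothesis chi1 : chi 1%N = 1.
Hypothesis chi_le1 : forall n, cnorm (chi n) <= 1.
Hypothesis chi_unit : forall p, prime p -> (q < p)%N -> cnorm (chi p) = 1.
Hypothesis q0 : (0 < q)%N.
Hypothesis chiP : forall n, chi (n + q)%N = chi n.
Variable S : R.
Hypothesis pret_bound :
  forall b, prime_sum 0 b (fun p => (1 - complex.Re (twist g chi p)) / p%:R) <= S.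
Local Notation h := (twist g chi).
Local Notation drift := (drift g chi).

Lemma twist_tail (delta : R) : 0 < delta -> exists y0, forall y b, (y0 <= y)%N ->
  prime_sum y b (fun p => cnorm (h p - 1) ^+ 2 / p%:R) <= delta.
Proof.
apply: (@prime_sum_tail _ _ (2 * S)) => [p _|b]; first by rewrite divr_ge0 ?sqr_ge0.
apply: le_trans (_ : 2 * prime_sum 0 b (fun p => (1 - complex.Re (h p)) / p%:R) <= _);
  last by rewrite ler_pM2l.
rewrite -prime_sumZ; apply: le_prime_sum => p pp _.
by rewrite mulrA ler_wpM2r ?invr_ge0// cnorm_twistB1// prime_gt0.
Qed.

Lemma drift_cat a b c : (a <= b)%N -> (b <= c)%N ->
  drift a c = drift a b + drift b c.
Proof. exact: prime_sum_cat. Qed.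

(** The drift changes little when the scale 2^K is raised to a bounded power:
    by Cauchy--Schwarz the increment is bounded by the tail of the second
    moments, which is small, and the sum of 1/p over the window, which is
    bounded. *)
Lemma drift_slow A (e : R) : (0 < A)%N -> 0 < e -> exists2 r0, (0 < r0)%N &
  forall r K' K, (r0 <= r)%N -> (r <= K')%N -> (K' <= K)%N -> (K <= A * r)%N ->
    cnorm (drift (2 ^ K') (2 ^ K)) <= e.
Proof.
move=> A0 e0; have AR : (0 : R) < A%:R by rewrite ltr0n.
pose s := e / (4 * A%:R); have s0 : 0 < s by rewrite divr_gt0// mulr_gt0.
have [|y0 Hy0] := @twist_tail (s * (e / 2)); first by rewrite mulr_gt0// divr_gt0.
exists y0.+1 => // r K' K yr rK' K'K KA.
apply: le_trans (cnorm_sum _ _ _) _.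
apply: le_trans (_ : prime_sum (2 ^ K') (2 ^ K) (fun p =>
   s^-1 * (cnorm (h p - 1) ^+ 2 / p%:R) + s * p%:R^-1) <= _).
  apply: le_prime_sum => p pp _; rewrite cnormM cnorm_real ger0_norm ?invr_ge0//.
  rewrite mulrA -mulrDl ler_pM2r ?invr_gt0 ?ltr0n ?prime_gt0//.
  by rewrite [s^-1 * _]mulrC [leRHS]addrC; exact: le_scaled_sqr.
rewrite prime_sumD !prime_sumZ [e]splitr; apply: lerD.
  rewrite ler_pdivrMl//; apply: Hy0.
  apply: leq_trans (ltnW yr) _; apply: leq_trans rK' _; exact/ltnW/ltn_expl.
have K'0 : (0 < K')%N by apply: leq_trans rK'; apply: leq_trans yr.
apply: le_trans (ler_wpM2l (ltW s0) (@prime_sum_inv_window R _ _ K'0 K'K)) _.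
apply: le_trans (_ : s * (2 * A%:R) <= _); last first.
  by rewrite /s le_eqVlt; apply/orP; left; apply/eqP; field; rewrite gt_eqF.
rewrite ler_pM2l// -mulrA ler_pM2l// ler_pdivrMr ?ltr0n// -natrM ler_nat.
by apply: leq_trans (leq_subr _ _) _; apply: leq_trans KA _; rewrite leq_mul2l rK' orbT.
Qed.

(** One fixed periodic sequence approximates g at every large scale, up to a
    factor that depends on the scale only. The factor is compared with an
    arbitrary constant c, which will be its limit. *)
Lemma periodic_approx_scale (e : R) : 0 < e -> exists (b : nat -> R[i]) (y K0 : nat),
  [/\ exists2 Q, (0 < Q)%N & forall n, b (n + Q)%N = b n,
      forall n, cnorm (b n) <= 1, (0 < K0)%N &
      forall K N c, (K0 <= K)%N -> (2 ^ K.*2 <= N)%N -> (N < 2 ^ K.*2.+2)%N ->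
        cnorm c <= 1 ->
        average Cesaro N (fun n => cnorm (g n - b n * c))
          <= e + cnorm (cexp (drift y (2 ^ K)) - c)].
Proof.
(* the choices of s, delta, y and k make the five error terms at most
   e/8, e/4, e/4, e/8 and e/4 *)
move=> e0; pose s := e / 32; have s0 : 0 < s by rewrite divr_gt0.
pose delta := Num.min (s * (e / 20)) (e / 16).
have delta0 : 0 < delta by rewrite lt_min !divr_gt0// !mulr_gt0.
have d1 : delta / s <= e / 20.
  by rewrite ler_pdivrMr// mulrC ge_min lexx.
have d2 : delta <= e / 16 by rewrite ge_min lexx orbT.
have [y0 Hy0] := twist_tail delta0.
pose y := (y0 + q + (Num.truncn (16 / e)).+1)%N.
have yq : (q <= y)%N by rewrite /y addnAC leq_addl.
have y1 : (0 < y)%N by apply: leq_trans yq.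
have yR : (0 : R) < y%:R by rewrite ltr0n.
have ye : 2 / y%:R <= e / 8.
  rewrite ler_pdivrMr// mulrC -ler_pdivrMr ?divr_gt0//.
  have -> : 2 / (e / 8) = 16 / e by field; rewrite gt_eqF.
  by apply: le_trans (ltW (truncnS_gt _)) _; rewrite ler_nat leq_addl.
pose k := (Num.truncn (y%:R * 4 / e)).+1.
have ke : 2 * y%:R / 2 ^+ k.+1 <= e / 4.
  have k2 : (0 : R) < 2 ^+ k by rewrite exprn_gt0.
  rewrite exprS invfM mulrACA divff// mul1r ler_pdivrMr//.
  rewrite mulrC mulrA ler_pdivlMr// -ler_pdivrMr//.
  apply: le_trans (ltW (truncnS_gt _)) _; rewrite -/k -natrX ler_nat.
  exact/ltnW/ltn_expl.
have yu p : prime p -> (y < p)%N -> cnorm (chi p) = 1.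
  by move=> pp yp; apply: chi_unit => //; exact: leq_ltn_trans yp.
exists (periodic_model g chi y k), y, 1%N; split => //.
- exists (q * y`! ^ k)%N; first by rewrite muln_gt0 q0 expn_gt0 fact_gt0.
  exact: periodic_model_period.
- exact: cnorm_periodic_model_le1.
move=> K N c K1 NK NK2 c1.
have N0 : (0 < N)%N by apply: leq_trans NK; rewrite expn_gt0.
set z := cexp _; have z1 : cnorm z <= 1.
  by apply: cnorm_cexp_le1; exact: Re_drift_le0.
apply: le_trans (_ : average Cesaro N (fun n =>
     (cnorm (g n - model g chi y n * z) +
      cnorm (model g chi y n - periodic_model g chi y k n)) + cnorm (z - c)) <= _).
  apply: le_average => n _.
  apply: le_trans (cnorm_triangle (periodic_model g chi y k n * z) _ _) _; apply: lerD.
    apply: le_trans (cnorm_triangle (model g chi y n * z) _ _) _; rewrite lerD2l.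
    by rewrite -mulrBl cnormM ler_piMr ?cnorm_ge0.
  rewrite -mulrBr cnormM ler_piMl ?cnorm_ge0//; exact: cnorm_periodic_model_le1.
rewrite averageD average_cst// lerD2r averageD.
have y0y : (y0 <= y)%N by rewrite /y -addnA leq_addr.
have H1 := averaged_model_approx gM g1 g_le1 chiM chi1 chi_le1 y1 yu K1 s0 NK NK2
  (fun b => Hy0 y b y0y).
apply: le_trans (lerD H1 (periodic_model_approx g_le1 chi_le1 y k N)) _.
by move: d1 d2 ye ke; rewrite /s -[5 * delta / _]mulrA; lra.
Qed.

(** Along a sequence on which the scale factor converges, g is approximated by
    periodic sequences for both kinds of averages. A logarithmic average over
    [N] also involves the Cesaro averages at scales n < N. Those with n >=
    N^(1/A) have nearly the same factor, because the drift is slow; the others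
    carry a proportion about 1/A of the logarithmic weight. *)
Lemma periodic_approx_along (M : nat -> nat) (gamma : R[i]) m (e : R) :
  {homo M : i j / (i < j)%N} ->
  (forall e : R, 0 < e -> exists k0, forall k, (k0 <= k)%N ->
     cnorm (cexp (drift 0 (2 ^ scale (M k))) - gamma) <= e) ->
  0 < e ->
  exists b : nat -> R[i], [/\ exists2 Q, (0 < Q)%N & forall n, b (n + Q)%N = b n,
    forall n, cnorm (b n) <= 1 &
    \forall k \near \oo, average m (M k) (fun n => cnorm (g n - b n) ^+ 2) <= e].
Proof.
move=> M_lt Mgamma e0; have e16 : 0 < e / 16 by rewrite divr_gt0.
have M_ge k : (k <= M k)%N by exact: increasing_ge.
have [b [y [K0 [bP b1 K00 Hb]]]] := periodic_approx_scale e16.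
pose A := (Num.truncn (32 / e)).+1.
have A0 : (0 < A)%N by [].
have AR : (0 : R) < A%:R by rewrite ltr0n.
have Ae : 16 / A%:R <= e / 2.
  rewrite ler_pdivrMr// mulrC -ler_pdivrMr ?divr_gt0//.
  have -> : 16 / (e / 2) = 32 / e by field; rewrite gt_eqF.
  exact: ltW (truncnS_gt _).
have [|r0 r00 Hr0] := @drift_slow (2 * A)%N (e / 16) _ e16; first by rewrite muln_gt0.
pose r1 := maxn r0 (maxn y K0).
have Ey0 := cexp_neq0 (drift 0 y); set z0 := cexp (drift 0 y) in Ey0.
have nz0 : 0 < cnorm z0 by rewrite cnorm_cexp expR_gt0.
pose c := gamma / z0.
have drift_y K : (y <= 2 ^ K)%N -> cexp (drift y (2 ^ K)) = cexp (drift 0 (2 ^ K)) / z0.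
  by move=> yK; rewrite (@drift_cat 0 y (2 ^ K))// cexpD mulrAC divff// mul1r.
have yK K : (r1 <= K)%N -> (y <= 2 ^ K)%N.
  move=> rK; apply: leq_trans (_ : y <= K)%N _; last exact/ltnW/ltn_expl.
  by apply: leq_trans rK; rewrite !leq_max leqnn orbT.
have scaleM r : exists k0, forall k, (k0 <= k)%N -> (r <= scale (M k))%N.
  exists (2 ^ r.*2)%N => k Hk; apply: scale_ge.
  exact: leq_trans Hk (M_ge k).
have cvg_c d : 0 < d -> exists k0, forall k, (k0 <= k)%N ->
    cnorm (cexp (drift y (2 ^ scale (M k))) - c) <= d.
  move=> d0; have [|k0 Hk0] := Mgamma (d * cnorm z0); first by rewrite mulr_gt0.
  have [k1 Hk1] := scaleM r1; exists (maxn k0 k1) => k; rewrite geq_max => /andP[kk0 kk1].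
  rewrite drift_y; last exact: yK (Hk1 _ kk1).
  by rewrite -mulrBl cnormM /cnorm ComplexField.Normc.normcV -/(cnorm _) ler_pdivrMr// Hk0.
have c1 : cnorm c <= 1.
  apply/ler_addgt0Pr => d d0; have [k0 Hk0] := cvg_c d d0.
  have := Hk0 k0 (leqnn _); set z := cexp _ => Hz.
  have z1 : cnorm z <= 1 by apply: cnorm_cexp_le1; exact: Re_drift_le0.
  rewrite -[c](subrK z) addrC; apply: le_trans (cnormD _ _) _.
  by rewrite cnormB; apply: lerD.
have [k1 Hk1] := scaleM (A * r1.+1)%N.
have [k2 Hk2] := cvg_c _ e16.
exists (fun n => b n * c); split.
- by have [Q Q0 HQ] := bP; exists Q => // n; rewrite HQ.
- by move=> n; rewrite cnormM mulr_ile1 ?cnorm_ge0.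
exists (maxn k1 k2) => // k /=; rewrite geq_max => /andP[kk1 kk2].
(* scales below 4^r, about N^(1/A), are treated as exceptional *)
set N := M k; pose K := scale N; pose r := (K %/ A)%N.
have KA : (A * r1.+1 <= K)%N by exact: Hk1.
have r1r : (r1 < r)%N by rewrite /r leq_divRL// mulnC.
have r_gt0 : (0 < r)%N by apply: leq_trans r1r.
have rK : (r <= K)%N by exact: leq_div.
have Kr : (K <= 2 * A * r)%N.
  apply: ltnW; apply: leq_trans (ltn_ceil K A0) _; rewrite -/r -mulnA mulnCA [leqLHS]mulnC.
  by rewrite leq_mul2l; apply/orP; right; lia.
have K1 : (0 < K)%N by apply: leq_trans rK.
have N0 : (0 < N)%N.
  by rewrite lt0n; apply/eqP => N0; move: K1; rewrite /K N0.
have u4 n : (0 < n)%N -> cnorm (g n - b n * c) ^+ 2 <= 2 * cnorm (g n - b n * c).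
  move=> n0; rewrite expr2 ler_wpM2r ?cnorm_ge0//.
  apply: le_trans (cnormD _ _) _; rewrite cnormN cnormM.
  have := g_le1 n0; have : cnorm (b n) * cnorm c <= 1 by rewrite mulr_ile1 ?cnorm_ge0.
  lra.
have avg_n n : (2 ^ r.*2 <= n)%N -> (n <= N)%N ->
    average Cesaro n (fun n => cnorm (g n - b n * c) ^+ 2) <= e / 2.
  move=> rn nN; have n0 : (0 < n)%N by apply: leq_trans rn; rewrite expn_gt0.
  have rs : (r <= scale n)%N by exact: scale_ge.
  have sK : (scale n <= K)%N by exact: leq_scale.
  apply: le_trans (_ : average Cesaro n (fun n => 2 * cnorm (g n - b n * c)) <= _).
    by apply: le_average => i /andP[i0 _]; exact: u4.
  have /andP[n1 n2] := scale_bounds n0.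
  have K0s : (K0 <= scale n)%N.
    apply: leq_trans rs; apply: leq_trans (ltnW r1r); by rewrite !leq_max leqnn !orbT.
  have := Hb _ _ c K0s n1 n2 c1; rewrite averageZ => H.
  have H2 := Hk2 k kk2; rewrite -/N -/K in H2.
  have H3 : cnorm (cexp (drift y (2 ^ scale n)) - cexp (drift y (2 ^ K))) <= 2 * (e / 16).
    apply: le_trans (cexp_lipschitz _ _) _; [exact: Re_drift_le0..|].
    have yn : (y <= 2 ^ scale n)%N by apply: yK; apply: leq_trans rs; exact: ltnW.
    rewrite ler_pM2l// (@drift_cat y _ (2 ^ K) yn) ?leq_exp2l// opprD addrA subrr add0r.
    rewrite cnormN; apply: (Hr0 r) => //.
    apply: leq_trans (ltnW r1r); by rewrite leq_maxl.
  have := cnorm_triangle (cexp (drift y (2 ^ K))) (cexp (drift y (2 ^ scale n))) c.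
  lra.
have KN : (2 ^ K.*2 <= N)%N by case/andP: (scale_bounds N0).
have rN : (2 ^ r.*2 <= N)%N by apply: leq_trans KN; rewrite leq_exp2l// leq_double.
case: m; first by apply: le_trans (avg_n N rN (leqnn _)) _; lra.
apply: le_trans (@log_average_le _ N (2 ^ r.*2) _ 4 (e / 2) N0 _ _ _ _) _ => //.
- by rewrite divr_ge0// ltW.
- move=> n /andP[n0 _]; rewrite -[leRHS](@average_cst _ Cesaro n)//.
  apply: le_average => i /andP[i0 _]; apply: le_trans (u4 i i0) _.
  have : cnorm (g i - b i * c) <= 2.
    apply: le_trans (cnormD _ _) _; rewrite cnormN cnormM.
    have := g_le1 i0; have : cnorm (b i) * cnorm c <= 1 by rewrite mulr_ile1 ?cnorm_ge0.
    lra.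
  lra.
- by move=> n /andP[rn nN]; exact: avg_n.
rewrite [leRHS]splitr lerD2l; apply: le_trans Ae.
have WN : 1 + K%:R <= @total_weight R Logarithmic N.
  apply: le_trans (le_total_weight _ KN); apply: le_trans (total_weight_log_ge _).
  by rewrite -muln2 natrM mulfK.
have Wr := @total_weight_log_le R r.*2.
have Kpos : 0 < 1 + K%:R :> R by rewrite addr_gt0// ltr0n.
rewrite ler_pdivrMr ?(lt_le_trans Kpos)//.
apply: le_trans (_ : 16 / A%:R * (A%:R * r%:R) <= _); last first.
  apply: ler_wpM2l; first by rewrite divr_ge0// ltW.
  apply: le_trans WN.
  rewrite -natrM; apply: le_trans (_ : K%:R <= _); last by rewrite lerDr.
  by rewrite ler_nat mulnC leq_trunc_div.
rewrite mulrA divfK ?gt_eqF//.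
have r1' : (1 : R) <= r%:R by rewrite ler1n.
by move: Wr; rewrite -muln2 natrM; lra.
Qed.

End BesicovitchApproximation.

(** * A lower bound for means of multiplicative functions *)

Section LowerBound.
Context {R : realType} (r : nat -> R).
Hypothesis rM : multiplicative_on_coprime r.
Hypothesis r1 : r 1%N = 1.
Hypothesis r01 : forall n, (0 < n)%N -> 0 <= r n <= 1.
Variable S : R.
Hypothesis r_bound : forall b, prime_sum 0 b (fun p => (1 - r p) / p%:R) <= S.

Lemma prod_ge_1Bsum (s : seq nat) (a : nat -> R) : {in s, forall p, 0 <= a p <= 1} ->
  1 - \sum_(p <- s) (1 - a p) <= \prod_(p <- s) a p.
Proof.
move=> Ha; suff [] : 1 - \sum_(p <- s) (1 - a p) <= \prod_(p <- s) a p /\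
   0 <= \prod_(p <- s) a p <= 1 by [].
elim: s Ha => [|p s IH] Ha; first by rewrite !big_nil subr0 lexx ler01.
have [|IH1 /andP[IH2 IH3]] := IH; first by move=> x xs; apply: Ha; rewrite inE xs orbT.
have /andP[a0 a1] := Ha p (mem_head _ _).
rewrite !big_cons; split; last by rewrite mulr_ge0// mulr_ile1.
by move: (\prod_(_ <- _) _) (\sum_(_ <- _) _) IH1 IH2 IH3 => P Q; nra.
Qed.

(** A product of numbers in [0, 1] is at least 1 minus the sum of the
    deficits. Where p^2 | n nothing is known about the factor, and its deficit
    is bounded by 1. *)
Lemma r_ge_1Bsum n : (0 < n)%N ->
  1 - \sum_(p <- primes n) ((1 - r p) + (p ^ 2 %| n)%:R) <= r n.
Proof.
move=> n0; rewrite (multiplicative_eq_prod rM r1 n0).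
have pn p : p \in primes n -> prime p by rewrite mem_primes => /andP[].
apply: le_trans (prod_ge_1Bsum (a := fun p => r (p ^ logn p n)%N) _); last first.
  by move=> p /pn pp; apply: r01; rewrite expn_gt0 prime_gt0.
rewrite lerD2l lerN2 big_seq [leRHS]big_seq; apply: ler_sum => p ppn; have pp := pn _ ppn.
have /andP[r0 rp1] := r01 (prime_gt0 pp).
have [p2|p2] := boolP (p ^ 2 %| n)%N.
  have /andP[r0' _] : 0 <= r (p ^ logn p n)%N <= 1 by apply: r01; rewrite expn_gt0 prime_gt0.
  by rewrite /=; lra.
have -> : logn p n = 1%N.
  apply/eqP; rewrite eqn_leq -(pfactor_dvdn 1 pp n0) expn1.
  move: ppn; rewrite mem_primes => /and3P[_ _ ->]; rewrite andbT leqNgt.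
  by rewrite -(pfactor_dvdn 2 pp n0).
by rewrite expn1 addr0.
Qed.

(** The m with d | Pm + 1 form one residue class modulo d, as d is coprime to
    P: distinct ones have distinct quotients m / d. *)
Lemma count_progression d P M : (0 < d)%N -> coprime d P ->
  \sum_(0 <= m < M) ((d %| (P * m).+1)%:R : R) <= M%:R / d%:R + 1.
Proof.
move=> d0 dP; pose s := [seq m <- iota 0 M | (d %| (P * m).+1)%N].
have -> : \sum_(0 <= m < M) ((d %| (P * m).+1)%:R : R) = (size s)%:R.
  rewrite -natr_sum; congr (_%:R); rewrite size_filter -sum1_count [RHS]big_mkcond/=.
  by rewrite /index_iota subn0; apply: eq_bigr => m _; case: (d %| _)%N.
have inj : {in s &, injective (fun m => m %/ d)%N}.
  move=> m k; rewrite !mem_filter => /andP[dm _] /andP[dk _] mk.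
  wlog lemk : m k dm dk mk / (m <= k)%N.
    by move=> H; case/orP: (leq_total m k) => ?; [|apply/esym]; apply: H.
  have : (d %| k - m)%N.
    rewrite -(Gauss_dvdr _ dP) mulnBr -subSS; exact: dvdn_sub.
  move=> dkm; have : (m = k %[mod d])%N.
    by apply/eqP; rewrite eq_sym eqn_mod_dvd.
  by move=> H; rewrite (divn_eq m d) (divn_eq k d) mk H.
have : (size s <= (M %/ d).+1)%N.
  rewrite -(size_map (fun m => m %/ d)%N s) -(size_iota 0 (M %/ d).+1).
  apply: uniq_leq_size.
    by rewrite map_inj_in_uniq// filter_uniq// iota_uniq.
  move=> x /mapP[m]; rewrite mem_filter mem_iota add0n => /andP[_ /andP[_ mM]] ->.
  by rewrite mem_iota add0n leq0n ltnS leq_div2r// ltnW.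
rewrite -(ler_nat R) => /le_trans; apply.
by rewrite -natr1 lerD2r divn_le_real.
Qed.

Lemma sum_small_le c B : \sum_(1 <= p < B.+1) ((p <= c)%:R : R) <= c%:R.
Proof.
rewrite -natr_sum ler_nat; suff -> : (\sum_(1 <= p < B.+1) (p <= c) = minn B c)%N.
  exact: geq_minr.
elim: B => [|B IH]; first by rewrite big_geq// min0n.
by rewrite big_nat_recr//= IH; lia.
Qed.

Lemma prime_sum_small_le y c B : prime_sum y B (fun p => (p <= c)%:R : R) <= c%:R.
Proof.
apply: le_trans (sum_small_le c B); rewrite /prime_sum big_mkcond/=.
apply: le_trans (_ : \sum_(y.+1 <= p < B.+1) ((p <= c)%:R : R) <= _).
  by apply: ler_sum => p _; case: ifP.
have [yB|By] := leqP y B; first by rewrite [leRHS](@big_cat_nat _ _ _ y.+1)//= lerDr sumr_ge0.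
rewrite [leLHS]big_geq; first exact: sumr_ge0.
exact: ltnW.
Qed.

Lemma progression_sum P M : (0 < P)%N ->
  \sum_(0 <= m < M) r (P * m).+1 <= \sum_(1 <= n < (P * M).+1) r n.
Proof.
move=> P0; elim: M => [|M IH]; first by rewrite muln0 !big_geq.
rewrite big_nat_recr//= [leRHS](@big_cat_nat _ _ _ (P * M).+1)//=; last first.
  by rewrite ?ltnS leq_mul2l leqnSn orbT.
apply: lerD => //; rewrite big_ltn ?lerDl.
  rewrite big_nat_cond; apply: sumr_ge0 => n /andP[/andP[n0 _] _].
  by have /andP[] := @r01 n (leq_trans (ltn0Sn _) n0).
by rewrite ltnS ltn_mul2l P0 leqnn.
Qed.

(** Restrict to n = Pm + 1 with P = y!. Such n have no prime factor up to y,
    and on average over m the deficits at the larger primes add up to at most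
    5/8: the tail of the pretentious distance gives 1/8, the rounding errors
    of the counts 2/8, and the prime squares 2/8. *)
Lemma multiplicative_lower_bound : exists2 kappa : R, 0 < kappa &
  exists N0, forall N, (N0 <= N)%N -> kappa <= average Cesaro N r.
Proof.
have F0 p : prime p -> 0 <= (1 - r p) / p%:R.
  by move=> pp; rewrite divr_ge0// subr_ge0; case/andP: (r01 (prime_gt0 pp)).
have [|y0 Hy0] := @prime_sum_tail _ _ S (1 / 8) F0 r_bound; first by rewrite divr_gt0.
pose y := (y0 + 8)%N; pose P := (y`!)%N.
have P0 : (0 < P)%N by exact: fact_gt0.
have PR : (0 : R) < P%:R by rewrite ltr0n.
have [|T0 HT0] := @prime_sum_tail _ _ S (1 / (8 * P%:R)) F0 r_bound.
  by rewrite divr_gt0// mulr_gt0.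
pose T := (T0 + y)%N.
pose M0 := (8 * T + 64 * P)%N.
have key M : (M0 <= M)%N -> 3 / 8 * M%:R <= \sum_(0 <= m < M) r (P * m).+1.
  move=> M0M.
  have MR : (0 : R) < M%:R by rewrite ltr0n (leq_trans _ M0M)// addn_gt0 !muln_gt0 P0 orbT.
  pose B := (P * M)%N.
  have rough m p : p \in primes (P * m).+1 -> (y < p)%N.
    rewrite mem_primes => /and3P[pp _ pm]; rewrite ltnNge; apply/negP => py.
    have pP : (p %| P * m)%N by rewrite dvdn_mulr// dvdn_fact// prime_gt0.
    by have := pm; rewrite -addn1 dvdn_addr// dvdn1 => /eqP p1; rewrite p1 in pp.
  have lower m : (m < M)%N ->
      1 - prime_sum y B (fun p => (p %| (P * m).+1)%:R * (1 - r p) + (p ^ 2 %| (P * m).+1)%:R)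
        <= r (P * m).+1.
    move=> mM; apply: le_trans (r_ge_1Bsum (ltn0Sn _)); rewrite lerD2l lerN2.
    suff -> : prime_sum y B (fun p => (p %| (P * m).+1)%:R * (1 - r p) + (p ^ 2 %| (P * m).+1)%:R) =
        \sum_(p <- primes (P * m).+1) ((1 - r p) + (p ^ 2 %| (P * m).+1)%:R) +
        \sum_(p <- [seq p <- index_iota y.+1 B.+1 | prime p] | ~~ (p %| (P * m).+1)%N)
           (p ^ 2 %| (P * m).+1)%:R :> R.
      by rewrite lerDl sumr_ge0.
    rewrite /prime_sum -[LHS]big_filter.
    rewrite (bigID (fun p => p %| (P * m).+1)%N)/=; congr (_ + _).
      rewrite -big_filter; rewrite (perm_big (primes (P * m).+1)); last first.
        apply: uniq_perm; rewrite ?primes_uniq ?filter_uniq ?iota_uniq//.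
        move=> p; rewrite !mem_filter mem_index_iota.
        apply/idP/idP; first by rewrite mem_primes => /and4P[-> -> _ _].
        move=> pm; have := pm; rewrite mem_primes => /and3P[-> _ pd].
        rewrite pd (rough _ _ pm)/= ltnS (leq_trans (dvdn_leq _ pd))//.
        by rewrite /B ltn_mul2l P0.
      rewrite big_seq [RHS]big_seq; apply: eq_bigr => p.
      by rewrite mem_primes => /and3P[_ _ ->]; rewrite mul1r.
    by apply: eq_bigr => p /negbTE ->; rewrite mul0r add0r.
  have Hsum : \sum_(0 <= m < M) prime_sum y B (fun p =>
      (p %| (P * m).+1)%:R * (1 - r p) + (p ^ 2 %| (P * m).+1)%:R) <= 5 / 8 * M%:R.
    rewrite /prime_sum exchange_big/=.
    apply: le_trans (_ : prime_sum y B (fun p => M%:R * ((1 - r p) / p%:R) + (1 - r p) +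
       (M%:R * (p ^ 2)%:R^-1 + (p <= M %/ 8)%:R)) <= _).
      apply: le_prime_sum => p pp /andP[yp pB].
      have pP : coprime p P.
        exact: prime_coprime_fact.
      have p0 := prime_gt0 pp.
      have /andP[rp0 rp1] := r01 p0.
      rewrite big_split/=; apply: lerD.
        rewrite -mulr_suml; have := ler_wpM2r (_ : 0 <= 1 - r p) (count_progression M p0 pP).
        rewrite subr_ge0 rp1 => /(_ isT) /le_trans; apply.
        by rewrite mulrDl mul1r lerD2r mulrAC mulrA.
      have [pM|Mp] := leqP p (M %/ 8).
        apply: le_trans (count_progression M _ _) _; rewrite ?expn_gt0 ?p0 ?coprimeXl//.
      rewrite addr0 big_nat big1 ?mulr_ge0 ?invr_ge0// => m /andP[_ mM].
      case: (boolP (p ^ 2 %| _)%N) => // /dvdn_leq => /(_ isT) H.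
      exfalso; have : (p ^ 2 <= P * M)%N.
        by apply: leq_trans H _; rewrite ltn_mul2l P0.
      apply/negP; rewrite -ltnNge.
      have Mp8 : (M < 8 * p)%N by rewrite mulnC -ltn_divLR.
      have PM : (64 * P <= M)%N by apply: leq_trans M0M; rewrite leq_addl.
      by rewrite -(ltn_pmul2l (isT : 0 < 64)%N); nia.
    rewrite prime_sumD [X in X + _]prime_sumD [X in _ + X]prime_sumD !prime_sumZ.
    have y8 : (8 <= y)%N by rewrite leq_addl.
    have y_gt0 : (0 < y)%N by apply: leq_trans y8.
    have E1 : M%:R * prime_sum y B (fun p => (1 - r p) / p%:R) <= 1 / 8 * M%:R.
      by rewrite mulrC ler_wpM2r//; apply: Hy0; rewrite leq_addr.
    have E2 : prime_sum y B (fun p => 1 - r p) <= 2 / 8 * M%:R.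
      apply: le_trans (_ : prime_sum y B (fun p => (p <= T)%:R + B%:R * (if (T < p)%N then (1 - r p) / p%:R else 0)) <= _).
        apply: le_prime_sum => p pp /andP[_ pB]; have p0 := prime_gt0 pp.
        have /andP[rp0 rp1] := r01 p0.
        case: leqP => pT; first by rewrite mulr0 addr0 /=; lra.
        rewrite add0r mulrCA ler_peMr ?subr_ge0// ler_pdivlMr ?ltr0n// mul1r.
        by rewrite ler_nat.
      rewrite prime_sumD prime_sumZ.
      have -> : 2 / 8 * M%:R = 1 / 8 * M%:R + 1 / 8 * M%:R :> R by lra.
      apply: lerD.
        apply: le_trans (_ : T%:R <= _); last first.
          rewrite mulrAC ler_pdivlMr// mul1r -natrM ler_nat mulnC.
          by apply: leq_trans M0M; rewrite leq_addr.
        exact: prime_sum_small_le.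
      have HT : prime_sum T B (fun p => (1 - r p) / p%:R) <= 1 / (8 * P%:R).
        by apply: HT0; rewrite leq_addr.
      apply: le_trans (_ : B%:R * (1 / (8 * P%:R)) <= _); last first.
        by rewrite /B natrM le_eqVlt; apply/orP; left; apply/eqP; field; rewrite gt_eqF.
      rewrite ler_wpM2l//; apply: le_trans HT.
      have yT : (y <= T)%N by rewrite leq_addl.
      have z0 a b : (b <= T)%N ->
          prime_sum a b (fun p => if (T < p)%N then (1 - r p) / p%:R else 0) = 0.
        move=> bT; rewrite /prime_sum big_nat_cond big1// => p /andP[/andP[_ pb] _].
        by rewrite ltnNge (leq_trans _ bT).
      have [TB|BT] := leqP T B.
        rewrite (@prime_sum_cat _ y T B)// z0// add0r.
        by apply: le_prime_sum => p _ /andP[-> _].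
      rewrite z0 ?(ltnW BT)//; apply: prime_sum_ge0 => p pp _; exact: F0.
    have E3 : M%:R * prime_sum y B (fun p => (p ^ 2)%:R^-1 : R) <= 1 / 8 * M%:R.
      rewrite mulrC ler_wpM2r//; apply: le_trans (prime_sum_inv_sqr _ y_gt0) _.
      by rewrite div1r lef_pV2 ?posrE ?ltr0n// ler_nat.
    have E4 : prime_sum y B (fun p => (p <= M %/ 8)%:R : R) <= 1 / 8 * M%:R.
      apply: le_trans (prime_sum_small_le _ _ _) _.
      by apply: le_trans (divn_le_real _ _) _ => //; lra.
    lra.
  apply: le_trans (_ : \sum_(0 <= m < M) (1 - prime_sum y B (fun p =>
      (p %| (P * m).+1)%:R * (1 - r p) + (p ^ 2 %| (P * m).+1)%:R)) <= _).
    rewrite sumrB sumr_const_nat subn0; move: Hsum; lra.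
  by apply: ler_sum_nat => m /andP[_ mM]; exact: lower.
exists (3 / (16 * P%:R)); first by rewrite divr_gt0// mulr_gt0.
exists (P * M0.+1)%N => N HN.
pose M := (N %/ P)%N.
have MM : (M0.+1 <= M)%N by rewrite /M leq_divRL// mulnC.
have N0 : (0 < N)%N by apply: leq_trans HN; rewrite muln_gt0 P0.
rewrite average_CesaroE ler_pdivlMl ?ltr0n//.
apply: le_trans (_ : 3 / 8 * M%:R <= _).
  have : (N <= 2 * P * M)%N.
    apply: ltnW; apply: leq_trans (ltn_ceil N P0) _; rewrite -/M -mulnA mulnCA [leqLHS]mulnC.
    by rewrite leq_mul2l; apply/orP; right; lia.
  rewrite -(ler_nat R) !natrM => H.
  rewrite mulrC mulrAC ler_pdivrMr ?mulr_gt0//; lra.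
apply: le_trans (key M (ltnW MM)) _; apply: le_trans (progression_sum M P0) _.
rewrite [leRHS](@big_cat_nat _ _ _ (P * M).+1)//=; last first.
  by rewrite ltnS mulnC leq_trunc_div.
rewrite lerDl big_nat_cond; apply: sumr_ge0 => n /andP[/andP[n0 _] _].
by have /andP[] := @r01 n (leq_trans (ltn0Sn _) n0).
Qed.

End LowerBound.

Section MeanLowerBound.
Context {R : realType} (r : nat -> R).
Hypothesis rM : multiplicative_on_coprime r.
Hypothesis r1 : r 1%N = 1.
Hypothesis r01 : forall n, (0 < n)%N -> 0 <= r n <= 1.
Variable S : R.
Hypothesis r_bound : forall b, prime_sum 0 b (fun p => (1 - r p) / p%:R) <= S.

(** For logarithmic averages, apply the comparison with Cesaro averages to
    kappa - r, which is nonpositive on average at large scales. *)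
Lemma mean_lower_bound : exists2 kappa : R, 0 < kappa &
  forall m N L, index_seq N -> mean_along m N L -> kappa <= L r.
Proof.
have [kappa k0 [n0 Hk]] := multiplicative_lower_bound rM r1 r01 r_bound.
exists (kappa / 2) => [|m N L HN HL]; first by rewrite divr_gt0.
have br : bdd r.
  exists (`|r 0%N| + 1) => -[|n]; first by rewrite lerDl.
  have /andP[rn0 rn1] := r01 (ltn0Sn n).
  by rewrite ger0_norm// (le_trans rn1)// lerDr.
apply: (mean_along_ge HN HL) => //; case: m HL => HL.
  exists n0 => // k /= Hn.
  apply: le_trans (Hk _ (leq_trans Hn (increasing_ge _ HN.2))).
  by move: k0; lra.
have := total_weight_index Logarithmic HN (2 * (1 + @total_weight R Logarithmic n0.+1)).
apply: filterS => k Wk; have Nk := HN.1 k; have W0 := @total_weight_gt0 R Logarithmic _ Nk.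
have avg n : (0 < n)%N -> average Cesaro n (fun i => kappa + - 1 * r i) = kappa - average Cesaro n r.
  by move=> n_gt0; rewrite averageD averageZ average_cst// mulN1r.
have := @log_average_le _ (N k) n0.+1 (fun i => kappa + - 1 * r i) kappa 0 Nk (ltW k0) (lexx _).
rewrite averageD averageZ average_cst// mulN1r add0r.
have A1 n : (0 < n <= N k)%N -> average Cesaro n (fun i => kappa + - 1 * r i) <= kappa.
  move=> /andP[n_gt0 _]; rewrite avg// lerBlDr lerDl; apply: average_ge0 => i /andP[i0 _].
  by case/andP: (r01 i0).
have A2 n : (n0 < n <= N k)%N -> average Cesaro n (fun i => kappa + - 1 * r i) <= 0.
  move=> /andP[n_gt0 _]; rewrite avg ?subr_le0 ?Hk//; first exact: ltnW.
  exact: leq_ltn_trans n_gt0.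
move=> /(_ A1 A2) H.
have : kappa * (1 + @total_weight R Logarithmic n0.+1) / @total_weight R Logarithmic (N k) <= kappa / 2.
  rewrite ler_pdivrMr// mulrAC ler_pdivlMr// -mulrA ler_pM2l// mulrC; exact: Wk.
lra.
Qed.

End MeanLowerBound.

(** * Topology of the sequence space *)

Section InitialTopology.
Lemma cvg_initial (S : choiceType) (T : topologicalType) (f : S -> T)
    (F : set_system S) (t : S) : Filter F ->
  f @ F --> f t -> F --> (t : initial_topology f).
Proof.
move=> FF Ff A /=; rewrite nbhsE => -[B [[C oC CB] Bt] BA].
rewrite -CB in Bt BA.
have : F (f @^-1` C) by apply: Ff; apply: open_nbhs_nbhs.
exact: filterS.
Qed.
End InitialTopology.

Section SequenceSpaceTopology.
Context {R : realType}.
Local Notation X := (seqspace R).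

Definition coordRe (i : int) (x : X) : R := complex.Re (udisc_val (x i)).
Definition coordIm (i : int) (x : X) : R := complex.Im (udisc_val (x i)).

Lemma udisc_val_le1 (z : udisc R) : cnorm (udisc_val z) <= 1.
Proof. by have := valP z; rewrite inE /= cnormE -lecR. Qed.

Lemma udisc_exist (z : R[i]) : cnorm z <= 1 -> exists u : udisc R, udisc_val u = z.
Proof.
move=> z1; have Hz : (z : R[i]^o) \in [set z : R[i]^o | `|z| <= 1].
  by rewrite inE /= cnormE lecR.
by exists (exist _ (z : R[i]^o) Hz).
Qed.

Lemma udisc_val_inj : injective (@udisc_val R).
Proof. exact: val_inj. Qed.

Lemma continuous_Re : continuous (fun z : R[i]^o => complex.Re z).
Proof.
move=> z; have FF : Filter (nbhs z) by exact: nbhs_filter.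
apply/(@cvgrPdist_lt _ _ _ _ FF) => e e0.
have eC : 0 < (e%:C%C : R[i]) by rewrite ltcR.
have /cvgrPdist_lt/(_ _ eC) : (w : R[i]^o) @[w --> z] --> z by exact: cvg_id.
apply: filterS => w; rewrite cnormE ltcR; apply: le_lt_trans.
by rewrite -Re_oppc -Re_addc normr_Re_le.
Qed.

Lemma continuous_Im : continuous (fun z : R[i]^o => complex.Im z).
Proof.
move=> z; have FF : Filter (nbhs z) by exact: nbhs_filter.
apply/(@cvgrPdist_lt _ _ _ _ FF) => e e0.
have eC : 0 < (e%:C%C : R[i]) by rewrite ltcR.
have /cvgrPdist_lt/(_ _ eC) : (w : R[i]^o) @[w --> z] --> z by exact: cvg_id.
apply: filterS => w; rewrite cnormE ltcR; apply: le_lt_trans.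
by rewrite -Im_oppc -Im_addc normr_Im_le.
Qed.

Lemma continuous_udisc_val : continuous (@udisc_val R : udisc R -> R[i]^o).
Proof. exact: initial_continuous. Qed.

Lemma continuous_coord (i : int) : continuous (fun x : X => x i).
Proof. exact: (@proj_continuous _ (fun _ : int => udisc R) i). Qed.

Lemma continuous_coordRe i : continuous (coordRe i).
Proof.
move=> x.
apply: (@cvg_comp _ _ _ (fun x : X => udisc_val (x i) : R[i]^o) _ _ (nbhs (udisc_val (x i) : R[i]^o))).
  apply: (@cvg_comp _ _ _ (fun x : X => x i) _ _ (nbhs (x i))).
    exact: continuous_coord.
  exact: continuous_udisc_val.
exact: continuous_Re.
Qed.

Lemma continuous_coordIm i : continuous (coordIm i).
Proof.
move=> x.
apply: (@cvg_comp _ _ _ (fun x : X => udisc_val (x i) : R[i]^o) _ _ (nbhs (udisc_val (x i) : R[i]^o))).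
  apply: (@cvg_comp _ _ _ (fun x : X => x i) _ _ (nbhs (x i))).
    exact: continuous_coord.
  exact: continuous_udisc_val.
exact: continuous_Im.
Qed.

Lemma seqspace_cvg (T : Type) (F : set_system T) (w : T -> X) (x : X) : Filter F ->
  (forall i, coordRe i (w t) @[t --> F] --> coordRe i x) ->
  (forall i, coordIm i (w t) @[t --> F] --> coordIm i x) ->
  w t @[t --> F] --> x.
Proof.
move=> FF HR HI; apply/cvg_sup => i.
apply: cvg_initial; apply: (@cvg_initial _ _ (@set_val _ _)) => /=.
apply/cvgrPdist_lt => e e0.
have [eR eI] : 0 < complex.Re e /\ complex.Im e = 0.
  by move: e0; rewrite ltcE/= => /andP[/eqP -> ->].
have {eI}eE : e = (complex.Re e)%:C%C by apply: complex_eq.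
have e2 : 0 < complex.Re e / 2 by rewrite divr_gt0.
have /cvgrPdist_lt/(_ _ e2) hR := HR i; have /cvgrPdist_lt/(_ _ e2) hI := HI i.
rewrite eE; near=> t; rewrite cnormE ltcR; apply: le_lt_trans (cnorm_le_ReIm _) _.
rewrite Re_addc Im_addc Re_oppc Im_oppc [ltRHS]splitr; apply: ltrD.
  by near: t; exact: hR.
by near: t; exact: hI.
Unshelve. all: by end_near. Qed.

Lemma nbhs_seqspace_filter (x : X) : Filter (nbhs x).
Proof. exact: (@nbhs_filter X x). Qed.

Lemma continuous_shift : continuous (@seqshift R).
Proof.
move=> x; have FF := nbhs_seqspace_filter x.
apply: (@seqspace_cvg X (nbhs x) (@seqshift R) (seqshift x) FF) => i.
  exact: (@continuous_coordRe (i + 1) x).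
exact: (@continuous_coordIm (i + 1) x).
Qed.

Lemma iter_shiftE n (x : X) i : iter n seqshift x i = x (i + n%:Z).
Proof.
elim: n i => [|n IH] i; first by rewrite addr0.
by rewrite iterS /seqshift IH -addrA -PoszD add1n.
Qed.

Lemma continuous_iter_shift n : continuous (iter n (@seqshift R)).
Proof.
elim: n => [|n IH] x; first exact: cvg_id.
apply: (@cvg_comp _ _ _ (iter n (@seqshift R)) _ _ (nbhs (iter n seqshift x))).
  exact: IH.
exact: continuous_shift.
Qed.

(** Tychonoff in concrete form: coordinates are bounded, hence converge along
    every ultrafilter. *)
Lemma ultra_seqspace (U : set_system nat) (w : nat -> X) : UltraFilter U ->
  exists x : X, (forall i, coordRe i (w k) @[k --> U] --> coordRe i x) /\
                (forall i, coordIm i (w k) @[k --> U] --> coordIm i x).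
Proof.
move=> UU.
have bR i : bdd (fun k => coordRe i (w k)).
  by exists 1 => k; apply: le_trans (normr_Re_le _) (udisc_val_le1 _).
have bI i : bdd (fun k => coordIm i (w k)).
  by exists 1 => k; apply: le_trans (normr_Im_le _) (udisc_val_le1 _).
pose z i : R[i] := Complex (lim (coordRe i (w k) @[k --> U])) (lim (coordIm i (w k) @[k --> U])).
have z1 i : cnorm (z i) <= 1.
  rewrite -(@ler_pXn2r _ 2) ?nnegrE ?cnorm_ge0// cnorm_sqr/= expr1n.
  have cR := ultra_cvg UU (bR i); have cI := ultra_cvg UU (bI i).
  have cc : (coordRe i (w k) ^+ 2 + coordIm i (w k) ^+ 2) @[k --> U] -->
      lim (coordRe i (w k) @[k --> U]) ^+ 2 + lim (coordIm i (w k) @[k --> U]) ^+ 2.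
    by apply: cvgD; rewrite !expr2; apply: cvgM.
  rewrite -(cvg_lim _ cc)//; apply: limr_le; first by apply/cvg_ex; eexists; exact: cc.
  apply: nearW => k; rewrite -cnorm_sqr expr_le1 ?cnorm_ge0 ?udisc_val_le1//.
pose x : X := fun i => projT1 (cid (udisc_exist (z1 i))).
have xE i : udisc_val (x i) = z i by rewrite /x; case: cid.
exists x; split=> i; rewrite /coordRe /coordIm xE /=.
  exact: ultra_cvg UU (bR i).
exact: ultra_cvg UU (bI i).
Qed.

Lemma coord_eq (x y : X) : (forall i, coordRe i x = coordRe i y) ->
  (forall i, coordIm i x = coordIm i y) -> x = y.
Proof.
move=> hR hI; apply/funext => i; apply: udisc_val_inj.
by apply: complex_eq; [exact: hR|exact: hI].
Qed.

(** The compactness argument behind every uniform continuity statement below.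
    D n expresses that two points are n-close; if no n worked, pairs of
    counterexamples would have the same limit along an ultrafilter while F
    keeps them apart. *)
Lemma uniform_by_contradiction (D : nat -> X -> X -> Prop) (F : X -> R) (e : R) :
  continuous F -> 0 < e ->
  (forall (U : set_system nat) (v w : nat -> X) (x y : X), UltraFilter U -> \oo `<=` U ->
     (forall k, D k (v k) (w k)) ->
     (forall i, coordRe i (v k) @[k --> U] --> coordRe i x) ->
     (forall i, coordIm i (v k) @[k --> U] --> coordIm i x) ->
     (forall i, coordRe i (w k) @[k --> U] --> coordRe i y) ->
     (forall i, coordIm i (w k) @[k --> U] --> coordIm i y) -> x = y) ->
  exists n, forall x y, D n x y -> `|F x - F y| <= e.
Proof.
move=> Fc e0 H; apply: contrapT => Hn.
have Hex n : exists p : X * X, D n p.1 p.2 /\ e < `|F p.1 - F p.2|.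
  apply: contrapT => Hp; apply: Hn; exists n => x y Dxy.
  rewrite leNgt; apply/negP => Hlt; apply: Hp; by exists (x, y).
pose p n := projT1 (cid (Hex n)).
have pD n : D n (p n).1 (p n).2 by rewrite /p; case: cid => ? [].
have pe n : e < `|F (p n).1 - F (p n).2| by rewrite /p; case: cid => ? [].
have [U [UU oU]] := ultraFilterLemma eventually_filter.
have [x [xR xI]] := @ultra_seqspace U (fun n => (p n).1) UU.
have [y [yR yI]] := @ultra_seqspace U (fun n => (p n).2) UU.
have xy : x = y by apply: (H U _ _ _ _ UU oU pD).
have Fx : F (p k).1 @[k --> U] --> F x.
  by apply: (@cvg_comp _ _ _ (fun k => (p k).1) F U (nbhs x)); [exact: seqspace_cvg|exact: Fc].
have Fy : F (p k).2 @[k --> U] --> F x.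
  rewrite xy; apply: (@cvg_comp _ _ _ (fun k => (p k).2) F U (nbhs y)); [exact: seqspace_cvg|exact: Fc].
have e2 : 0 < e / 2 by rewrite divr_gt0.
have : \forall k \near U, `|F (p k).1 - F (p k).2| <= e.
  move/cvgrPdist_le/(_ _ e2) : Fx => Fx; move/cvgrPdist_le/(_ _ e2) : Fy => Fy.
  near=> k; have -> : F (p k).1 - F (p k).2 = - (F x - F (p k).1) + (F x - F (p k).2) by ring.
  apply: le_trans (ler_normD _ _) _; rewrite normrN [e]splitr; apply: lerD.
    by near: k; exact: Fx.
  by near: k; exact: Fy.
by move=> /filter_ex[k]; rewrite leNgt pe.
Unshelve. all: by end_near. Qed.

Lemma continuous_bounded (F : X -> R) : continuous F -> exists B, forall x, `|F x| <= B.
Proof.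
move=> Fc; apply: contrapT => Hn.
have Hex n : exists x : X, n%:R < `|F x|.
  apply: contrapT => Hp; apply: Hn; exists n%:R => x.
  by rewrite leNgt; apply/negP => Hlt; apply: Hp; exists x.
pose p n := projT1 (cid (Hex n)).
have pe n : n%:R < `|F (p n)| by rewrite /p; case: cid.
have [U [UU oU]] := ultraFilterLemma eventually_filter.
have [x [xR xI]] := @ultra_seqspace U p UU.
have Fx : F (p k) @[k --> U] --> F x.
  by apply: (@cvg_comp _ _ _ p F U (nbhs x)); [exact: seqspace_cvg|exact: Fc].
move/cvgrPdist_le/(_ _ ltr01) : Fx => Fx.
have : \forall k \near U, (Num.truncn (`|F x| + 1) < k)%N /\ `|F x - F (p k)| <= 1.
  by apply: filterI => //; apply: oU; exists (Num.truncn (`|F x| + 1)).+1.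
move=> /filter_ex[k [k1 k2]].
have := pe k; rewrite ltNge => /negP; apply.
apply: le_trans (_ : `|F x| + 1 <= _).
  have -> : F (p k) = F x - (F x - F (p k)) by ring.
  by apply: le_trans (ler_normB _ _) _; rewrite lerD2l.
apply: ltW; apply: lt_le_trans (truncnS_gt _) _; by rewrite ler_nat.
Qed.

(** Closeness on the coordinates from -n to n, with tolerance 1/(n+1), forces
    equal limits in every coordinate. *)
Lemma continuous_modulus (F : X -> R) (e : R) : continuous F -> 0 < e ->
  exists n : nat, forall x y : X,
    (forall i : int, (`|i| <= n)%N -> cnorm (udisc_val (x i) - udisc_val (y i)) <= n.+1%:R^-1) ->
    `|F x - F y| <= e.
Proof.
move=> Fc e0.
apply: (@uniform_by_contradiction (fun n x y => forall i : int, (`|i| <= n)%N ->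
  cnorm (udisc_val (x i) - udisc_val (y i)) <= n.+1%:R^-1)) => //.
move=> U v w x y UU oU Hvw vR vI wR wI.
have small i d : 0 < d -> \forall k \near U, cnorm (udisc_val (v k i) - udisc_val (w k i)) <= d.
  move=> d0; apply: oU; exists (`|i| + (Num.truncn d^-1).+1)%N => // k /= Hk.
  apply: le_trans (Hvw k i _) _; first by apply: leq_trans Hk; rewrite leq_addr.
  rewrite -[leRHS]invrK lef_pV2 ?posrE ?invr_gt0//.
  apply: ltW; apply: lt_le_trans (truncnS_gt _) _; rewrite ler_nat.
  by apply: leqW; apply: leq_trans Hk; rewrite leq_addl.
apply: coord_eq => i; apply/eqP; rewrite -subr_eq0 -normr_le0; apply/ler_addgt0Pr => d d0;
  rewrite add0r.
- have : (coordRe i (v k) - coordRe i (w k)) @[k --> U] --> coordRe i x - coordRe i y by exact: cvgB.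
  move=> /cvg_norm cc; rewrite -(cvg_lim _ cc)//; apply: limr_le; first by apply/cvg_ex; eexists; exact: cc.
  apply: filterS (small i d d0) => k; apply: le_trans.
  by rewrite /coordRe -Re_oppc -Re_addc normr_Re_le.
- have : (coordIm i (v k) - coordIm i (w k)) @[k --> U] --> coordIm i x - coordIm i y by exact: cvgB.
  move=> /cvg_norm cc; rewrite -(cvg_lim _ cc)//; apply: limr_le; first by apply/cvg_ex; eexists; exact: cc.
  apply: filterS (small i d d0) => k; apply: le_trans.
  by rewrite /coordIm -Im_oppc -Im_addc normr_Im_le.
Qed.

End SequenceSpaceTopology.

(** * Integrals of bounded functions, digits and Borel sets *)

Section BoundedIntegrals.
Context {d : measure_display} {T : measurableType d} {R : realType}.
Implicit Types (f g h : T -> R).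

Definition bounded_measurable f :=
  measurable_fun setT f /\ exists B : R, forall x, `|f x| <= B.

Lemma bmf_cst (c : R) : bounded_measurable (fun=> c).
Proof. by split; [exact: measurable_cst|exists `|c|]. Qed.

Lemma bmfD f g : bounded_measurable f -> bounded_measurable g ->
  bounded_measurable (fun x => f x + g x).
Proof.
move=> [mf [B fB]] [mg [C gC]]; split; first exact: measurable_funD.
by exists (B + C) => x; apply: le_trans (ler_normD _ _) _; rewrite lerD.
Qed.

Lemma bmfM f g : bounded_measurable f -> bounded_measurable g ->
  bounded_measurable (fun x => f x * g x).
Proof.
move=> [mf [B fB]] [mg [C gC]]; split; first exact: measurable_funM.
by exists (B * C) => x; rewrite normrM ler_pM.
Qed.

Lemma bmfZ c f : bounded_measurable f -> bounded_measurable (fun x => c * f x).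
Proof. by move=> bf; apply: bmfM => //; exact: bmf_cst. Qed.

Lemma bmfN f : bounded_measurable f -> bounded_measurable (fun x => - f x).
Proof.
move=> bf; have := bmfZ (-1) bf.
by congr bounded_measurable; apply/funext => x; rewrite mulN1r.
Qed.

Lemma bmfB f g : bounded_measurable f -> bounded_measurable g ->
  bounded_measurable (fun x => f x - g x).
Proof. by move=> bf bg; apply: bmfD => //; exact: bmfN. Qed.

Lemma bmf_norm f : bounded_measurable f -> bounded_measurable (fun x => `|f x|).
Proof.
move=> [mf [B fB]]; split; first exact: measurableT_comp.
by exists B => x; rewrite normr_id.
Qed.

Lemma bmf_sum (I : Type) (s : seq I) (P : pred I) (F : I -> T -> R) :
  (forall i, bounded_measurable (F i)) ->
  bounded_measurable (fun x => \sum_(i <- s | P i) F i x).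
Proof.
move=> bF; elim: s => [|i s IH].
  by under eq_fun do rewrite big_nil; exact: bmf_cst.
case Pi : (P i); first by under eq_fun do rewrite big_cons Pi; exact: bmfD.
by under eq_fun do rewrite big_cons Pi.
Qed.

Lemma bmf_indic (A : set T) : measurable A -> bounded_measurable (\1_A : T -> R).
Proof.
move=> mA; split; first exact: measurable_indic.
by exists 1 => x; rewrite indicE; case: (_ \in _); rewrite ?normr1 ?normr0 ?ler01.
Qed.

Lemma bmf_comp f (S : T -> T) : measurable_fun setT S -> bounded_measurable f ->
  bounded_measurable (fun x => f (S x)).
Proof.
by move=> mS [mf [B fB]]; split; [exact: measurableT_comp|exists B].
Qed.

Section Integrals.
Variable mu : probability T R.
Lemma bmf_integrable f : bounded_measurable f -> mu.-integrable setT (EFin \o f).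
Proof.
move=> [mf [B fB]]; apply: measurable_bounded_integrable => //.
  by apply: le_lt_trans (probability_le1 mu measurableT) _; rewrite ltry.
exists B; split; first exact: num_real.
by move=> M BM x _; apply: le_trans (fB x) (ltW BM).
Qed.

Lemma bintD f g : bounded_measurable f -> bounded_measurable g ->
  \int[mu]_x (f x + g x) = \int[mu]_x f x + \int[mu]_x g x.
Proof. by move=> bf bg; rewrite RintegralD//; exact: bmf_integrable. Qed.

Lemma bintB f g : bounded_measurable f -> bounded_measurable g ->
  \int[mu]_x (f x - g x) = \int[mu]_x f x - \int[mu]_x g x.
Proof. by move=> bf bg; rewrite RintegralB//; exact: bmf_integrable. Qed.

Lemma bintZ c f : bounded_measurable f ->
  \int[mu]_x (c * f x) = c * \int[mu]_x f x.
Proof. by move=> bf; rewrite RintegralZl//; exact: bmf_integrable. Qed.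

Lemma bint_cst c : \int[mu]_x c = c.
Proof. by rewrite Rintegral_cst//= probability_setT mulr1. Qed.

Lemma le_bint f g : bounded_measurable f -> bounded_measurable g ->
  (forall x, f x <= g x) -> \int[mu]_x f x <= \int[mu]_x g x.
Proof. by move=> bf bg fg; apply: le_Rintegral => //; exact: bmf_integrable. Qed.

Lemma bint_norm f : bounded_measurable f ->
  `|\int[mu]_x f x| <= \int[mu]_x `|f x|.
Proof. by move=> bf; apply: le_normr_Rintegral => //; exact: bmf_integrable. Qed.

Lemma bint_triangle (u v w : T -> R) : bounded_measurable u -> bounded_measurable v ->
  bounded_measurable w ->
  \int[mu]_y `|u y - w y| <= \int[mu]_y `|u y - v y| + \int[mu]_y `|v y - w y|.
Proof.
move=> bu bv bw; rewrite -bintD; [|by apply: bmf_norm; exact: bmfB..].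
apply: le_bint; first by apply: bmf_norm; exact: bmfB.
  by apply: bmfD; apply: bmf_norm; exact: bmfB.
by move=> y; apply: le_trans (ler_normD _ _); rewrite addrA subrK.
Qed.

Lemma bint_sum (I : Type) (s : seq I) (P : pred I) (F : I -> T -> R) :
  (forall i, bounded_measurable (F i)) ->
  \int[mu]_x (\sum_(i <- s | P i) F i x) = \sum_(i <- s | P i) \int[mu]_x F i x.
Proof.
move=> bF; elim: s => [|i s IH].
  by under eq_Rintegral do rewrite big_nil; rewrite bint_cst big_nil.
rewrite big_cons; case: ifP => Pi.
  by under eq_Rintegral do rewrite big_cons Pi; rewrite bintD ?IH//; exact: bmf_sum.
by under eq_Rintegral do rewrite big_cons Pi.
Qed.

Lemma bint_indic (A : set T) : measurable A -> (\int[mu]_x \1_A x)%:E = mu A.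
Proof.
move=> mA; rewrite /Rintegral integral_indic// setIT fineK//.
by rewrite ge0_fin_numE// (le_lt_trans (probability_le1 _ mA))// ltry.
Qed.

Lemma EFin_bint f : bounded_measurable f ->
  ((\int[mu]_x f x)%R%:E = \int[mu]_x (f x)%:E)%E.
Proof.
by move=> bf; rewrite /Rintegral fineK//; apply: integrable_fin_num => //;
  exact: bmf_integrable.
Qed.

Lemma bint_norm_le f (A : set T) B e : bounded_measurable f -> measurable A ->
  (forall x, `|f x| <= B) -> (forall x, ~ A x -> `|f x| <= e) -> 0 <= e ->
  \int[mu]_x `|f x| <= e + B * fine (mu A).
Proof.
move=> bf mA fB fe e0.
have B0 : 0 <= B by apply: le_trans (fB point).
have mAE : fine (mu A) = \int[mu]_x \1_A x.
  by apply: EFin_inj; rewrite bint_indic// fineK// ge0_fin_numE// (le_lt_trans (probability_le1 _ mA))// ltry.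
have bA := bmf_indic mA.
rewrite mAE -bintZ// -{1}[e]bint_cst -bintD; [|exact: bmf_cst|exact: bmfZ].
apply: le_bint; first exact: bmf_norm.
  by apply: bmfD; [exact: bmf_cst|exact: bmfZ].
move=> x; rewrite indicE; have [xA|] := boolP (x \in A).
  by rewrite mulr1 (le_trans (fB x))// lerDr.
by rewrite notin_setE mulr0 addr0 => /fe.
Qed.

End Integrals.
End BoundedIntegrals.

Section Cells.
Context {R : realType}.
Local Notation X := (seqspace R).
Local Notation B := (borel_seqspace R).

Definition part (b : bool) (i : int) (x : X) : R :=
  if b then coordRe i x else coordIm i x.

(** Binary coordinates: each digit compares the real or imaginary part of one
    coordinate with a rational. The digits determine the point, and every open
    set is a countable union of the cells that they cut out. *)
Definition digit (j : nat) (x : X) : bool :=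
  if unpickle j is Some (b, i, q) then part b i x < ratr q else false.

Lemma rat_between (x y : R) : x < y -> exists q : rat, x < ratr q /\ ratr q < y.
Proof. by move=> /rat_in_itvoo[q]; rewrite in_itv /= => /andP[]; exists q. Qed.

Lemma continuous_part b i : continuous (part b i).
Proof. by case: b; [exact: continuous_coordRe|exact: continuous_coordIm]. Qed.

Lemma digit_part b i (q : rat) x : digit (pickle (b, i, q)) x = (part b i x < ratr q).
Proof. by rewrite /digit pickleK. Qed.

Lemma seqspace_cvg_part (T : Type) (F : set_system T) (w : T -> X) (x : X) : Filter F ->
  (forall b i, part b i (w t) @[t --> F] --> part b i x) -> w t @[t --> F] --> x.
Proof. by move=> FF H; apply: seqspace_cvg => i; [exact: (H true)|exact: (H false)]. Qed.

Lemma part_eq (x y : X) : (forall b i, part b i x = part b i y) -> x = y.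
Proof. by move=> H; apply: coord_eq => i; [exact: (H true)|exact: (H false)]. Qed.

(** Two rationals squeeze each coordinate of the limit. *)
Lemma digits_cvg (F : set_system nat) (w : nat -> X) (x : X) : Filter F ->
  (forall j, \forall k \near F, digit j (w k) = digit j x) -> w k @[k --> F] --> x.
Proof.
move=> FF H; apply: seqspace_cvg_part => b i; apply/cvgrPdist_le => e e0.
have /rat_between[q1 [q1l q1u]] : part b i x - e < part b i x by rewrite ltrBlDr ltrDl.
have /rat_between[q2 [q2l q2u]] : part b i x < part b i x + e by rewrite ltrDl.
have h1 := H (pickle (b, i, q1)); have h2 := H (pickle (b, i, q2)).
near=> k.
have : digit (pickle (b, i, q1)) (w k) = digit (pickle (b, i, q1)) x by near: k; exact: h1.
have : digit (pickle (b, i, q2)) (w k) = digit (pickle (b, i, q2)) x by near: k; exact: h2.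
rewrite !digit_part q2l (ltNge (part b i x) (ratr q1)) (ltW q1u)/= => /= k2 /negbT.
rewrite -leNgt => k1; rewrite ler_distlC; apply/andP; split.
  exact: le_trans (ltW q1l) k1.
exact: le_trans (ltW k2) (ltW q2u).
Unshelve. all: by end_near. Qed.

(** Otherwise points outside A agreeing with x on more and more digits would
    converge to x. *)
Lemma cell_nbhs (A : set X) x : open A -> A x ->
  exists n, forall y, (forall j, (j < n)%N -> digit j y = digit j x) -> A y.
Proof.
move=> oA Ax; apply: contrapT => Hn.
have Hex n : exists y, (forall j, (j < n)%N -> digit j y = digit j x) /\ ~ A y.
  apply: contrapT => Hp; apply: Hn; exists n => y Hy.
  by apply: contrapT => nA; apply: Hp; exists y.
pose w n := projT1 (cid (Hex n)).
have wd n j : (j < n)%N -> digit j (w n) = digit j x.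
  exact: (projT2 (cid (Hex n))).1.
have wA n : ~ A (w n) by exact: (projT2 (cid (Hex n))).2.
have : w k @[k --> \oo] --> x.
  by apply: digits_cvg => j; exists j.+1 => // k /= jk; exact: wd.
move=> /(_ A) H; have /filter_ex[k] : \forall k \near \oo, A (w k).
  by apply: H; apply: open_nbhs_nbhs.
exact: wA.
Qed.

Lemma digits_modulus (F : X -> R) (e : R) : continuous F -> 0 < e ->
  exists n, forall x y, (forall j, (j < n)%N -> digit j x = digit j y) -> `|F x - F y| <= e.
Proof.
move=> Fc e0.
apply: (@uniform_by_contradiction R (fun n x y => forall j, (j < n)%N -> digit j x = digit j y)) => //.
move=> U v w x y UU oU Hvw vR vI wR wI.
have vP b i : part b i (v k) @[k --> U] --> part b i x by case: b; [exact: vR|exact: vI].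
have wP b i : part b i (w k) @[k --> U] --> part b i y by case: b; [exact: wR|exact: wI].
have key (v' w' : nat -> X) (x' y' : X) b i :
    (forall b i, part b i (v' k) @[k --> U] --> part b i x') ->
    (forall b i, part b i (w' k) @[k --> U] --> part b i y') ->
    (forall k j, (j < k)%N -> digit j (v' k) = digit j (w' k)) ->
    part b i x' <= part b i y'.
  move=> v'P w'P Hvw'; rewrite leNgt; apply/negP => lt.
  have [q [q1 q2]] := rat_between lt.
  have hw : \forall k \near U, part b i (w' k) < ratr q by exact: (cvgr_lt _ (w'P b i)).
  have hv : \forall k \near U, ratr q < part b i (v' k) by exact: (cvgr_gt _ (v'P b i)).
  have ho : \forall k \near U, (pickle (b, i, q) < k)%N by apply: oU; exists (pickle (b, i, q)).+1.
  have : \forall k \near U, part b i (w' k) < ratr q /\ ratr q < part b i (v' k) /\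
      (pickle (b, i, q) < k)%N by apply: filterI => //; exact: filterI.
  move=> /filter_ex[k [hw1 [hv1 ho1]]].
  have := Hvw' k _ ho1; rewrite !digit_part hw1 => /lt_trans/(_ hv1).
  by rewrite ltxx.
apply: part_eq => b i; apply/eqP; rewrite eq_le; apply/andP; split.
  exact: (key v w).
by apply: (key w v) => // k j /Hvw ->.
Qed.

(** An open set is the union of the countably many cells, one for each finite
    word of digits, that it contains. Borel sets are therefore generated by
    countably many half-spaces. *)
Lemma borel_digit_ind (G : set (set B)) : sigma_algebra setT G ->
  (forall b i (q : rat), G [set x | part b i x < ratr q]) ->
  forall A : set B, measurable A -> G A.
Proof.
move=> sG HG; apply: smallest_sub => //= A oA.
have [G0 GC GU] := sG.
have GC' C : G C -> G (~` C) by move=> /GC; rewrite setTD.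
have GUn C D : G C -> G D -> G (C `|` D).
  by move=> GCC GD; rewrite -bigcup2E; apply: GU => -[|[|k]].
have GIn C D : G C -> G D -> G (C `&` D).
  by move=> /GC' c /GC' d; rewrite -[C `&` D]setCK setCI; apply: GC'; apply: GUn.
have Gd j (b : bool) : G [set x | digit j x = b].
  have Gt : G [set x | digit j x].
    rewrite /digit; case: unpickle => [[[c i] q]|]; first exact: HG.
    by rewrite (_ : [set _ | _] = set0)//; apply/seteqP; split.
  case: b => //; rewrite (_ : [set x | digit j x = false] = ~` [set x | digit j x]); first exact: GC'.
  by apply/seteqP; split=> x /=; [move=> ->|move=> /negP/negbTE].
have Gcell (s : seq bool) : G [set x | forall j, (j < size s)%N -> digit j x = nth false s j].
  elim/last_ind: s => [|s b IH].
    rewrite (_ : [set _ | _] = ~` set0); first exact: GC'.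
  by rewrite setC0; apply/seteqP; split.
  rewrite (_ : [set _ | _] = [set x | forall j, (j < size s)%N -> digit j x = nth false s j]
       `&` [set x | digit (size s) x = b]); first exact: GIn.
  apply/seteqP; split=> [x /= H|x /= [H1 H2] j].
    split=> [j js|]; first by rewrite H ?nth_rcons ?js// size_rcons ltnW.
    by rewrite H ?size_rcons// nth_rcons ltnn eqxx.
  by rewrite size_rcons ltnS nth_rcons leq_eqVlt => /orP[/eqP ->|js]; rewrite ?ltnn ?eqxx// js H1.
pose C (k : nat) : set B := if unpickle k is Some s then
  [set x | (forall j, (j < size s)%N -> digit j x = nth false s j) /\
    (forall y, (forall j, (j < size s)%N -> digit j y = nth false s j) -> A y)] else set0.
rewrite (_ : A = \bigcup_k C k).
  apply: GU => k; rewrite /C; case: unpickle => [s|//].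
  have [Hs|Hs] := pselect (forall y, (forall j, (j < size s)%N -> digit j y = nth false s j) -> A y).
    by rewrite (_ : [set _ | _] = [set x | forall j, (j < size s)%N -> digit j x = nth false s j])//;
      apply/seteqP; split=> x /=; [case|].
  by rewrite (_ : [set _ | _] = set0)//; apply/seteqP; split=> x //= [].
apply/seteqP; split=> [x Ax|x [k _]].
  have [n Hn] := cell_nbhs oA Ax.
  exists (pickle (mkseq (fun j => digit j x) n)) => //; rewrite /C pickleK size_mkseq/=.
  split=> [j jn|y Hy]; first by rewrite nth_mkseq.
  by apply: Hn => j jn; rewrite Hy// nth_mkseq.
by rewrite /C; case: unpickle => [s /= [Hx HA]|//]; exact: HA.
Qed.

Lemma measurable_continuous (F : X -> R) : continuous F -> measurable_fun (setT : set B) F.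
Proof.
move=> cF; apply: (measurability _ (RGenOpens.measurableE R)).
move=> _ [_ [a [b ->]] <-]; rewrite setTI; apply: sub_sigma_algebra.
by apply: open_comp => [x _|]; [exact: cF|exact: interval_open].
Qed.

Lemma measurable_part b i : measurable_fun (setT : set B) (part b i).
Proof. by apply: measurable_continuous; exact: continuous_part. Qed.

Lemma measurable_into_borel d (T : measurableType d) (g : T -> B) :
  (forall b i (q : rat), measurable [set t | part b i (g t) < ratr q]) ->
  measurable_fun setT g.
Proof.
move=> H _ A mA; rewrite setTI; move: A mA.
apply: borel_digit_ind => //; split=> /= [|C|C].
- by rewrite preimage_set0.
- by rewrite setTD preimage_setC; exact: measurableC.
- by move=> mC; rewrite preimage_bigcup; exact: bigcupT_measurable.
Qed.

End Cells.

(** * Approximating bounded Borel functions by continuous ones *)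

Section Density.
Context {R : realType}.
Local Notation X := (seqspace R).
Local Notation B := (borel_seqspace R).

Lemma continuous_cst (c : R) : continuous (fun _ : X => c).
Proof.
move=> x A /nbhs_singleton Ac; have FF := nbhs_seqspace_filter x.
by apply: (@filterE _ (nbhs x) FF) => y; exact: Ac.
Qed.

Lemma continuous_sum (I : Type) (s : seq I) (P : pred I) (F : I -> X -> R) :
  (forall i, continuous (F i)) -> continuous (fun x => \sum_(i <- s | P i) F i x).
Proof.
move=> cF; elim: s => [|i s IH].
  by under eq_fun do rewrite big_nil; exact: continuous_cst.
case Pi : (P i); under eq_fun do rewrite big_cons Pi; last by [].
by move=> x; apply: (@cvgD _ _ _ _ (nbhs_seqspace_filter x)); [exact: cF|exact: IH].
Qed.

(** A strong form of continuity off a small set: with exact equality off E the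
    property passes to complements and, by exhausting the measure, to countable
    unions. *)
Definition almost_clopen (nu : {measure set B -> \bar R}) (A : set B) :=
  forall e : R, 0 < e -> exists (F : X -> R) (E : set B),
    [/\ continuous F, forall x, 0 <= F x <= 1, measurable E, (nu E <= e%:E)%E &
        forall x, ~ E x -> F x = \1_A x].

Section AlmostClopen.
Variable nu : {measure set B -> \bar R}.
Hypothesis nufin : (nu setT < +oo)%E.

Let nu_lt (A : set B) : measurable A -> (nu A < +oo)%E.
Proof.
by move=> mA; apply: le_lt_trans nufin; apply: le_measure; rewrite ?inE.
Qed.

Lemma almost_clopen0 : almost_clopen nu set0.
Proof.
move=> e e0; exists (fun=> 0), set0; split=> //.
- exact: continuous_cst.
- by move=> x; rewrite lexx ler01.
- by rewrite measure0 lee_fin ltW.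
- by move=> x _; rewrite indicE in_set0.
Qed.

Lemma almost_clopenC A : almost_clopen nu A -> almost_clopen nu (~` A).
Proof.
move=> H e e0; have [F [E [cF F01 mE nE HE]]] := H _ e0.
exists (fun x => 1 - F x), E; split=> //.
- move=> x; have FF := nbhs_seqspace_filter x.
  by apply: (@cvgB _ _ _ _ FF); [exact: continuous_cst|exact: cF].
- by move=> x; have := F01 x; lra.
- by move=> x /HE ->; rewrite !indicE in_setC; case: (_ \in _) => /=; rewrite ?subrr ?subr0.
Qed.

Lemma almost_clopenU A C : almost_clopen nu A -> almost_clopen nu C -> almost_clopen nu (A `|` C).
Proof.
move=> HA HC e e0; have e2 : 0 < e / 2 by rewrite divr_gt0.
have [F [E [cF F01 mE nE HE]]] := HA _ e2; have [G [E' [cG G01 mE' nE' HE']]] := HC _ e2.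
exists (fun x => F x + G x - F x * G x), (E `|` E'); split=> //.
- move=> x; have FF := nbhs_seqspace_filter x.
  apply: (@cvgB _ _ _ _ FF); first by apply: (@cvgD _ _ _ _ FF); [exact: cF|exact: cG].
  by apply: (@cvgM _ _ _ FF); [exact: cF|exact: cG].
- by move=> x; have := F01 x; have := G01 x; nra.
- exact: measurableU.
- apply: le_trans (measureU2 nu mE mE') _.
  by rewrite [e]splitr EFinD leeD.
- move=> x /not_orP[/HE -> /HE' ->]; rewrite !indicE in_setU.
  by case: (x \in A); case: (x \in C) => /=; ring.
Qed.

(** The continuous function that suits C n also suits A, once the small
    difference is added to the exceptional set. *)
Lemma almost_clopen_limit (A : set B) (C : nat -> set B) : measurable A ->
  (forall n, measurable (C n)) ->
  (forall n, almost_clopen nu (C n)) ->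
  (forall n, C n `<=` C n.+1) -> \bigcup_n C n = A -> almost_clopen nu A.
Proof.
move=> mA mC HC Cinc CA e e0; have e2 : 0 < e / 2 by rewrite divr_gt0.
have Cnd : nonincreasing_seq (fun n => A `\` C n).
  apply/nonincreasing_seqP => n; apply/subsetPset => x [Ax nC]; split=> // /Cinc.
  exact: nC.
have CI : \bigcap_n (A `\` C n) = set0.
  rewrite -subset0 => x H; have [Ax _] := H 0%N I; rewrite -CA in Ax.
  by have [n _ Cx] := Ax; have [_] := H n I.
have mD n : measurable (A `\` C n) by exact: measurableD.
have := @nonincreasing_cvg_mu _ _ _ nu (fun n => A `\` C n) (nu_lt (mD 0%N)) mD.
rewrite CI measure0 => /(_ measurable0 Cnd) /fine_cvgP[_] /cvgrPdist_le /(_ _ e2) [n _ /(_ n (leqnn n))].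
rewrite sub0r normrN /= => Hn.
have nun : (nu (A `\` C n) <= (e / 2)%:E)%E.
  rewrite -[leLHS]fineK ?ge0_fin_numE ?nu_lt// lee_fin; exact: le_trans (ler_norm _) Hn.
have [F [E [cF F01 mE nE HE]]] := HC n _ e2.
exists F, (E `|` (A `\` C n)); split=> //.
- exact: measurableU.
- apply: le_trans (measureU2 nu mE (mD n)) _.
  by rewrite [e]splitr EFinD leeD.
- move=> x /not_orP[/HE -> nA]; rewrite !indicE; congr (_%:R : R).
  have Cs : C n `<=` A by rewrite -CA => y Cy; exists n.
  congr nat_of_bool; apply/idP/idP; rewrite !inE; first exact: Cs.
  by move=> Ax; apply: contrapT => nC; apply: nA.
Qed.

(** The sets with this property form a sigma-algebra that contains the
    half-spaces. *)
Lemma almost_clopen_measurable (A : set B) : measurable A -> almost_clopen nu A.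
Proof.
move=> mA; suff [] : measurable A /\ almost_clopen nu A by [].
move: A mA; apply: (@borel_digit_ind R (fun A => measurable A /\ almost_clopen nu A)).
  split=> [|A [mA HA]|A HA].
  - by split=> //; exact: almost_clopen0.
  - by rewrite setTD; split; [exact: measurableC|exact: almost_clopenC].
  - have mU := bigcupT_measurable _ (fun n => (HA n).1); split=> //.
    have H n : measurable (\big[setU/set0]_(i < n) A i) /\ almost_clopen nu (\big[setU/set0]_(i < n) A i).
      elim: n => [|n [mn IH]].
        by rewrite big_ord0; split=> //; exact: almost_clopen0.
      rewrite big_ord_recr/=; split; first by apply: measurableU => //; exact: (HA n).1.
      by apply: almost_clopenU => //; exact: (HA n).2.
    apply: (@almost_clopen_limit _ (fun n => \big[setU/set0]_(i < n) A i)) => //.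
    + by move=> n; exact: (H n).1.
    + by move=> n; exact: (H n).2.
    + by move=> n; rewrite big_ord_recr/=; exact: subsetUl.
    + apply/seteqP; split=> x [n _].
        by rewrite -bigcup_mkord => -[k _ Akx]; exists k.
      by move=> Anx; exists n.+1 => //; rewrite big_ord_recr/=; right.
move=> b i q.
have mH (c : R) : measurable [set x : B | part b i x < c].
  have := @measurable_part R b i measurableT _ (measurable_itv `]-oo, c[).
  by rewrite setTI; congr measurable; apply/seteqP; split=> x /=; rewrite in_itv.
split=> //.
pose c (n : nat) : R := ratr q - n.+1%:R^-1.
have cq n : c n < ratr q by rewrite ltrBlDr ltrDl invr_gt0.
have cinc n : c n <= c n.+1.
  by rewrite lerD2l lerN2 lef_pV2 ?posrE ?ltr0n// ler_nat.
have mS (n : nat) : measurable ([set x : B | part b i x < ratr q] `\` [set x | part b i x < c n]).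
  exact: measurableD.
move=> e e0.
have CI : \bigcap_n ([set x : B | part b i x < ratr q] `\` [set x | part b i x < c n]) = set0.
  rewrite -subset0 => x H; have [Ax _] := H 0%N I; move: Ax => /= Ax.
  have d0 : 0 < ratr q - part b i x by rewrite subr_gt0.
  pose n := Num.truncn (ratr q - part b i x)^-1.
  have [_] := H n I; apply; rewrite /= /c ltrBrDr -ltrBrDl.
  rewrite -[ltRHS]invrK ltf_pV2 ?posrE ?invr_gt0//; exact: truncnS_gt.
have Cnd : nonincreasing_seq (fun n => [set x : B | part b i x < ratr q] `\` [set x | part b i x < c n]).
  apply/nonincreasing_seqP => n; apply/subsetPset => x [Ax nC]; split=> // Hx; apply: nC => /=.
  exact: lt_le_trans Hx (cinc n).
have := @nonincreasing_cvg_mu _ _ _ nu _ (nu_lt (mS 0%N)) mS.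
rewrite CI measure0 => /(_ measurable0 Cnd) /fine_cvgP[_] /cvgrPdist_le /(_ _ e0) [n _ /(_ n (leqnn n))].
rewrite sub0r normrN /= => Hn.
(* a continuous ramp from 1 at the level c n down to 0 at q; E is the strip between *)
exists (fun x => Num.min 1 (n.+1%:R * Num.max 0 (ratr q - part b i x))),
  ([set x : B | part b i x < ratr q] `\` [set x | part b i x < c n]); split=> //.
- move=> x; have FF := nbhs_seqspace_filter x.
  apply: (@continuous_min _ _ (fun=> 1) _ x); first exact: continuous_cst.
  apply: (@cvgM _ _ _ FF); first exact: continuous_cst.
  apply: (@continuous_max _ _ (fun=> 0) _ x); first exact: continuous_cst.
  by apply: (@cvgB _ _ _ _ FF); [exact: continuous_cst|exact: continuous_part].
- move=> x; rewrite le_min ler01 ge_min lexx/= andbT mulr_ge0//.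
  by rewrite le_max lexx.
- rewrite -[leLHS]fineK ?ge0_fin_numE ?nu_lt// lee_fin; exact: le_trans (ler_norm _) Hn.
- move=> x nE; rewrite indicE; case: (ltP (part b i x) (ratr q)) => Hx.
    rewrite mem_set//.
    have Hc : part b i x < c n by apply: contrapT => Hc; apply: nE.
    rewrite min_l// max_r; last by rewrite subr_ge0 ltW.
    move: Hc; rewrite /c ltrBrDr -ltrBrDl => Hc.
    by rewrite mulrC -ler_pdivrMr ?ltr0n// mul1r ltW.
  rewrite memNset; last by apply/negP; rewrite -leNgt.
  by rewrite max_l ?subr_le0// mulr0 min_r.
Qed.

End AlmostClopen.

(** Bounded Borel functions are uniformly close to continuous ones off a set
    of small measure: quantize h into n levels of spacing at most e and make
    the indicator of each level set continuous. *)
Lemma lusin (nu : {measure set B -> \bar R}) (h : X -> R) (C e : R) :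
  (nu setT < +oo)%E -> measurable_fun (setT : set B) h ->
  (forall x, `|h x| <= C) -> 0 < e ->
  exists (F : X -> R) (E : set B), [/\ continuous F, forall x, `|F x| <= C,
    measurable E, (nu E <= e%:E)%E & forall x, ~ E x -> `|h x - F x| <= e].
Proof.
move=> nufin mh hC e0.
have C0 : 0 <= C by apply: le_trans (hC point).
pose n := (Num.truncn (2 * C / e)).+1.
have n0 : (0 : R) < n%:R by rewrite ltr0n.
pose dl := 2 * C / n%:R.
have dl0 : 0 <= dl by rewrite divr_ge0// mulr_ge0.
have dle : dl <= e.
  have : 2 * C / e < n%:R by exact: truncnS_gt.
  by rewrite /dl ltr_pdivrMr// ler_pdivrMr// [e * _]mulrC => /ltW.
have ndl : n%:R * dl = 2 * C by rewrite /dl mulrC divfK// gt_eqF.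
pose A (j : 'I_n) : set B := [set x | - C + j.+1%:R * dl <= h x].
have mA j : measurable (A j).
  have := mh measurableT _ (measurable_itv `[(- C + j.+1%:R * dl), +oo[).
  by rewrite setTI; congr measurable; apply/seteqP; split=> x /=; rewrite in_itv/= andbT.
have en0 : 0 < e / n%:R by rewrite divr_gt0.
pose P (j : 'I_n) (p : (X -> R) * set B) := [/\ continuous p.1, forall x, 0 <= p.1 x <= 1, measurable p.2,
  (nu p.2 <= (e / n%:R)%:E)%E & forall x, ~ p.2 x -> p.1 x = \1_(A j) x].
have Hex j : exists p, P j p.
  by have [F [E HFE]] := almost_clopen_measurable nufin (mA j) en0; exists (F, E).
pose p j := projT1 (cid (Hex j)).
have pP j : P j (p j) by exact: (projT2 (cid (Hex j))).
have [mU nU] : measurable (\big[setU/set0]_(j < n) (p j).2) /\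
    (nu (\big[setU/set0]_(j < n) (p j).2) <= \sum_(j < n) (e / n%:R)%:E)%E.
  apply: (big_ind2 (fun (S : set B) z => measurable S /\ (nu S <= z)%E)).
  - by rewrite measure0.
  - move=> S1 z1 S2 z2 [m1 n1] [m2 n2]; split; first exact: measurableU.
    by apply: le_trans (measureU2 nu m1 m2) _; exact: leeD.
  - by move=> j _; have [] := pP j.
exists (fun x => - C + dl * \sum_j (p j).1 x), (\big[setU/set0]_j (p j).2).
split.
- move=> x; have FF := nbhs_seqspace_filter x.
  apply: (@cvgD _ _ _ _ FF); first exact: continuous_cst.
  apply: (@cvgM _ _ _ FF); first exact: continuous_cst.
  by apply: continuous_sum => j; have [] := pP j.
- move=> x; have s0 : 0 <= \sum_j (p j).1 x.
    by apply: sumr_ge0 => j _; have [_ /(_ x) /andP[]] := pP j.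
  have s1 : \sum_j (p j).1 x <= n%:R.
    rewrite -[n in leRHS]card_ord -sumr_const; apply: ler_sum => j _.
    by have [_ /(_ x) /andP[]] := pP j.
  rewrite ler_norml; apply/andP; split; first by rewrite lerDl mulr_ge0.
  have := ler_wpM2l dl0 s1; rewrite [dl * n%:R]mulrC ndl; lra.
- exact: mU.
- apply: le_trans nU _.
  rewrite sumEFin lee_fin sumr_const card_ord -[leLHS]mulr_natr -mulrA mulVf ?mulr1//.
  by rewrite gt_eqF.
- move=> x nE.
  have -> : \sum_j (p j).1 x = \sum_(j < n) \1_(A j) x.
    apply: eq_bigr => j _; have [_ _ _ _] := pP j; apply => Ex; apply: nE.
    by rewrite (bigD1 j)//=; left.
  (* dl times the number of levels below h x falls short of h x + C by at most dl *)
  pose a (k : nat) : R := ((- C + k.+1%:R * dl <= h x)%R : bool)%:R.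
  have -> : \sum_(j < n) \1_(A j) x = \sum_(j < n) a j :> R.
    apply: eq_bigr => j _; rewrite indicE /a; congr (nat_of_bool _)%:R.
    by apply/idP/idP; rewrite inE.
  set y := h x.
  have Hk k : [/\ \sum_(j < k) a j <= k%:R, dl * \sum_(j < k) a j <= y + C &
      y + C <= dl * \sum_(j < k) a j + dl \/ \sum_(j < k) a j = k%:R].
    elim: k => [|k [IH1 IH2 IH3]].
      rewrite big_ord0 mulr0; split=> //; last by right.
      by have := hC x; rewrite ler_norml => /andP[+ _]; rewrite -/y; lra.
    rewrite big_ord_recr/=; set s := \sum_(_ < _) _ in IH1 IH2 IH3 *; rewrite /a -/y.
    have dlk : k.+1%:R = k%:R + 1 :> R by rewrite -natr1.
    rewrite dlk; case: (leP (- C + (k%:R + 1) * dl) y) => /= Hy; rewrite ?addr0 ?mulrDr ?mulr1.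
      split; first by rewrite lerD2r.
        by have := ler_wpM2l dl0 IH1; lra.
      by case: IH3 => IH3; [left; lra|right; rewrite IH3].
    by split=> //; [lra|left; case: IH3 => // ->; lra].
  have [_ H2 H3] := Hk n.
  have yC : y <= C by have := hC x; rewrite ler_norml => /andP[].
  rewrite ler_norml; apply/andP; split; first by lra.
  case: H3 => [H3|->]; first by lra.
  by rewrite [dl * _]mulrC ndl; lra.
Qed.

End Density.

(** * Existence of Furstenberg systems *)

Section EmpiricalIntegrals.
Context {R : realType}.
Local Notation X := (seqspace R).
Local Notation B := (borel_seqspace R).

Lemma average_sum m N (I : Type) (s : seq I) (P : pred I) (F : I -> nat -> R) :
  average m N (fun n => \sum_(i <- s | P i) F i n) = \sum_(i <- s | P i) average m N (F i).
Proof.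
elim: s => [|i s IH].
  rewrite big_nil -[RHS](mul0r (average m N (fun=> 0))) -averageZ.
  by congr average; apply/funext => n; rewrite big_nil mul0r.
rewrite big_cons -IH; case Pi : (P i).
  by rewrite -averageD; congr average; apply/funext => n; rewrite big_cons Pi.
by congr average; apply/funext => n; rewrite big_cons Pi.
Qed.

Lemma ge0_integral_empirical m N (x : X) (F : X -> R) : measurable_fun (setT : set B) F ->
  (forall y, 0 <= F y) ->
  (\int[empirical m N x]_y (F y)%:E = (average m N (fun n => F (iter n seqshift x)))%:E)%E.
Proof.
move=> mF F0.
have mE : measurable_fun (setT : set B) (EFin \o F) by exact/measurable_EFinP.
have F0' y : setT y -> (0 <= (EFin \o F) y)%E by move=> _; rewrite lee_fin.
rewrite (ge0_integral_mscale _ _ _ mE)//= ge0_integral_measure_sum//.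
rewrite /average EFinM big_add1/= big_mkord -sumEFin; congr (_ * _)%E.
apply: eq_bigr => i _; rewrite (ge0_integral_mscale _ _ _ mE)//= integral_dirac//.
by rewrite diracT mul1e EFinM.
Qed.

Lemma integral_empirical m N (x : X) (F : X -> R) : measurable_fun (setT : set B) F ->
  \int[empirical m N x]_y F y = average m N (fun n => F (iter n seqshift x)).
Proof.
move=> mF; rewrite /Rintegral integralE.
have -> : ((fun y => (F y)%:E)^\+ = (fun y => (Num.max (F y) 0)%:E) :> (X -> \bar R))%E.
  by apply/funext => y; rewrite funeposE EFin_max.
have -> : ((fun y => (F y)%:E)^\- = (fun y => (Num.max (- F y) 0)%:E) :> (X -> \bar R))%E.
  by apply/funext => y; rewrite funenegE EFin_max EFinN.
have mF' : measurable_fun (setT : set B) (fun y => - F y).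
  exact: measurable_funN.
have m0 : measurable_fun (setT : set B) (fun=> 0 : R) by exact: measurable_cst.
rewrite ge0_integral_empirical; [|exact: measurable_maxr|by move=> y; rewrite le_max lexx orbT].
rewrite ge0_integral_empirical; [|exact: measurable_maxr|by move=> y; rewrite le_max lexx orbT].
rewrite -EFinB /= -[X in _ - X]mul1r -mulNr -averageZ -averageD; apply: eq_average => n _ /=.
set z := F _; rewrite mulN1r; case: (leP 0 z) => hz.
  by rewrite max_r ?oppr_le0// subr0.
by rewrite max_l ?oppr_ge0 ?ltW// sub0r opprK.
Qed.

(** The averages converge, by assumption, along the whole sequence, hence also
    along the ultrafilter, to the same limit. *)
Lemma furstenberg_mean m N (a : nat -> udisc R) (mu : probability B R) L :
  index_seq N -> mean_along m N L -> furstenberg_system_along m N a mu ->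
  exists x : X, (forall n, (0 < n)%N -> x n%:Z = a n) /\
    forall F : X -> R, continuous F ->
      \int[mu]_y F y = L (fun n => F (iter n seqshift x)).
Proof.
move=> HN HL [x [xa H]]; exists x; split=> // F cF.
apply/esym; apply: (mean_along_cvg HL).
suff -> : (fun k => average m (N k) (fun n => F (iter n seqshift x))) =
  (fun k => \int[empirical m (N k) x]_y F y) by exact: H.
by apply/funext => k; rewrite integral_empirical//; exact: measurable_continuous.
Qed.

End EmpiricalIntegrals.

Section UnitInterval.
Context {R : realType}.

Let mI : measurable (`[0%R, 1%R[%classic : set (measurableTypeR R)).
Proof. exact: measurable_itv. Qed.

Definition unit_lebesgue : set (measurableTypeR R) -> \bar R := mrestr lebesgue_measure mI.

HB.instance Definition _ := Measure.on unit_lebesgue.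

Let unit_lebesgue_setT : unit_lebesgue setT = 1%E.
Proof. by rewrite /unit_lebesgue /mrestr setTI lebesgue_measure_itv/= lte_fin ltr01 sube0. Qed.

HB.instance Definition _ := Measure_isProbability.Build _ _ _ unit_lebesgue unit_lebesgue_setT.

Lemma unit_lebesgue_itv (a b : R) : 0 <= a -> a <= b -> b <= 1 ->
  unit_lebesgue [set t | a <= t < b] = (b - a)%:E.
Proof.
move=> a0 ab b1; rewrite /unit_lebesgue /mrestr.
have -> : [set t | a <= t < b] `&` `[0, 1[ = `[a, b[%classic :> set R.
  apply/seteqP; split=> t /=; rewrite !in_itv/=; first by case.
  by move=> /andP[h1 h2]; rewrite h1 h2 (le_trans a0 h1) (lt_le_trans h2 b1).
rewrite lebesgue_measure_itv/= lte_fin; case: ltP => // ba.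
by rewrite (@le_anti _ _ a b) ?ab// subrr.
Qed.

Lemma unit_lebesgue_outside (A : set (measurableTypeR R)) :
  (forall t, 0 <= t < 1 -> ~ A t) -> unit_lebesgue A = 0%E.
Proof.
move=> H; rewrite /unit_lebesgue /mrestr (_ : _ `&` _ = set0) ?measure0//.
by rewrite -subset0 => t [At]; rewrite /= in_itv/= => /H.
Qed.

End UnitInterval.

Section ImageProbability.
Context {d1 d2 : measure_display} {T1 : measurableType d1} {T2 : measurableType d2} {R : realType}.

Lemma image_probability (P : probability T1 R) (g : T1 -> T2) : measurable_fun setT g ->
  exists mu : probability T2 R, forall F : T2 -> R, bounded_measurable F ->
    \int[mu]_y F y = \int[P]_t F (g t).
Proof.
move=> mg; pose gm : {mfun T1 >-> T2} := mfun_Sub (mem_set mg).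
exists (distribution P gm) => F bF.
have bG : bounded_measurable (fun t => F (g t)).
  by have [mF [C FC]] := bF; split; [exact: measurableT_comp|exists C].
rewrite /Rintegral; congr fine; rewrite integral_pushforward//.
- by apply/measurable_EFinP; case: bF.
- exact: bmf_integrable.
Qed.

End ImageProbability.

Section Existence.
Context {R : realType}.
Local Notation X := (seqspace R).
Local Notation B := (borel_seqspace R).

Definition prefix_word n (y : X) : seq bool := mkseq (fun j => digit j y) n.

Lemma size_prefix_word n y : size (prefix_word n y) = n.
Proof. exact: size_mkseq. Qed.

Lemma prefix_wordS n y : prefix_word n.+1 y = rcons (prefix_word n y) (digit n y).
Proof. by rewrite /prefix_word -mkseqS. Qed.

Lemma prefix_word_eq n k y z : (k <= n)%N -> prefix_word n y = prefix_word n z ->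
  forall j, (j < k)%N -> digit j y = digit j z.
Proof.
move=> kn E j jk; have jn := leq_trans jk kn.
by have := congr1 (fun s => nth false s j) E; rewrite !nth_mkseq.
Qed.

Lemma sum_words n (v : seq bool) (G : seq bool -> R) : size v = n ->
  \sum_(w : n.-tuple bool) (v == w)%:R * G w = G v.
Proof.
move=> sv; have sv' : size v == n by exact/eqP.
rewrite (bigD1 (Tuple sv'))//= eqxx mul1r big1 ?addr0// => w nw.
case: eqP => [E|]; last by rewrite mul0r.
by case/negP: nw; apply/eqP/val_inj; rewrite /= E.
Qed.

Section Fixed.
Variables (L : (nat -> R) -> R) (HL : invariant_mean L) (xs : nat -> X).

Definition word_freq (w : seq bool) : R := L (fun n => (prefix_word (size w) (xs n) == w)%:R).

Let bdd_bool (b : nat -> bool) : bdd (fun n => (b n)%:R : R).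
Proof. by exists 1 => n; case: (b n); rewrite ?normr1 ?normr0 ?ler01. Qed.

Lemma word_freq_ge0 w : 0 <= word_freq w.
Proof. by apply: (mean_ge0 HL) => // n; rewrite ler0n. Qed.

Lemma word_freq_nil : word_freq [::] = 1.
Proof. by rewrite -[RHS](mean1 HL). Qed.

Lemma word_freq_split w : word_freq w = word_freq (rcons w false) + word_freq (rcons w true).
Proof.
rewrite /word_freq -(meanD HL)//; congr (L _); apply/funext => n.
rewrite !size_rcons prefix_wordS !eqseq_rcons; case: (_ == w) => //=; last by rewrite addr0.
by case: (digit _ _); rewrite /= ?add0r ?addr0.
Qed.

(** The words of length n, in lexicographic order, cut the unit interval into
    consecutive intervals whose lengths are the frequencies. The interval of w
    begins after those of the words that branch off to the left of w, at a
    position where w has the digit true. *)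
Definition word_start (w : seq bool) : R :=
  \sum_(j < size w | nth false w j) word_freq (rcons (take j w) false).

Lemma word_start_rcons w b :
  word_start (rcons w b) = word_start w + (if b then word_freq (rcons w false) else 0).
Proof.
rewrite /word_start size_rcons big_mkcond big_ord_recr/= nth_rcons ltnn eqxx.
rewrite [in RHS]big_mkcond/=; congr (_ + _).
  apply: eq_bigr => j _; rewrite nth_rcons ltn_ord -(cats1 w b) takel_cat//.
  exact: ltnW.
by rewrite -(cats1 w b) takel_cat// take_size.
Qed.

(** The word whose interval contains t, found by descending: the digit is true
    when t lies beyond the interval of the left child. *)
Fixpoint word_at n (t : R) : seq bool :=
  if n is n'.+1 then
    let w := word_at n' t in
    rcons w (word_start w + word_freq (rcons w false) <= t)
  else [::].

Lemma size_word_at n t : size (word_at n t) = n.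
Proof. by elim: n => //= n IH; rewrite size_rcons IH. Qed.

Lemma word_start_ge0 w : 0 <= word_start w.
Proof. by apply: sumr_ge0 => i _; exact: word_freq_ge0. Qed.

Lemma word_end_le1 w : word_start w + word_freq w <= 1.
Proof.
elim/last_ind: w => [|w b IH].
  by rewrite word_freq_nil /word_start big_ord0 add0r.
rewrite word_start_rcons; apply: le_trans IH; rewrite -addrA lerD2l (word_freq_split w).
by case: b; rewrite ?add0r ?lerDl ?word_freq_ge0.
Qed.

Lemma word_at_eq n t (w : seq bool) : 0 <= t < 1 -> size w = n ->
  (word_at n t == w) = (word_start w <= t < word_start w + word_freq w).
Proof.
move=> t01 <-{n}; elim/last_ind: w => [|w b IH].
  by rewrite word_freq_nil /word_start big_ord0 add0r t01 eqxx.
rewrite size_rcons/= eqseq_rcons IH word_start_rcons.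
have f0 := word_freq_ge0 (rcons w false); have f1 := word_freq_ge0 (rcons w true).
have [E|N] := eqVneq (word_at (size w) t) w.
  move: IH; rewrite E eqxx => /esym/[dup] /andP[w1 w2] ->.
  rewrite word_freq_split in w2; case: b => /=.
    rewrite eqb_id -addrA [X in t < X]addrA -addrA w2 andbT//.
  rewrite addr0 w1/= ltNge; by case: (_ <= t).
have -> : (word_start w <= t < word_start w + word_freq w) = false by rewrite -IH; exact/negbTE.
rewrite word_freq_split in IH.
apply/esym/negbTE/negP => /andP[h1 h2].
move: IH; rewrite (negbTE N) => /esym/negbT/negP; apply.
apply/andP; split; first by apply: le_trans h1; case: (b); rewrite ?addr0// lerDl.
by apply: lt_le_trans h2 _; case: (b); rewrite ?addr0 -?addrA ?lerD2l// lerDl.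
Qed.

Lemma word_freq_neq0 w : word_freq w != 0 -> exists n, prefix_word (size w) (xs n) = w.
Proof.
move=> H; apply: contrapT => Hn; case/eqP: H; rewrite -[RHS](mean_cst HL 0).
congr (L _); apply/funext => n; case: eqP => // E; case: Hn; by exists n.
Qed.

(** A word of positive frequency is the prefix of some point of the orbit,
    which is chosen to represent it; other words have empty intervals. *)
Definition word_point (w : seq bool) : X :=
  if pselect (exists n, prefix_word (size w) (xs n) = w) is left H then xs (projT1 (cid H))
  else point.

Lemma word_pointP w n : prefix_word (size w) (xs n) = w ->
  prefix_word (size w) (word_point w) = w.
Proof.
move=> E; rewrite /word_point; case: pselect => [H|[]]; last by exists n.
exact: (projT2 (cid H)).
Qed.

Lemma unit_word n (w : seq bool) : size w = n ->
  unit_lebesgue [set t : measurableTypeR R | 0 <= t < 1 /\ word_at n t = w] = (word_freq w)%:E.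
Proof.
move=> sw; rewrite (_ : [set _ | _] = [set t | word_start w <= t < word_start w + word_freq w]).
  rewrite unit_lebesgue_itv ?word_start_ge0 ?lerDl ?word_freq_ge0 ?word_end_le1//.
  by rewrite addrAC subrr add0r.
apply/seteqP; split=> t /=.
  by move=> [t01 /eqP]; rewrite word_at_eq.
move=> Ht; have t01 : 0 <= t < 1.
  move: Ht => /andP[h1 h2]; rewrite (le_trans (word_start_ge0 w) h1)/=.
  exact: lt_le_trans h2 (word_end_le1 w).
by split=> //; apply/eqP; rewrite word_at_eq.
Qed.

Lemma measurable_word n (w : n.-tuple bool) :
  measurable [set t : measurableTypeR R | 0 <= t < 1 /\ word_at n t = w].
Proof.
rewrite (_ : [set _ | _] = `[word_start w, (word_start w + word_freq w)[ `&` `[0, 1[).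
  by apply: measurableI; exact: measurable_itv.
apply/seteqP; split=> t /=; rewrite !in_itv/=.
  by move=> [t01 /eqP]; rewrite word_at_eq ?size_tuple// => ->.
by move=> [Ht t01]; split=> //; apply/eqP; rewrite word_at_eq ?size_tuple.
Qed.

Lemma nth_word_at n t j : (j < n)%N ->
  nth false (word_at n t) j = nth false (word_at j.+1 t) j.
Proof.
elim: n => // n IH; rewrite ltnS leq_eqVlt => /orP[/eqP ->//|jn].
by rewrite {1}/word_at -/word_at nth_rcons size_word_at jn IH.
Qed.

Let pt n t := word_point (word_at n t).

Lemma digit_word_point n t j : 0 <= t < 1 -> (j < n)%N ->
  digit j (pt n t) = nth false (word_at n t) j.
Proof.
move=> t01 jn; have : word_freq (word_at n t) != 0.
  have := word_at_eq t01 (size_word_at n t); rewrite eqxx => /esym/andP[h1 h2].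
  by apply/eqP => E; move: h2; rewrite E addr0 ltNge h1.
move=> /word_freq_neq0[k]; rewrite size_word_at => Hk.
have := @word_pointP (word_at n t) k; rewrite size_word_at => /(_ Hk) E.
by rewrite /pt -[in RHS]E nth_mkseq.
Qed.

(** For fixed t the representatives of the words around t have longer and
    longer common prefixes; an ultrafilter limit exists by compactness, and
    convergence is uniform in t for each continuous F. *)
Lemma limit_point : exists y : R -> X, measurable_fun setT (y : measurableTypeR R -> B) /\
  forall (F : X -> R) (e : R), continuous F -> 0 < e -> exists n0, forall n t,
    (n0 <= n)%N -> 0 <= t < 1 -> `|F (y t) - F (pt n t)| <= e.
Proof.
have [U [UU oU]] := ultraFilterLemma eventually_filter.
pose y (t : R) : X := if (0 <= t < 1) then projT1 (cid (ultra_seqspace (fun n => pt n t) UU)) else point.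
have yP (F : X -> R) (e : R) : continuous F -> 0 < e -> exists n0, forall n t,
    (n0 <= n)%N -> 0 <= t < 1 -> `|F (y t) - F (pt n t)| <= e.
  move=> cF e0; have [n0 Hn0] := digits_modulus cF e0; exists n0 => n t n0n t01.
  rewrite /y t01; case: cid => z [/= zR zI].
  have Fz : F (pt k t) @[k --> U] --> F z.
    by apply: (@cvg_comp _ _ _ (fun k => pt k t) F U (nbhs z)); [exact: seqspace_cvg|exact: cF].
  have cc : `|F (pt k t) - F (pt n t)| @[k --> U] --> `|F z - F (pt n t)|.
    by apply: cvg_norm; apply: cvgB => //; exact: cvg_cst.
  rewrite -(cvg_lim _ cc)//; apply: limr_le; first by apply/cvg_ex; eexists; exact: cc.
  apply: oU; exists n0 => // k /= n0k; apply: Hn0 => j jn0.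
  have jk := leq_trans jn0 n0k; have jn := leq_trans jn0 n0n.
  by rewrite !digit_word_point// nth_word_at// [RHS]nth_word_at.
exists y; split=> //.
have mY b i : measurable_fun setT (fun t : measurableTypeR R => part b i (y t)).
  pose h n (t : measurableTypeR R) : R := if 0 <= t < 1 then part b i (pt n t) else part b i point.
  apply: (@measurable_fun_cvg _ _ _ _ h) => [n|t _]; last first.
    apply/cvgrPdist_le => e e0; have [n0 Hn0] := yP _ _ (@continuous_part R b i) e0.
    exists n0 => // n /= n0n; rewrite /h; case: ifP => t01; first exact: Hn0.
    by rewrite /y t01 subrr normr0 ltW.
  rewrite (_ : h n = fun t => \sum_(w : n.-tuple bool)
      \1_[set t : measurableTypeR R | 0 <= t < 1 /\ word_at n t = w] t * (part b i (word_point w) - part b i point)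
      + part b i point).
    apply: measurable_funD; last exact: measurable_cst.
    apply: measurable_sum => w; apply: measurable_funM; last exact: measurable_cst.
    exact: measurable_indic (measurable_word w).
  apply/funext => t; rewrite /h; case: ifP => t01.
    rewrite -[LHS](subrK (part b i point)); congr (_ + _).
    rewrite -(@sum_words n (word_at n t) (fun w => part b i (word_point w) - part b i point)) ?size_word_at//.
    apply: eq_bigr => w _; rewrite indicE; congr ((nat_of_bool _)%:R * _).
    by apply/eqP/idP => [E|]; rewrite inE //= => -[].
  rewrite big1 ?add0r// => w _; rewrite indicE memNset ?mul0r//=.
  by rewrite t01 => -[].
apply: measurable_into_borel => b i q.
have := mY b i measurableT _ (measurable_itv `]-oo, (ratr q : R)[).
by rewrite setTI; congr measurable; apply/seteqP; split=> t /=; rewrite in_itv.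
Qed.

(** Push the uniform measure forward by the limit map. The sum over words is
    the integral of a step function of t, close to F along the limit map. *)
Lemma mean_probability : exists mu : probability B R, forall (F : X -> R) (e : R),
  continuous F -> 0 < e -> exists n0, forall n, (n0 <= n)%N ->
    `|\int[mu]_y F y - \sum_(w : n.-tuple bool) word_freq w * F (word_point w)| <= e.
Proof.
have [y [my yP]] := limit_point.
have [mu Hmu] := @image_probability _ _ _ _ _ (@unit_lebesgue R) _ my.
exists mu => F e cF e0; have [n0 Hn0] := yP F e cF e0; exists n0 => n n0n.
have [C FC] := continuous_bounded cF.
have bF : bounded_measurable (F : B -> R) by split; [exact: measurable_continuous|exists C].
rewrite Hmu//.
have bFy : bounded_measurable (fun t : measurableTypeR R => F (y t)).
  by split; [exact: (measurableT_comp bF.1 my)|exists C].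
have mS := @measurable_word n.
pose g (t : measurableTypeR R) : R := \sum_(w : n.-tuple bool)
  F (word_point w) * \1_[set t : measurableTypeR R | 0 <= t < 1 /\ word_at n t = w] t.
have bg : bounded_measurable g.
  by apply: bmf_sum => w; apply: bmfZ; exact: bmf_indic.
have gE : \int[@unit_lebesgue R]_t g t = \sum_(w : n.-tuple bool) word_freq w * F (word_point w).
  rewrite bint_sum; last by move=> w; apply: bmfZ; exact: bmf_indic.
  apply: eq_bigr => w _; rewrite bintZ; last exact: bmf_indic.
  rewrite mulrC; congr (_ * _); apply: EFin_inj; rewrite bint_indic//.
  by apply: unit_word; rewrite size_tuple.
have gin t : 0 <= t < 1 -> g t = F (pt n t).
  move=> t01; rewrite -(@sum_words n (word_at n t) (fun w => F (word_point w))) ?size_word_at//.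
  apply: eq_bigr => w _; rewrite indicE mulrC; congr ((nat_of_bool _)%:R * _).
  by apply/idP/eqP => [|E]; rewrite inE //= => -[].
have gout t : ~ (0 <= t < 1) -> g t = 0.
  by move=> nt; rewrite /g big1// => w _; rewrite indicE memNset ?mulr0//= => -[].
have C0 : 0 <= C by apply: le_trans (FC point).
rewrite -gE -bintB//; apply: le_trans (bint_norm _ (bmfB bFy bg)) _.
have mO : measurable [set t : measurableTypeR R | ~ (0 <= t < 1)].
  rewrite (_ : [set _ | _] = ~` `[0, 1[); first by apply: measurableC; exact: measurable_itv.
  by apply/seteqP; split=> t /=; rewrite in_itv.
apply: le_trans (@bint_norm_le _ _ _ _ _ _ (C + C) e (bmfB bFy bg) mO _ _ (ltW e0)) _.
- move=> t; have [t01|t01] := pselect (0 <= t < 1).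
    by rewrite gin//; apply: le_trans (ler_normB _ _) _; rewrite lerD.
  by rewrite gout// subr0; apply: le_trans (FC _) _; rewrite lerDl.
- by move=> t /contrapT t01; rewrite gin//; exact: Hn0.
- rewrite [X in fine X](_ : _ = 0%E) ?mulr0 ?addr0//.
  by apply: unit_lebesgue_outside => t t01; exact.
Qed.

End Fixed.

(** Word frequencies along an ultrafilter define the limit measure. There are
    countably many words, so a subsequence can be chosen along which all
    frequencies converge in the usual sense; continuous functions depend, up
    to e, on finitely many digits. *)
Lemma furstenberg_exists m (x : X) : exists (N : nat -> nat) (mu : probability B R),
  index_seq N /\ weak_star_cvg (fun k => empirical m (N k) x) mu.
Proof.
have HN0 : index_seq succn by split.
have [L HL] := @mean_along_ex R m succn; have HLm := mean_along_mean HN0 HL.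
pose xs n := iter n seqshift x.
have [mu Hmu] := mean_probability HLm xs.
pose T (w : seq bool) n : R := (prefix_word (size w) (xs n) == w)%:R.
have bT w : bdd (T w) by exists 1 => n; rewrite /T; case: (_ == w); rewrite ?normr1 ?normr0 ?ler01.
pose Ti (i : nat) := if unpickle i is Some w then T w else fun=> 0.
have bTi i : bdd (Ti i) by rewrite /Ti; case: unpickle => [w|]; [exact: bT|exact: bdd_cst].
have [|phi [phi_inc Hphi]] := @subsequence_choice
    (fun k j => forall i : 'I_k, `|average m j.+1 (Ti i) - L (Ti i)| <= k.+1%:R^-1).
  move=> k j0; apply: (@mean_along_approx R m succn L HN0 HL _ (fun i : 'I_k => Ti i)) => //.
exists (fun k => (phi k).+1), mu; split.
  by split=> // i j /phi_inc.
have freq (w : seq bool) (d : R) : 0 < d -> \forall k \near \oo,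
    `|average m (phi k).+1 (T w) - word_freq L xs w| <= d.
  move=> d0; exists (pickle w + (Num.truncn d^-1).+1)%N => // k /= Hk.
  have wk : (pickle w < k)%N by apply: leq_trans Hk; rewrite addnS ltnS leq_addr.
  have TiE : Ti (pickle w) = T w by rewrite /Ti pickleK.
  have : `|average m (phi k).+1 (Ti (pickle w)) - L (Ti (pickle w))| <= k.+1%:R^-1 := Hphi k (Ordinal wk).
  rewrite TiE => /le_trans; apply.
  rewrite -[leRHS]invrK lef_pV2 ?posrE ?invr_gt0//.
  apply: ltW; apply: lt_le_trans (truncnS_gt _) _; rewrite ler_nat.
  by apply: leqW; apply: leq_trans Hk; rewrite leq_addl.
move=> F cF; apply/cvgrPdist_le => e e0.
have [C FC] := continuous_bounded cF; have C0 : 0 <= C by apply: le_trans (FC point).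
have e3 : 0 < e / 3 by rewrite divr_gt0.
have [n1 Hn1] := Hmu F _ cF e3; have [n2 Hn2] := digits_modulus cF e3.
pose n := maxn n1 n2; pose K : R := \sum_(w : n.-tuple bool) 1.
have K0 : 0 <= K by apply: sumr_ge0 => w _; exact: ler01.
have K1 : 0 < K + 1 by rewrite ltr_wpDl.
have C1 : 0 < C + 1 by rewrite ltr_wpDl.
pose d := e / 3 / (C + 1) / (K + 1).
have d0 : 0 < d by rewrite !divr_gt0.
have Hall : \forall k \near \oo, forall w : n.-tuple bool,
    `|average m (phi k).+1 (T w) - word_freq L xs w| <= d.
  by apply: filter_forall => w; exact: freq.
apply: filterS Hall => k Hk; rewrite integral_empirical; last exact: measurable_continuous.
set I := \int[mu]_y F y.
have H1 : `|I - \sum_(w : n.-tuple bool) word_freq L xs w * F (word_point xs w)| <= e / 3.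
  by apply: Hn1; rewrite leq_maxl.
have H2 : `|average m (phi k).+1 (fun j => F (xs j)) -
    \sum_(w : n.-tuple bool) average m (phi k).+1 (T w) * F (word_point xs w)| <= e / 3.
  have -> : \sum_(w : n.-tuple bool) average m (phi k).+1 (T w) * F (word_point xs w) =
      average m (phi k).+1 (fun j => F (word_point xs (prefix_word n (xs j)))).
    transitivity (average m (phi k).+1 (fun j => \sum_(w : n.-tuple bool) T w j * F (word_point xs w))).
      rewrite average_sum; apply: eq_bigr => w _.
      by rewrite mulrC -averageZ; congr average; apply/funext => j; rewrite mulrC.
    apply: eq_average => j _; rewrite -(@sum_words n (prefix_word n (xs j)) (fun w => F (word_point xs w))) ?size_prefix_word//.
    by apply: eq_bigr => w _; rewrite /T size_tuple.
  rewrite -[X in _ - X]mul1r -mulNr -averageZ -averageD.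
  apply: average_norm_le => // j; rewrite mulN1r; apply: Hn2.
  have := @word_pointP xs (prefix_word n (xs j)) j; rewrite size_prefix_word => /(_ erefl) E.
  by apply: (prefix_word_eq _ (esym E)); rewrite leq_maxr.
have H3 : `|\sum_(w : n.-tuple bool) word_freq L xs w * F (word_point xs w) -
    \sum_(w : n.-tuple bool) average m (phi k).+1 (T w) * F (word_point xs w)| <= e / 3.
  rewrite -sumrB; apply: le_trans (ler_norm_sum _ _ _) _.
  apply: (@le_trans _ _ (\sum_(w : n.-tuple bool) d * (C + 1))).
    apply: ler_sum => w _; rewrite -mulrBl normrM ler_pM//; first by rewrite distrC.
    by apply: le_trans (FC _) _; rewrite lerDl.
  under eq_bigr do rewrite -[d * _]mulr1.
  rewrite -mulr_sumr -/K /d.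
  have -> : e / 3 / (C + 1) / (K + 1) * (C + 1) * K = e / 3 * (K / (K + 1)).
    by field; rewrite !gt_eqF.
  by rewrite ger_pMr// ler_pdivrMr// mul1r lerDl.
set S1 := \sum_(w : _) _ in H1 H3; set S2 := \sum_(w : _) _ in H2 H3; set A := average _ _ _ in H2 *.
have -> : I - A = (I - S1) + (S1 - S2) + - (A - S2) by ring.
apply: le_trans (ler_normD _ _) _; rewrite normrN.
have := ler_normD (I - S1) (S1 - S2); lra.
Qed.

Lemma furstenberg_system_exists m (a : nat -> udisc R) :
  exists mu : probability B R, furstenberg_system m a mu.
Proof.
pose x : X := fun i => if i is Posz n then a n else point.
have [N [mu [HN H]]] := furstenberg_exists m x.
by exists mu, N; split=> //; exists x.
Qed.

End Existence.

(** * Upper limits of sequences of functions *)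

Section LimsupFunctions.
Context {R : realType}.
Implicit Types w : nat -> R.

Definition limsup w : R := fine (limn_esup (fun k => (w k)%:E)).

Lemma limsupE w (C : R) : (forall k, `|w k| <= C) -> limn_esup (fun k => (w k)%:E) = (limsup w)%:E.
Proof.
move=> wC; rewrite /limsup.
have up : (limn_esup (fun k => (w k)%:E) <= C%:E)%E.
  apply/limn_esup_leP => e e0; apply: nearW => k.
  by apply: le_trans (ler_norm _) _; apply: le_trans (wC k) _; rewrite lerDl ltW.
case E : (limn_esup _) up => [r| |] //= _.
have : (limn_esup (fun k => (w k)%:E) <= (- C - 2)%:E)%E by rewrite E leNye.
move=> /limn_esup_leP/(_ _ ltr01)/filter_ex[k wk]; exfalso.
by have := wC k; rewrite ler_norml => /andP[]; lra.
Qed.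

Lemma limsup_near w C : (forall k, `|w k| <= C) ->
  forall e, 0 < e -> \forall k \near \oo, w k <= limsup w + e.
Proof. by move=> wC; apply/limn_esup_leP; rewrite (limsupE wC). Qed.

Lemma limsup_le w C a : (forall k, `|w k| <= C) -> (\forall k \near \oo, w k <= a) ->
  limsup w <= a.
Proof.
move=> wC wa; rewrite -lee_fin -(limsupE wC); apply/limn_esup_leP => e e0.
by apply: filterS wa => k /le_trans; apply; rewrite lerDl ltW.
Qed.

Lemma limsup_ge w C a : (forall k, `|w k| <= C) -> (\forall k \near \oo, a <= w k) ->
  a <= limsup w.
Proof.
move=> wC wa; apply/ler_addgt0Pr => e e0.
have := limsup_near wC e0 => H.
have /filter_ex[k [k1 k2]] : \forall k \near \oo, a <= w k /\ w k <= limsup w + e by exact: filterI.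
exact: le_trans k1 k2.
Qed.

Lemma limsup_dist w C i s : (forall k, `|w k| <= C) ->
  (forall k, (i <= k)%N -> `|w k - w i| <= s) -> `|w i - limsup w| <= s.
Proof.
move=> wC H; rewrite ler_norml; apply/andP; split.
  suff : limsup w <= w i + s by lra.
  apply: (limsup_le wC); exists i => // k /= /H; rewrite ler_norml => /andP[]; lra.
suff : w i - s <= limsup w by lra.
by apply: (limsup_ge wC); exists i => // k /= /H; rewrite ler_norml => /andP[]; lra.
Qed.

Lemma eq_limsup w w' C : (forall k, `|w k| <= C) -> (forall k, `|w' k| <= C) ->
  (forall e, 0 < e -> \forall k \near \oo, `|w k - w' k| <= e) -> limsup w = limsup w'.
Proof.
move=> wC w'C H.
have le u v : (forall k, `|u k| <= C) -> (forall k, `|v k| <= C) ->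
    (forall e, 0 < e -> \forall k \near \oo, `|u k - v k| <= e) -> limsup u <= limsup v.
  move=> uC vC Huv; apply/ler_addgt0Pr => e e0; have e2 : 0 < e / 2 by rewrite divr_gt0.
  apply: (limsup_le uC); have h1 := limsup_near vC e2; have h2 := Huv _ e2.
  have : \forall k \near \oo, v k <= limsup v + e / 2 /\ `|u k - v k| <= e / 2 by exact: filterI.
  by apply: filterS => k [k1]; rewrite ler_norml => /andP[]; lra.
apply/eqP; rewrite eq_le; apply/andP; split; apply: le => // e e0.
by apply: filterS (H e e0) => k; rewrite distrC.
Qed.

Context {d : measure_display} {T : measurableType d} (mu : probability T R).

Lemma measurable_limsup (A : nat -> T -> R) : (forall j, measurable_fun setT (A j)) ->
  measurable_fun setT (fun x => limsup (A ^~ x)).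
Proof.
move=> mA; apply: measurableT_comp; first exact: fine_measurable.
by apply: measurable_fun_limn_esup => j; exact/measurable_EFinP.
Qed.

Lemma limsup_bound w (C : R) : (forall k, `|w k| <= C) -> `|limsup w| <= C.
Proof.
move=> wC; rewrite ler_norml; apply/andP; split.
  by apply: (limsup_ge wC); apply: nearW => k; have := wC k; rewrite ler_norml => /andP[].
by apply: (limsup_le wC); apply: nearW => k; have := wC k; rewrite ler_norml => /andP[].
Qed.

Lemma bmf_limsup (A : nat -> T -> R) (C : R) : (forall j, measurable_fun setT (A j)) ->
  (forall j x, `|A j x| <= C) -> bounded_measurable (fun x => limsup (A ^~ x)).
Proof.
move=> mA AC; split; first exact: measurable_limsup.
by exists C => x; exact: limsup_bound.
Qed.

(** If the successive L1 distances are summable, the pointwise upper limit is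
    an L1 limit: its distance to A i is bounded by the sum of the later
    increments, and the integral of that series is geometric. *)
Lemma limsup_L1 (A : nat -> T -> R) (C e : R) : (forall j, measurable_fun setT (A j)) ->
  (forall j x, `|A j x| <= C) ->
  (forall j, \int[mu]_x `|A j.+1 x - A j x| <= e / 2 ^+ j) ->
  forall i, \int[mu]_x `|A i x - limsup (A ^~ x)| <= 2 * e / 2 ^+ i.
Proof.
move=> mA AC HA i.
have bA j : bounded_measurable (A j) by split=> //; exists C.
have bG := bmf_limsup mA AC.
have bAG : bounded_measurable (fun x => `|A i x - limsup (A ^~ x)|) by apply: bmf_norm; exact: bmfB.
pose f n x := `|A (i + n).+1 x - A (i + n)%N x|.
have bf n : bounded_measurable (f n) by apply: bmf_norm; exact: bmfB.
have mf n : measurable_fun setT (fun x => (f n x)%:E) by apply/measurable_EFinP; case: (bf n).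
have f0 n x : setT x -> (0 <= (f n x)%:E)%E by move=> _; rewrite lee_fin /f.
rewrite -lee_fin EFin_bint//.
apply: (@le_trans _ _ (\int[mu]_x \sum_(0 <= n <oo) (f n x)%:E)%E).
  apply: ge0_le_integral => //.
  - by apply/measurable_EFinP; case: bAG.
  - by apply: ge0_emeasurable_sum => *; rewrite ?lee_fin ?normr_ge0.
  move=> x _.
  have S0 : (0 <= \sum_(0 <= n <oo) (f n x)%:E)%E by apply: nneseries_ge0 => n _ _; exact: f0.
  have Hk k : ((\sum_(0 <= n < k) f n x)%:E <= \sum_(0 <= n <oo) (f n x)%:E)%E.
    by rewrite -sumEFin; apply: nneseries_lim_ge => n _ _; exact: f0.
  case: (\sum_(0 <= n <oo) (f n x)%:E)%E S0 Hk => [s| |] // S0 Hk; last by rewrite leey.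
  rewrite lee_fin; apply: (@limsup_dist (A ^~ x) C i s) => // k ik.
  have := Hk (k - i)%N; rewrite lee_fin; apply: le_trans.
  rewrite -{1}(subnKC ik); elim: (k - i)%N => [|l IH].
    by rewrite addn0 subrr normr0 big_geq.
  rewrite big_nat_recr//= addnS.
  have -> : A (i + l).+1 x - A i x = (A (i + l)%N x - A i x) + (A (i + l).+1 x - A (i + l)%N x) by ring.
  by apply: le_trans (ler_normD _ _) _; rewrite lerD.
rewrite integral_nneseries//.
apply: lime_le.
  by apply: is_cvg_nneseries => n _ _; apply: integral_ge0 => x _; exact: f0.
apply: nearW => k; under eq_bigr do rewrite -EFin_bint//.
rewrite sumEFin lee_fin.
have e0 : 0 <= e.
  have := HA 0%N; rewrite expr0 divr1; apply: le_trans; exact: Rintegral_ge0.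
apply: (@le_trans _ _ (2 * e / 2 ^+ i * (1 - (2 ^+ k)^-1))); last first.
  by rewrite ler_piMr ?divr_ge0 ?mulr_ge0// ?exprn_ge0// gerBl invr_ge0 exprn_ge0.
elim: k => [|k IH]; first by rewrite big_geq// expr0 invr1 subrr mulr0.
rewrite big_nat_recr//=; apply: le_trans (lerD IH (HA (i + k)%N)) _.
rewrite exprD exprS le_eqVlt; apply/orP; left; apply/eqP; field.
by rewrite !expf_neq0.
Qed.

End LimsupFunctions.

Section Uniqueness.
Context {R : realType}.
Local Notation X := (seqspace R).
Local Notation B := (borel_seqspace R).

(** The approximation is needed for two measures with the same F, so apply the
    approximation theorem to their sum. *)
Lemma continuous_dense2 (mu mu' : probability B R) (h : X -> R) (C e : R) :
  measurable_fun (setT : set B) h -> (forall x, `|h x| <= C) -> 0 < e ->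
  exists F : X -> R, [/\ continuous F, forall x, `|F x| <= C,
    \int[mu]_x `|h x - F x| <= e & \int[mu']_x `|h x - F x| <= e].
Proof.
move=> mh hC e0; have C0 : 0 <= C by apply: le_trans (hC point).
pose nu := measure_add mu mu'.
have nuE A : nu A = (mu A + mu' A)%E by rewrite /nu measure_addE.
have nufin : (nu setT < +oo)%E.
  by rewrite nuE; apply: lte_add_pinfty; apply: le_lt_trans (probability_le1 _ measurableT) _; rewrite ltry.
pose dl := e / (1 + 2 * C); have C1 : 0 < 1 + 2 * C by rewrite ltr_wpDr// mulr_ge0.
have dl0 : 0 < dl by rewrite divr_gt0.
have [F [E [cF FC mE nE HE]]] := lusin nufin mh hC dl0.
have bF : bounded_measurable (F : B -> R) by split; [exact: measurable_continuous|exists C].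
have bh : bounded_measurable (h : B -> R) by split=> //; exists C.
have key (m : probability B R) : (m E <= dl%:E)%E -> \int[m]_x `|h x - F x| <= e.
  move=> mEd; apply: le_trans (bint_norm_le m (B := 2 * C) (bmfB bh bF) mE _ HE (ltW dl0)) _.
    by move=> x; apply: le_trans (ler_normB _ _) _; rewrite mulrDl mul1r lerD.
  have : fine (m E) <= dl.
    by rewrite -lee_fin fineK// ge0_fin_numE// (le_lt_trans mEd)// ltry.
  have dlE : dl * (1 + 2 * C) = e by rewrite /dl divfK// gt_eqF.
  move=> H; have := ler_wpM2l (_ : 0 <= 2 * C) H; rewrite mulr_ge0// => /(_ isT); lra.
have nE' : (mu E + mu' E <= dl%:E)%E by rewrite -nuE.
exists F; split=> //; apply: key; apply: le_trans nE'.
  by rewrite leeDl.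
by rewrite leeDr.
Qed.

Lemma continuous_dense (mu : probability B R) (h : X -> R) (C e : R) :
  measurable_fun (setT : set B) h -> (forall x, `|h x| <= C) -> 0 < e ->
  exists F : X -> R, [/\ continuous F, forall x, `|F x| <= C & \int[mu]_x `|h x - F x| <= e].
Proof. by move=> mh hC e0; have [F []] := continuous_dense2 mu mu mh hC e0; exists F. Qed.

Lemma probability_eq (mu mu' : probability B R) :
  (forall F : X -> R, continuous F -> \int[mu]_x F x = \int[mu']_x F x) ->
  forall A, measurable A -> mu A = mu' A.
Proof.
move=> H A mA; rewrite -!bint_indic//; congr EFin; apply/eqP; rewrite -subr_eq0 -normr_le0.
have b1 := @bmf_indic _ _ R A mA.
apply/ler_addgt0Pr => e e0; rewrite add0r; have e2 : 0 < e / 2 by rewrite divr_gt0.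
have h1 (x : B) : `|\1_A x : R| <= 1.
  by rewrite indicE; case: (_ \in _); rewrite ?normr1 ?normr0 ?ler01.
have [F [cF FC H1 H2]] := continuous_dense2 mu mu' (h := \1_A) b1.1 h1 e2.
have bF : bounded_measurable (F : B -> R) by split; [exact: measurable_continuous|exists 1].
have := le_trans (bint_norm mu (bmfB b1 bF)) H1; have := le_trans (bint_norm mu' (bmfB b1 bF)) H2.
rewrite !bintB// (H F cF) !ler_norml => /andP[? ?] /andP[? ?]; apply/andP; split; lra.
Qed.

End Uniqueness.

(** * Orbits of almost periodic points *)

Section RationallyAlmostPeriodic.
Context {R : realType} (L : (nat -> R) -> R).

(** Besicovitch rational almost periodicity with respect to an invariant mean. *)
Definition mean_rap (a : nat -> R[i]) := forall e : R, 0 < e ->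
  exists (b : nat -> R[i]) (q : nat), [/\ (0 < q)%N, forall n, b (n + q)%N = b n,
    forall n, cnorm (b n) <= 1 & L (fun n => cnorm (a n - b n) ^+ 2) <= e].

End RationallyAlmostPeriodic.

Section OrbitSystem.
Context {R : realType}.
Local Notation X := (seqspace R).
Local Notation B := (borel_seqspace R).
Local Notation T := (@seqshift R).
Variables (mu : probability B R) (x : X) (L : (nat -> R) -> R).
Hypothesis HL : invariant_mean L.
Hypothesis mu_mean : forall F : X -> R, continuous F -> \int[mu]_y F y = L (fun n => F (iter n T x)).

Lemma measurable_shift : measurable_fun (setT : set B) (T : B -> B).
Proof.
apply: measurable_into_borel => b i q.
have := @measurable_part R b (i + 1) measurableT _ (measurable_itv `]-oo, (ratr q : R)[).
rewrite setTI; congr measurable; apply/seteqP; split=> y /=; rewrite in_itv/=;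
  by rewrite /part /coordRe /coordIm /seqshift.
Qed.

Lemma measurable_iter_shift n : measurable_fun (setT : set B) (iter n T : B -> B).
Proof.
elim: n => [|n IH]; first exact: measurable_id.
by apply: (measurableT_comp measurable_shift IH).
Qed.

Lemma bounded_orbit (F : X -> R) : continuous F -> bdd (fun n => F (iter n T x)).
Proof. by move=> /continuous_bounded[C FC]; exists C. Qed.

Lemma bmf_continuous (F : X -> R) : continuous F -> bounded_measurable (F : B -> R).
Proof.
by move=> cF; split; [exact: measurable_continuous|have [C FC] := continuous_bounded cF; exists C].
Qed.

Lemma continuous_comp_shift n (F : X -> R) : continuous F -> continuous (fun y => F (iter n T y)).
Proof.
move=> cF y; apply: (@cvg_comp _ _ _ (iter n T) F _ (nbhs (iter n T y))); last exact: cF.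
exact: continuous_iter_shift.
Qed.

(** Both measures have the same integrals of continuous functions, by shift
    invariance of the mean, hence are equal. *)
Lemma integral_shift (h : X -> R) : bounded_measurable (h : B -> R) ->
  \int[mu]_y h (T y) = \int[mu]_y h y.
Proof.
move=> bh; have [mu' Hmu'] := image_probability mu measurable_shift.
have E : forall A, measurable A -> mu' A = mu A.
  apply: probability_eq => F cF; rewrite Hmu'; last exact: bmf_continuous.
  rewrite (mu_mean (@continuous_comp_shift 1%N F cF)) (mu_mean cF).
  rewrite -[RHS](meanS HL)//; exact: bounded_orbit.
by rewrite -Hmu'// /Rintegral; congr fine; apply: eq_measure_integral => A mA _; exact: E.
Qed.

Lemma integral_iter_shift n (h : X -> R) : bounded_measurable (h : B -> R) ->
  \int[mu]_y h (iter n T y) = \int[mu]_y h y.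
Proof.
move=> bh; elim: n => // n IH; rewrite -IH -[RHS]integral_shift.
  by apply: eq_Rintegral => y _; rewrite -iterSr.
by have [mh [C hC]] := bh; split; [exact: (measurableT_comp mh (measurable_iter_shift n))|exists C].
Qed.

Lemma shift_invariant (A : set B) : measurable A -> mu (T @^-1` A) = mu A.
Proof.
move=> mA; have bA := @bmf_indic _ _ R A mA.
have mTA : measurable ((T : B -> B) @^-1` A).
  by rewrite -[X in measurable X]setTI; exact: measurable_shift.
by rewrite -(bint_indic mu mA) -(bint_indic mu mTA) -(integral_shift bA).
Qed.

Hypothesis x_rap : mean_rap L (fun n => udisc_val (x n%:Z)).

(** If x is close in square mean to a periodic sequence b, then F(T^n x) is
    close in mean to F(T^n y), where y is the point with coordinates b. By
    uniform continuity the difference is at most e/2 unless one of the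
    coordinates within distance n0 of n is far from b; Chebyshev bounds the
    frequency of this, and K absorbs the constants. Shifting n by n0 + 1 keeps
    all the coordinates involved at positive indices, where x is known. *)
Lemma rap_continuous (F : X -> R) (e : R) : continuous F -> 0 < e ->
  exists (b : nat -> R) (q : nat), [/\ (0 < q)%N, forall n, b (n + q)%N = b n,
    bdd b & L (fun n => `|F (iter n T x) - b n|) <= e].
Proof.
move=> cF e0; have [C FC] := continuous_bounded cF.
have C0 : 0 <= C by apply: le_trans (FC point).
have e2 : 0 < e / 2 by rewrite divr_gt0.
have [n0 Hn0] := continuous_modulus cF e2.
pose J := n0.*2.+1; pose K : R := 2 * C * (n0.+1%:R ^+ 2 * J%:R) + 1.
have K0 : 0 < K by rewrite ltr_wpDl// !mulr_ge0// exprn_ge0.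
have [b [q [q0 bq b1 Hb]]] := x_rap (divr_gt0 e2 K0).
pose u n := projT1 (cid (udisc_exist (b1 n))).
have uE n : udisc_val (u n) = b n by rewrite /u; case: cid.
have bper n k : b (n + k * q)%N = b n.
  by elim: k => [|k IH]; rewrite ?mul0n ?addn0// mulSn addnA [(n + q)%N]addnC -addnA addnC bq.
have qz : q%:Z != 0 by rewrite eqz_nat -lt0n.
pose y : X := fun i => u `|(i %% q%:Z)%Z|%N.
have yper i : y (i + q%:Z) = y i by rewrite /y modzDr.
have ynat n : udisc_val (y n%:Z) = b n.
  by rewrite /y modz_nat absz_nat uE [n in RHS](divn_eq n q) addnC bper.
have yq : iter q T y = y by apply/funext => i; rewrite iter_shiftE yper.
exists (fun n => F (iter n T y)), q; split=> //.
- by move=> n; rewrite iterD yq.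
- by exists C.
pose s n := \sum_(j < J) cnorm (udisc_val (x (n + j)%N%:Z) - b (n + j)%N) ^+ 2.
have bd n : cnorm (udisc_val (x n%:Z) - b n) <= 2.
  by apply: le_trans (cnormD _ _) _; rewrite cnormN [2]mulr2n lerD// udisc_val_le1.
have bdd1 : bdd (fun n => cnorm (udisc_val (x n%:Z) - b n) ^+ 2).
  by exists (2 ^+ 2) => n; rewrite ger0_norm ?exprn_ge0 ?cnorm_ge0// lerXn2r ?nnegrE ?cnorm_ge0.
have bs : bdd s by apply: bdd_sum => j; have := bdd_comp (addn^~ j) bdd1.
have bdF : bdd (fun n => `|F (iter n T x) - F (iter n T y)|).
  by exists (2 * C) => n; rewrite normr_id (le_trans (ler_normB _ _))// mulrDl mul1r lerD.
rewrite -(mean_shift HL n0.+1 bdF).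
apply: (@le_trans _ _ (L (fun n => e / 2 + 2 * C * n0.+1%:R ^+ 2 * s n.+1))).
  apply: (mean_le HL); [exact: (bdd_comp (addn^~ n0.+1) bdF)|by apply: bddD; [exact: bdd_cst|apply: bddM; [exact: bdd_cst|exact: (bdd_comp succn bs)]]|].
  move=> n; set v := iter _ T x; set w := iter _ T y.
  have s0 : 0 <= s n.+1 by apply: sumr_ge0 => j _; rewrite exprn_ge0// cnorm_ge0.
  have [near|far] := pselect (forall i : int, (`|i| <= n0)%N ->
      cnorm (udisc_val (v i) - udisc_val (w i)) <= n0.+1%:R^-1).
    by apply: le_trans (Hn0 _ _ near) _; rewrite lerDl !mulr_ge0// exprn_ge0.
  have [i /not_implyP[iN /negP]] := (existsNP _).2 far.
  rewrite -ltNge => far_i.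
  apply: (@le_trans _ _ (2 * C)).
    by rewrite (le_trans (ler_normB _ _))// mulrDl mul1r lerD.
  rewrite -[leLHS]add0r lerD ?(ltW e2)// -mulrA ler_peMr ?mulr_ge0//.
  have jJ : (`|(n0%:Z + i)%R| < J)%N by rewrite /J; lia.
  have Hi : (n + n0.+1)%:Z + i = (n.+1 + `|(n0%:Z + i)%R|)%N%:Z by lia.
  have Hi' : i + (n + n0.+1)%:Z = (n.+1 + `|(n0%:Z + i)%R|)%N%:Z by lia.
  move: far_i; rewrite /v /w !iter_shiftE Hi' ynat => far_i.
  apply: (@le_trans _ _ (n0.+1%:R ^+ 2 * n0.+1%:R^-1 ^+ 2)).
    by rewrite -exprMn divff ?expr1n// pnatr_eq0.
  rewrite ler_wpM2l ?exprn_ge0// /s (bigD1 (Ordinal jJ))//=.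
  apply: ler_wpDr; first by apply: sumr_ge0 => j _; rewrite exprn_ge0// cnorm_ge0.
  by rewrite lerXn2r ?nnegrE ?cnorm_ge0 ?invr_ge0// ltW.
have bs1 : bdd (fun n => s n.+1) by exact: (bdd_comp succn bs).
rewrite (meanD HL) ?(mean_cst HL) ?(meanZ HL)//; [|exact: bdd_cst|by solve_bdd].
rewrite (meanS HL bs) (mean_sum HL); last by move=> j; have := bdd_comp (addn^~ j) bdd1.
rewrite [leRHS]splitr lerD2l.
apply: (@le_trans _ _ (2 * C * n0.+1%:R ^+ 2 * (J%:R * (e / 2 / K)))).
  rewrite ler_wpM2l ?mulr_ge0 ?exprn_ge0//.
  rewrite -[J in leRHS]card_ord mulr_natl -sumr_const; apply: ler_sum => j _.
  by rewrite (mean_shift HL j bdd1).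
have -> : 2 * C * n0.+1%:R ^+ 2 * (J%:R * (e / 2 / K)) = (K - 1) / K * (e / 2).
  have KE : 2 * C * (n0.+1%:R ^+ 2 * J%:R) = K - 1 by rewrite /K addrK.
  by rewrite -KE; ring.
by rewrite ler_piMl ?(ltW e2)// ler_pdivrMr// mul1r gerBl.
Qed.

End OrbitSystem.

(** * Ergodicity and approximation by functions invariant under a power of the shift *)

Section PeriodicSequences.

Lemma avg_ord_cst (R : realType) q (c : R) : (0 < q)%N -> q%:R^-1 * \sum_(h < q) c = c.
Proof.
by move=> q0; rewrite sumr_const card_ord -[c *+ q]mulr_natl mulrA mulVf ?mul1r// pnatr_eq0 -lt0n.
Qed.

Lemma periodic_mul (T : Type) (p : nat -> T) q k n : (forall n, p (n + q)%N = p n) ->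
  p (n + q * k)%N = p n.
Proof.
by move=> pq; elim: k => [|k IH]; rewrite ?muln0 ?addn0// mulnS [(q + _)%N]addnC addnA pq.
Qed.

Lemma periodic_mod (T : Type) (p : nat -> T) q n : (forall n, p (n + q)%N = p n) ->
  p (n %% q)%N = p n.
Proof. by move=> pq; rewrite [in RHS](divn_eq n q) addnC mulnC periodic_mul. Qed.

Lemma sum_periodic (V : zmodType) (p : nat -> V) q n : (forall n, p (n + q)%N = p n) ->
  \sum_(h < q) p (n + h)%N = \sum_(h < q) p h.
Proof.
move=> pq; elim: n => [//|n <-].
case: q pq => [|q] pq; first by rewrite !big_ord0.
rewrite big_ord_recr big_ord_recl /= addSnnS pq addn0 addrC; congr (_ + _).
by apply: eq_bigr => i _; rewrite /= /bump /= addSnnS.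
Qed.

Context {R : realType} (L : (nat -> R) -> R) (HL : invariant_mean L).

Lemma bdd_periodic (p : nat -> R) q : (0 < q)%N -> (forall n, p (n + q)%N = p n) -> bdd p.
Proof.
move=> q0 pq; exists (\sum_(h < q) `|p h|) => n.
rewrite -(periodic_mod n pq) (bigD1 (Ordinal (ltn_pmod n q0)))//= lerDl.
by apply: sumr_ge0.
Qed.

Lemma mean_periodic (p : nat -> R) q : (0 < q)%N -> (forall n, p (n + q)%N = p n) ->
  L p = q%:R^-1 * \sum_(h < q) p h.
Proof.
move=> q0 pq; have bp := bdd_periodic q0 pq.
have qn0 : q%:R != 0 :> R by rewrite pnatr_eq0 -lt0n.
apply: (mulfI qn0); rewrite mulrA divff// mul1r.
have -> : q%:R * L p = \sum_(h < q) L (fun n => p (n + h)%N).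
  under eq_bigr do rewrite (mean_shift HL _ bp).
  by rewrite sumr_const card_ord mulr_natl.
rewrite -(mean_sum HL); last by move=> h; have := bdd_comp (addn^~ h) bp.
rewrite -[RHS](mean_cst HL); congr (L _); apply/funext => n.
exact: sum_periodic.
Qed.

(** The conditional expectation of u with respect to the residue class modulo
    q. *)
Definition residue_mean q (u : nat -> R) n := q%:R * L (fun k => (k == n %[mod q])%:R * u k).

Lemma mean_triangle (u v w : nat -> R) : bdd u -> bdd v -> bdd w ->
  L (fun n => `|u n - w n|) <= L (fun n => `|u n - v n|) + L (fun n => `|v n - w n|).
Proof.
move=> bu bv bw; rewrite -(meanD HL); [|by solve_bdd..].
apply: (mean_le HL); [by solve_bdd..|move=> n].
by apply: le_trans (ler_normD _ _); rewrite addrA subrK.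
Qed.

Variable q : nat.
Hypothesis q0 : (0 < q)%N.

Lemma residue_mean_periodic u n : residue_mean q u (n + q)%N = residue_mean q u n.
Proof. by rewrite /residue_mean modnDr. Qed.

Let bdd_res n (u : nat -> R) : bdd u -> bdd (fun k => (k == n %[mod q])%:R * u k).
Proof.
move=> [C uC]; exists C => k; rewrite normrM; case: (_ == _); rewrite ?normr1 ?normr0 ?mul1r ?mul0r//.
exact: le_trans (uC 0%N).
Qed.

Lemma residue_meanB u v n : bdd u -> bdd v ->
  residue_mean q (fun k => u k - v k) n = residue_mean q u n - residue_mean q v n.
Proof.
move=> bu bv; rewrite /residue_mean -mulrBr -(meanB HL); [|exact: bdd_res..].
by congr (_ * L _); apply/funext => k; rewrite mulrBr.
Qed.

Lemma residue_mean_id p n : (forall n, p (n + q)%N = p n) -> residue_mean q p n = p n.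
Proof.
move=> pq; rewrite /residue_mean.
have -> : (fun k => (k == n %[mod q])%:R * p k) = (fun k => p n * (k == n %[mod q])%:R).
  apply/funext => k; rewrite mulrC; case: eqP => [E|]; last by rewrite !mulr0.
  by rewrite -(periodic_mod k pq) E periodic_mod.
rewrite (@mean_periodic _ q)//; last by move=> k; rewrite modnDr.
rewrite mulrA divff ?pnatr_eq0 -?lt0n// mul1r (bigD1 (Ordinal (ltn_pmod n q0)))//= modn_mod eqxx mulr1.
rewrite big1 ?addr0// => i /eqP Hi; case: eqP => E; rewrite ?mulr0//.
by case: Hi; apply: val_inj => /=; rewrite -E modn_small.
Qed.

Lemma residue_mean_le u : bdd u ->
  L (fun n => `|residue_mean q u n|) <= L (fun n => `|u n|).
Proof.
move=> bu; rewrite (@mean_periodic _ q)//; last by move=> n; rewrite residue_mean_periodic.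
rewrite mulr_sumr; apply: (@le_trans _ _ (\sum_(h < q) L (fun k => (k == h %[mod q])%:R * `|u k|))).
  apply: ler_sum => h _; rewrite /residue_mean normrM ger0_norm// mulrA mulVf ?pnatr_eq0 -?lt0n// mul1r.
  apply: le_trans (mean_norm HL (bdd_res h bu)) _; apply: (mean_le HL).
  - exact: bdd_norm (bdd_res h bu).
  - exact: bdd_res (bdd_norm bu).
  - by move=> k; rewrite normrM; case: (_ == _); rewrite ?normr1 ?normr0.
rewrite -(mean_sum HL); last by move=> h; apply: bdd_res; exact: bdd_norm.
rewrite le_eqVlt; apply/orP; left; apply/eqP; congr (L _); apply/funext => k.
rewrite -mulr_suml (bigD1 (Ordinal (ltn_pmod k q0)))//= modn_mod eqxx.
rewrite big1 ?addr0 ?mul1r// => i /eqP Hi; case: eqP => E//.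
by case: Hi; apply: val_inj => /=; rewrite E modn_small.
Qed.

Lemma residue_mean_lin (c : R) M (v : 'I_M -> nat -> R) n : (forall m, bdd (v m)) ->
  residue_mean q (fun k => c * \sum_m v m k) n = c * \sum_m residue_mean q (v m) n.
Proof.
move=> bv; rewrite /residue_mean.
have -> : (fun k => (k == n %[mod q])%:R * (c * \sum_m v m k)) =
    (fun k => c * \sum_m (k == n %[mod q])%:R * v m k).
  by apply/funext => k; rewrite mulrCA; congr (_ * _); rewrite mulr_sumr.
rewrite (meanZ HL); last by apply: bdd_sum => m; exact: bdd_res.
rewrite (mean_sum HL); last by move=> m; exact: bdd_res.
by rewrite mulrCA -mulr_sumr.
Qed.

Lemma residue_mean_shift j u n : bdd u ->
  residue_mean q (fun k => u (k + q * j)%N) n = residue_mean q u n.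
Proof.
move=> bu; rewrite /residue_mean -[in RHS](mean_shift HL (q * j) (bdd_res n bu)).
by congr (_ * L _); apply/funext => k; rewrite [in RHS](addnC k) (mulnC q j) modnMDl [in RHS](addnC _ k).
Qed.

End PeriodicSequences.

Section ErgodicTheory.
Context {R : realType}.
Local Notation X := (seqspace R).
Local Notation B := (borel_seqspace R).
Local Notation T := (@seqshift R).
Variables (mu : probability B R) (x : X) (L : (nat -> R) -> R).
Hypothesis HL : invariant_mean L.
Hypothesis mu_mean : forall F : X -> R, continuous F -> \int[mu]_y F y = L (fun n => F (iter n T x)).
Hypothesis x_rap : mean_rap L (fun n => udisc_val (x n%:Z)).

Lemma continuous_norm (F : X -> R) : continuous F -> continuous (fun y => `|F y|).
Proof. by move=> cF y; apply: (@cvg_norm _ _ _ _ (nbhs_seqspace_filter y)); exact: cF. Qed.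

Lemma continuous_scale (c : R) (F : X -> R) : continuous F -> continuous (fun y => c * F y).
Proof.
by move=> cF y; apply: (@cvgM _ _ _ (nbhs_seqspace_filter y)); [exact: continuous_cst|exact: cF].
Qed.

Lemma continuous_sub (F G : X -> R) : continuous F -> continuous G -> continuous (fun y => F y - G y).
Proof.
by move=> cF cG y; apply: (@cvgB _ _ _ _ (nbhs_seqspace_filter y)); [exact: cF|exact: cG].
Qed.

(** Approximate the indicator of an invariant set A by a continuous F, and F
    along the orbit by a sequence b of period q. Averaging over q consecutive
    shifts leaves the indicator unchanged and turns b into the constant be.
    The indicator is then within e of a constant in L1, and p |1 - be| + (1 -
    p) |be| >= p (1 - p). *)
Lemma orbit_ergodic : ergodic mu (T : B -> B).
Proof.
split; [exact: measurable_shift|exact: (shift_invariant HL mu_mean)|move=> A mA TA].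
have bA := @bmf_indic _ _ R A mA.
have iterA n y : \1_A (iter n T y) = \1_A y :> R.
  elim: n => // n <-; rewrite iterS !indicE; congr (nat_of_bool _)%:R.
  by rewrite -{2}TA; apply/idP/idP; rewrite !inE.
pose p := \int[mu]_y (\1_A y : R).
have pE : mu A = p%:E by rewrite -(@bint_indic _ _ R mu A mA).
have p0 : 0 <= p by apply: Rintegral_ge0 => y _; rewrite indicE ler0n.
have p1 : p <= 1.
  rewrite -[leRHS](bint_cst mu); apply: le_bint => //; exact: bmf_cst.
suff : p * (1 - p) <= 0.
  rewrite pE => H; have : p * (1 - p) == 0 by rewrite eq_le H mulr_ge0// subr_ge0.
  by rewrite mulf_eq0 subr_eq0 => /orP[]/eqP; [left; congr EFin|right; congr EFin].
apply/ler_addgt0Pr => e e0; rewrite add0r; have e2 : 0 < e / 2 by rewrite divr_gt0.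
have h1 (y : B) : `|\1_A y : R| <= 1.
  by rewrite indicE; case: (_ \in _); rewrite ?normr1 ?normr0 ?ler01.
have [F [cF FC HF]] := continuous_dense mu bA.1 h1 e2.
have [b [q [q0 bq bb Hb]]] := rap_continuous HL x_rap cF e2.
have bF := bmf_continuous cF.
pose G y := q%:R^-1 * \sum_(h < q) F (iter h T y).
pose be := q%:R^-1 * \sum_(h < q) b h.
have qn0 : q%:R != 0 :> R by rewrite pnatr_eq0 -lt0n.
have q00 : (0 : R) <= q%:R^-1 by rewrite invr_ge0.
have cG : continuous G.
  by apply: continuous_scale; apply: continuous_sum => h; exact: continuous_comp_shift.
have bG := bmf_continuous cG.
have cst (c : R) := avg_ord_cst c q0.
have HG : \int[mu]_y `|G y - be| <= e / 2.
  rewrite (@mu_mean (fun y => `|G y - be|)); last first.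
    by apply: continuous_norm; apply: continuous_sub => //; exact: continuous_cst.
  rewrite -(cst (e / 2)).
  have bdh (h : 'I_q) : bdd (fun n => `|F (iter (n + h) T x) - b (n + h)%N|).
    apply: bdd_norm; apply: bddD; first exact: (bdd_comp (addn^~ h) (bounded_orbit x cF)).
    apply: bddN; exact: (bdd_comp (addn^~ h) bb).
  have bds : bdd (fun n => \sum_(h < q) `|F (iter (n + h) T x) - b (n + h)%N|) by apply: bdd_sum.
  apply: (@le_trans _ _ (L (fun n => q%:R^-1 * \sum_(h < q) `|F (iter (n + h) T x) - b (n + h)%N|))).
    apply: (mean_le HL).
    - apply: bdd_norm; apply: bddD; [exact: bounded_orbit|exact: bdd_cst].
    - by apply: bddM; [exact: bdd_cst|].
    move=> n; rewrite /be -(sum_periodic n bq) -mulrBr -sumrB normrM ger0_norm// ler_wpM2l//.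
    apply: le_trans (ler_norm_sum _ _ _) _; apply: ler_sum => h _.
    by rewrite -iterD addnC.
  rewrite (meanZ HL)// ler_wpM2l// (mean_sum HL)//; apply: ler_sum => h _.
  have b0 : bdd (fun n => `|F (iter n T x) - b n|).
    apply: bdd_norm; apply: bddD; first exact: bounded_orbit.
    exact: bddN.
  by rewrite (mean_shift HL h b0).
have HAG : \int[mu]_y `|\1_A y - G y| <= e / 2.
  have bh h : bounded_measurable (fun y : B => `|\1_A (iter h T y) - F (iter h T y)|).
    by apply: (@bmf_comp _ _ _ (fun y : B => `|\1_A y - F y|)); [exact: measurable_iter_shift|apply: bmf_norm; exact: bmfB].
  rewrite -(cst (e / 2)).
  apply: (@le_trans _ _ (\int[mu]_y (q%:R^-1 * \sum_(h < q) `|\1_A (iter h T y) - F (iter h T y)|))).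
    apply: le_bint; [by apply: bmf_norm; exact: bmfB|by apply: bmfZ; apply: bmf_sum|].
    move=> y; rewrite -[\1_A y](cst) -mulrBr -sumrB normrM ger0_norm// ler_wpM2l//.
    apply: le_trans (ler_norm_sum _ _ _) _; apply: ler_sum => h _.
    by rewrite iterA.
  rewrite bintZ; last by apply: bmf_sum.
  rewrite ler_wpM2l// bint_sum//; apply: ler_sum => h _.
  rewrite (integral_iter_shift HL mu_mean h (h := fun y => `|\1_A y - F y|))//.
  by apply: bmf_norm; exact: bmfB.
have : \int[mu]_y `|\1_A y - be| <= e.
  by rewrite [e]splitr; apply: le_trans (lerD HAG HG); apply: bint_triangle => //; exact: bmf_cst.
apply: le_trans.
have -> : p * (1 - p) = \int[mu]_y (p * (1 - p)) by rewrite bint_cst.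
have -> : \int[mu]_y `|\1_A y - be| = \int[mu]_y (`|be| + (`|1 - be| - `|be|) * \1_A y).
  apply: eq_Rintegral => y _; rewrite indicE; case: (_ \in _).
    by rewrite mulr1 [RHS]addrC subrK.
  by rewrite sub0r normrN mulr0 addr0.
rewrite bint_cst bintD; [|exact: bmf_cst|exact: bmfZ].
rewrite bint_cst bintZ// -/p.
have : 1 <= `|be| + `|1 - be|.
  by rewrite -[leLHS]normr1 -{1}(subrK be 1) addrC; apply: le_trans (ler_normD _ _) _.
move: (normr_ge0 be) (normr_ge0 (1 - be)); set u := `|be|; set v := `|1 - be| => u0 v0 uv.
have q1 : 0 <= 1 - p by rewrite subr_ge0.
have := mulr_ge0 (mulr_ge0 p0 q1) (_ : 0 <= u + v - 1); rewrite subr_ge0 => /(_ uv).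
by have := mulr_ge0 u0 (sqr_ge0 (1 - p)); have := mulr_ge0 v0 (sqr_ge0 p); nra.
Qed.

(** A continuous function is, up to a small L1 error, invariant under a power
    of the shift: the upper limit of its averages along multiples of q. Here q
    is a period of a first approximation b_0 of F(T^n x). The j-th average
    runs over a multiple M j of a period of a better approximation b_j, so
    that along the orbit it is within d / 2^j of a q-periodic sequence; this
    sequence is close to the residue means of F(T^n x), which do not depend on
    j. Hence successive averages are summably close in L1. As M j tends to
    infinity, the limit is invariant under the q-th power of the shift. *)
Lemma invariant_approx (F : X -> R) (C e : R) : continuous F -> (forall y, `|F y| <= C) -> 0 < e ->
  exists (q : nat) (G : X -> R), [/\ (0 < q)%N, measurable_fun (setT : set B) G,
    forall y, `|G y| <= C, forall y, G (iter q T y) = G y & \int[mu]_y `|F y - G y| <= e].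
Proof.
move=> cF FC e0; have C0 : 0 <= C by apply: le_trans (FC point).
have bF := bmf_continuous cF.
(* the total error 2 d + 8 d equals e *)
pose d := e / 10; have d0 : 0 < d by rewrite divr_gt0.
have dj j : 0 < d / 2 ^+ j by rewrite divr_gt0// exprn_gt0.
pose a n := F (iter n T x); have ba : bdd a by exact: bounded_orbit.
pose P j (p : (nat -> R) * nat) := [/\ (0 < p.2)%N, forall n, p.1 (n + p.2)%N = p.1 n,
    bdd p.1 & L (fun n => `|a n - p.1 n|) <= d / 2 ^+ j].
have Hex j : exists p, P j p.
  by have [b [q Hb]] := rap_continuous HL x_rap cF (dj j); exists (b, q).
pose pr j := projT1 (cid (Hex j)); have prP j : P j (pr j) by exact: (projT2 (cid (Hex j))).
pose q := (pr 0%N).2; have q0 : (0 < q)%N by have [] := prP 0%N.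
pose M j := ((pr j).2 * j.+1)%N.
have M0 j : (0 < M j)%N by rewrite muln_gt0 andbT; have [] := prP j.
have Mn0 j : (M j)%:R != 0 :> R by rewrite pnatr_eq0 -lt0n.
have Mi0 j : (0 : R) <= (M j)%:R^-1 by rewrite invr_ge0.
have cst j (c : R) := avg_ord_cst c (M0 j).
pose A j y := (M j)%:R^-1 * \sum_(m < M j) F (iter (q * m) T y).
have cA j : continuous (A j).
  by apply: continuous_scale; apply: continuous_sum => m; exact: continuous_comp_shift.
have AC j y : `|A j y| <= C.
  rewrite /A normrM ger0_norm// -[C](cst j) ler_wpM2l//.
  by apply: le_trans (ler_norm_sum _ _ _) _; apply: ler_sum => m _.
have bA j := bmf_continuous (cA j).
pose al j n := A j (iter n T x); have bal j : bdd (al j) by exact: bounded_orbit.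
have alE j n : al j n = (M j)%:R^-1 * \sum_(m < M j) a (n + q * m)%N.
  by congr (_ * _); apply: eq_bigr => m _; rewrite /a -iterD addnC.
pose bb j n := (M j)%:R^-1 * \sum_(m < M j) (pr j).1 (n + q * m)%N.
have bbq j n : bb j (n + q)%N = bb j n.
  rewrite /bb; congr (_ * _).
  have := @sum_periodic _ (fun m => (pr j).1 (n + q * m)%N) (M j) 1; rewrite /= => <-.
    by apply: eq_bigr => m _; rewrite mulnDr muln1 addnA.
  move=> m; have [_ pq _ _] := prP j.
  by rewrite mulnDr addnA [(q * M j)%N]mulnC /M -!mulnA periodic_mul.
have bbb j : bdd (bb j) by exact: (bdd_periodic q0 (bbq j)).
have near j : L (fun n => `|al j n - bb j n|) <= d / 2 ^+ j.
  have [_ _ bp Hp] := prP j.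
  have b0 : bdd (fun n => `|a n - (pr j).1 n|) by apply: bdd_norm; apply: bddD => //; exact: bddN.
  have bm (m : 'I_(M j)) : bdd (fun n => `|a (n + q * m)%N - (pr j).1 (n + q * m)%N|).
    exact: (bdd_comp (fun n => (n + q * m)%N) b0).
  rewrite -(cst j (d / 2 ^+ j)).
  apply: (@le_trans _ _ (L (fun n => (M j)%:R^-1 * \sum_(m < M j) `|a (n + q * m)%N - (pr j).1 (n + q * m)%N|))).
    apply: (mean_le HL).
    - by apply: bdd_norm; apply: bddD => //; exact: bddN.
    - by apply: bddM; [exact: bdd_cst|exact: bdd_sum].
    move=> n; rewrite alE /bb -mulrBr -sumrB normrM ger0_norm// ler_wpM2l//.
    exact: ler_norm_sum.
  rewrite (meanZ HL); last by apply: bdd_sum.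
  rewrite ler_wpM2l// (mean_sum HL)//; apply: ler_sum => m _.
  by rewrite (mean_shift HL (q * m) b0).
pose be := residue_mean L q a.
have resA j n : residue_mean L q (al j) n = be n.
  have -> : al j = (fun k => (M j)%:R^-1 * \sum_(m < M j) a (k + q * m)%N).
    by apply/funext => k; exact: alE.
  rewrite (residue_mean_lin HL)//; last by move=> m; exact: (bdd_comp (fun k => (k + q * m)%N) ba).
  rewrite -[RHS](cst j); congr (_ * _); apply: eq_bigr => m _.
  exact: residue_mean_shift.
have bbe : bdd be by apply: (bdd_periodic q0) => n; rewrite /be residue_mean_periodic.
have nearb j : L (fun n => `|al j n - be n|) <= 2 * (d / 2 ^+ j).
  apply: le_trans (mean_triangle HL (bal j) (bbb j) bbe) _.
  rewrite mulrDl mul1r lerD//.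
  have E n : bb j n - be n = residue_mean L q (fun k => bb j k - al j k) n.
    by rewrite (residue_meanB HL)// (residue_mean_id HL q0)// resA.
  under eq_fun do rewrite E.
  apply: le_trans (residue_mean_le HL q0 _) _; first by apply: bddD => //; exact: bddN.
  by under eq_fun do rewrite distrC.
have H0 : \int[mu]_y `|F y - A 0%N y| <= 2 * d.
  rewrite (@mu_mean (fun y => `|F y - A 0%N y|)); last first.
    by apply: continuous_norm; exact: continuous_sub.
  have [_ b0q bb0 Hb0] := prP 0%N.
  apply: le_trans (mean_triangle HL ba bb0 (bal 0%N)) _.
  have d1 : d / 2 ^+ 0 = d by rewrite expr0 divr1.
  rewrite mulrDl mul1r lerD//; first by rewrite -d1.
  rewrite -d1; apply: le_trans (near 0%N).
  rewrite le_eqVlt; apply/orP; left; apply/eqP; congr (L _); apply/funext => n.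
  rewrite distrC; congr (`|_ - _|); rewrite /bb -[LHS](cst 0%N); congr (_ * _).
  by apply: eq_bigr => m _; rewrite periodic_mul.
have HA j : \int[mu]_y `|A j.+1 y - A j y| <= 4 * d / 2 ^+ j.
  rewrite (@mu_mean (fun y => `|A j.+1 y - A j y|)); last first.
    by apply: continuous_norm; exact: continuous_sub.
  apply: le_trans (mean_triangle HL (bal j.+1) bbe (bal j)) _.
  have := nearb j.+1; have := nearb j; under [X in _ -> _ -> _ + L X <= _]eq_fun do rewrite distrC.
  have -> : d / 2 ^+ j.+1 = d / 2 ^+ j / 2 by rewrite exprS invfM mulrA mulrAC.
  by have := dj j; rewrite -[4 * d / _]mulrA; lra.
have mA j := (bA j).1; have bG := bmf_limsup mA AC.
exists q, (fun y => limsup (A ^~ y)); split=> //; [by case: bG|by move=> y; exact: limsup_bound|..].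
- move=> y; apply: (@eq_limsup _ _ _ C) => // e' e'0.
  exists (Num.truncn (2 * C / e')) => // j /= Hj.
  have -> : A j (iter q T y) - A j y = (M j)%:R^-1 * (F (iter (q * M j) T y) - F y).
    rewrite /A -mulrBr -sumrB; congr (_ * _).
    under eq_bigr do rewrite -iterD -[X in (_ + X)%N]muln1 -mulnDr addn1.
    have := @telescope_sumr _ 0 (M j) (fun m => F (iter (q * m) T y)) (leq0n _).
    by rewrite big_mkord muln0 => ->.
  rewrite normrM ger0_norm//.
  apply: (@le_trans _ _ ((M j)%:R^-1 * (2 * C))).
    by rewrite ler_wpM2l// (le_trans (ler_normB _ _))// mulrDl mul1r lerD.
  rewrite [leLHS]mulrC ler_pdivrMr ?ltr0n// [leRHS]mulrC -ler_pdivrMr//.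
  have H : 2 * C / e' < (Num.truncn (2 * C / e')).+1%:R by exact: truncnS_gt.
  apply: ltW; apply: lt_le_trans H _; rewrite ler_nat.
  by apply: leq_trans (_ : (j.+1 <= _)%N); rewrite ?ltnS// /M leq_pmull//; have [] := prP j.
- have := @limsup_L1 _ _ _ mu A C (4 * d) mA AC HA 0%N; rewrite expr0 divr1 => H1.
  have -> : e = 2 * d + 2 * (4 * d) by rewrite /d; field.
  by apply: le_trans (lerD H0 H1); apply: bint_triangle.
Qed.

End ErgodicTheory.

(** * Rational discrete spectrum *)

Section RootsOfUnity.
Context {R : realType}.

Lemma ecircD (s t : R) : ecirc (s + t) = ecirc s * ecirc t.
Proof. by rewrite /ecirc mulrDr cisD. Qed.

Lemma ecirc0 : ecirc 0 = 1 :> R[i].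
Proof. by rewrite /ecirc mulr0 cis0. Qed.

Lemma ecirc1 : ecirc 1 = 1 :> R[i].
Proof.
by rewrite /ecirc mulr1 /cis mulr_natl cos2pi sin2pi.
Qed.

Lemma ecircMn (t : R) n : ecirc (t * n%:R) = ecirc t ^+ n.
Proof. by rewrite /ecirc mulrA cisMn. Qed.

Lemma ecirc_nat n : ecirc (n%:R) = 1 :> R[i].
Proof. by rewrite -[n%:R]mul1r ecircMn ecirc1 expr1n. Qed.

Lemma ecircNn n : ecirc (- n%:R) = 1 :> R[i].
Proof. by rewrite -[LHS]mulr1 -[X in _ * X](ecirc_nat n) -ecircD addNr ecirc0. Qed.

Lemma cnorm_ecirc (t : R) : cnorm (ecirc t) = 1.
Proof. exact: cnorm_cis. Qed.

Lemma ecirc_neq1 (t : R) : 0 < t < 1 -> ecirc (- t) != 1.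
Proof.
move=> /andP[t0 t1]; apply/eqP => /(congr1 (@complex.Re R)) /=.
rewrite mulrN cosN (_ : 2 * pi * t = (pi * t) *+ 2); last by rewrite -mulr_natl; ring.
rewrite cos_mulr2n => H.
have : 0 < sin (pi * t).
  by apply: sin_gt0_pi; rewrite mulr_gt0 ?pi_gt0//= gtr_pMr ?pi_gt0.
have := sin2cos2 (pi * t); set s := sin _; set c := cos _ in H *.
by move=> E s0; have := exprn_gt0 2 s0; rewrite E; move: H; lra.
Qed.

Lemma sum_ecirc q h : (0 < h < q)%N ->
  \sum_(j < q) ecirc (- (j%:R * h%:R / q%:R)) = 0 :> R[i].
Proof.
move=> /andP[h0 hq]; have q0 : (0 : R) < q%:R by rewrite ltr0n (leq_trans _ hq).
set z := ecirc (- (h%:R / q%:R)) : R[i].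
have z1 : z - 1 != 0.
  by rewrite subr_eq0; apply: ecirc_neq1; apply/andP; split;
    [apply: divr_gt0 => //; rewrite ltr0n|rewrite ltr_pdivrMr// mul1r ltr_nat].
have E j : ecirc (- (j%:R * h%:R / q%:R)) = z ^+ j.
  by rewrite -ecircMn; congr ecirc; rewrite mulNr; congr (- _); ring.
under eq_bigr do rewrite E.
apply: (mulfI z1); rewrite mulr0 -subrX1 -ecircMn mulNr divfK ?gt_eqF//.
by rewrite ecircNn subrr.
Qed.

(** Discrete Fourier transform modulo q, normalized so that the coefficients of
    z sum to z 0. *)
Definition dft q (z : nat -> R[i]) (j : nat) : R[i] :=
  \sum_(h < q) (q%:R^-1)%:C%C * z h * ecirc (- (j%:R * h%:R / q%:R)).

Lemma dft_shift q z j : (0 < q)%N -> (forall h, z (h + q)%N = z h) ->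
  dft q (fun h => z h.+1) j = ecirc (j%:R / q%:R) * dft q z j.
Proof.
move=> q0 zq; have qn0 : q%:R != 0 :> R by rewrite pnatr_eq0 -lt0n.
pose p h := (q%:R^-1)%:C%C * z h * ecirc (- (j%:R * h%:R / q%:R)) : R[i].
have pq h : p (h + q)%N = p h.
  rewrite /p zq; congr (_ * _).
  have -> : - (j%:R * (h + q)%:R / q%:R) = - (j%:R * h%:R / q%:R) + - j%:R :> R.
    by rewrite natrD; field.
  by rewrite ecircD ecircNn mulr1.
rewrite /dft -(@sum_periodic _ p q 1 pq) mulr_sumr; apply: eq_bigr => h _.
rewrite /p add1n [RHS]mulrCA; congr (_ * _).
rewrite -ecircD; congr ecirc.
by rewrite -[h.+1%:R]natr1; field.
Qed.

Lemma sum_dft q z : (0 < q)%N -> \sum_(j < q) dft q z j = z 0%N.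
Proof.
move=> q0; have qn0 : q%:R != 0 :> R by rewrite pnatr_eq0 -lt0n.
rewrite /dft exchange_big/= (bigD1 (Ordinal q0))//= [X in _ + X]big1 ?addr0.
  rewrite -mulr_sumr.
  under eq_bigr do rewrite mulr0 mul0r oppr0 ecirc0.
  rewrite sumr_const card_ord -[1 *+ q]/(q%:R) -(rmorph_nat (real_complex R)) mulrAC -rmorphM/=.
  by rewrite mulVf// mul1r.
move=> h /eqP hn0; rewrite -mulr_sumr sum_ecirc ?mulr0//.
by rewrite ltn_ord andbT lt0n; apply/eqP => E; apply: hn0; exact: val_inj.
Qed.

End RootsOfUnity.

Section Spectrum.
Context {R : realType}.
Local Notation X := (seqspace R).
Local Notation B := (borel_seqspace R).
Local Notation T := (@seqshift R).
Variable mu : probability B R.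

Lemma L2_bounded (g : X -> R[i]) : bounded_measurable (fun y : B => complex.Re (g y)) ->
  bounded_measurable (fun y : B => complex.Im (g y)) -> L2 mu (g : B -> R[i]).
Proof.
move=> bR bI; split; [exact: bR.1|exact: bI.1|].
have b2 : bounded_measurable (fun y : B => cnorm (g y) ^+ 2).
  rewrite (_ : (fun y => _) = (fun y => complex.Re (g y) * complex.Re (g y) + complex.Im (g y) * complex.Im (g y))).
    by apply: bmfD; exact: bmfM.
  by apply/funext => y; rewrite cnorm_sqr -!expr2.
by rewrite -(EFin_bint mu b2) ltry.
Qed.

(** The component of G on which the shift acts by e(j/q), when G is invariant
    under the q-th power of the shift. *)
Definition eigencomponent q (G : X -> R) (j : nat) (y : X) : R[i] :=
  dft q (fun h => (G (iter h T y))%:C%C) j.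

Lemma eigencomponent_shift q G j y : (0 < q)%N -> (forall y, G (iter q T y) = G y) ->
  eigencomponent q G j (T y) = ecirc (ratr (j%:R / q%:R : rat)) * eigencomponent q G j y.
Proof.
move=> q0 Gq.
have -> : ratr (j%:R / q%:R : rat) = j%:R / q%:R :> R by rewrite fmorph_div /= !ratr_nat.
rewrite -dft_shift//; last by move=> h; rewrite addnC iterD Gq.
by congr dft; apply/funext => h; rewrite iterSr.
Qed.

Lemma eigencomponent_rational q (G : X -> R) (j : nat) (C : R) : (0 < q)%N ->
  measurable_fun (setT : set B) G -> (forall y, `|G y| <= C) ->
  (forall y, G (iter q T y) = G y) ->
  rational_eigenfunction mu (T : B -> B) (eigencomponent q G j).
Proof.
move=> q0 mG GC Gq.
have bG : bounded_measurable (G : B -> R) by split=> //; exists C.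
split; last first.
  exists (j%:R / q%:R); apply: aeW => y; exact: eigencomponent_shift.
apply: L2_bounded.
  under eq_fun do rewrite /eigencomponent /dft Re_sum.
  apply: bmf_sum => h; under eq_fun do rewrite -rmorphM Re_mulrc.
  apply: bmfM; last exact: bmf_cst.
  by apply: bmfZ; apply: (@bmf_comp _ _ _ (G : B -> R)) => //; exact: measurable_iter_shift.
under eq_fun do rewrite /eigencomponent /dft Im_sum.
apply: bmf_sum => h; under eq_fun do rewrite -rmorphM Im_mulrc.
apply: bmfM; last exact: bmf_cst.
by apply: bmfZ; apply: (@bmf_comp _ _ _ (G : B -> R)) => //; exact: measurable_iter_shift.
Qed.

Lemma measurable_sqr_cnorm (h : B -> R[i]) :
  measurable_fun setT (fun y => complex.Re (h y)) ->
  measurable_fun setT (fun y => complex.Im (h y)) ->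
  measurable_fun setT (fun y => cnorm (h y) ^+ 2).
Proof.
move=> mR mI.
rewrite (_ : (fun y => _) = fun y => complex.Re (h y) ^+ 2 + complex.Im (h y) ^+ 2).
  by apply: measurable_funD; exact: measurable_funX.
by apply/funext => y; rewrite cnorm_sqr.
Qed.

(** Dominated convergence, with the square of the modulus of h as the
    dominating function. *)
Lemma truncation (h : B -> R[i]) (e : R) : L2 mu h -> 0 < e ->
  exists K : R, [/\ 0 <= K, measurable [set y | cnorm (h y) ^+ 2 <= K] &
    (\int[mu]_y (cnorm (h y) ^+ 2 * (~~ (cnorm (h y) ^+ 2 <= K)%R)%:R)%:E <= e%:E)%E].
Proof.
move=> [mR mI hfin] e0; pose n2 y := cnorm (h y) ^+ 2.
have m2 : measurable_fun setT n2 by exact: measurable_sqr_cnorm.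
have mS (K : R) : measurable [set y | n2 y <= K].
  have := m2 measurableT _ (measurable_itv `]-oo, K]).
  by rewrite setTI; congr measurable; apply/seteqP; split=> y /=; rewrite in_itv.
pose f (k : nat) y := (n2 y * (~~ (n2 y <= k%:R)%R)%:R)%:E : \bar R.
have n20 y : 0 <= n2 y by rewrite exprn_ge0// cnorm_ge0.
have mf k : measurable_fun setT (f k).
  apply/measurable_EFinP; apply: measurable_funM => //.
  rewrite (_ : (fun y => _) = \1_(~` [set y | n2 y <= k%:R])); first by apply: measurable_indic; exact: measurableC.
  apply/funext => y; rewrite indicE in_setC; congr (nat_of_bool (~~ _))%:R.
  by apply/idP/idP; rewrite inE.
have f0 k y : (0 <= f k y)%E by rewrite lee_fin mulr_ge0.
have i2 : mu.-integrable setT (EFin \o n2).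
  apply/integrableP; split; first exact/measurable_EFinP.
  rewrite (eq_integral (fun y => (cnorm (h y) ^+ 2)%:E))// => y _.
  by rewrite /= ger0_norm.
have [|||_ _ H] := @dominated_convergence _ _ _ mu setT measurableT f (cst 0%E) (EFin \o n2) mf _ _ i2.
- exact: measurable_cst.
- apply: aeW => y _; apply: cvg_near_cst.
  exists (Num.truncn (n2 y)).+1 => // k /= Hk; rewrite /f.
  have -> : (n2 y <= k%:R) by apply: ltW; apply: lt_le_trans (truncnS_gt _) _; rewrite ler_nat.
  by rewrite mulr0.
- apply: aeW => y k _; rewrite gee0_abs//= lee_fin.
  by case: (n2 y <= k%:R); rewrite /= ?mulr0 ?mulr1.
move: H; rewrite integral0 => /fine_cvgP[fin /cvgrPdist_le/(_ _ e0) H].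
have : \forall k \near \oo, (\int[mu]_x f k x)%E \is a fin_num /\
    `|0 - fine (\int[mu]_x f k x)| <= e by exact: filterI.
move=> /filter_ex[k [kfin]]; rewrite sub0r normrN => Hk.
exists k%:R; split=> //.
rewrite -[leLHS]fineK// lee_fin; exact: le_trans (ler_norm _) Hk.
Qed.

Variables (x : X) (L : (nat -> R) -> R).
Hypothesis HL : invariant_mean L.
Hypothesis mu_mean : forall F : X -> R, continuous F -> \int[mu]_y F y = L (fun n => F (iter n T x)).
Hypothesis x_rap : mean_rap L (fun n => udisc_val (x n%:Z)).

Lemma measurable_invariant_approx (u : B -> R) (C e : R) : measurable_fun setT u ->
  (forall y, `|u y| <= C) -> 0 < e ->
  exists (q : nat) (G : X -> R), [/\ (0 < q)%N, measurable_fun (setT : set B) G,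
    forall y, `|G y| <= C, forall y, G (iter q T y) = G y & \int[mu]_y `|u y - G y| <= e].
Proof.
move=> m_u uC e0; have e2 : 0 < e / 2 by rewrite divr_gt0.
have [F [cF FC HF]] := continuous_dense mu m_u uC e2.
have [q [G [q0 mG GC Gq HG]]] := invariant_approx HL mu_mean x_rap cF FC e2.
exists q, G; split=> //; rewrite [e]splitr; apply: le_trans (lerD HF HG).
by apply: bint_triangle; [split=> //; exists C|exact: bmf_continuous|split=> //; exists C].
Qed.

(** Truncate h, approximate the bounded real and imaginary parts by functions
    invariant under powers of the shift, and split each of these into its
    eigencomponents. For functions bounded by C, an L1 bound gives an L2 bound
    at the price of a factor proportional to C. *)
Lemma orbit_rational_discrete_spectrum : rational_discrete_spectrum mu (T : B -> B).
Proof.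
move=> h L2h eps eps0; pose e := eps ^+ 2 / 8.
have e0 : 0 < e by rewrite divr_gt0// exprn_gt0.
have [K [K0 mS HK]] := truncation L2h e0; have [mR mI _] := L2h.
pose S := [set y : B | cnorm (h y) ^+ 2 <= K]; pose C := K + 1.
have C0 : 0 < C by rewrite ltr_wpDl.
have sqC (r s : R) y : r ^+ 2 + s ^+ 2 = cnorm (h y) ^+ 2 -> `|r * \1_S y| <= C.
  rewrite indicE; have [|] := boolP (y \in S); rewrite ?mulr0 ?normr0 ?(ltW C0)// mulr1.
  rewrite inE /S /= => + E; rewrite -E => H; rewrite -[C](ger0_norm (ltW C0)) -ler_sqr ?nnegrE//.
  rewrite !real_normK ?num_real// /C; have := sqr_ge0 s; have := sqr_ge0 K; lra.
pose u1 y := complex.Re (h y) * \1_S y; pose u2 y := complex.Im (h y) * \1_S y.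
have m1 : measurable_fun setT u1 by apply: measurable_funM => //; exact: measurable_indic.
have m2 : measurable_fun setT u2 by apply: measurable_funM => //; exact: measurable_indic.
have uC1 y : `|u1 y| <= C by apply: (sqC _ (complex.Im (h y))); rewrite cnorm_sqr.
have uC2 y : `|u2 y| <= C by apply: (sqC _ (complex.Re (h y))); rewrite cnorm_sqr addrC.
pose d := e / (4 * C); have d0 : 0 < d by rewrite divr_gt0// mulr_gt0.
have [q1 [G1 [q10 mG1 GC1 Gq1 HG1]]] := measurable_invariant_approx m1 uC1 d0.
have [q2 [G2 [q20 mG2 GC2 Gq2 HG2]]] := measurable_invariant_approx m2 uC2 d0.
exists (q1 + q2)%N, (fun i : 'I_(q1 + q2) => if fintype.split i is inl _ then 1 else Complex 0 1),
  (fun i : 'I_(q1 + q2) => match fintype.split i with inl j => eigencomponent q1 G1 j | inr j => eigencomponent q2 G2 j end).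
split.
  by move=> i; case: (fintype.split i) => j; [exact: (eigencomponent_rational j q10 mG1 GC1 Gq1)|exact: (eigencomponent_rational j q20 mG2 GC2 Gq2)].
have sumE y : \sum_(i < q1 + q2) (if fintype.split i is inl _ then 1 else Complex 0 1) *
    (match fintype.split i with inl j => eigencomponent q1 G1 j | inr j => eigencomponent q2 G2 j end) y
    = Complex (G1 y) (G2 y).
  rewrite big_split_ord/=.
  under eq_bigr do rewrite (unsplitK (inl _)) mul1r.
  under [X in _ + X]eq_bigr do rewrite (unsplitK (inr _)).
  rewrite -mulr_sumr !sum_dft//; apply: complex_eq => /=; ring.
under eq_integral do rewrite sumE.
pose f y : R := cnorm (h y) ^+ 2 * (~~ (cnorm (h y) ^+ 2 <= K))%:R.
pose v y : R := 4 * C * (`|u1 y - G1 y| + `|u2 y - G2 y|).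
have b1 : bounded_measurable (fun y : B => `|u1 y - G1 y|).
  by apply: bmf_norm; apply: bmfB; split=> //; exists C.
have b2 : bounded_measurable (fun y : B => `|u2 y - G2 y|).
  by apply: bmf_norm; apply: bmfB; split=> //; exists C.
have bv : bounded_measurable v by apply: bmfZ; exact: bmfD.
have n2m := measurable_sqr_cnorm mR mI.
have mf : measurable_fun setT f.
  apply: measurable_funM => //.
  rewrite (_ : (fun y => _) = \1_(~` S)); first by apply: measurable_indic; exact: measurableC.
  apply/funext => y; rewrite indicE in_setC; congr (nat_of_bool (~~ _))%:R.
  by apply/idP/idP; rewrite inE.
have f0 y : 0 <= f y by rewrite /f mulr_ge0// exprn_ge0// cnorm_ge0.
have v0 y : 0 <= v y by rewrite /v !mulr_ge0 ?addr_ge0// ltW.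
have diff (r g u : R) y : u = r * \1_S y -> `|u| <= C -> `|g| <= C ->
    (r - g) ^+ 2 <= 2 * (r ^+ 2 * (~~ (cnorm (h y) ^+ 2 <= K))%:R) + 4 * C * `|u - g|.
  move=> uE uC gC.
  have E1 : (r - u) ^+ 2 = r ^+ 2 * (~~ (cnorm (h y) ^+ 2 <= K))%:R.
    rewrite uE indicE; have -> : (y \in S) = (cnorm (h y) ^+ 2 <= K) by apply/idP/idP; rewrite inE.
    by case: (_ <= K); rewrite /= ?mulr1 ?mulr0 ?subr0 ?subrr ?expr0n.
  have E2 : (u - g) ^+ 2 <= 2 * C * `|u - g|.
    rewrite -real_normK ?num_real// expr2 ler_wpM2r//.
    by apply: le_trans (ler_normB _ _) _; rewrite mulrDl mul1r lerD.
  rewrite -E1; have := sqr_ge0 ((r - u) - (u - g)); move: E2; nra.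
apply: (@le_lt_trans _ _ (\int[mu]_y (2 * f y + v y)%:E)%E).
  apply: ge0_le_integral => //.
  - by move=> y _; rewrite lee_fin exprn_ge0// cnorm_ge0.
  - apply/measurable_EFinP.
    rewrite (_ : (fun y => _) = fun y => (complex.Re (h y) - G1 y) ^+ 2 + (complex.Im (h y) - G2 y) ^+ 2).
      by apply: measurable_funD; apply: measurable_funX; exact: measurable_funB.
    by apply/funext => y; rewrite cnorm_sqr Re_addc Im_addc Re_oppc Im_oppc.
  - apply/measurable_EFinP; apply: measurable_funD; last exact: bv.1.
    by apply: measurable_funM => //; exact: measurable_cst.
  - move=> y _; rewrite lee_fin cnorm_sqr Re_addc Im_addc Re_oppc Im_oppc /=.
    have := diff _ (G1 y) (u1 y) y erefl (uC1 y) (GC1 y).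
    have := diff _ (G2 y) (u2 y) y erefl (uC2 y) (GC2 y).
    rewrite /f /v {3}cnorm_sqr; set bo : R := (~~ _)%:R; lra.
under eq_integral do rewrite EFinD EFinM.
have fE0 y : setT y -> (0 <= (f y)%:E)%E by move=> _; rewrite lee_fin.
have vE0 y : setT y -> (0 <= (v y)%:E)%E by move=> _; rewrite lee_fin.
have f2E0 y : setT y -> (0 <= 2%:E * (f y)%:E)%E by move=> yT; rewrite mule_ge0 ?lee_fin.
have mfE : measurable_fun setT (EFin \o f) by exact/measurable_EFinP.
have mvE : measurable_fun setT (EFin \o v) by apply/measurable_EFinP; exact: bv.1.
have mf2E : measurable_fun setT (fun y => 2%:E * (f y)%:E)%E by apply: emeasurable_funM.
rewrite (ge0_integralD mu measurableT f2E0 mf2E vE0 mvE).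
rewrite (ge0_integralZl mu measurableT mfE fE0)//.
have Hv : \int[mu]_y v y <= 2 * e.
  rewrite bintZ ?bintD//; last exact: bmfD.
  have Cd : 4 * C * d = e by rewrite /d mulrC divfK// gt_eqF// mulr_gt0.
  have C4 : 0 <= 4 * C by rewrite mulr_ge0 // ltW.
  have := ler_wpM2l C4 (lerD HG1 HG2); rewrite [4 * C * (d + d)]mulrDr Cd; lra.
rewrite -(EFin_bint mu bv).
apply: (@le_lt_trans _ _ (2%:E * e%:E + (2 * e)%:E)%E).
  by apply: leeD; [rewrite lee_pmul2l|rewrite lee_fin].
rewrite -EFinM -EFinD lte_fin /e; have := exprn_gt0 2 eps0; lra.
Qed.

Lemma orbit_procyclic : procyclic mu (T : B -> B).
Proof. by split; [exact: (orbit_ergodic HL mu_mean x_rap)|exact: orbit_rational_discrete_spectrum]. Qed.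

End Spectrum.

(** * Twisting by n^{it} *)

Section ComplexMeans.
Context {R : realType} (L : (nat -> R) -> R) (HL : invariant_mean L).
Implicit Types (z w : nat -> R[i]).

Definition cmean z : R[i] :=
  Complex (L (fun n => complex.Re (z n))) (L (fun n => complex.Im (z n))).

Lemma Re_cmeanM (c : R[i]) z : cbdd z -> complex.Re (c * cmean z) = L (fun n => complex.Re (c * z n)).
Proof.
move=> bz; have -> : (fun n => complex.Re (c * z n)) =
    (fun n => complex.Re c * complex.Re (z n) - complex.Im c * complex.Im (z n)).
  by apply/funext => n; rewrite Re_mulc.
by rewrite (meanB HL) ?(meanZ HL) ?Re_mulc//; solve_bdd.
Qed.

(** Rotate so that the mean is a nonnegative real number; then only real parts
    matter. *)
Lemma cnorm_cmean_le z : cbdd z -> cnorm (cmean z) <= L (fun n => cnorm (z n)).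
Proof.
move=> bz; have Lz0 : 0 <= L (fun n => cnorm (z n)).
  by apply: (mean_ge0 HL) => [|n]; [exact: bdd_cnorm|exact: cnorm_ge0].
have [->|u0] := eqVneq (cnorm (cmean z)) 0; first by [].
have up : 0 < cnorm (cmean z) by rewrite lt_def u0 cnorm_ge0.
rewrite -(ler_pM2l up) -expr2.
have -> : cnorm (cmean z) ^+ 2 = complex.Re (conjc (cmean z) * cmean z).
  by rewrite mulrC mulc_conj.
rewrite Re_cmeanM// -(meanZ HL); last exact: bdd_cnorm.
apply: (mean_le HL).
- by solve_bdd.
- by apply: bddM; [exact: bdd_cst|exact: bdd_cnorm].
- by move=> n; apply: le_trans (Re_le_cnorm _) _; rewrite cnormM cnorm_conj.
Qed.

Lemma cmeanB z w : cbdd z -> cbdd w -> cmean (fun n => z n - w n) = cmean z - cmean w.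
Proof.
move=> bz bw; apply: complex_eq; rewrite /= ?Re_addc ?Re_oppc ?Im_addc ?Im_oppc /=;
  rewrite -(meanB HL); try by solve_bdd.
  by congr (L _); apply/funext => n; rewrite Re_addc Re_oppc.
by congr (L _); apply/funext => n; rewrite Im_addc Im_oppc.
Qed.

Lemma cmean_periodic z q : (0 < q)%N -> (forall n, z (n + q)%N = z n) ->
  cmean z = (q%:R^-1)%:C%C * \sum_(h < q) z h.
Proof.
move=> q0 zq; apply: complex_eq.
  by rewrite Re_mulrc Re_sum /= (mean_periodic HL q0)// => n; rewrite zq.
by rewrite Im_mulrc Im_sum /= (mean_periodic HL q0)// => n; rewrite zq.
Qed.

Lemma cnorm_avg_le q (z : 'I_q -> R[i]) :
  cnorm ((q%:R^-1)%:C%C * \sum_(h < q) z h) <= q%:R^-1 * \sum_(h < q) cnorm (z h).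
Proof.
by rewrite cnormM cnorm_real ger0_norm ?invr_ge0// ler_wpM2l ?invr_ge0// cnorm_sum.
Qed.

Lemma cbdd_periodic z q : (0 < q)%N -> (forall n, z (n + q)%N = z n) -> cbdd z.
Proof.
move=> q0 zq; have [C HC] := @bdd_periodic R (fun n => cnorm (z n)) q q0 (fun n => congr1 _ (zq n)).
by exists C => n; apply: le_trans (ler_norm _) (HC n).
Qed.

Lemma cmean_triangle (u v w : nat -> R[i]) : cbdd u -> cbdd v -> cbdd w ->
  L (fun n => cnorm (u n - w n)) <= L (fun n => cnorm (u n - v n)) + L (fun n => cnorm (v n - w n)).
Proof.
move=> bu bv bw; rewrite -(meanD HL); [|by solve_bdd..].
apply: (mean_le HL); [by solve_bdd..|move=> n].
by apply: le_trans (cnorm_triangle (v n) _ _) _.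
Qed.

Lemma nit_slow t h n : (0 < n)%N -> cnorm (nit t (n + h) - nit t n : R[i]) <= `|t| * h%:R / n%:R.
Proof.
move=> n0; have n0R : (0 : R) < n%:R by rewrite ltr0n.
apply: le_trans (cnorm_cisB_le _ _) _; rewrite -mulrBr normrM -mulrA ler_wpM2l//.
rewrite -ln_div ?posrE ?ltr0n ?addn_gt0 ?n0//.
have -> : (n + h)%:R / n%:R = 1 + h%:R / n%:R :> R by rewrite natrD mulrDl divff// gt_eqF.
have hn : 0 <= h%:R / n%:R :> R by rewrite divr_ge0.
rewrite ger0_norm ?ln_ge0 ?lerDl//; apply: le_ln1Dx.
by apply: lt_le_trans hn; rewrite ltrN10.
Qed.

(** As the increments are O(1/n), n^{it} is almost constant on windows of
    bounded length. *)
Lemma mean_nit_slow t h : L (fun n => cnorm (nit t (n + h) - nit t n)) = 0.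
Proof.
have bn := @cbdd_nit R t; have bnh : cbdd (fun n => nit t (n + h)) := cbdd_comp (addn^~ h) bn.
have := @mean_null R L HL (fun n => cnorm (nit t (n + h) - nit t n)).
rewrite (_ : (fun n => `|_|) = (fun n => cnorm (nit t (n + h) - nit t n))); last first.
  by apply/funext => n; rewrite ger0_norm ?cnorm_ge0.
apply; first by solve_bdd.
move=> e e0; exists (Num.truncn (`|t| * h%:R / e)).+1 => n Hn.
rewrite ger0_norm ?cnorm_ge0//; have n0 : (0 < n)%N by apply: leq_trans Hn.
apply: le_trans (nit_slow _ _ n0) _; rewrite ler_pdivrMr ?ltr0n//.
have : `|t| * h%:R / e < (Num.truncn (`|t| * h%:R / e)).+1%:R by exact: truncnS_gt.
rewrite ltr_pdivrMr// => /ltW/le_trans; apply.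
by rewrite [leLHS]mulrC ler_wpM2l ?(ltW e0)// ler_nat.
Qed.

Hypothesis osc : oscillating L.

(** As n^{it} is almost constant on a period, c may be replaced by its average
    over a period; what remains is the mean of n^{it} itself. *)
Lemma mean_twist_periodic t rho (c : nat -> R[i]) q : (0 < q)%N ->
  (forall n, c (n + q)%N = c n) -> 0 <= rho ->
  (forall a, L (fun n => complex.Re (a * nit t n)) <= rho * cnorm a) ->
  L (fun n => complex.Re (nit t n * c n)) <= rho * L (fun n => cnorm (c n)).
Proof.
move=> q0 cq rho0 Hrho; have bc := cbdd_periodic q0 cq; have bn := @cbdd_nit R t.
have qn0 : q%:R != 0 :> R by rewrite pnatr_eq0 -lt0n.
have bch h : cbdd (fun n => c (n + h)%N) := cbdd_comp (addn^~ h) bc.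
have bnh h : cbdd (fun n => nit t (n + h)%N) := cbdd_comp (addn^~ h) bn.
have Hh h : L (fun n => complex.Re (nit t n * c n)) <= L (fun n => complex.Re (nit t n * c (n + h)%N)).
  have bu : bdd (fun n => complex.Re (nit t n * c n)) by solve_bdd.
  rewrite -(mean_shift HL h bu); have [C HC] := bc.
  have bd : bdd (fun n => cnorm (nit t (n + h) - nit t n)) by apply: bdd_cnorm; solve_bdd.
  rewrite -[leRHS]addr0 -(mulr0 C) -(mean_nit_slow t h) -(meanZ HL)// -(meanD HL); last first.
  - by apply: bddM; [exact: bdd_cst|].
  - by solve_bdd.
  apply: (mean_le HL); [by apply: bdd_Re; solve_bdd|by apply: bddD; [solve_bdd|apply: bddM; [exact: bdd_cst|]]|].
  move=> n; have -> : nit t (n + h) * c (n + h)%N = nit t n * c (n + h)%N + (nit t (n + h) - nit t n) * c (n + h)%N by ring.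
  rewrite Re_addc lerD2l; apply: le_trans (Re_le_cnorm _) _; rewrite cnormM mulrC.
  by rewrite ler_wpM2r ?cnorm_ge0.
pose cb := (q%:R^-1)%:C%C * \sum_(h < q) c h : R[i].
apply: (@le_trans _ _ (L (fun n => complex.Re (cb * nit t n)))).
  have -> : L (fun n => complex.Re (nit t n * c n)) = q%:R^-1 * \sum_(h < q) L (fun n => complex.Re (nit t n * c n)).
    by rewrite avg_ord_cst.
  have -> : (fun n => complex.Re (cb * nit t n)) = (fun n => q%:R^-1 * \sum_(h < q) complex.Re (nit t n * c (n + h)%N)).
    apply/funext => n; rewrite /cb -(sum_periodic n cq) -mulrA Re_mulrc mulr_suml Re_sum.
    by congr (_ * _); apply: eq_bigr => h _; rewrite mulrC.
  rewrite (meanZ HL) ?(mean_sum HL).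
  - by rewrite ler_wpM2l ?invr_ge0//; apply: ler_sum => h _.
  - by move=> h; solve_bdd.
  - by apply: bdd_sum => h; solve_bdd.
apply: le_trans (Hrho cb) _; rewrite ler_wpM2l// (mean_periodic HL q0) => [|n]; last by rewrite cq.
exact: cnorm_avg_le.
Qed.

(** A rationally almost periodic sequence stays so after a twist by n^{it}
    only if it is negligible: if b' and b approximate g and n^{it} g, then
    n^{it} b' is close to b in square mean. But the correlation of n^{it} with
    b' conj(b) is at most rho times the mean of |b' b|, so that b' itself must
    be small. *)
Lemma twist_rap_null t (g : nat -> R[i]) : t != 0 -> cbdd g -> mean_rap L g ->
  mean_rap L (fun n => nit t n * g n) -> L (fun n => cnorm (g n) ^+ 2) <= 0.
Proof.
move=> t0 bg g_rap ng_rap; have [rho /andP[rho0 rho1] Hrho] := osc t0.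
have bn := @cbdd_nit R t.
pose r := 1 - rho; have r0 : 0 < r by rewrite subr_gt0.
apply/ler_addgt0Pr => e' e'0; rewrite add0r.
pose e := e' / (2 + 8 / r); have K0 : 0 < 2 + 8 / r by rewrite addr_gt0// divr_gt0.
have e0 : 0 < e by rewrite divr_gt0.
have [b' [q' [q'0 b'q b'1 Hb']]] := g_rap e e0.
have [b [q [q0 bq b1 Hb]]] := ng_rap e e0.
have bb : cbdd b by exists 1. have bb' : cbdd b' by exists 1.
pose Q := (q * q')%N; have Q0 : (0 < Q)%N by rewrite muln_gt0 q0 q'0.
have bQ n : b (n + Q)%N = b n by rewrite periodic_mul.
have b'Q n : b' (n + Q)%N = b' n by rewrite /Q mulnC periodic_mul.
have sq0 (z : R[i]) : 0 <= cnorm z ^+ 2 by rewrite exprn_ge0// cnorm_ge0.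
have par (z w : R[i]) : cnorm (z + w) ^+ 2 <= 2 * cnorm z ^+ 2 + 2 * cnorm w ^+ 2.
  have := cnormD z w; have := cnorm_ge0 (z + w); have := cnorm_ge0 z; have := cnorm_ge0 w.
  by have := sqr_ge0 (cnorm z - cnorm w); nra.
have up : L (fun n => cnorm (nit t n * b' n - b n) ^+ 2) <= 4 * e.
  apply: (@le_trans _ _ (L (fun n => 2 * cnorm (g n - b' n) ^+ 2 + 2 * cnorm (nit t n * g n - b n) ^+ 2))).
    apply: (mean_le HL); [by apply: bddX; apply: bdd_cnorm; solve_bdd|by solve_bdd|move=> n].
    have -> : nit t n * b' n - b n = - (nit t n * (g n - b' n)) + (nit t n * g n - b n) by ring.
    by apply: le_trans (par _ _) _; rewrite cnormN cnormM cnorm_cis mul1r.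
  by rewrite (meanD HL) ?(meanZ HL); [lra|by solve_bdd..].
have low : r * L (fun n => cnorm (b' n) ^+ 2) <= L (fun n => cnorm (nit t n * b' n - b n) ^+ 2).
  have -> : (fun n => cnorm (nit t n * b' n - b n) ^+ 2) = (fun n => cnorm (b' n) ^+ 2 + cnorm (b n) ^+ 2
      - 2 * complex.Re (nit t n * (b' n * conjc (b n)))).
    apply/funext => n; rewrite cnormB_sqr cnormM cnorm_cis mul1r mulrA.
    by ring.
  have cb : cbdd (fun n => nit t n * (b' n * conjc (b n))) by solve_bdd.
  rewrite (meanB HL) ?(meanD HL) ?(meanZ HL); [|by solve_bdd..].
  have := @mean_twist_periodic t rho (fun n => b' n * conjc (b n)) Q Q0 _ rho0 Hrho.
  have {}H n : b' (n + Q)%N * conjc (b (n + Q)%N) = b' n * conjc (b n) by rewrite bQ b'Q.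
  move=> /(_ H) {}H.
  have H2 : 2 * L (fun n => cnorm (b' n * conjc (b n))) <= L (fun n => cnorm (b' n) ^+ 2) + L (fun n => cnorm (b n) ^+ 2).
    rewrite -(meanZ HL) -?(meanD HL); [|by solve_bdd..].
    apply: (mean_le HL); [by solve_bdd..|move=> n]; rewrite cnormM cnorm_conj.
    by have := sqr_ge0 (cnorm (b' n) - cnorm (b n)); nra.
  have Lb : 0 <= L (fun n => cnorm (b n) ^+ 2) by apply: (mean_ge0 HL) => [|n]; [solve_bdd|].
  have Lb' : 0 <= L (fun n => cnorm (b' n) ^+ 2) by apply: (mean_ge0 HL) => [|n]; [solve_bdd|].
  by rewrite /r; nra.
apply: (@le_trans _ _ (L (fun n => 2 * cnorm (g n - b' n) ^+ 2 + 2 * cnorm (b' n) ^+ 2))).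
  apply: (mean_le HL); [by solve_bdd..|move=> n].
  by rewrite -{1}[g n](subrK (b' n)); exact: par.
rewrite (meanD HL) ?(meanZ HL); [|by solve_bdd..].
have H3 : L (fun n => cnorm (b' n) ^+ 2) <= 4 * e / r.
  by rewrite ler_pdivlMr// mulrC; exact: le_trans low up.
have eE : e' = 2 * e + 2 * (4 * e / r).
  by rewrite /e; field; rewrite !gt_eqF// addr_gt0 ?mulr_gt0.
by rewrite eE; lra.
Qed.

End ComplexMeans.

Section ErgodicConstants.
Context {R : realType} {d : measure_display} {X : measurableType d}.
Variables (mu : probability X R) (T : X -> X).

(** The sublevel sets are invariant, hence null or full; the constant is the
    level at which their measure jumps. *)
Lemma ergodic_constant (G : X -> R) (C : R) : ergodic mu T -> measurable_fun setT G ->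
  (forall y, `|G y| <= C) -> (forall y, G (T y) = G y) ->
  exists c, `|c| <= C /\ \int[mu]_y `|G y - c| <= 0.
Proof.
move=> [_ _ erg] mG GC GT; have C0 : 0 <= C by apply: le_trans (GC point).
pose D r := [set y | G y <= r].
have mD r : measurable (D r).
  have := mG measurableT _ (measurable_itv `]-oo, r]).
  by rewrite setTI; congr measurable; apply/seteqP; split=> y /=; rewrite in_itv.
have D01 r : mu (D r) = 0%E \/ mu (D r) = 1%E.
  by apply: erg => //; apply/seteqP; split=> y; rewrite /D /= GT.
pose S := [set r | mu (D r) = 0%E].
have GCu y : G y <= C by apply: le_trans (ler_norm _) (GC y).
have GCl y : - C <= G y by have := GC y; rewrite ler_norml => /andP[].
have ubS : ubound S C.
  move=> r; rewrite /S /= => Dr; rewrite leNgt; apply/negP => Cr; move: Dr.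
  rewrite (_ : D r = setT); last by apply/seteqP; split=> y // _; exact: le_trans (GCu y) (ltW Cr).
  by move/eqP; rewrite (probability_setT mu) onee_eq0.
have lowS r : r < - C -> S r.
  move=> rC; rewrite /S /= (_ : D r = set0) ?measure0//.
  by rewrite -subset0 => y /= yr; have := le_lt_trans yr rC; rewrite ltNge GCl.
have hS : has_sup S by split; [exists (- C - 1); apply: lowS; rewrite ltrBlDr ltrDl|exists C].
pose c := sup S.
have below e : 0 < e -> mu (D (c - e)) = 0%E.
  move=> e0; have [r Sr rc] := sup_adherent e0 hS.
  apply/eqP; rewrite eq_le measure_ge0 andbT -Sr.
  by apply: le_measure; rewrite ?inE// => y /= /le_trans; apply; exact: ltW.
have above e : 0 < e -> mu (~` D (c + e)) = 0%E.
  move=> e0; rewrite probability_setC//; have [D0|->] := D01 (c + e); last by rewrite subee.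
  have : c + e <= c by apply: sup_upper_bound.
  by rewrite gerDl leNgt e0.
have cC : `|c| <= C.
  rewrite ler_norml; apply/andP; split; last by apply: ge_sup => //; case: hS.
  apply/ler_addgt0Pr => e e0; rewrite -lerBlDr; apply: sup_upper_bound => //.
  by apply: lowS; rewrite ltrBlDr ltrDl.
exists c; split=> //; apply/ler_addgt0Pr => e e0; rewrite add0r.
have bG : bounded_measurable (fun y => G y - c).
  by apply: bmfB; [split=> //; exists C|exact: bmf_cst].
have mA : measurable (D (c - e) `|` ~` D (c + e)) by apply: measurableU => //; exact: measurableC.
apply: le_trans (@bint_norm_le _ _ _ mu _ _ (C + C) e bG mA _ _ (ltW e0)) _.
- by move=> y; apply: le_trans (ler_normB _ _) _; rewrite lerD.
- move=> y /not_orP[/negP h1 /contrapT h2]; move: h1; rewrite -ltNge => h1.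
  by rewrite ler_norml; apply/andP; split; move: h1 h2; rewrite /D /=; lra.
rewrite (_ : mu _ = 0%E) ?mulr0 ?addr0//.
apply/eqP; rewrite eq_le measure_ge0 andbT.
apply: le_trans (measureU2 _ _ _) _ => //; first exact: measurableC.
by rewrite [X in (X + _)%E](_ : _ = 0%E) ?[X in (_ + X)%E](_ : _ = 0%E) ?adde0//; [exact: above|exact: below].
Qed.

End ErgodicConstants.

(** * Twisted orbits are not ergodic *)

Section ErgodicLimit.
Context {R : realType} {d : measure_display} {X : measurableType d}.

(** The upper limit of the A j is invariant, hence constant, and it is an L1
    limit. *)
Lemma ergodic_limit (mu : probability X R) (T : X -> X) (A : nat -> X -> R) (C e : R) :
  ergodic mu T -> (forall j, measurable_fun setT (A j)) -> (forall j y, `|A j y| <= C) ->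
  (forall j, \int[mu]_y `|A j.+1 y - A j y| <= e / 2 ^+ j) ->
  (forall y e', 0 < e' -> \forall j \near \oo, `|A j (T y) - A j y| <= e') ->
  exists c, `|c| <= C /\ \int[mu]_y `|A 0%N y - c| <= 2 * e.
Proof.
move=> erg mA AC HA inv; have bG := bmf_limsup mA AC.
have GT y : limsup (A ^~ (T y)) = limsup (A ^~ y).
  by apply: (@eq_limsup _ _ _ C) => // e' /inv.
have [c [cC Hc]] := ergodic_constant erg bG.1 (fun y => limsup_bound (AC ^~ y)) GT.
exists c; split=> //; have := @limsup_L1 _ _ _ mu A C e mA AC HA 0%N; rewrite expr0 divr1 => H.
rewrite -[leRHS]addr0; apply: le_trans (lerD H Hc).
have bA : bounded_measurable (A 0%N) by split=> //; exists C.
by apply: bint_triangle => //; exact: bmf_cst.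
Qed.

End ErgodicLimit.

Section ComplexContinuous.
Context {R : realType}.
Local Notation X := (seqspace R).
Local Notation T := (@seqshift R).

Definition ccontinuous (z : X -> R[i]) :=
  continuous (fun y => complex.Re (z y)) /\ continuous (fun y => complex.Im (z y)).

Lemma ccontinuous_cst c : ccontinuous (fun=> c).
Proof. by split; exact: continuous_cst. Qed.

Lemma continuous_add (F G : X -> R) : continuous F -> continuous G -> continuous (fun y => F y + G y).
Proof.
by move=> cF cG y; apply: (@cvgD _ _ _ _ (nbhs_seqspace_filter y)); [exact: cF|exact: cG].
Qed.

Lemma continuous_mul (F G : X -> R) : continuous F -> continuous G -> continuous (fun y => F y * G y).
Proof.
by move=> cF cG y; apply: (@cvgM _ _ _ (nbhs_seqspace_filter y)); [exact: cF|exact: cG].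
Qed.

Lemma ccontinuousM z w : ccontinuous z -> ccontinuous w -> ccontinuous (fun y => z y * w y).
Proof.
move=> [zR zI] [wR wI]; split.
  under eq_fun do rewrite Re_mulc.
  by apply: continuous_sub; exact: continuous_mul.
under eq_fun do rewrite Im_mulc.
by apply: continuous_add; exact: continuous_mul.
Qed.

Lemma ccontinuousX z k : ccontinuous z -> ccontinuous (fun y => z y ^+ k).
Proof.
move=> cz; elim: k => [|k IH]; first exact: ccontinuous_cst.
by under eq_fun do rewrite exprS; exact: ccontinuousM.
Qed.

Lemma ccontinuous_sum (I : Type) (s : seq I) (P : pred I) (F : I -> X -> R[i]) :
  (forall i, ccontinuous (F i)) -> ccontinuous (fun y => \sum_(i <- s | P i) F i y).
Proof.
move=> cF; split.
  under eq_fun do rewrite Re_sum; apply: continuous_sum => i; exact: (cF i).1.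
under eq_fun do rewrite Im_sum; apply: continuous_sum => i; exact: (cF i).2.
Qed.

Lemma ccontinuous_coord i : ccontinuous (fun y : X => udisc_val (y i)).
Proof. by split; [exact: continuous_coordRe|exact: continuous_coordIm]. Qed.

Lemma cnormB_expr (a b : R[i]) k : cnorm a <= 1 -> cnorm b <= 1 ->
  cnorm (a ^+ k - b ^+ k) <= k%:R * cnorm (a - b).
Proof.
move=> a1 b1; elim: k => [|k IH]; first by rewrite !expr0 subrr cnorm0 mul0r.
have -> : a ^+ k.+1 - b ^+ k.+1 = a * (a ^+ k - b ^+ k) + (a - b) * b ^+ k.
  by rewrite !exprS; ring.
apply: le_trans (cnormD _ _) _; rewrite !cnormM -[k.+1%:R]natr1 [leRHS]mulrDl [1 * _]mul1r; apply: lerD.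
  by apply: le_trans IH; rewrite ler_piMl ?cnorm_ge0.
by rewrite cnormX ler_piMr ?cnorm_ge0// exprn_ile1 ?cnorm_ge0.
Qed.

End ComplexContinuous.

Section TwistNotErgodic.
Context {R : realType}.
Local Notation X := (seqspace R).
Local Notation B := (borel_seqspace R).
Local Notation T := (@seqshift R).
Variables (mu : probability B R) (x : X) (L : (nat -> R) -> R).
Hypothesis HL : invariant_mean L.
Hypothesis osc : oscillating L.
Hypothesis mu_mean : forall F : X -> R, continuous F -> \int[mu]_y F y = L (fun n => F (iter n T x)).
Variables (t : R) (g : nat -> R[i]).
Hypothesis t0 : t != 0.
Hypothesis xE : forall n, (0 < n)%N -> udisc_val (x n%:Z) = nit t n * g n.
Hypothesis g_rap : mean_rap L g.
Hypothesis g1 : forall n, cnorm (g n) <= 1.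

Let bg : cbdd g. Proof. by exists 1. Qed.

Section Frequency.
Variables (q j0 : nat).
Hypothesis q0 : (0 < q)%N.

Let w n : R[i] := ecirc (- (j0%:R * n%:R / q%:R)).
Let w' n : R[i] := ecirc (j0%:R * n%:R / q%:R).
Let qn0 : q%:R != 0 :> R. Proof. by rewrite pnatr_eq0 -lt0n. Qed.

Let w1 n : cnorm (w n) = 1. Proof. exact: cnorm_ecirc. Qed.
Let w'1 n : cnorm (w' n) = 1. Proof. exact: cnorm_ecirc. Qed.
Let wq n : w (n + q)%N = w n.
Proof.
rewrite /w (_ : - _ = - (j0%:R * n%:R / q%:R) + - j0%:R); last by rewrite natrD; field.
by rewrite ecircD ecircNn mulr1.
Qed.
Let w_split n h : w h = w' n * w (n + h)%N.
Proof. by rewrite /w /w' -ecircD; congr ecirc; rewrite natrD; field. Qed.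
Let w'X n : w' n ^+ q = 1.
Proof.
rewrite -ecircMn mulrAC -mulrA divff// mulr1.
by rewrite -natrM ecirc_nat.
Qed.

(* the Fourier coefficient of g at the frequency j0 / q *)
Let gamma := cmean L (fun n => g n * w n).

Let bgw : cbdd (fun n => g n * w n).
Proof. by exists 1 => n; rewrite cnormM w1 mulr1. Qed.

Let gamma1 : cnorm gamma <= 1.
Proof.
apply: le_trans (cnorm_cmean_le HL bgw) _; rewrite -(mean_cst HL 1).
by apply: (mean_le HL); [exact: bdd_cnorm|exact: bdd_cst|move=> n; rewrite cnormM w1 mulr1].
Qed.

(* the local Fourier coefficient, at the same frequency, of a point *)
Let phi H (y : X) : R[i] := (H%:R^-1)%:C%C * \sum_(h < H) w h * udisc_val (y h%:Z).

Let phi1 H y : (0 < H)%N -> cnorm (phi H y) <= 1.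
Proof.
move=> H0; apply: le_trans (cnorm_avg_le _) _.
rewrite ler_pdivrMl ?ltr0n// mulr1 -[H in leRHS]card_ord -sumr_const.
by apply: ler_sum => h _; rewrite cnormM w1 mul1r udisc_val_le1.
Qed.

Let phi_shift H y : (0 < H)%N ->
  cnorm (phi H (T y) - ecirc (j0%:R / q%:R) * phi H y) <= 2 / H%:R.
Proof.
move=> H0; have Hn0 : (0 : R) < H%:R by rewrite ltr0n.
pose p h := w h * udisc_val (y h%:Z) : R[i].
have -> : phi H (T y) - ecirc (j0%:R / q%:R) * phi H y =
    (H%:R^-1)%:C%C * (ecirc (j0%:R / q%:R) * (p H - p 0%N)).
  rewrite /phi mulrCA -mulrBr; congr (_ * _).
  have -> : \sum_(h < H) w h * udisc_val (T y h%:Z) = ecirc (j0%:R / q%:R) * \sum_(h < H) p h.+1.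
    rewrite mulr_sumr; apply: eq_bigr => h _.
    rewrite /p mulrA /seqshift -PoszD addn1; congr (_ * _).
    by rewrite (w_split 1 h) add1n /w' mulr1.
  rewrite -mulrBr; congr (_ * _).
  have := @telescope_sumr _ 0 H p (leq0n _); rewrite big_mkord => <-.
  by rewrite sumrB.
rewrite cnormM cnorm_real ger0_norm ?invr_ge0// mulrC ler_wpM2r ?invr_ge0//.
rewrite cnormM cnorm_ecirc mul1r; apply: le_trans (cnormD _ _) _.
by rewrite cnormN !cnormM !w1 !mul1r [2]mulr2n lerD// udisc_val_le1.
Qed.

(* Along the orbit phi is close to n^{it} e(j0 n / q) gamma: on a window of
   length H the factor n^{it} is constant, and the average over H of b w is its
   mean, because H is a multiple of both periods. *)
Let phi_approx (b : nat -> R[i]) Q k e : (0 < Q)%N -> (0 < k)%N -> (forall n, b (n + Q)%N = b n) ->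
  L (fun n => cnorm (g n - b n)) <= e ->
  L (fun n => cnorm (phi (q * (Q * k)) (iter n T x) - nit t n * w' n * gamma)) <= 2 * e.
Proof.
move=> Q0 k0 bQ Hb; set H := (q * (Q * k))%N.
have H0 : (0 < H)%N by rewrite !muln_gt0 q0 Q0 k0.
have bb : cbdd b by exact: (cbdd_periodic Q0 bQ).
have bn := @cbdd_nit R t.
have bw : cbdd w by exists 1 => n; rewrite w1.
have bw' : cbdd w' by exists 1 => n; rewrite w'1.
have shiftb (z : nat -> R[i]) h : cbdd z -> cbdd (fun n => z (n + h)%N) by exact: (cbdd_comp (addn^~ h)).
pose be := (H%:R^-1)%:C%C * \sum_(h < H) b h * w h : R[i].
have bwH n : b (n + H)%N * w (n + H)%N = b n * w n.
  rewrite /H (periodic_mul _ _ wq); congr (_ * _).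
  by rewrite mulnCA periodic_mul.
have gH (z : nat -> R[i]) : cbdd z -> cbdd (fun n => (H%:R^-1)%:C%C * \sum_(h < H) z (n + h)%N).
  by move=> bz; apply: cbddM; [exact: cbdd_cst|apply: cbdd_sum => h; exact: shiftb].
have bphi : cbdd (fun n => phi H (iter n T x)) by exists 1 => n; exact: phi1.
pose ps n := nit t n * w' n * ((H%:R^-1)%:C%C * \sum_(h < H) g (n + h)%N * w (n + h)%N).
have bps : cbdd ps by apply: cbddM; [exact: cbddM|apply: gH bgw].
have bga : cbdd (fun n => nit t n * w' n * gamma) by apply: cbddM; [exact: cbddM|exact: cbdd_cst].
have bbe : cbdd (fun n => nit t n * w' n * be) by apply: cbddM; [exact: cbddM|exact: cbdd_cst].
have avg (a : R) := avg_ord_cst a H0.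
have H1 : L (fun n => cnorm (phi H (iter n T x) - ps n)) <= 0.
  have bd h : bdd (fun n => cnorm (nit t (n + h) - nit t n)).
    by apply: bdd_cnorm; apply: cbddD; [exact: shiftb|exact: cbddN].
  apply: (@le_trans _ _ (L (fun n => H%:R^-1 * \sum_(h < H) cnorm (nit t (n + h) - nit t n)))).
    apply: (@mean_le_from _ _ HL 1%N).
    - by apply: bdd_cnorm; apply: cbddD => //; exact: cbddN.
    - by apply: bddM; [exact: bdd_cst|apply: bdd_sum => h].
    move=> n n0; rewrite /ps /phi [nit t n * _ * _]mulrCA -mulrBr mulr_sumr -sumrB.
    apply: le_trans (cnorm_avg_le _) _; rewrite ler_wpM2l ?invr_ge0//; apply: ler_sum => h _.
    rewrite iter_shiftE [(_ + n%:Z)%R]addrC -PoszD xE ?addn_gt0 ?n0// (w_split n h).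
    have -> : w' n * w (n + h)%N * (nit t (n + h) * g (n + h)%N) - nit t n * w' n * (g (n + h)%N * w (n + h)%N)
       = (nit t (n + h) - nit t n) * (w' n * w (n + h)%N * g (n + h)%N) by ring.
    by rewrite cnormM !cnormM w1 w'1 !mul1r ler_piMr ?cnorm_ge0.
  rewrite (meanZ HL) ?(mean_sum HL)//; last by apply: bdd_sum => h.
  by rewrite big1 ?mulr0// => h _; rewrite (mean_nit_slow HL).
have H2 : L (fun n => cnorm (ps n - nit t n * w' n * be)) <= e.
  have bd h : bdd (fun n => cnorm (g (n + h)%N - b (n + h)%N)).
    by apply: bdd_cnorm; apply: cbddD; [exact: shiftb|apply: cbddN; exact: shiftb].
  rewrite -(avg e).
  apply: (@le_trans _ _ (L (fun n => H%:R^-1 * \sum_(h < H) cnorm (g (n + h)%N - b (n + h)%N)))).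
    apply: (mean_le HL).
    - by apply: bdd_cnorm; apply: cbddD => //; exact: cbddN.
    - by apply: bddM; [exact: bdd_cst|apply: bdd_sum => h].
    move=> n; rewrite /ps /be -mulrBr cnormM cnormM cnorm_cis w'1 !mul1r.
    have := @sum_periodic _ (fun h => b h * w h) H n bwH => <-.
    rewrite -mulrBr -sumrB.
    apply: le_trans (cnorm_avg_le _) _; rewrite ler_wpM2l ?invr_ge0//; apply: ler_sum => h _.
    by rewrite -mulrBl cnormM w1 mulr1.
  rewrite (meanZ HL) ?(mean_sum HL)//; last by apply: bdd_sum => h.
  rewrite ler_wpM2l ?invr_ge0//; apply: ler_sum => h _.
  have b0 : bdd (fun n => cnorm (g n - b n)) by apply: bdd_cnorm; apply: cbddD => //; exact: cbddN.
  by rewrite (mean_shift HL h b0).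
have H3 : L (fun n => cnorm (nit t n * w' n * be - nit t n * w' n * gamma)) <= e.
  have -> : (fun n => cnorm (nit t n * w' n * be - nit t n * w' n * gamma)) = (fun=> cnorm (be - gamma)).
    by apply/funext => n; rewrite -mulrBr !cnormM cnorm_cis w'1 !mul1r.
  rewrite (mean_cst HL) cnormB /be -(cmean_periodic HL H0 bwH) /gamma.
  have bbw : cbdd (fun n => b n * w n) by exact: cbddM.
  rewrite -(cmeanB HL)//; apply: le_trans (cnorm_cmean_le HL _) _.
    by apply: cbddD => //; exact: cbddN.
  apply: le_trans Hb; rewrite le_eqVlt; apply/orP; left; apply/eqP; congr (L _); apply/funext => n.
  by rewrite -mulrBl cnormM w1 mulr1.
have := cmean_triangle HL bphi bps bga; have := cmean_triangle HL bps bbe bga; lra.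
Qed.

Hypothesis erg : ergodic mu (T : B -> B).

(** Suppose gamma is not 0. The q-th powers of the functions phi are almost
    invariant under the shift, since T multiplies phi by e(j0/q) up to O(1/H).
    Along the orbit they are close to n^{iqt} gamma^q, so they converge in L1,
    and by ergodicity their limit is a constant c. But n^{iqt} oscillates and
    cannot be close to a constant. *)
Lemma twisted_frequency_null : cmean L (fun n => g n * w n) = 0.
Proof.
pose tau := q%:R * t; have tau0 : tau != 0 by rewrite mulf_neq0.
have [rho /andP[rho0 rho1] Hrho] := osc tau0.
pose Ga := gamma ^+ q.
have qp : (0 : R) < q%:R by rewrite ltr0n.
have Ga1 : cnorm Ga <= 1 by rewrite cnormX exprn_ile1 ?cnorm_ge0.
have bn := @cbdd_nit R tau.
have bnG : cbdd (fun n => nit tau n * Ga) by apply: cbddM => //; exact: cbdd_cst.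
have key d : 0 < d -> (1 - rho) * cnorm Ga ^+ 2 <= 84 * q%:R * d.
  move=> d0; have dj j : 0 < d / 2 ^+ j by rewrite divr_gt0// exprn_gt0.
  pose P j (p : (nat -> R[i]) * nat) := [/\ (0 < p.2)%N, forall n, p.1 (n + p.2)%N = p.1 n &
    L (fun n => cnorm (g n - p.1 n)) <= d / 2 ^+ j].
  have Hex j : exists p, P j p.
    have [b [Q [Q0 bQ b1 Hb]]] := g_rap (exprn_gt0 2 (dj j)); exists (b, Q); split=> //=.
    have bgb : bdd (fun n => cnorm (g n - b n)).
      by apply: bdd_cnorm; apply: cbddD => //; apply: cbddN; exists 1.
    have := mean_sqr_le HL bgb (ltW (dj j)) Hb.
    by under eq_fun do rewrite ger0_norm ?cnorm_ge0//.
  pose pr j := projT1 (cid (Hex j)); have prP j : P j (pr j) by exact: (projT2 (cid (Hex j))).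
  pose H j := (q * ((pr j).2 * j.+1))%N.
  have H0 j : (0 < H j)%N by have [] := prP j; rewrite !muln_gt0 q0 andbT => ->.
  pose Ph j y := phi (H j) y ^+ q.
  have Ph1 j y : cnorm (Ph j y) <= 1 by rewrite cnormX exprn_ile1 ?cnorm_ge0// phi1.
  have cPh j : ccontinuous (Ph j).
    apply: ccontinuousX; apply: ccontinuousM; first exact: ccontinuous_cst.
    by apply: ccontinuous_sum => h; apply: ccontinuousM; [exact: ccontinuous_cst|exact: ccontinuous_coord].
  have bPh j : cbdd (fun n => Ph j (iter n T x)) by exists 1 => n.
  have app j : L (fun n => cnorm (Ph j (iter n T x) - nit tau n * Ga)) <= 2 * q%:R * (d / 2 ^+ j).
    have [Q0 bQ Hb] := prP j.
    have bgam : cbdd (fun n => nit t n * w' n * gamma).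
      by exists 1 => n; rewrite !cnormM cnorm_cis w'1 !mul1r.
    have bph : cbdd (fun n => phi (H j) (iter n T x)) by exists 1 => n; exact: phi1.
    have bdf : bdd (fun n => cnorm (phi (H j) (iter n T x) - nit t n * w' n * gamma)).
      by apply: bdd_cnorm; apply: cbddD => //; exact: cbddN.
    apply: (@le_trans _ _ (L (fun n => q%:R * cnorm (phi (H j) (iter n T x) - nit t n * w' n * gamma)))).
      apply: (mean_le HL).
      - by apply: bdd_cnorm; apply: cbddD => //; exact: cbddN.
      - by apply: bddM => //; exact: bdd_cst.
      move=> n; have -> : nit tau n * Ga = (nit t n * w' n * gamma) ^+ q.
        rewrite /Ga !exprMn w'X mulr1 -cisMn; congr (cis _ * _).
        by rewrite /tau; ring.
      by apply: cnormB_expr; [exact: phi1|rewrite !cnormM cnorm_cis w'1 !mul1r].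
    rewrite (meanZ HL)// [2 * _]mulrC -mulrA ler_wpM2l//.
    exact: (phi_approx Q0 _ bQ Hb).
  have inv y j : cnorm (Ph j (T y) - Ph j y) <= q%:R * (2 / (H j)%:R).
    have -> : Ph j y = (ecirc (j0%:R / q%:R) * phi (H j) y) ^+ q.
      rewrite exprMn -ecircMn divfK// ecirc_nat mul1r//.
    apply: le_trans (cnormB_expr _ _ _) _; [exact: phi1| |].
      by rewrite cnormM cnorm_ecirc mul1r phi1.
    by rewrite ler_wpM2l// phi_shift.
  have inv_small y e' : 0 < e' -> \forall j \near \oo, cnorm (Ph j (T y) - Ph j y) <= e'.
    move=> e'0; exists (Num.truncn (q%:R * 2 / e')) => // j /= Hj.
    apply: le_trans (inv y j) _; rewrite mulrA ler_pdivrMr ?ltr0n//.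
    have : q%:R * 2 / e' < (Num.truncn (q%:R * 2 / e')).+1%:R by exact: truncnS_gt.
    rewrite ltr_pdivrMr// => /ltW/le_trans; apply; rewrite [leLHS]mulrC ler_wpM2l ?(ltW e'0)// ler_nat.
    apply: leq_trans (_ : (j.+1 <= _)%N) => //.
    by rewrite /H mulnA leq_pmull// muln_gt0 q0; have [] := prP j.
  (* the limit is taken for the real part and for the imaginary part *)
  have part_limit (pt : R[i] -> R) : (forall z u, pt (z - u) = pt z - pt u) ->
      (forall z, `|pt z| <= cnorm z) -> (forall j, continuous (fun y => pt (Ph j y))) ->
      exists c, `|c| <= 1 /\ L (fun n => `|pt (nit tau n * Ga) - c|) <= 14 * q%:R * d.
    move=> ptB pt1 cpt.
    have bpt (z : nat -> R[i]) : cbdd z -> bdd (fun n => pt (z n)).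
      by move=> [C HC]; exists C => n; apply: le_trans (pt1 _) (HC n).
    have apt j : L (fun n => `|pt (Ph j (iter n T x)) - pt (nit tau n * Ga)|) <= 2 * q%:R * (d / 2 ^+ j).
      apply: le_trans (app j); apply: (mean_le HL).
      - by apply: bdd_norm; apply: bddD; [exact: bpt|apply: bddN; exact: bpt].
      - by apply: bdd_cnorm; apply: cbddD => //; exact: cbddN.
      - by move=> n; rewrite -ptB.
    have [||||c [c1 Hc]] := @ergodic_limit _ _ _ mu T (fun j y => pt (Ph j y)) 1 (4 * q%:R * d) erg.
    - by move=> j; exact: measurable_continuous.
    - by move=> j y; apply: le_trans (pt1 _) _.
    - move=> j; rewrite (@mu_mean (fun y => `|pt (Ph j.+1 y) - pt (Ph j y)|)); last first.
        by apply: continuous_norm; exact: continuous_sub.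
      apply: le_trans (mean_triangle HL (bpt _ (bPh j.+1)) (bpt _ bnG) (bpt _ (bPh j))) _.
      have := apt j; have := apt j.+1; under [X in _ -> _ -> _ + L X <= _]eq_fun do rewrite distrC.
      have -> : d / 2 ^+ j.+1 = d / 2 ^+ j / 2 by rewrite exprS invfM mulrA mulrAC.
      have -> : 4 * q%:R * d / 2 ^+ j = 4 * (q%:R * (d / 2 ^+ j)) by ring.
      have : 0 < q%:R * (d / 2 ^+ j) by rewrite mulr_gt0.
      by rewrite -!mulrA; lra.
    - move=> y e' e'0; apply: filterS (inv_small y e' e'0) => j; apply: le_trans.
      by rewrite -ptB.
    exists c; split=> //.
    have {}Hc : L (fun n => `|pt (Ph 0%N (iter n T x)) - c|) <= 2 * (4 * q%:R * d).
      rewrite -(@mu_mean (fun y => `|pt (Ph 0%N y) - c|))//.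
      by apply: continuous_norm; apply: continuous_sub => //; exact: continuous_cst.
    have := mean_triangle HL (bpt _ bnG) (bpt _ (bPh 0%N)) (bdd_cst c).
    have := apt 0%N; rewrite expr0 divr1; under eq_fun do rewrite distrC.
    have : 0 <= q%:R * d by rewrite mulr_ge0// ltW.
    move: Hc; rewrite -!mulrA; lra.
  have [a [a1 Ha]] := part_limit (@complex.Re R)
    (fun z u => etrans (Re_addc _ _) (congr1 _ (Re_oppc _))) (@normr_Re_le R) (fun j => (cPh j).1).
  have [b [b1 Hb]] := part_limit (@complex.Im R)
    (fun z u => etrans (Im_addc _ _) (congr1 _ (Im_oppc _))) (@normr_Im_le R) (fun j => (cPh j).2).
  pose c : R[i] := Complex a b.
  have bc : cbdd (fun n => nit tau n * Ga - c) by apply: cbddD => //; exact: cbdd_cst.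
  have Hsum : L (fun n => cnorm (nit tau n * Ga - c)) <= 28 * q%:R * d.
    apply: (@le_trans _ _ (L (fun n => `|complex.Re (nit tau n * Ga) - a| + `|complex.Im (nit tau n * Ga) - b|))).
      apply: (mean_le HL); [exact: bdd_cnorm|by apply: bddD; apply: bdd_norm; apply: bddD; [solve_bdd|exact: bdd_cst|solve_bdd|exact: bdd_cst]|].
      move=> n; apply: le_trans (cnorm_le_ReIm _) _.
      by rewrite Re_addc Im_addc Re_oppc Im_oppc.
    rewrite (meanD HL); [|by apply: bdd_norm; apply: bddD; [solve_bdd|exact: bdd_cst]..].
    by move: Ha Hb; rewrite -!mulrA; lra.
  have c2 : cnorm c <= 2.
    by apply: le_trans (cnorm_le_ReIm _) _; rewrite [2]mulr2n lerD.
  have up : L (fun n => cnorm (nit tau n * Ga - c) ^+ 2) <= 3 * (28 * q%:R * d).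
    apply: (@le_trans _ _ (L (fun n => 3 * cnorm (nit tau n * Ga - c)))).
      apply: (mean_le HL); [by apply: bddX; exact: bdd_cnorm|by apply: bddM; [exact: bdd_cst|exact: bdd_cnorm]|].
      move=> n; rewrite expr2 ler_wpM2r ?cnorm_ge0//.
      apply: le_trans (cnormD _ _) _; rewrite cnormN cnormM cnorm_cis mul1r.
      by rewrite (_ : 3 = 1 + 2 :> R) ?lerD//; lra.
    by rewrite (meanZ HL) ?ler_wpM2l//; exact: bdd_cnorm.
  have low : (1 - rho) * cnorm Ga ^+ 2 <= L (fun n => cnorm (nit tau n * Ga - c) ^+ 2).
    have -> : (fun n => cnorm (nit tau n * Ga - c) ^+ 2) =
        (fun n => (cnorm Ga ^+ 2 + cnorm c ^+ 2) - 2 * complex.Re ((Ga * conjc c) * nit tau n)).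
      apply/funext => n; rewrite cnormB_sqr cnormM cnorm_cis mul1r.
      have -> : nit tau n * Ga * conjc c = Ga * conjc c * nit tau n by ring.
      by ring.
    have bR : bdd (fun n => complex.Re ((Ga * conjc c) * nit tau n)) by solve_bdd.
    rewrite (meanB HL) ?(mean_cst HL) ?(meanZ HL)//; [|exact: bdd_cst|by apply: bddM => //; exact: bdd_cst].
    have := Hrho (Ga * conjc c); rewrite cnormM cnorm_conj.
    have := sqr_ge0 (cnorm Ga - cnorm c); have := cnorm_ge0 Ga; have := cnorm_ge0 c.
    have := sqr_ge0 (cnorm c); nra.
  by apply: le_trans low (le_trans up _); rewrite -!mulrA; lra.
have : (1 - rho) * cnorm Ga ^+ 2 <= 0.
  apply/ler_addgt0Pr => e e0; rewrite add0r.
  have K0 : (0 : R) < 84 * q%:R by rewrite mulr_gt0.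
  have := key _ (divr_gt0 e0 K0); rewrite [84 * q%:R * _]mulrC divfK ?gt_eqF//.
rewrite pmulr_rle0 ?subr_gt0// => H.
have : cnorm Ga ^+ 2 == 0 by rewrite eq_le H exprn_ge0 ?cnorm_ge0.
rewrite sqrf_eq0 => /eqP/cnorm_eq0/eqP; rewrite expf_eq0 q0 /= => /eqP.
exact.
Qed.

End Frequency.

(** All rational Fourier coefficients of g vanish, so g is orthogonal to the
    periodic sequences that approximate it. *)
Lemma twist_not_ergodic : ergodic mu (T : B -> B) -> L (fun n => cnorm (g n) ^+ 2) <= 0.
Proof.
move=> erg; apply/ler_addgt0Pr => e e0; rewrite add0r.
have [b [q [q0 bq b1 Hb]]] := g_rap e0.
have bb : cbdd b by exists 1.
have qn0 : q%:R != 0 :> R by rewrite pnatr_eq0 -lt0n.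
have bE n : b n = \sum_(j < q) ecirc (j%:R * n%:R / q%:R) * dft q b j.
  rewrite -{1}[n]add0n -(@sum_dft R q (fun h => b (h + n)%N))//; apply: eq_bigr => j _.
  elim: n => [|n IH].
    rewrite mulr0 mul0r ecirc0 mul1r; congr dft; apply/funext => h; by rewrite addn0.
  have -> : (fun h => b (h + n.+1)%N) = (fun h => (fun h => b (h + n)%N) h.+1).
    by apply/funext => h; rewrite addSnnS.
  rewrite (@dft_shift R q (fun h => b (h + n)%N) j q0); last by move=> h; rewrite addnAC bq.
  rewrite IH mulrA -ecircD; congr (ecirc _ * _).
  by rewrite -[n.+1%:R]natr1; field.
have conjE (s : R) : conjc (ecirc s) = ecirc (- s) :> R[i] by rewrite /ecirc conjc_cis mulrN.
have cs (F : 'I_q -> R[i]) : conjc (\sum_j F j) = \sum_j conjc (F j) by rewrite rmorph_sum.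
have orth : L (fun n => complex.Re (g n * conjc (b n))) = 0.
  have -> : (fun n => complex.Re (g n * conjc (b n))) = (fun n => \sum_(j < q)
      complex.Re (conjc (dft q b j) * (g n * ecirc (- (j%:R * n%:R / q%:R))))).
    apply/funext => n; rewrite bE cs mulr_sumr Re_sum; apply: eq_bigr => j _.
    by rewrite conjcM conjE; congr complex.Re; ring.
  have bz (j : 'I_q) : cbdd (fun n => g n * ecirc (- (j%:R * n%:R / q%:R))).
    by exists 1 => n; rewrite cnormM cnorm_ecirc mulr1.
  rewrite (mean_sum HL); last by move=> j; apply: bdd_Re; apply: cbddM => //; exact: cbdd_cst.
  apply: big1 => j _; rewrite -(Re_cmeanM HL) ?(twisted_frequency_null j q0 erg) ?mulr0//.
apply: le_trans Hb.
have -> : (fun n => cnorm (g n - b n) ^+ 2) =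
    (fun n => cnorm (g n) ^+ 2 + cnorm (b n) ^+ 2 - 2 * complex.Re (g n * conjc (b n))).
  by apply/funext => n; rewrite cnormB_sqr.
rewrite (meanB HL) ?(meanZ HL) ?orth ?mulr0 ?subr0; [|by solve_bdd..].
by apply: (mean_le HL); [by solve_bdd..|move=> n; rewrite lerDl exprn_ge0 ?cnorm_ge0].
Qed.

End TwistNotErgodic.

(** * Pretentious functions and the equivalences *)

Section DirichletCharacters.
Context {R : realType} (q : nat) (chi : nat -> R[i]).
Hypothesis chiD : dirichlet_character q chi.

Lemma character1 : chi 1%N = 1.
Proof.
have [q0 chiP chiM chi0] := chiD.
have n1 : chi 1%N != 0 by rewrite chi0 coprime1n.
by apply: (mulfI n1); rewrite -chiM muln1 mulr1.
Qed.

Lemma characterX n k : chi (n ^ k)%N = chi n ^+ k.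
Proof.
have [q0 chiP chiM chi0] := chiD.
by elim: k => [|k IH]; rewrite ?expn0 ?expr0 ?character1// expnS exprS chiM IH.
Qed.

(** By Euler's theorem chi(n)^totient(q) = 1. *)
Lemma cnorm_character n : coprime n q -> cnorm (chi n) = 1.
Proof.
have [q0 chiP chiM chi0] := chiD; move=> nq.
have : chi n ^+ totient q = 1.
  rewrite -characterX -(periodic_mod _ chiP) cyclic.Euler_exp_totient// periodic_mod//.
  exact: character1.
move=> /(congr1 (@cnorm R)); rewrite cnormX cnorm1 => /eqP.
by rewrite pexpr_eq1 ?cnorm_ge0 ?totient_gt0// => /eqP.
Qed.

Lemma cnorm_character_le1 n : cnorm (chi n) <= 1.
Proof.
have [q0 chiP chiM chi0] := chiD.
have [nq|nq] := boolP (coprime n q); first by rewrite cnorm_character.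
by move: (chi0 n); rewrite (negbTE nq) => /negbFE/eqP ->; rewrite cnorm0 ler01.
Qed.

Lemma cnorm_character_prime p : prime p -> (q < p)%N -> cnorm (chi p) = 1.
Proof.
move=> pp qp; apply: cnorm_character; rewrite prime_coprime//.
have [q0 _ _ _] := chiD; apply/negP => /dvdn_leq => /(_ q0).
by rewrite leqNgt qp.
Qed.

End DirichletCharacters.

Section PretentiousFunction.
Context {R : realType} (f : nat -> udisc R) (t : R) (q : nat) (chi : nat -> R[i]).
Hypothesis f_mul : is_multiplicative f.
Hypothesis chiD : dirichlet_character q chi.
Hypothesis f_pret : pret_equiv (udisc_val \o f) (fun n => nit t n * chi n).

(** Dividing out n^{it} leaves a function at finite pretentious distance from
    chi. *)
Definition untwist n : R[i] := nit (- t) n * udisc_val (f n).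
Local Notation g := untwist.

Lemma nitM s m n : (0 < m)%N -> (0 < n)%N -> nit s (m * n) = nit s m * nit s n :> R[i].
Proof. by move=> m0 n0; rewrite /nit -cisD -mulrDr -lnM ?posrE ?ltr0n// natrM. Qed.

Lemma nitN n : nit t n * nit (- t) n = 1 :> R[i].
Proof. by rewrite /nit -cisD mulNr subrr cis0. Qed.

Lemma untwistK n : nit t n * g n = udisc_val (f n).
Proof. by rewrite mulrA nitN mul1r. Qed.

Lemma cnorm_untwist n : cnorm (g n) = cnorm (udisc_val (f n)).
Proof. by rewrite cnormM cnorm_cis mul1r. Qed.

Lemma cnorm_untwist_le1 n : cnorm (g n) <= 1.
Proof. by rewrite cnorm_untwist udisc_val_le1. Qed.

Lemma untwist_multiplicative : multiplicative_on_coprime g.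
Proof.
move=> m n m0 n0 mn; rewrite /g nitM// f_mul//; ring.
Qed.

Lemma pret_sum_bound : exists S : R, forall b,
  prime_sum 0 b (fun p => (1 - complex.Re (twist g chi p)) / p%:R) <= S.
Proof.
pose F p : R := p%:R^-1 * (1 - complex.Re (udisc_val (f p) * conjc (nit t p * chi p))).
have FE p : F p = (1 - complex.Re (twist g chi p)) / p%:R.
  rewrite /F mulrC /twist /g conjcM conjc_cis.
  by rewrite -/(nit (- t) p) -mulNr; congr ((1 - complex.Re _) / _); rewrite /nit; ring.
have F0 p : 0 <= F p.
  rewrite /F mulr_ge0 ?invr_ge0// subr_ge0; apply: le_trans (Re_le_cnorm _) _.
  rewrite cnormM cnorm_conj cnormM cnorm_cis mul1r mulr_ile1 ?cnorm_ge0 ?udisc_val_le1//.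
  exact: (cnorm_character_le1 chiD).
have D0 : (0 <= dist2 (udisc_val \o f) (fun n => (nit t n * chi n)%R))%E.
  by apply: nneseries_ge0 => p _ _; rewrite lee_fin; exact: F0.
move: f_pret; rewrite /pret_equiv; case E : (dist2 _ _) D0 => [S| |]// _ _.
exists S => b; rewrite -lee_fin -E /prime_sum -sumEFin.
apply: (@le_trans _ _ (\sum_(0 <= p < b.+1 | prime p) (F p)%:E)%E).
  rewrite [leRHS]big_ltn_cond//= le_eqVlt; apply/orP; left; apply/eqP.
  by apply: eq_bigr => p _; rewrite FE.
by apply: nneseries_lim_ge => p _ _; rewrite lee_fin.
Qed.

(** The definition of multiplicativity allows f to vanish identically. Then
    every prime would contribute 1/p to the distance; that the sum of 1/p
    diverges is deduced by applying the lower bound for means to the indicator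
    of 1. *)
Lemma untwist1 : g 1%N = 1.
Proof.
have gg : g 1%N * g 1%N = g 1%N by rewrite -untwist_multiplicative.
have [g0|n1] := eqVneq (g 1%N) 0; last by apply: (mulfI n1); rewrite gg mulr1.
have gn0 n : (0 < n)%N -> g n = 0.
  by move=> n0; rewrite -[n]muln1 untwist_multiplicative ?coprimen1// g0 mulr0.
have [S HS] := pret_sum_bound.
pose r (n : nat) : R := (n == 1%N)%:R.
have rM : multiplicative_on_coprime r.
  by move=> m n m0 n0 _; rewrite /r -natrM mulnb muln_eq1.
have r01 n : (0 < n)%N -> 0 <= r n <= 1 by rewrite /r; case: (_ == _); rewrite ?lexx ?ler01.
have [|kappa k0 Hk] := @mean_lower_bound R r rM erefl r01 S.
  move=> b; apply: le_trans (HS b); apply: le_prime_sum => p pp _.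
  rewrite /r /twist gn0 ?prime_gt0// mul0r /= subr0.
  by rewrite (_ : (p == 1)%N = false) ?subr0//; apply/negbTE/negP => /eqP E; rewrite E in pp.
have HN : index_seq succn by split.
have [L HL] := @mean_along_ex R Cesaro succn; have HLm := mean_along_mean HN HL.
have := Hk _ _ _ HN HL.
have -> : L r = L (fun=> 0).
  apply: (@mean_eq_from _ _ HLm 2%N); [|exact: bdd_cst|].
    by exists 1 => n; rewrite /r; case: (_ == _); rewrite ?normr1 ?normr0 ?ler01.
  by case=> [|[|n]].
by rewrite (mean_cst HLm) leNgt k0.
Qed.

(** |g|^2 is multiplicative with values in [0, 1], and 1 - |g(p)|^2 <= 2 (1 -
    Re twist p). *)
Lemma untwist_square_mean : exists2 kappa : R, 0 < kappa &
  forall m N L, index_seq N -> mean_along m N L -> kappa <= L (fun n => cnorm (g n) ^+ 2).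
Proof.
have [S HS] := pret_sum_bound.
apply: (@mean_lower_bound R (fun n => cnorm (g n) ^+ 2) _ _ _ (2 * S)).
- by move=> m n m0 n0 mn; rewrite untwist_multiplicative// cnormM exprMn.
- by rewrite untwist1 cnorm1 expr1n.
- by move=> n _; rewrite exprn_ge0 ?cnorm_ge0//= expr_le1 ?cnorm_ge0 ?cnorm_untwist_le1.
move=> b; apply: (@le_trans _ _ (2 * prime_sum 0 b (fun p => (1 - complex.Re (twist g chi p)) / p%:R))).
  rewrite -prime_sumZ; apply: le_prime_sum => p pp _; rewrite mulrA ler_wpM2r ?invr_ge0//.
  have : complex.Re (twist g chi p) <= cnorm (g p).
    apply: le_trans (Re_le_cnorm _) _; rewrite cnormM cnorm_conj ler_piMr ?cnorm_ge0//.
    exact: (cnorm_character_le1 chiD).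
  by have := sqr_ge0 (1 - cnorm (g p)); lra.
by rewrite ler_pM2l.
Qed.

(** The factors exp(drift) lie in the unit disc, so they converge along a
    subsequence. It serves both kinds of averages and all precisions at once. *)
Lemma untwist_subsequence N : index_seq N -> exists phi : nat -> nat, {homo phi : i j / (i < j)%N} /\
  forall m (e : R), 0 < e -> exists b : nat -> R[i],
    [/\ exists2 Q, (0 < Q)%N & forall n, b (n + Q)%N = b n, forall n, cnorm (b n) <= 1 &
      \forall k \near \oo, average m (N (phi k)) (fun n => cnorm (g n - b n) ^+ 2) <= e].
Proof.
move=> [N0 Nh]; have [S HS] := pret_sum_bound.
have [q0 chiP chiM _] := chiD.
have bw : cbdd (fun k => cexp (drift g chi 0 (2 ^ scale (N k)))).
  exists 1 => k; apply: cnorm_cexp_le1; apply: Re_drift_le0 => n.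
  - by move=> _; exact: cnorm_untwist_le1.
  - exact: (cnorm_character_le1 chiD).
have [phi [gamma [phi_inc Hphi]]] := bounded_subsequence bw.
exists phi; split=> // m e e0.
apply: (@periodic_approx_along R g chi q untwist_multiplicative untwist1 (fun n _ => cnorm_untwist_le1 n)
  chiM (character1 chiD) (cnorm_character_le1 chiD) (cnorm_character_prime chiD) q0 chiP S HS
  (fun k => N (phi k)) gamma m e) => // i j /phi_inc /Nh //.
Qed.

End PretentiousFunction.

Section AlongSequences.
Context {R : realType}.

Lemma index_seq_comp N phi : index_seq N -> {homo phi : i j / (i < j)%N} ->
  index_seq (fun k => N (phi k)).
Proof. by move=> [N0 Nh] ph; split=> // i j /ph /Nh. Qed.

Lemma near_subsequence (phi : nat -> nat) (P : nat -> Prop) : {homo phi : i j / (i < j)%N} ->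
  (\forall k \near \oo, P k) -> \forall k \near \oo, P (phi k).
Proof.
move=> ph [k0 _ Hk]; exists k0 => // k /= k0k; apply: Hk => /=.
exact: leq_trans k0k (increasing_ge k ph).
Qed.

Lemma furstenberg_subsequence m N phi (a : nat -> udisc R) mu : {homo phi : i j / (i < j)%N} ->
  furstenberg_system_along m N a mu -> furstenberg_system_along m (fun k => N (phi k)) a mu.
Proof.
move=> ph [x [xa H]]; exists x; split=> // F cF.
apply: cvg_comp (H F cF) => A [k0 _ Hk]; exists k0 => // k /= k0k; apply: Hk => /=.
exact: leq_trans k0k (increasing_ge k ph).
Qed.

Section Means.
Context (m : averaging) (N : nat -> nat) (L : (nat -> R) -> R).
Hypothesis HN : index_seq N.
Hypothesis HL : mean_along m N L.

Lemma mean_rap_along (a : nat -> R[i]) : (forall n, cnorm (a n) <= 1) ->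
  (forall e : R, 0 < e -> exists b : nat -> R[i],
    [/\ exists2 Q, (0 < Q)%N & forall n, b (n + Q)%N = b n, forall n, cnorm (b n) <= 1 &
      \forall k \near \oo, average m (N k) (fun n => cnorm (a n - b n) ^+ 2) <= e]) ->
  mean_rap L a.
Proof.
move=> a1 H e e0; have [b [[Q Q0 bQ] b1 Hb]] := H e e0; exists b, Q; split=> //.
apply: (mean_along_le HN HL) => //.
by apply: bddX; apply: bdd_cnorm; apply: cbddD; [exists 1|apply: cbddN; exists 1].
Qed.

Lemma mean_rap_eq (a a' : nat -> R[i]) : cbdd a -> cbdd a' ->
  (forall n, (0 < n)%N -> a n = a' n) -> mean_rap L a -> mean_rap L a'.
Proof.
move=> ba ba' aa' H e e0; have [b [Q [Q0 bQ b1 Hb]]] := H e e0; exists b, Q; split=> //.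
have bb : cbdd b by exists 1.
rewrite -(@mean_eq_from _ _ (mean_along_mean HN HL) 1%N (fun n => cnorm (a n - b n) ^+ 2))//.
- by apply: bddX; apply: bdd_cnorm; apply: cbddD => //; exact: cbddN.
- by apply: bddX; apply: bdd_cnorm; apply: cbddD => //; exact: cbddN.
- by move=> n n0; rewrite aa'.
Qed.

End Means.

Lemma besicovitch_mean_rap m N phi (a : nat -> udisc R) L : index_seq N ->
  {homo phi : i j / (i < j)%N} -> mean_along m (fun k => N (phi k)) L ->
  besicovitch_rap_along m N a -> mean_rap L (fun n => udisc_val (a n)).
Proof.
move=> HN ph HL H; apply: (mean_rap_along (index_seq_comp HN ph) HL) => [n|e e0].
  exact: udisc_val_le1.
have e2 : 0 < e / 2 by rewrite divr_gt0.
have [b [[q [q0 bq]] /limn_esup_leP Hb]] := H _ e2.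
(* shifted by a period so as to be periodic from 0 on *)
exists (fun n => udisc_val (b (n + q)%N)); split.
- by exists q => // n; rewrite [in LHS]bq// addn_gt0 q0 orbT.
- by move=> n; exact: udisc_val_le1.
have := near_subsequence ph (Hb _ e2); apply: filterS => k Hk.
rewrite [e]splitr; apply: le_trans Hk; rewrite le_eqVlt; apply/orP; left; apply/eqP.
by apply: eq_average => n /andP[n0 _]; rewrite bq.
Qed.

End AlongSequences.

Section Equivalences.
Context {R : realType} (f : nat -> udisc R).
Hypothesis f_mul : is_multiplicative f.
Local Notation v := (udisc_val \o f).

Lemma nit0 n : nit 0 n = 1 :> R[i].
Proof. by rewrite /nit mul0r cis0. Qed.

Lemma nit0_mul (chi : nat -> R[i]) : (fun n => nit 0 n * chi n) = chi.
Proof. by apply/funext => n; rewrite nit0 mul1r. Qed.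

Lemma untwist0 : untwist f 0 = v.
Proof. by apply/funext => n; rewrite /untwist oppr0 nit0 mul1r. Qed.

Definition character_like := exists chi : nat -> R[i], primitive_character chi /\ pret_equiv v chi.

Lemma character_like_subsequence N : character_like -> index_seq N ->
  exists phi : nat -> nat, {homo phi : i j / (i < j)%N} /\
  forall m (e : R), 0 < e -> exists b : nat -> R[i],
    [/\ exists2 Q, (0 < Q)%N & forall n, b (n + Q)%N = b n, forall n, cnorm (b n) <= 1 &
      \forall k \near \oo, average m (N (phi k)) (fun n => cnorm (v n - b n) ^+ 2) <= e].
Proof.
move=> [chi [[q [chiD _]] fchi]] HN.
have fchi' : pret_equiv v (fun n => nit 0 n * chi n) by rewrite nit0_mul.
by have := untwist_subsequence f_mul chiD fchi' HN; rewrite untwist0.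
Qed.

Lemma character_like_rap N : character_like -> index_seq N ->
  exists phi : nat -> nat, {homo phi : i j / (i < j)%N} /\
    forall m : averaging, besicovitch_rap_along m (N \o phi) f.
Proof.
move=> fc HN; have [phi [ph H]] := character_like_subsequence fc HN; exists phi; split=> // m e e0.
have [b [[Q Q0 bQ] b1 Hb]] := H m e e0.
pose u n := projT1 (cid (udisc_exist (b1 n))).
have uE n : udisc_val (u n) = b n by rewrite /u; case: cid.
exists u; split; first by exists Q; split=> // n _; apply: udisc_val_inj; rewrite !uE.
apply/limn_esup_leP => e' e'0; apply: filterS Hb => k /= Hk.
under [X in average _ _ X]eq_fun do rewrite uE.
by apply: le_trans Hk _; rewrite lerDl ltW.
Qed.

Lemma character_like_procyclic m mu : character_like -> furstenberg_system m f mu ->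
  procyclic mu (@seqshift R : borel_seqspace R -> borel_seqspace R).
Proof.
move=> fc [N [HN Hmu]]; have [phi [ph H]] := character_like_subsequence fc HN.
have HN' := index_seq_comp HN ph; have [L HL] := @mean_along_ex R m (fun k => N (phi k)).
have HLm := mean_along_mean HN' HL.
have [x [xf mu_mean]] := furstenberg_mean HN' HL (furstenberg_subsequence ph Hmu).
apply: (orbit_procyclic HLm mu_mean).
apply: (mean_rap_eq HN' HL (a := v)).
- by exists 1 => n; exact: udisc_val_le1.
- by exists 1 => n; exact: udisc_val_le1.
- by move=> n n0; rewrite xf.
- by apply: (mean_rap_along HN' HL) => [n|e /(H m)]; [exact: udisc_val_le1|].
Qed.

Hypothesis f_pret : pretentious f.

(** If t is not 0, pass to a subsequence along which g is almost periodic;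
    ergodicity would make g negligible, against the lower bound for its square
    mean. *)
Lemma ergodic_character_like m mu : furstenberg_system m f mu ->
  ergodic mu (@seqshift R : borel_seqspace R -> borel_seqspace R) -> character_like.
Proof.
move=> [N [HN Hmu]] erg; have [t [chi [chi_prim fchi]]] := f_pret.
have [t0|t0] := eqVneq t 0; first by exists chi; split=> //; move: fchi; rewrite t0 nit0_mul.
exfalso; have [q [chiD _]] := chi_prim.
have [phi [ph H]] := untwist_subsequence f_mul chiD fchi HN.
have HN' := index_seq_comp HN ph; have [L HL] := @mean_along_ex R m (fun k => N (phi k)).
have HLm := mean_along_mean HN' HL.
have [x [xf mu_mean]] := furstenberg_mean HN' HL (furstenberg_subsequence ph Hmu).
have [kappa k0 Hk] := untwist_square_mean f_mul chiD fchi.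
have g_rap : mean_rap L (untwist f t).
  by apply: (mean_rap_along HN' HL) => [n|e /(H m)]; [exact: cnorm_untwist_le1|].
have xE n : (0 < n)%N -> udisc_val (x n%:Z) = nit t n * untwist f t n.
  by move=> n0; rewrite xf// untwistK.
have := twist_not_ergodic HLm (mean_along_oscillating HN' HL) mu_mean t0 xE g_rap (cnorm_untwist_le1 f t) erg.
by rewrite leNgt (lt_le_trans k0 (Hk _ _ _ HN' HL)).
Qed.

(** If t is not 0, then g and n^{it} g would both be almost periodic along a
    subsequence, and g would be negligible. *)
Lemma rap_character_like m N : index_seq N -> besicovitch_rap_along m N f -> character_like.
Proof.
move=> HN f_rap; have [t [chi [chi_prim fchi]]] := f_pret.
have [t0|t0] := eqVneq t 0; first by exists chi; split=> //; move: fchi; rewrite t0 nit0_mul.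
exfalso; have [q [chiD _]] := chi_prim.
have [phi [ph H]] := untwist_subsequence f_mul chiD fchi HN.
have HN' := index_seq_comp HN ph; have [L HL] := @mean_along_ex R m (fun k => N (phi k)).
have HLm := mean_along_mean HN' HL.
have [kappa k0 Hk] := untwist_square_mean f_mul chiD fchi.
have g_rap : mean_rap L (untwist f t).
  by apply: (mean_rap_along HN' HL) => [n|e /(H m)]; [exact: cnorm_untwist_le1|].
have bg : cbdd (untwist f t) by exists 1; exact: cnorm_untwist_le1.
have ng_rap : mean_rap L (fun n => nit t n * untwist f t n).
  have -> : (fun n => nit t n * untwist f t n) = (fun n => udisc_val (f n)).
    by apply/funext => n; rewrite untwistK.
  exact: (besicovitch_mean_rap HN ph HL f_rap).
have := twist_rap_null HLm (mean_along_oscillating HN' HL) t0 bg g_rap ng_rap.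
by rewrite leNgt (lt_le_trans k0 (Hk _ _ _ HN' HL)).
Qed.

End Equivalences.

Theorem corollary2p9 (R : realType) (f : nat -> udisc R)
    (f_mul : is_multiplicative f) (f_pret : pretentious f) :
  [<-> (* (i) *)
       exists chi : nat -> R[i], primitive_character chi /\ pret_equiv (udisc_val \o f) chi;
       (* (ii) *)
       exists (m : averaging) (mu : probability (borel_seqspace R) R),
         furstenberg_system m f mu /\ ergodic mu seqshift;
       (* (iii) *)
       forall (m : averaging) (mu : probability (borel_seqspace R) R),
         furstenberg_system m f mu -> procyclic mu seqshift;
       (* (iv) *)
       exists (m : averaging) (N : nat -> nat),
         index_seq N /\ besicovitch_rap_along m N f;
       (* (v) *)
       forall N : nat -> nat, index_seq N ->
         exists phi : nat -> nat, {homo phi : i j / (i < j)%N} /\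
           forall m : averaging, besicovitch_rap_along m (N \o phi) f].
Proof.
have succ_seq : index_seq succn by split.
have [mu0 Hmu0] := furstenberg_system_exists Cesaro f.
have rap_iv : character_like f -> exists (m : averaging) (N : nat -> nat),
    index_seq N /\ besicovitch_rap_along m N f.
  move=> fc; have [phi [ph H]] := character_like_rap f_mul fc succ_seq.
  by exists Cesaro, (succn \o phi); split; [exact: index_seq_comp|exact: H].
tfae.
- by move=> fc; exists Cesaro, mu0; split=> //; have [] := character_like_procyclic f_mul fc Hmu0.
- move=> [m [mu [Hmu erg]]] m' mu'; apply: character_like_procyclic => //.
  exact: ergodic_character_like Hmu erg.
- move=> H; apply: rap_iv; have [erg _] := H _ _ Hmu0.
  exact: ergodic_character_like Hmu0 erg.
- move=> [m [N [HN H]]] N' HN'; apply: character_like_rap => //.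
  exact: rap_character_like HN H.
- move=> H; have [phi [ph Hphi]] := H _ succ_seq.
  apply: (@rap_character_like R f f_mul f_pret Cesaro (succn \o phi)) => //.
Qed.
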